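(* Assume the setting described in the context and let $X\colon[0,T]\times\Omega\to H_\varrho$ be a stochastic process with continuous sample paths which satisfies for all $t\in[0,T]$ that $[X_t]_{\mathbb P,\mathcal B(H)}=\big[e^{tA}\xi+\int_0^te^{(t-s)A}F(X_s)\,ds\big]_{\mathbb P,\mathcal B(H)}+\int_0^te^{(t-s)A}\,dW_s$. Then it holds for all $p\in(0,\infty)$ that $$\limsup_{n\to\infty}\sup_{t\in[0,T]}\mathbb E\big[\|X_t-\mathcal X^n_t\|_H^p\big]=0.$$
   Context: Setting. Let $T,c_0,\gamma,\theta,\vartheta\in(0,\infty)$, $\alpha\in[0,\frac12]$, $\varphi\in[0,1)$, $\rho\in[0,\frac14)$, $\varrho\in(\rho,\frac14)$, $\chi\in(0,\frac{\varrho-\rho}{1+\vartheta}]$, $H=L^2((0,1);\mathbb R)$ (with Lebesgue measure), $e_n=(\sqrt2\sin(n\pi x))_{x\in(0,1)}\in H$ and $\lambda_n=c_0\pi^2n^2$ for $n\in\mathbb N$, let $A\colon D(A)\subseteq H\to H$ be the linear operator with $D(A)=\{v\in H\colon\sum_{k=1}^\infty|\lambda_k\langle e_k,v\rangle_H|^2<\infty\}$ and $Av=\sum_{k=1}^\infty-\lambda_k\langle e_k,v\rangle_He_k$, let $(H_r,\langle\cdot,\cdot\rangle_{H_r},\|\cdot\|_{H_r})$, $r\in\mathbb R$, be a family of interpolation spaces associated to $-A$, let $\xi\in H_{1/2}$, let $F\in\mathcal C(H_\varrho,H_{-\alpha})$, $(P_n)_{n\in\mathbb N}\colon\mathbb N\to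 L(H_{-1})$, $(h_n)_{n\in\mathbb N}\colon\mathbb N\to(0,T]$, and $\phi,\Phi\colon H_1\to[0,\infty)$ satisfy for all $u\in H_1$, $n\in\mathbb N$, $v,w\in P_n(H)$ that $\phi(u)=\gamma+\gamma\sup_{x\in(0,1)}|\underline u(x)|^2$, $\Phi(u)=\gamma+\gamma\sup_{x\in(0,1)}|\underline u(x)|^\gamma$, $P_n(u)=\sum_{k=1}^n\langle e_k,u\rangle_He_k$, $\limsup_{m\to\infty}h_m=0$, $\langle v,P_nF(v+w)\rangle_H\le\phi(w)\|v\|_H^2+\varphi\|v\|_{H_{1/2}}^2+\Phi(w)$, and $\|F(v)-F(w)\|_{H_{-\alpha}}\le\theta(1+\|v\|_{H_\rho}^\vartheta+\|w\|_{H_\rho}^\vartheta)\|v-w\|_{H_\rho}$. Let $(\Omega,\mathcal F,\mathbb P)$ be a probability space, let $(W_t)_{t\in[0,T]}$ be an $\mathrm{Id}_H$-cylindrical $(\Omega,\mathcal F,\mathbb P)$-Wiener process, and let $\mathcal X^n,\mathcal O^n\colon[0,T]\times\Omega\to P_n(H)$, $n\in\mathbb N$, be stochastic processes which satisfy for all $n\in\mathbb N$, $t\in[0,T]$ that $[\mathcal O^n_t]_{\mathbb P,\mathcal B(H)}=\int_0^tP_ne^{(t-s)A}\,dW_s$ and $$\mathbb P\Big(\mathcal X^n_t=P_ne^{tA}\xi+\int_0^tP_ne^{(t-s)A}\,\mathbf 1_{\{\|\mathcal X^n_{\lfloor s\rfloor_{h_n}}\|_{H_\varrho}+\|\mathcal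 O^n_{\lfloor s\rfloor_{h_n}}+P_ne^{\lfloor s\rfloor_{h_n}A}\xi\|_{H_\varrho}\le|h_n|^{-\chi}\}}F(\mathcal X^n_{\lfloor s\rfloor_{h_n}})\,ds+\mathcal O^n_t\Big)=1.$$ Notation. $\underline u$ is the continuous representative on $(0,1)$ of an equivalence class $u$ that possesses one. $\lfloor t\rfloor_h=\max((-\infty,t]\cap\{0,h,-h,2h,-2h,\dots\})$ for $h>0$. $[f]_{\mathbb P,\mathcal B(H)}$ is the class of all $\mathcal F/\mathcal B(H)$-measurable functions agreeing with $f$ outside a $\mathbb P$-null set; stochastic integrals are such classes. $H_r$ for $r\ge0$ is $D((-A)^r)$ with $\|v\|_{H_r}=\|(-A)^rv\|_H$, and for $r<0$ is the completion of $H$ with respect to $\|(-A)^r\cdot\|_H$; $P_n$ and $e^{tA}$ act on these spaces by continuous extension. *)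

(* Defs.v *)
From Stdlib Require List.
From HB Require Import structures.
From mathcomp Require Import all_boot all_order all_algebra.
From mathcomp Require Import all_classical all_reals all_analysis.
From mathcomp Require Import measurable_realfun ess_sup_inf.
Set Implicit Arguments.
Unset Strict Implicit.
Unset Printing Implicit Defensive.
Import Order.TTheory GRing.Theory Num.Theory.
Import numFieldNormedType.Exports.
Local Open Scope classical_set_scope.
Local Open Scope ring_scope.
Local Open Scope quotient_scope.

Lemma filterS4 (T : Type) (F : set_system T) (P Q S U V : set T) : Filter F ->
  (forall x, P x -> Q x -> S x -> U x -> V x) ->
  F P -> F Q -> F S -> F U -> F V.
Proof.
move=> FF h FP FQ FS FU.
apply: (filterS _ (filterI (filterI FP FQ) (filterI FS FU))).
by move=> x [[? ?] [? ?]]; exact: h.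
Qed.

(* The library's quotient L^p, made a normed module; an element coerces to its
   chosen representative, so the operations are given on representatives. *)
Section LspaceNormedModule.
Context d (T : measurableType d) (R : realType).
Variables (mu : {measure set T -> \bar R}) (p : \bar R) (p1 : (1 <= p)%E).

Local Notation Lp := (LspaceType mu p1).
Local Notation Fp := (LfunType mu p1).
Local Notation Mq := ({mfun_ mu, T >-> measurableTypeR R}).

Lemma ae_eq_Lnorm (f g : T -> R) :
  measurable_fun setT f -> measurable_fun setT g ->
  f = g %[ae mu] -> Lnorm mu p (EFin \o f) = Lnorm mu p (EFin \o g).
Proof.
move=> mf mg fg; rewrite unlock; case: p p1 => [r|//|//] r1.
  congr (_ `^ _)%E; apply: ae_eq_integral => //.
  - move/measurable_EFinP in mf; move/measurable_EFinP in mg; apply: (measurableT_comp (measurable_poweR r)); exact: measurableT_comp.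
  - move/measurable_EFinP in mf; move/measurable_EFinP in mg; apply: (measurableT_comp (measurable_poweR r)); exact: measurableT_comp.
  - by apply: filterS fg => x /(_ I) /= fgx _; rewrite fgx.
case: ifPn => // _; apply: eq_ess_sup.
by apply: filterS fg => x /(_ I) /= ->.
Qed.


Definition mfun_class (f : {mfun T >-> measurableTypeR R}) : Mq := \pi_Mq f.

Lemma mfun_classE (f : {mfun T >-> measurableTypeR R}) :
  ae_eq mu setT (mfun_class f) f.
Proof.
have : (repr (mfun_class f) == f %[mod Mq]) by rewrite reprK.
by rewrite eqmodE => /asboolP.
Qed.

Lemma Lfun_measurable (f : Fp) :
  measurable_fun [set: T] (f : T -> measurableTypeR R).
Proof. by have /andP[/set_mem] := LfunP f. Qed.

Definition Lfun_mfun (f : Fp) : {mfun T >-> measurableTypeR R} :=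
  HB.pack (f : T -> measurableTypeR R)
    (isMeasurableFun.Build _ _ _ _ (f : T -> measurableTypeR R)
       (Lfun_measurable f)).

Lemma finite_norm_mfun_class (f : Fp) :
  finite_norm mu p (mfun_class (Lfun_mfun f)).
Proof.
rewrite /finite_norm [ltLHS](_ : _ = Lnorm mu p (EFin \o f)).
  exact: Lfunction_finite.
apply: ae_eq_Lnorm; last exact: (mfun_classE (Lfun_mfun f)).
  exact: (@measurable_funPT _ _ _ _ (repr (mfun_class (Lfun_mfun f)))).
exact: Lfun_measurable.
Qed.

Definition Lclass (f : Fp) : Lp :=
  HB.pack (mfun_class (Lfun_mfun f))
    (isFinLebesgue.Build _ _ _ mu p p1 _ (finite_norm_mfun_class f)).

Lemma LclassE (f : Fp) : ae_eq mu setT (Lclass f) (f : T -> R).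
Proof. exact: (mfun_classE (Lfun_mfun f)). Qed.

Lemma Lspace_measurable (u : Lp) : measurable_fun [set: T] (u : T -> R).
Proof. exact: (@measurable_funPT _ _ _ _ (repr (u : Mq))). Qed.

Lemma Lspace_Lfun (u : Lp) : (u : T -> R) \in Lfun mu p.
Proof.
apply/andP; split; apply/mem_set; first exact: Lspace_measurable.
exact: Lebesgue_finite.
Qed.

Definition Lrepr (u : Lp) : Fp := Lfun_Sub p1 (Lspace_Lfun u).

Lemma LspaceP (u v : Lp) : ae_eq mu setT (u : T -> R) (v : T -> R) -> u = v.
Proof.
move=> uv.
have : (u : Mq) = (v : Mq).
  have : (repr (u : Mq) == repr (v : Mq) %[mod Mq]) by rewrite eqmodE; exact/asboolP.
  by rewrite !reprK => /eqP.
case: u v {uv} => [u [[hu]]] [v [[hv]]] /= uv.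
by subst v; rewrite (Prop_irrelevance hu hv).
Qed.

HB.instance Definition _ := gen_eqMixin Lp.
HB.instance Definition _ := gen_choiceMixin Lp.

Definition Lzero : Lp := Lclass 0.
Definition Ladd (u v : Lp) : Lp := Lclass (Lrepr u + Lrepr v).
Definition Lopp (u : Lp) : Lp := Lclass (- Lrepr u).
Definition Lscale (a : R) (u : Lp) : Lp := Lclass (a *: Lrepr u).

Lemma LzeroE : ae_eq mu setT Lzero (fun=> 0 : R).
Proof. exact: LclassE. Qed.

Lemma LaddE u v : ae_eq mu setT (Ladd u v) (fun x => (u x + v x : R)).
Proof. exact: LclassE. Qed.

Lemma LoppE u : ae_eq mu setT (Lopp u) (fun x => (- u x : R)).
Proof. exact: LclassE. Qed.

Lemma LscaleE a u : ae_eq mu setT (Lscale a u) (fun x => (a * u x : R)).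
Proof. exact: LclassE. Qed.

Let LaddA : associative Ladd.
Proof.
move=> u v w; apply: LspaceP.
have := LaddE u (Ladd v w); have := LaddE (Ladd u v) w.
have := LaddE u v; have := LaddE v w.
apply: filterS4 => x /(_ I) h1 /(_ I) h2 /(_ I) h3 /(_ I) h4 _.
by rewrite h4 h3 h2 h1 addrA.
Qed.

Let LaddC : commutative Ladd.
Proof.
move=> u v; apply: LspaceP; have := LaddE u v; have := LaddE v u.
by apply: filterS2 => x /(_ I) h1 /(_ I) h2 _; rewrite h1 h2 addrC.
Qed.

Let Ladd0 : left_id Lzero Ladd.
Proof.
move=> u; apply: LspaceP; have := LaddE Lzero u; have := LzeroE.
by apply: filterS2 => x /(_ I) h1 /(_ I) h2 _; rewrite h2 h1 add0r.
Qed.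

Let LaddN : left_inverse Lzero Lopp Ladd.
Proof.
move=> u; apply: LspaceP.
have := LaddE (Lopp u) u; have := LzeroE; have := LoppE u.
by apply: filterS3 => x /(_ I) h1 /(_ I) h2 /(_ I) h3 _;
  rewrite h3 h2 h1 addNr.
Qed.

HB.instance Definition _ := GRing.isZmodule.Build Lp LaddA LaddC Ladd0 LaddN.

Let LscaleA a b (u : Lp) : Lscale a (Lscale b u) = Lscale (a * b) u.
Proof.
apply: LspaceP.
have := LscaleE a (Lscale b u); have := LscaleE b u; have := LscaleE (a * b) u.
by apply: filterS3 => x /(_ I) h1 /(_ I) h2 /(_ I) h3 _;
  rewrite h3 h2 h1 mulrA.
Qed.

Let Lscale1 : left_id 1 Lscale.
Proof.
move=> u; apply: LspaceP; have := LscaleE 1 u.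
by apply: filterS => x /(_ I) h _; rewrite h mul1r.
Qed.

Let LscaleDr : right_distributive Lscale +%R.
Proof.
move=> a u v; apply: LspaceP.
have h1 := LscaleE a (u + v); have h2 := LaddE u v.
have h3 := LaddE (Lscale a u) (Lscale a v).
have h4 := LscaleE a u; have h5 := LscaleE a v.
have h6 : \forall x \ae mu, ((u + v) x = u x + v x :> R) /\
    ((Lscale a u + Lscale a v) x = Lscale a u x + Lscale a v x :> R).
  by move: h2 h3; apply: filterS2 => x /(_ I) e2 /(_ I) e3; split.
move: h1 h6 h4 h5; apply: filterS4 => x /(_ I) e1 [e2 e3] /(_ I) e4 /(_ I) e5 _.
by rewrite e1 e2 e3 e4 e5 mulrDr.
Qed.

Let LscaleDl (u : Lp) : {morph Lscale^~ u : a b / a + b}.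
Proof.
move=> a b; apply: LspaceP.
have := LscaleE (a + b) u; have := LscaleE a u; have := LscaleE b u.
have := LaddE (Lscale a u) (Lscale b u).
apply: filterS4 => x /(_ I) h1 /(_ I) h2 /(_ I) h3 /(_ I) h4 _.
by rewrite h4 h1 h2 h3 mulrDl.
Qed.

HB.instance Definition _ :=
  GRing.Zmodule_isLmodule.Build R Lp LscaleA Lscale1 LscaleDr LscaleDl.

Definition Lsnorm (u : Lp) : R := fine (Lnorm mu p (EFin \o (u : T -> R))).

Let Lclass_norm (f : Fp) : Lsnorm (Lclass f) = fine (Lnorm mu p (EFin \o f)).
Proof.
congr fine; apply: ae_eq_Lnorm; [exact: Lspace_measurable|exact: Lfun_measurable|exact: LclassE].
Qed.

Let LsnormD (u v : Lp) : Lsnorm (u + v) <= Lsnorm u + Lsnorm v.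
Proof. by rewrite Lclass_norm (ler_LnormD (Lrepr u) (Lrepr v)). Qed.

Let LsnormZ (a : R) (u : Lp) : Lsnorm (a *: u) = `|a| * Lsnorm u.
Proof.
rewrite Lclass_norm.
by have /(congr1 fine) := LnormZ (Lrepr u) a; rewrite -finite_norm_fine.
Qed.

Let Lsnorm_eq0 (u : Lp) : Lsnorm u = 0 -> u = 0.
Proof.
move=> u0; apply: LspaceP.
have h := @fine_Lnormr_eq0 _ _ _ mu p p1 (Lrepr u) u0.
have := LzeroE; move: h.
by apply: filterS2 => x /(_ I) h1 /(_ I) h2 _; rewrite h2; exact: h1.
Qed.

HB.instance Definition _ :=
  @Lmodule_isNormed.Build R Lp Lsnorm LsnormD LsnormZ Lsnorm_eq0.

End LspaceNormedModule.

Section BochnerIntegral.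
Context d (T : measurableType d) (R : realType) (E : normedModType R).
Variable mu : {measure set T -> \bar R}.

(* A simple function, as the list of its pieces (A, y), each standing for the
   function \1_A *: y. *)
Definition simple_eval (s : seq (set T * E)) (x : T) : E :=
  \sum_(i <- s) \1_(i.1) x *: i.2.

Definition simple_integral (s : seq (set T * E)) : E :=
  \sum_(i <- s) fine (mu i.1) *: i.2.

Definition is_bochner_integral (D : set T) (f : T -> E) (y : E) : Prop :=
  exists s : nat -> seq (set T * E),
  [/\ forall n i, List.In i (s n) ->
        [/\ measurable i.1, i.1 `<=` D & (mu i.1 < +oo)%E],
      forall n, measurable_fun D (fun x => `|f x - simple_eval (s n) x|),
      (\int[mu]_(x in D) `|f x - simple_eval (s n) x|%:E)%E
        @[n --> \oo] --> 0%E &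
      simple_integral (s n) @[n --> \oo] --> y].

Definition bochner_integral (D : set T) (f : T -> E) : E :=
  get [set y | is_bochner_integral D f y].

End BochnerIntegral.

Section BorelMeasurability.
Context d (Omega : measurableType d) (E : topologicalType).

Definition borel_rv (Y : Omega -> E) : Prop :=
  forall B : set E, <<s @open E >> B -> measurable (Y @^-1` B).

End BorelMeasurability.

Section UnitInterval.
Variable R : realType.

Lemma lebesgue_itv01_lty :
  (@lebesgue_measure R `]0%R, 1%R[%classic < +oo)%E.
Proof. by rewrite lebesgue_measure_itv /= lte01 oppr0 adde0 ltry. Qed.

Lemma measurable_itv01 : @measurable _ (measurableTypeR R) `]0%R, 1%R[%classic.
Proof. exact: measurable_itv. Qed.

Definition lebesgue01 :
    {finite_measure set (measurableTypeR R) -> \bar R} :=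
  [the {finite_measure set (measurableTypeR R) -> \bar R} of
    @mfrestr _ (measurableTypeR R) R _ (@lebesgue_measure R)
      measurable_itv01 lebesgue_itv01_lty].

End UnitInterval.

(* The real Hilbert space L^2((0,1)), with Lebesgue measure. *)
Notation L2_01 R := (LspaceType2 (lebesgue01 R)).

Section SpectralCalculus.
Variable R : realType.
Implicit Types (c r t : R) (k n : nat) (u v : L2_01 R).

Definition ip u v : R := (\int[lebesgue01 R]_x (u x * v x))%R.

Definition sine_fun k (x : R) : R := Num.sqrt 2 * sin (k%:R * pi * x).

Lemma sine_fun_Lfun k : sine_fun k \in Lfun (lebesgue01 R) 2%:E.
Proof.
have mf : measurable_fun [set: R] (sine_fun k).
  apply: continuous_measurable_fun => x.
  apply: cvgM; first exact: cvg_cst.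
  apply: continuous_comp; last exact: continuous_sin.
  by apply: cvgM; [exact: cvg_cst|exact: cvg_id].
have mfin : lebesgue01 R setT \is a fin_num.
  exact: fin_num_measure.
apply/andP; split; apply/mem_set => //=.
rewrite /finite_norm unlock poweR_lty//.
rewrite (@le_lt_trans _ _ (\int[lebesgue01 R]_x 2%:E)%E) //.
  apply: ge0_le_integral => //.
  - by move=> x _; exact: poweR_ge0.
  - apply: (measurableT_comp (measurable_poweR _)).
    by apply: measurableT_comp => //; exact/measurable_EFinP.
  - move=> x _ /=; rewrite lee_fin powR_mulrn// normrM exprMn.
    rewrite real_normK ?num_real// sqr_sqrtr//.
    rewrite -[leRHS]mulr1 ler_wpM2l// -normrX ger0_norm ?sqr_ge0//.
by rewrite integral_cst// ltey_eq fin_numM.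
Qed.

Definition eigf k : L2_01 R := Lclass (Lfun_Sub (lee1n 2) (sine_fun_Lfun k)).

Definition lam c k : R := c * pi ^+ 2 * k%:R ^+ 2.

(* [specA c f] is f(A) for the diagonal operator
   A v = \sum_(k >= 1) - lam c k * <e_k, v> e_k, and [specA_dom c f] is its
   domain; so A itself is [specA c id], on [specA_dom c id]. *)
Definition specA_dom c (f : R -> R) : set (L2_01 R) :=
  [set v | (\sum_(1 <= k <oo)
     (`|f (- lam c k) * ip (eigf k) v| ^+ 2)%:E < +oo)%E].

Definition specA c (f : R -> R) v : L2_01 R :=
  limn (fun n => \sum_(1 <= k < n.+1) (f (- lam c k) * ip (eigf k) v) *: eigf k).

Definition powA c r : L2_01 R -> L2_01 R := specA c (fun z => (- z) `^ r).

Definition expA c t : L2_01 R -> L2_01 R := specA c (fun z => expR (t * z)).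

Definition Pproj n v : L2_01 R := \sum_(1 <= k < n.+1) ip (eigf k) v *: eigf k.

(* The interpolation space H_r, r >= 0, is the subset [Hdom c r] of H with
   the norm [Hnorm c r]. *)
Definition Hdom c r : set (L2_01 R) := specA_dom c (fun z => (- z) `^ r).

Definition Hnorm c r v : R := `|powA c r v|.

Definition Hopen c r : set (set (L2_01 R)) :=
  [set U | U `<=` Hdom c r /\ forall u, U u -> exists2 eps : R, 0 < eps &
     forall v, Hdom c r v -> Hnorm c r (v - u) < eps -> U v].

Definition Hborel c r : set (set (L2_01 R)) := <<s Hdom c r, Hopen c r >>.

Definition Hcontinuous c r (V : normedModType R) (F : L2_01 R -> V) : Prop :=
  forall u, Hdom c r u -> forall eps : R, 0 < eps ->
  exists2 delta : R, 0 < delta &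
    forall v, Hdom c r v -> Hnorm c r (v - u) < delta -> `|F v - F u| < eps.

Definition Hcontinuous_path c r (T : R) (x : R -> L2_01 R) : Prop :=
  forall t : R, 0 <= t <= T -> forall eps : R, 0 < eps ->
  exists2 delta : R, 0 < delta &
    forall s : R, 0 <= s <= T -> `|s - t| < delta -> Hnorm c r (x s - x t) < eps.

(* For r < 0, H_r is a completion of H for the norm `|powA c r u|; [iota] is
   the embedding of H into it. *)
Definition is_Hcompletion c r (V : completeNormedModType R)
    (iota : {linear L2_01 R -> V}) : Prop :=
  (forall u, `|iota u| = `|powA c r u|) /\ dense (range iota).

(* The extension to the completion V, by continuity, of an operator f on H. *)
Definition extend (V : completeNormedModType R) (iota : {linear L2_01 R -> V})
    (f : L2_01 R -> L2_01 R) (v : V) : L2_01 R :=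
  get [set y | exists u_ : nat -> L2_01 R,
    iota (u_ n) @[n --> \oo] --> v /\ f (u_ n) @[n --> \oo] --> y].

Definition cont_repr u : R -> R :=
  get [set f : R -> R | {within `]0%R, 1%R[%classic, continuous f} /\
                        ae_eq (lebesgue01 R) setT (u : R -> R) f].

End SpectralCalculus.

Section TimeGrid.
Variable R : realType.

Definition grid_floor (h t : R) : R :=
  sup ([set s | s <= t] `&` [set k%:~R * h | k in [set: int]]).

(* The supremum above is a maximum. *)
Lemma grid_floorE (h t : R) : 0 < h ->
  grid_floor h t = (Num.floor (t / h))%:~R * h.
Proof.
move=> h0; set g := _ * h.
have gS : ([set s | s <= t] `&` [set k%:~R * h | k in [set: int]]) g.
  split; last by exists (Num.floor (t / h)).
  by rewrite /= /g -ler_pdivlMr// floor_le.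
have gub : ubound ([set s | s <= t] `&` [set k%:~R * h | k in [set: int]]) g.
  move=> x [/= xt [k _ kx]]; move: xt; rewrite -kx -ler_pdivlMr// => kt.
  by rewrite /g ler_pM2r// ler_int floor_ge_int.
apply/eqP; rewrite eq_le; apply/andP; split.
  by apply: ge_sup => //; exists g.
by apply: ub_le_sup => //; exists g.
Qed.

End TimeGrid.

Section WienerIntegral.
Context d (Omega : measurableType d) (R : realType).
Variables (P : probability Omega R) (T : R).
Implicit Type W : R -> L2_01 R -> Omega -> R.

Definition increment W (s t : R) (h : L2_01 R) (w : Omega) : R :=
  W t h w - W s h w.

(* Generated by the W r g, 0 <= r <= s. *)
Definition wiener_past W (s : R) : set (set Omega) :=
  <<s [set C | exists (r : R) (g : L2_01 R) (B : set (measurableTypeR R)),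
        [/\ 0 <= r <= s, measurable B & C = W r g @^-1` B]] >>.

(* W t h stands for <h, W_t>. *)
Record is_cylindrical_wiener W : Prop := CylindricalWiener {
  cyl_measurable : forall (t : R) (h : L2_01 R), 0 <= t <= T ->
    measurable_fun [set: Omega] (W t h) ;
  cyl_start : forall h : L2_01 R, {ae P, forall w, W 0 h w = 0} ;
  cyl_linear : forall (t a : R) (g h : L2_01 R), 0 <= t <= T ->
    {ae P, forall w, W t (a *: g + h) w = a * W t g w + W t h w} ;
  cyl_gaussian : forall (s t : R) (h : L2_01 R) (B : set (measurableTypeR R)),
    0 <= s < t -> t <= T -> h != 0 -> measurable B ->
    P (increment W s t h @^-1` B) =
    normal_prob 0 (Num.sqrt (t - s) * `|h|) B ;
  cyl_indep : forall (s t : R) (h : L2_01 R)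
      (C : set Omega) (B : set (measurableTypeR R)),
    0 <= s < t -> t <= T -> wiener_past W s C -> measurable B ->
    P (C `&` increment W s t h @^-1` B) =
    (P C * P (increment W s t h @^-1` B))%E ;
  cyl_continuous : forall h : L2_01 R, {ae P, forall w,
    {within `[0%R, T]%classic, continuous (fun t => W t h w)}}
}.

(* One term of a finite-rank operator-valued step function, namely
   s |-> \1_(]lo, hi]) s * <inp, .> *: out. *)
Record step_term := StepTerm {
  st_lo : R ; st_hi : R ; st_in : L2_01 R ; st_out : L2_01 R }.

Definition step_eval (E : seq step_term) (s : R) (u : L2_01 R) : L2_01 R :=
  \sum_(x <- E)
    (\1_(`]st_lo x, st_hi x]%classic) s * ip (st_in x) u) *: st_out x.

Definition step_integral W (E : seq step_term) (w : Omega) : L2_01 R :=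
  \sum_(x <- E)
    increment W (st_lo x) (st_hi x) (st_in x) w *: st_out x.

(* The squared Hilbert-Schmidt norm. *)
Definition hs2 (B : L2_01 R -> L2_01 R) : \bar R :=
  (\sum_(1 <= k <oo) (`|B (eigf R k)| ^+ 2)%:E)%E.

(* Y is a version of the stochastic integral over [0, t] of the deterministic
   Hilbert-Schmidt-valued integrand Phi, i.e. Y is the value at Phi of the
   extension of [step_integral W] given by the Ito isometry. *)
Definition is_wiener_integral W (t : R) (Phi : R -> L2_01 R -> L2_01 R)
    (Y : Omega -> L2_01 R) : Prop :=
  borel_rv Y /\
  exists E : nat -> seq step_term,
  [/\ forall n x, List.In x (E n) -> 0 <= st_lo x <= st_hi x /\ st_hi x <= t,
      forall n, measurable_fun `]0%R, t[%classic
        (fun s => hs2 (fun u => Phi s u - step_eval (E n) s u)),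
      (\int[@lebesgue_measure R]_(s in `]0%R, t[)
         hs2 (fun u => Phi s u - step_eval (E n) s u)%R)%E
        @[n --> \oo] --> 0%E &
      (\int[P]_w (`|Y w - step_integral W (E n) w| ^+ 2)%:E)%E
        @[n --> \oo] --> 0%E].

End WienerIntegral.

(* Main.v *)
(* Pathwise, P_n X and the scheme solve equations with the same noise, so that their
   difference is controlled by a weighted Gronwall argument in H_varrho, on the event
   that the taming is inactive, which a continuation argument over the grid shows to
   hold for all large n. This gives almost sure convergence at arbitrary times t_n.

   To pass to moments the scheme is bounded in every L^p uniformly in n and t. For a
   damping rate eta the noise is replaced by the recursion
   w_(j+1) = (e^(dA) w_j + dO_j) / (1 + eta d), a Gaussian process with covariance at
   most 1 / (lam + eta), and the coercivity of F is applied to v = X^n - w cell by cell.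
   It yields |X^n|^2 <= C eta^2 (polynomial in w) as soon as
   S = 2 gamma sum_j d_j |w_j|_oo^2 <= 1. With eta = 2^(8 m) the random variable S has
   moments of order 2^(-q m) for every q (chaining in the space variable), so the first m
   with S <= 1 satisfies E 2^(b m) < oo for every b, which sums the polynomial bounds. *)
Require Import Defs.
From mathcomp Require Import all_boot all_order all_algebra.
From mathcomp Require Import all_classical all_reals all_analysis.
From mathcomp Require Import measurable_realfun ring lra.
Set Implicit Arguments.
Unset Strict Implicit.
Unset Printing Implicit Defensive.
Import Order.TTheory GRing.Theory Num.Theory.
Import numFieldNormedType.Exports.
Local Open Scope classical_set_scope.
Local Open Scope ring_scope.

(** * The Hilbert space [L2_01 R] *)

(** [F] is only locally Lipschitz, so the error constants depend on the path: convergence is first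
    almost sure, and moments enter through uniform integrability. The supremum over t is handled by
    selecting a bad time for each n, so that almost sure convergence along one sequence of times is
    enough; only countably many exceptional sets occur, and neither a maximal inequality nor
    regularity of the noise in time is used. The damping is forced by coercivity: Gronwall's
    inequality produces exp (2 gamma sum_j d_j |w_j|_oo^2), whose mean may be infinite for the
    undamped noise when gamma is large. A large eta makes the exponent small with high probability,
    at the price of a factor eta^2. Coercivity concerns F at the current v + w, while the scheme
    freezes F at the left end of each cell; the bound on chi makes the freezing error polynomial in
    the noise alone. Limits of step integrals are never shown to be Gaussian: an upper bound on
    their exponential moments survives mean square limits and yields both moments and uniqueness. *)

Section L2Hilbert.
Variable R : realType.
Local Notation H := (L2_01 R).
Local Notation mu := (lebesgue01 R).
Implicit Types (u v w : H) (a : R).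

Lemma measurable_L2 u : measurable_fun [set: measurableTypeR R] (u : R -> R).
Proof. exact: Lspace_measurable. Qed.

Lemma ip_integrable u v :
  mu.-integrable setT (EFin \o (fun x => u x * v x)).
Proof.
apply/Lfun1_integrable.
by apply: Lfun2_mul_Lfun1; exact: Lspace_Lfun.
Qed.

Lemma ipC u v : ip u v = ip v u.
Proof. by apply: eq_Rintegral => x _; rewrite mulrC. Qed.

Lemma ip_congr (f g : R -> R) : measurable_fun [set: R] f ->
  measurable_fun [set: R] g -> ae_eq mu setT f g ->
  \int[mu]_x f x = \int[mu]_x g x.
Proof.
move=> mf mg fg; congr fine; apply: ae_eq_integral => //.
- exact/measurable_EFinP.
- exact/measurable_EFinP.
- by apply: filterS fg => x /(_ I) /= ->.
Qed.

Lemma ipDl u v w : ip (u + v) w = ip u w + ip v w.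
Proof.
rewrite /ip -RintegralD//; try exact: ip_integrable.
apply: ip_congr.
- by apply: measurable_funM; exact: measurable_L2.
- by apply: measurable_funD; apply: measurable_funM; exact: measurable_L2.
- by have := LaddE u v; apply: filterS => x /(_ I) /= e _; rewrite e mulrDl.
Qed.

Lemma ipZl a u v : ip (a *: u) v = a * ip u v.
Proof.
rewrite /ip -RintegralZl//; last exact: ip_integrable.
apply: ip_congr.
- by apply: measurable_funM; exact: measurable_L2.
- by apply: measurable_funM => //; apply: measurable_funM; exact: measurable_L2.
- by have := LscaleE a u; apply: filterS => x /(_ I) /= e _; rewrite e mulrA.
Qed.

Lemma ipDr u v w : ip w (u + v) = ip w u + ip w v.
Proof. by rewrite !(ipC w) ipDl. Qed.

Lemma ipZr a u v : ip u (a *: v) = a * ip u v.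
Proof. by rewrite !(ipC u) ipZl. Qed.

Lemma ip0l v : ip 0 v = 0.
Proof. by rewrite -(scale0r 0) ipZl mul0r. Qed.

Lemma ip0r v : ip v 0 = 0. Proof. by rewrite ipC ip0l. Qed.

Lemma ipNl u v : ip (- u) v = - ip u v.
Proof. by rewrite -scaleN1r ipZl mulN1r. Qed.

Lemma ipNr u v : ip u (- v) = - ip u v.
Proof. by rewrite ipC ipNl ipC. Qed.

Lemma ipBl u v w : ip (u - v) w = ip u w - ip v w.
Proof. by rewrite ipDl ipNl. Qed.

Lemma ipBr u v w : ip w (u - v) = ip w u - ip w v.
Proof. by rewrite ipDr ipNr. Qed.

Lemma ip_suml (I : Type) (r : seq I) (P : pred I) (F : I -> H) v :
  ip (\sum_(i <- r | P i) F i) v = \sum_(i <- r | P i) ip (F i) v.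
Proof.
by elim/big_ind2 : _ => [|x a y b <- <-|//]; [exact: ip0l|exact: ipDl].
Qed.

Lemma ip_sumr (I : Type) (r : seq I) (P : pred I) (F : I -> H) v :
  ip v (\sum_(i <- r | P i) F i) = \sum_(i <- r | P i) ip v (F i).
Proof. by rewrite ipC ip_suml; apply: eq_bigr => i _; rewrite ipC. Qed.

Lemma Lnorm2E (f : R -> R) :
  Lnorm mu 2%:E (EFin \o f) = ((\int[mu]_x (f x ^+ 2)%:E) `^ 2^-1)%E.
Proof.
rewrite unlock; congr (_ `^ _)%E; apply: eq_integral => x _ /=.
by rewrite powR_mulrn// real_normK ?num_real.
Qed.

Lemma ip_normE u : (\int[mu]_x (u x ^+ 2)%:E)%E = (ip u u)%:E.
Proof.
rewrite /ip fineK; last first.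
  by apply: integrable_fin_num => //; exact: (ip_integrable u u).
by apply: eq_integral => x _; rewrite expr2.
Qed.

Lemma ip_ge0 u : 0 <= ip u u.
Proof. by apply: Rintegral_ge0 => x _; rewrite -expr2 sqr_ge0. Qed.

Lemma norm_ip u : `|u| = Num.sqrt (ip u u).
Proof.
rewrite [LHS]/(fine (Lnorm mu 2%:E (EFin \o (u : R -> R)))) Lnorm2E ip_normE.
by rewrite poweR_EFin /= powR12_sqrt// ip_ge0.
Qed.

Lemma norm_sqr u : `|u| ^+ 2 = ip u u.
Proof. by rewrite norm_ip sqr_sqrtr// ip_ge0. Qed.

Lemma normB_sqr u v : `|u - v| ^+ 2 = `|u| ^+ 2 - 2 * ip u v + `|v| ^+ 2.
Proof. rewrite !norm_sqr !ipBl !ipBr (ipC v u); ring. Qed.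

Lemma cauchy_schwarz u v : `|ip u v| <= `|u| * `|v|.
Proof.
have [->|v0] := eqVneq v 0; first by rewrite ip0r normr0 mulr_ge0.
have nv0 : 0 < `|v| ^+ 2 by rewrite exprn_gt0// normr_gt0.
rewrite -(@ler_pXn2r _ 2) ?nnegrE// ?mulr_ge0// exprMn real_normK ?num_real//.
have := ip_ge0 (u - (ip u v / `|v| ^+ 2) *: v).
rewrite -norm_sqr normB_sqr ipZr normrZ exprMn real_normK ?num_real//.
rewrite -(ler_pM2r nv0) mul0r.
set n := `|v|; set m := `|u| => h.
have {}h : 0 <= m ^+ 2 * n ^+ 2 - ip u v ^+ 2.
  apply: le_trans h _; rewrite le_eqVlt; apply/orP; left; apply/eqP.
  by field; rewrite normr_eq0.
by rewrite -subr_ge0.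
Qed.

Lemma ip_le u v : ip u v <= `|u| * `|v|.
Proof. exact: le_trans (ler_norm _) (cauchy_schwarz _ _). Qed.

Lemma ip_continuous v (u_ : nat -> H) u : u_ n @[n --> \oo] --> u ->
  ip v (u_ n) @[n --> \oo] --> ip v u.
Proof.
move=> /cvgrPdist_lt uu; apply/cvgrPdist_lt => e e0.
have e1 : 0 < e / (`|v| + 1) by rewrite divr_gt0// ltr_wpDl.
have := uu _ e1; apply: filterS => n h.
rewrite -ipBr (le_lt_trans (cauchy_schwarz _ _))//.
rewrite (@le_lt_trans _ _ ((`|v| + 1) * `|u - u_ n|))//.
  by rewrite ler_wpM2r// lerDl.
by rewrite mulrC -ltr_pdivlMr// ltr_wpDl.
Qed.

Lemma norm_int u : (\int[mu]_x (u x ^+ 2)%:E)%E = (`|u| ^+ 2)%:E.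
Proof. by rewrite ip_normE norm_sqr. Qed.

(** Hölder's inequality against the constant 1, whose norm is 1 because the unit interval has
    measure 1. It turns summable L^2 norms into absolute convergence almost everywhere. *)
Lemma L1_le_norm u : (\int[mu]_x `|u x|%:E <= `|u|%:E)%E.
Proof.
have mu1 : mu [set: R] = 1%E.
  rewrite /mu /= /mfrestr /= /mrestr /= setTI lebesgue_measure_itv /=.
  by rewrite lte01 oppr0 adde0.
have mu_ : measurable_fun [set: R] (u : R -> R) by exact: measurable_L2.
have := @hoelder _ _ _ mu (u : R -> R) (cst 1) 2 2 mu_
  (measurable_cst _) (ltr0Sn _ _) (ltr0Sn _ _).
rewrite Lnorm1 (_ : 2^-1 + 2^-1 = 1); last by rewrite [RHS]splitr !div1r.
move=> /(_ erefl) h; apply: (le_trans (le_trans _ h)).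
  rewrite le_eqVlt; apply/orP; left; apply/eqP.
  by apply: eq_integral => x _ /=; rewrite mulr1.
rewrite [X in (X * _)%E](_ : _ = `|u|%:E); last first.
  by rewrite Lnorm2E norm_int poweR_EFin
     powR12_sqrt ?sqr_ge0// sqrtr_sqr normr_id.
rewrite [X in (_ * X)%E](_ : _ = 1%E) ?mule1//.
rewrite -[X in (X = _)%E]/(Lnorm mu 2%:E (EFin \o cst (1:R))) Lnorm2E.
rewrite (eq_integral (cst 1%E)); last by move=> x _ /=; rewrite expr1n.
by rewrite integral_cst//= mul1e mu1 poweR1r.
Qed.
End L2Hilbert.

Lemma cvg_natE (R : realType) (u : nat -> R) (l : R) :
  u n @[n --> \oo] --> l -> ((u n)%:E @[n --> \oo] --> l%:E)%E.
Proof. by move=> h; apply: cvg_EFin => //; exact: nearW. Qed.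

Lemma ae_mono d (T : semiRingOfSetsType d) (R : realFieldType)
  (mu : {content set T -> \bar R}) (P Q : T -> Prop) :
  (forall x, P x -> Q x) -> {ae mu, forall x, P x} -> {ae mu, forall x, Q x}.
Proof.
move=> PQ [N [mN N0 NP]]; exists N; split => // x nQ; apply: NP.
by apply: contra_not nQ; exact: PQ.
Qed.

(** * Fatou's lemma along almost everywhere limits *)

Section Fatou.
Context d (T : measurableType d) (R : realType).
Variable mu : {measure set T -> \bar R}.
Local Open Scope ereal_scope.

Lemma limn_einf_le (u : nat -> \bar R) (C : \bar R) :
  (\forall n \near \oo, u n <= C) -> limn_einf u <= C.
Proof.
move=> [N _ uC]; rewrite limn_einf_lim; apply: lime_le.
  exact: is_cvg_einfs.
apply: nearW => n; apply: (@le_trans _ _ (u (maxn n N))); last first.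
  by apply: uC; rewrite /= leq_maxr.
by apply: ereal_inf_lbound; exists (maxn n N) => //=; rewrite leq_maxl.
Qed.

(** In this form moment bounds pass to limits of truncations, of maxima over finer grids, and from
    the scheme to the solution. *)
Lemma ae_fatou (f_ : nat -> T -> \bar R) (f : T -> \bar R) (C : \bar R) :
  (forall n, measurable_fun setT (f_ n)) -> measurable_fun setT f ->
  (forall n x, 0 <= f_ n x) ->
  {ae mu, forall x, f_ n x @[n --> \oo] --> f x} ->
  (\forall n \near \oo, \int[mu]_x f_ n x <= C) ->
  \int[mu]_x f x <= C.
Proof.
move=> mf_ mf f0 ff fC.
rewrite (@ae_eq_integral _ _ _ mu setT (fun x => limn_einf (f_^~ x)))//.
- apply: le_trans (fatou mu measurableT mf_ (fun n x _ => f0 n x)) _.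
  exact: limn_einf_le.
- rewrite /limn_einf; apply: measurableT_comp => //.
  apply: measurable_fun_limn_esup => n; exact: measurableT_comp.
- apply: filterS ff => x h _.
  by have [-> _] := cvg_limn_einf_sup h.
Qed.

End Fatou.

(** * Completeness of $L^2((0,1))$ *)

Section RieszFischer.
Variable R : realType.
Local Notation H := (L2_01 R).
Local Notation mu := (lebesgue01 R).

Lemma ae_L2B (u v : H) : {ae mu, forall x, (u - v) x = u x - v x :> R}.
Proof.
have := LaddE u (- v); have := LoppE v.
by apply: filterS2 => x /(_ I) h1 /(_ I) h2; rewrite h2 h1.
Qed.

Lemma measurable_normL2 (u : H) :
  measurable_fun [set: measurableTypeR R] (fun x => (`|u x|%:E : \bar R)).
Proof.
apply/measurable_EFinP.
by apply: (@measurableT_comp _ _ _ _ _ _ (@Num.norm R R) _ (u : R -> R)) => //;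
  exact: measurable_L2.
Qed.

Let cvg_pt (u : nat -> R) :
  (\sum_(k <oo) `|u k.+1 - u k|%:E < +oo)%E -> cvgn u.
Proof.
move=> h; have : cvgn (series (telescope u)).
  apply: normed_cvg; apply/cvg_ex.
  have s0 : (0 <= \sum_(k <oo) `|u k.+1 - u k|%:E)%E by apply: nneseries_ge0.
  exists (fine (\sum_(k <oo) `|u k.+1 - u k|%:E)%E).
  rewrite (_ : [normed (series (telescope u))] =
    fine \o (fun n => \sum_(0 <= k < n) `|u k.+1 - u k|%:E)%E); last first.
    by apply/funext => n /=; rewrite sumEFin.
  apply: fine_cvg; rewrite fineK ?ge0_fin_numE//.
  exact: is_cvg_nneseries.
rewrite telescopeK => h2.
rewrite (_ : u = cst (u 0%N) + [sequence u n - u 0%N]_n)%R; last first.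
  by apply/funext => n /=; rewrite /GRing.add /= addrC subrK.
by apply: is_cvgD => //; exact: is_cvg_cst.
Qed.

(** Riesz-Fischer: along a subsequence whose increments have norm at most 2^-k the increments are
    summable in L^1, hence absolutely summable almost everywhere; Fatou's lemma then compares the
    pointwise limit with the whole sequence. *)
Lemma L2_complete (u : nat -> H) :
  (forall e : R, 0 < e -> exists N, forall m n, (N <= m)%N -> (N <= n)%N ->
     `|u m - u n| < e) ->
  exists v : H, u n @[n --> \oo] --> v.
Proof.
move=> uC.
have /choice[N NP] : forall k : nat, exists N, forall m n, (N <= m)%N ->
    (N <= n)%N -> `|u m - u n| < (2^-1) ^+ k :> R.
  by move=> k; apply: uC; rewrite exprn_gt0.
(* The sum dominates every [N i] with i <= k, so no monotone choice of [N] has to be made. *)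
pose phi k := (\sum_(i < k.+1) N i)%N.
have phiN k j : (k <= j)%N -> (N k <= phi j)%N.
  by move=> kj; rewrite /phi (bigD1 (inord k))//= inordK// leq_addr.
pose w k := u (phi k.+1) - u (phi k).
have wk k : `|w k| <= (2^-1) ^+ k.
  by apply: ltW; apply: NP; apply: phiN.
have sumw : (\int[mu]_x (\sum_(k <oo) `|w k x|%:E) < +oo)%E.
  rewrite integral_nneseries//; last first.
    by move=> n; exact: measurable_normL2.
  apply: (@le_lt_trans _ _ (\sum_(k <oo) ((2^-1) ^+ k : R)%:E)%E).
    apply: lee_nneseries => [k _ _|k _]; first by apply: integral_ge0 => x _; rewrite lee_fin.
    by apply: le_trans (L1_le_norm _) _; rewrite lee_fin.
  have := @cvg_geometric_series R 1 2^-1.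
  rewrite ger0_norm// invf_lt1// ltr1n => /(_ isT) /cvg_natE h.
  rewrite (_ : limn _ = (1 * (1 - 2^-1)^-1)%:E) ?ltry//.
  apply/cvg_lim => //; move: h; apply: cvg_trans; apply: near_eq_cvg.
  apply: nearW => n /=; rewrite sumEFin /series/=; congr EFin.
  by apply: eq_bigr => i _; rewrite /geometric/= mul1r.
have mw k : measurable_fun setT (fun x => `|w k x|%:E).
  exact: measurable_normL2.
have aew : {ae mu, forall x, (\sum_(k <oo) `|w k x|%:E < +oo)%E}.
  have : mu.-integrable setT (fun x => \sum_(k <oo) `|w k x|%:E)%E.
    apply/integrableP; split; first exact: ge0_emeasurable_sum.
    under eq_integral do rewrite gee0_abs ?nneseries_ge0//.
    exact: sumw.
  move=> /integrable_ae; move/(_ measurableT).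
  by apply: filterS => x /(_ I); rewrite ge0_fin_numE// nneseries_ge0.
have aeall : {ae mu, forall x, forall k, w k x = u (phi k.+1) x - u (phi k) x :> R}.
  by apply/ae_foralln => k; exact: ae_L2B.
(* An upper limit is measurable and defined everywhere; [fine] keeps it real-valued also where
   convergence fails. *)
pose f x := fine (limn_esup (fun k => (u (phi k) x)%:E)).
have aef : {ae mu, forall x, u (phi k) x @[k --> \oo] --> f x}.
  move: aew aeall; apply: filterS2 => x h1 h2.
  have : cvgn (fun k => u (phi k) x : R).
    apply: cvg_pt; under eq_eseriesr do rewrite -h2; exact: h1.
  move=> /cvg_ex[l /= ul]; rewrite /f.
  have /cvg_limn_einf_sup[_ ->] : ((u (phi k) x)%:E @[k --> \oo] --> l%:E)%E.
    exact: cvg_natE.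
  exact: ul.
have mf : measurable_fun [set: measurableTypeR R] f.
  apply: measurableT_comp => //; apply: measurable_fun_limn_esup => n.
  apply/measurable_EFinP; exact: measurable_L2.
have key (e : R) (n : nat) : 0 <= e -> (\forall k \near \oo, `|u (phi k) - u n| <= e) ->
    (\int[mu]_x ((f x - u n x) ^+ 2)%:E <= (e ^+ 2)%:E)%E.
  move=> e0 hk.
  apply: (@ae_fatou _ _ _ mu (fun k x => ((u (phi k) x - u n x) ^+ 2)%:E)).
  - move=> k; apply/measurable_EFinP; apply: measurable_funX.
    by apply: measurable_funB; exact: measurable_L2.
  - apply/measurable_EFinP; apply: measurable_funX.
    by apply: measurable_funB => //; exact: measurable_L2.
  - by move=> k x; rewrite lee_fin sqr_ge0.
  - move: aef; apply: filterS => x h; apply: cvg_natE.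
    under eq_fun do rewrite expr2.
    by rewrite expr2; apply: cvgM; apply: cvgB => //; exact: cvg_cst.
  - apply: filterS hk => k hk.
    have -> : (\int[mu]_x ((u (phi k) x - u n x) ^+ 2)%:E =
              (`|u (phi k) - u n| ^+ 2)%:E)%E.
      rewrite -norm_int; apply: ae_eq_integral => //.
      + apply/measurable_EFinP; apply: measurable_funX.
        by apply: measurable_funB; exact: measurable_L2.
      + by apply/measurable_EFinP; apply: measurable_funX; exact: measurable_L2.
      + by have := ae_L2B (u (phi k)) (u n); apply: filterS => x -> _.
    by rewrite lee_fin ler_pXn2r// nnegrE.
have near_phi (n k : nat) : (N k <= n)%N -> \forall j \near \oo, `|u (phi j) - u n| <= (2^-1) ^+ k.
  move=> kn; near=> j; apply/ltW; apply: NP => //; apply: phiN.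
  by near: j; exact: nbhs_infty_ge.
pose g n x : R := f x - u n x.
have mg n : measurable_fun [set: measurableTypeR R] (g n).
  by apply: measurable_funB => //; exact: measurable_L2.
have g2 n : (N 0 <= n)%N -> g n \in Lfun mu 2%:E.
  move=> n0; apply/andP; split; apply/mem_set; first exact: mg.
  rewrite /= /finite_norm Lnorm2E poweR_lty//.
  apply: (le_lt_trans (@key 1 n ler01 _)); last by rewrite ltry.
  exact: near_phi n0.
(* Only differences with late terms are known to be square integrable ([key] with bound 1), so the
   limit is rebuilt from the class of [f - u (N 0)]. *)
pose v : H := Lclass (Lfun_Sub (lee1n 2) (g2 (N 0%N) (leqnn _))) + u (N 0%N).
exists v; apply/cvgrPdist_le => e e0.
have vu n : (`|v - u n| ^+ 2)%:E = (\int[mu]_x ((f x - u n x) ^+ 2)%:E)%E.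
  rewrite -norm_int; apply: ae_eq_integral => //.
  - by apply/measurable_EFinP; apply: measurable_funX; exact: measurable_L2.
  - apply/measurable_EFinP; apply: measurable_funX; exact: mg.
  - have h1 := ae_L2B v (u n).
    have h2 := LaddE (Lclass (Lfun_Sub (lee1n 2) (g2 (N 0%N) (leqnn _)))) (u (N 0%N)).
    have h3 := LclassE (Lfun_Sub (lee1n 2) (g2 (N 0%N) (leqnn _))).
    move: h1 h2 h3; apply: filterS3 => x h1 /(_ I) h2 /(_ I) h3 _.
    rewrite h1 /v; congr EFin; congr (_ ^+ 2); congr (_ - _).
    by rewrite [LHS]h2 [X in X + _]h3 /= /g subrK.
have [k ke] : exists k, (2^-1) ^+ k <= e :> R.
  have := @cvg_geometric R 1 2^-1.
  rewrite ger0_norm// invf_lt1// ltr1n => /(_ isT) /cvgrPdist_le /(_ _ e0).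
  case=> k _ /(_ k (leqnn k)) /=; rewrite sub0r normrN mul1r ger0_norm ?exprn_ge0//.
  by exists k.
near=> n; apply: (le_trans _ ke).
rewrite -(@ler_pXn2r _ 2)// ?nnegrE ?exprn_ge0// -lee_fin vu; apply: key.
  by rewrite exprn_ge0.
by apply: near_phi; near: n; exact: nbhs_infty_ge.
Unshelve. all: by end_near. Qed.

End RieszFischer.

(** * The sine basis *)

Section SineBasis.
Variable R : realType.
Local Notation H := (L2_01 R).
Local Notation mu := (lebesgue01 R).
Local Notation leb := (@lebesgue_measure R).
Local Notation I01 := (`]0%R, 1%R[%classic : set (measurableTypeR R)).

Lemma mu01E (A : set (measurableTypeR R)) : mu A = leb (A `&` I01).
Proof. by []. Qed.

Lemma mu01_compl : mu (~` I01) = 0%E.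
Proof. by rewrite mu01E setICl measure0. Qed.

Lemma measurable_I01 : measurable I01.
Proof. exact: measurable_itv. Qed.

Lemma ge0_integral01 (f : R -> \bar R) :
  measurable_fun [set: measurableTypeR R] f -> (forall x, 0 <= f x)%E ->
  (\int[mu]_x f x = \int[leb]_(x in I01) f x)%E.
Proof.
move=> mf f0.
rewrite (@ge0_negligible_integral _ _ _ mu setT (~` I01))//; last 2 first.
- by apply: measurableC; exact: measurable_I01.
- exact: mu01_compl.
rewrite setTD setCK; apply: eq_measure_integral => A mA AI.
by transitivity (leb (A `&` I01)); [|rewrite setIidl].
Qed.

Lemma integral01 (f : R -> \bar R) :
  measurable_fun [set: measurableTypeR R] f ->
  (\int[mu]_x f x = \int[leb]_(x in I01) f x)%E.
Proof.
move=> mf; rewrite integralE [RHS]integralE.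
rewrite (ge0_integral01 (measurable_funepos mf) (fun x => funepos_ge0 f x)).
by rewrite (ge0_integral01 (measurable_funeneg mf) (fun x => funeneg_ge0 f x)).
Qed.

Lemma ae01 (Q : R -> Prop) : {ae leb, forall x, I01 x -> Q x} ->
  {ae mu, forall x : measurableTypeR R, Q x}.
Proof.
move=> [N [mN N0 NQ]]; exists (N `|` ~` I01); split.
- by apply: measurableU => //; apply: measurableC; exact: measurable_I01.
- rewrite mu01E setIUl setICl setU0.
  apply/eqP; rewrite eq_le measure_ge0 andbT -N0.
  apply: le_measure; rewrite ?inE//.
  by apply: measurableI => //; exact: measurable_I01.
- move=> x /= nQ; have [xI|xI] := pselect (I01 x); last by right.
  by left; apply: NQ => /=; apply: contra_not nQ; exact.
Qed.

Lemma continuous_cosM (a : R) : continuous (fun x : R => cos (a * x)).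
Proof.
move=> x; apply: continuous_comp; last exact: continuous_cos.
by apply: cvgM; [exact: cvg_cst|exact: cvg_id].
Qed.

Lemma measurable_cosM (a : R) :
  measurable_fun [set: measurableTypeR R] (fun x : R => cos (a * x)).
Proof. by apply: continuous_measurable_fun; exact: continuous_cosM. Qed.

Lemma is_derive_mull (a x : R) : is_derive x 1 (fun y : R => a * y) a.
Proof.
have h := @is_deriveZ R R R id a x 1 1 (is_derive_id x 1).
by rewrite -[X in is_derive _ _ _ X](mulr1 a).
Qed.

Lemma is_derive_sinM (a x : R) :
  is_derive x 1 (fun y : R => sin (a * y)) (a * cos (a * x)).
Proof.
rewrite mulrC.
exact: (@is_derive1_comp _ sin (fun y => a * y) x _ _ (is_derive_sin _)
  (is_derive_mull a x)).
Qed.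

Lemma mu01T : mu setT = 1%E.
Proof.
rewrite [LHS](mu01E setT) setTI lebesgue_measure_itv /=.
by rewrite lte01 oppr0 adde0.
Qed.

Lemma integral01_cos (a : R) : a != 0 ->
  (\int[mu]_x (cos (a * x))%:E = (sin a / a)%:E)%E.
Proof.
move=> a0; rewrite integral01; last first.
  by apply/measurable_EFinP; exact: measurable_cosM.
rewrite -(@integral_itv_bndoo _ _ _ _ true false); last first.
  apply/measurable_EFinP; apply: measurable_funS (measurable_cosM a) => //.
rewrite (@continuous_FTC2 _ _ (fun x => sin (a * x) / a))//.
- by rewrite mulr1 mulr0 sin0 mul0r sube0.
- apply: continuous_subspaceT; exact: continuous_cosM.
- have d x : derivable (fun x : R => sin (a * x) / a) x 1 by [].
  have c : continuous (fun x : R => sin (a * x) / a).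
    by move=> x; apply: differentiable_continuous; exact/derivable1_diffP.
  split => //.
  + by apply: cvg_at_right_filter; exact: c.
  + by apply: cvg_at_left_filter; exact: c.
- move=> x _; rewrite derive1E.
  have -> : (fun x : R => sin (a * x) / a) = a^-1 \*: (fun x => sin (a * x)).
    by apply/funext => y /=; rewrite mulrC.
  have := is_deriveZ a^-1 (is_derive_sinM a x).
  move=> h; rewrite derive_val.
  by rewrite /GRing.scale /= mulKf.
Qed.

Lemma ip_eigfl k (u : H) : ip (eigf R k) u = \int[mu]_x (sine_fun k x * u x).
Proof.
apply: ip_congr.
- by apply: measurable_funM; exact: measurable_L2.
- apply: measurable_funM; last exact: measurable_L2.
  by have /andP[/set_mem] := sine_fun_Lfun R k.
- have := LclassE (Lfun_Sub (lee1n 2) (sine_fun_Lfun R k)).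
  by apply: filterS => x /(_ I) h _; rewrite h.
Qed.

Lemma continuous_sine k : continuous (@sine_fun R k).
Proof.
move=> x; apply: cvgM; first exact: cvg_cst.
apply: continuous_comp; last exact: continuous_sin.
by apply: cvgM; [exact: cvg_cst|exact: cvg_id].
Qed.

Lemma measurable_sine k : measurable_fun [set: measurableTypeR R] (@sine_fun R k).
Proof. by apply: continuous_measurable_fun; exact: continuous_sine. Qed.

Lemma sin_nat_pi (n : nat) : sin (n%:R * pi) = 0 :> R.
Proof.
elim: n => [|n IH]; first by rewrite mul0r sin0.
by rewrite -natr1 mulrDl mul1r sinDpi IH oppr0.
Qed.

Lemma integral01_cosE (a : R) : sin a = 0 ->
  \int[mu]_x cos (a * x) = (a == 0)%:R.
Proof.
move=> sa; have [->|a0] := eqVneq a 0; last first.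
  by rewrite /Rintegral integral01_cos// sa mul0r.
under eq_Rintegral do rewrite mul0r cos0.
rewrite Rintegral_cst// mul1r; exact: (congr1 fine mu01T).
Qed.

Lemma integrable01_cos (a : R) :
  mu.-integrable setT (EFin \o (fun x => cos (a * x))).
Proof.
apply: measurable_bounded_integrable => //.
- by have : (mu setT < +oo)%E by rewrite mu01T ltry.
- exact: measurable_cosM.
- exists 1; split; first exact: num_real.
  by move=> M M1 x _ /=; apply: (le_trans _ (ltW M1)); rewrite ler_norml cos_geN1 cos_le1.
Qed.

Lemma eigf_ortho j k : (0 < j)%N -> (0 < k)%N ->
  ip (eigf R j) (eigf R k) = (j == k)%:R.
Proof.
move=> j0 k0; rewrite ipC ip_eigfl.
rewrite (@ip_congr _ _ (fun x => sine_fun k x * sine_fun j x)); last 3 first.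
- apply: measurable_funM; [exact: measurable_sine|exact: measurable_L2].
- apply: measurable_funM; exact: measurable_sine.
- have := LclassE (Lfun_Sub (lee1n 2) (sine_fun_Lfun R j)).
  by apply: filterS => x /(_ I) h _; rewrite h.
rewrite (@eq_Rintegral _ _ _ mu setT (fun x => cos ((k%:R - j%:R) * pi * x) -
   cos ((k + j)%:R * pi * x))); last first.
  move=> x _; rewrite /sine_fun.
  have -> : (k%:R - j%:R) * pi * x = k%:R * pi * x - j%:R * pi * x by ring.
  rewrite (_ : (k + j)%:R * pi * x = k%:R * pi * x + j%:R * pi * x); last first.
    by rewrite natrD; ring.
  rewrite cosB cosD.
  have s2 : Num.sqrt 2 * Num.sqrt 2 = 2 :> R by rewrite -expr2 sqr_sqrtr.
  set a := sin _; set b := sin _.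
  rewrite (_ : _ * (_ * _) = (Num.sqrt 2 * Num.sqrt 2) * (a * b)); last by ring.
  by rewrite s2; ring.
rewrite RintegralB//; [|exact: integrable01_cos|exact: integrable01_cos].
rewrite !integral01_cosE; last 2 first.
- rewrite mulrBl sinB !sin_nat_pi; ring.
- exact: sin_nat_pi.
rewrite !mulf_eq0 !(gt_eqF (pi_gt0 R)) !orbF subr_eq0 eqr_nat.
by rewrite pnatr_eq0 addn_eq0 (gtn_eqF k0) /= subr0 eq_sym.
Qed.

End SineBasis.

(** * Completeness of the sine system *)

Section SineComplete.
Variable R : realType.
Local Notation H := (L2_01 R).
Local Notation mu := (lebesgue01 R).
Local Notation leb := (@lebesgue_measure R).
Local Notation I01 := (`]0%R, 1%R[%classic : set (measurableTypeR R)).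

Lemma integrable_L2 (f : H) : mu.-integrable setT (EFin \o (f : R -> R)).
Proof.
apply/integrableP; split.
  by apply/measurable_EFinP; exact: measurable_L2.
by apply: le_lt_trans (L1_le_norm f) _; rewrite ltry.
Qed.

Lemma integrable_L2M (f : H) (g : R -> R) (M : R) :
  measurable_fun [set: measurableTypeR R] g -> (forall x, `|g x| <= M) ->
  mu.-integrable setT (EFin \o (fun x => f x * g x)).
Proof.
move=> mg gM.
have h : mu.-integrable setT ((EFin \o g) \* (EFin \o (f : R -> R)))%E.
  apply: integrableMr => //; last exact: integrable_L2.
  exists M; split; first exact: num_real.
  by move=> N MN x _ /=; apply: (le_trans _ (ltW MN)).
by apply: eq_integrable h => // x _ /=; rewrite -EFinM mulrC.
Qed.

(** Not the cardinal sine: the powers of cos (pi x) are there because sin (k pi x) times a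
    polynomial in cos (pi x) stays in the span of the sines. *)
Definition sinc (k j : nat) (x : R) : R := sin (k%:R * pi * x) * cos (pi * x) ^+ j.

Lemma measurable_sinc k j : measurable_fun [set: measurableTypeR R] (sinc k j).
Proof.
apply: measurable_funM; last by apply: measurable_funX; exact: measurable_cosM.
apply: continuous_measurable_fun => x.
apply: continuous_comp; last exact: continuous_sin.
by apply: cvgM; [exact: cvg_cst|exact: cvg_id].
Qed.

Lemma sinc_le1 k j x : `|sinc k j x| <= 1.
Proof.
rewrite /sinc normrM normrX.
apply: mulr_ile1; rewrite ?exprn_ge0//.
  by rewrite ler_norml sin_geN1 sin_le1.
by apply: exprn_ile1 => //; rewrite ler_norml cos_geN1 cos_le1.
Qed.

Section orthogonal.
Variable f : H.
Hypothesis f0 : forall k, (0 < k)%N -> ip (eigf R k) f = 0.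

(** Induction on [j] by sin a cos b = (sin (a + b) + sin (a - b)) / 2, which shifts [k] by one in
    both directions; [k = 0] is reached on the way down and is trivial since sin 0 = 0. *)
Lemma int_sinc0 k j : \int[mu]_x (f x * sinc k j x) = 0.
Proof.
elim: j k => [|j IH] [|k].
- by under eq_Rintegral do rewrite /sinc mul0r mul0r sin0 mul0r mulr0;
    rewrite /Rintegral integral0.
- have := f0 (ltn0Sn k); rewrite ip_eigfl.
  have s2 : Num.sqrt 2 != 0 :> R by rewrite sqrtr_eq0 -ltNge.
  rewrite (@eq_Rintegral _ _ _ mu setT (fun x => Num.sqrt 2 * (f x * sinc k.+1 0 x)));
    last by move=> x _; rewrite /sine_fun /sinc expr0; ring.
  rewrite RintegralZl//; last exact: (integrable_L2M f (measurable_sinc _ _) (@sinc_le1 _ _)).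
  by move=> /eqP; rewrite mulf_eq0 (negbTE s2) => /eqP.
- by under eq_Rintegral do rewrite /sinc mul0r mul0r sin0 mul0r mulr0;
    rewrite /Rintegral integral0.
- rewrite (@eq_Rintegral _ _ _ mu setT
     (fun x => 2^-1 * (f x * sinc k.+2 j x + f x * sinc k j x))); last first.
    move=> x _; rewrite /sinc exprS.
    have -> : k.+2%:R * pi * x = k.+1%:R * pi * x + pi * x.
      by rewrite -(natr1 k.+1); ring.
    have -> : k%:R * pi * x = k.+1%:R * pi * x - pi * x.
      by rewrite -(natr1 k); ring.
    by rewrite sinD sinB; field.
  have i1 m := integrable_L2M f (measurable_sinc m j) (@sinc_le1 m j).
  rewrite RintegralZl//; last by have := integrableD measurableT (i1 k.+2) (i1 k).
  by rewrite RintegralD// !IH addr0 mulr0.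
Qed.

Lemma measurable_hornerc (p : {poly R}) :
  measurable_fun [set: measurableTypeR R] (fun x => p.[cos (pi * x)]).
Proof.
apply: continuous_measurable_fun => x.
apply: continuous_comp; first exact: continuous_cosM.
exact: continuous_horner.
Qed.

Lemma horner_bound (p : {poly R}) : exists M, forall x, `|p.[cos (pi * x)]| <= M.
Proof.
exists (\sum_(i < size p) `|p`_i|) => x; rewrite horner_coef.
apply: le_trans (ler_norm_sum _ _ _) _; apply: ler_sum => i _.
rewrite normrM ler_piMr// normrX exprn_ile1//.
by rewrite ler_norml cos_geN1 cos_le1.
Qed.

Lemma int_sinc_poly (p : {poly R}) j :
  \int[mu]_x (f x * (sinc 1 j x * p.[cos (pi * x)])) = 0.
Proof.
elim/poly_ind: p j => [|p c IH] j.
  under eq_Rintegral do rewrite horner0 !mulr0.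
  by rewrite /Rintegral integral0.
rewrite (@eq_Rintegral _ _ _ mu setT
   (fun x => f x * (sinc 1 j.+1 x * p.[cos (pi * x)]) + c * (f x * sinc 1 j x)));
   last first.
  by move=> x _; rewrite hornerMXaddC /sinc exprS; ring.
have i1 m := integrable_L2M f (measurable_sinc m j) (@sinc_le1 m j).
have [M pM] := horner_bound p.
rewrite RintegralD//; last 2 first.
- apply: (@integrable_L2M f _ M).
  + by apply: measurable_funM; [exact: measurable_sinc|exact: measurable_hornerc].
  + move=> x; rewrite normrM (le_trans _ (pM x))// ler_piMl//; exact: sinc_le1.
- have h := integrableZl measurableT c (i1 1%N).
  by apply: eq_integrable h.
by rewrite IH RintegralZl// int_sinc0 mulr0 addr0.
Qed.

(* On [0,1] the polynomials (1 - z^n)^(2^n) converge boundedly to the indicator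
   of z < 1/2; z is taken affine in cos (pi x). *)
Lemma step_poly_cvg (z : R) : 0 <= z <= 1 -> z != 2^-1 ->
  (1 - z ^+ n) ^+ (2 ^ n) @[n --> \oo] --> ((z < 2^-1)%R%:R : R).
Proof.
move=> /andP[z0 z1] zh.
have zn n : 0 <= z ^+ n <= 1 by rewrite exprn_ge0//= exprn_ile1.
have [zlt|zge] := ltP z 2^-1.
- apply: (@squeeze_cvgr _ _ _ _ (fun n => 1 - (2 * z) ^+ n) (cst 1)).
  + apply: nearW => n; apply/andP; split; last first.
      by have /andP[h1 h2] := zn n; rewrite exprn_ile1// ?subr_ge0// gerBl.
    rewrite exprMn -natrX.
    have : forall m : nat, 1 - m%:R * z ^+ n <= (1 - z ^+ n) ^+ m.
      elim=> [|m IH]; first by rewrite mul0r subr0 expr0.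
      rewrite exprS; have /andP[h1 h2] := zn n.
      have := ler_wpM2l (_ : 0 <= 1 - z ^+ n) IH.
      rewrite subr_ge0 => /(_ h2); apply: le_trans.
      rewrite -natr1; have m0 : 0 <= m%:R :> R by [].
      nra.
    exact.
  + rewrite -[X in _ --> X](subr0 1); apply: cvgB; first exact: cvg_cst.
    apply: cvg_expr; rewrite ger0_norm ?mulr_ge0//; lra.
  + exact: cvg_cst.
- have zgt : 2^-1 < z by rewrite lt_neqAle eq_sym zh.
  apply: (@squeeze_cvgr _ _ _ _ (cst 0) (fun n => ((2 * z)^-1) ^+ n)).
  + apply: nearW => n; have /andP[h1 h2] := zn n.
    rewrite exprn_ge0 ?subr_ge0//=.
    (* Counterpart of Bernoulli's inequality, (1 - y)^m (1 + m y) <= 1; with y = z^n and m = 2^n it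
       bounds the polynomial by 1 / (2 z)^n. *)
    have key : forall m : nat, (1 - z ^+ n) ^+ m * (1 + m%:R * z ^+ n) <= 1.
      elim=> [|m IH]; first by rewrite mul0r addr0 expr0 mulr1.
      apply: le_trans IH; rewrite exprSr -mulrA ler_wpM2l//.
        by rewrite exprn_ge0 ?subr_ge0.
      rewrite -natr1; have m0 : 0 <= m%:R :> R by [].
      nra.
    have := key (2 ^ n)%N; rewrite natrX -exprMn => hk.
    have p0 : 0 < (2 * z) ^+ n by rewrite exprn_gt0//; lra.
    rewrite exprVn -[leRHS]mul1r ler_pdivlMr//.
    apply: le_trans hk; rewrite ler_wpM2l ?exprn_ge0 ?subr_ge0//.
    by rewrite lerDr.
  + exact: cvg_cst.
  + apply: cvg_expr; rewrite ger0_norm ?invr_ge0 ?mulr_ge0//.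
    rewrite invf_lt1; lra.
Qed.

(** The cosine is strictly decreasing on [0, pi], so the segment x < a is a sublevel set of an
    affine function of cos (pi x); [step_poly_cvg] makes its indicator a bounded limit of
    polynomials in cos (pi x), against which the integral already vanishes. *)
Lemma int_initial_seg (a : R) : 0 < a < 1 ->
  \int[mu]_x (f x * (sinc 1 0 x * (x < a)%R%:R)) = 0.
Proof.
move=> /andP[a0 a1].
pose c := cos (pi * a).
(* Dividing by 4 keeps [z] in [0, 1], as [c] and the cosine lie in [-1, 1]; on (0, 1) the condition
   z < 1/2 means x < a. *)
pose z x : R := 2^-1 + (c - cos (pi * x)) / 4.
pose Z : {poly R} := (2^-1 + c / 4)%:P - 4^-1 *: 'X.
pose p n : {poly R} := (1 - Z ^+ n) ^+ (2 ^ n).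
have pE n x : (p n).[cos (pi * x)] = (1 - z x ^+ n) ^+ (2 ^ n).
  rewrite /p /Z horner_exp hornerD hornerN horner_exp !hornerE.
  suff -> : 2^-1 + c / 4 - 4^-1 * cos (pi * x) = z x by [].
  by rewrite /z; field.
have z01 x : 0 <= z x <= 1.
  have c1 : -1 <= c <= 1 by rewrite cos_geN1 cos_le1.
  have c2 : -1 <= cos (pi * x) <= 1 by rewrite cos_geN1 cos_le1.
  rewrite /z; lra.
have p1 n x : `|(p n).[cos (pi * x)]| <= 1.
  rewrite pE; have /andP[h1 h2] := z01 x.
  have h : 0 <= 1 - z x ^+ n <= 1.
    by rewrite subr_ge0 exprn_ile1//= gerBl exprn_ge0.
  move: h => /andP[h3 h4].
  by rewrite ger0_norm ?exprn_ge0// exprn_ile1.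
have intx (g : R -> R) : measurable_fun [set: measurableTypeR R] g ->
    (forall x, `|g x| <= 1) ->
    mu.-integrable setT (EFin \o (fun x => f x * (sinc 1 0 x * g x))).
  move=> mg g1; apply: (@integrable_L2M f _ 1).
    by apply: measurable_funM => //; exact: measurable_sinc.
  by move=> x; rewrite normrM mulr_ile1// sinc_le1.
have mind : measurable_fun [set: measurableTypeR R] (fun x : R => (x < a)%R%:R : R).
  rewrite (_ : (fun _ => _) = \1_(`]-oo, a[%classic : set (measurableTypeR R))); last first.
    by apply/funext => x; rewrite indicE mem_setE in_itv.
  by apply: measurable_indic; exact: measurable_itv.
have H1 x : `|(x < a)%R%:R : R| <= 1 by case: ltP => _; rewrite ?normr1 ?normr0.
have H2 : {ae mu, forall x : measurableTypeR R, [set: R] x ->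
   (f x * (sinc 1 0 x * (p n).[cos (pi * x)]))%:E @[n --> \oo] -->
   (f x * (sinc 1 0 x * (x < a)%R%:R))%:E}.
  apply: ae01.
  exists [set a]; split => //; first exact: lebesgue_measure_set1.
  move=> x /=; apply: contra_notP => xa; rewrite in_itv/= => /andP[x0 x1] _.
  apply: cvg_natE; apply: cvgM; first exact: cvg_cst.
  apply: cvgM; first exact: cvg_cst.
  under eq_fun do rewrite pE.
  have ca : (cos (pi * x) <= c) = (a <= x).
    rewrite /c leNgt ltr_cos ?in_itv/= ?mulr_ge0 ?pi_ge0 ?ger_pMr ?pi_gt0 ?(ltW x0) ?(ltW x1) ?(ltW a0) ?(ltW a1)//.
    by rewrite ltr_pM2l ?pi_gt0// -leNgt.
  have ca' : (c < cos (pi * x)) = (x < a) by rewrite ltNge ca -ltNge.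
  have -> : (x < a) = (z x < 2^-1).
    rewrite -ca' /z; apply/idP/idP; lra.
  apply: step_poly_cvg; first exact: z01.
  apply/eqP => zx; apply: xa.
  have cc : cos (pi * x) = cos (pi * a) by move: zx; rewrite /z -/c; lra.
  have : pi * x = pi * a :> R.
    by apply: cos_inj cc; rewrite in_itv/= mulr_ge0 ?pi_ge0 ?ger_pMr ?pi_gt0 ?(ltW x0) ?(ltW x1) ?(ltW a0) ?(ltW a1).
  by apply: mulfI; rewrite gt_eqF ?pi_gt0.
have H3 : {ae mu, forall (x : measurableTypeR R) n, [set: R] x ->
   (`|(f x * (sinc 1 0 x * (p n).[cos (pi * x)]))%:E| <= (abse \o (EFin \o (f : R -> R))) x)%E}.
  apply: aeW => x n _; rewrite lee_fin normrM ler_piMr// normrM.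
  by rewrite mulr_ile1// sinc_le1.
have m1 n : measurable_fun [set: measurableTypeR R]
    (fun x => (f x * (sinc 1 0 x * (p n).[cos (pi * x)]))%:E).
  by have /integrableP[] := intx _ (measurable_hornerc (p n)) (p1 n).
have m2 : measurable_fun [set: measurableTypeR R]
    (fun x => (f x * (sinc 1 0 x * (x < a)%R%:R))%:E).
  by have /integrableP[] := intx _ mind H1.
have [_ _ h] := @dominated_convergence _ _ _ mu setT measurableT
  _ _ _ m1 m2 H2 (integrable_abse (integrable_L2 f)) H3.
have {}h : (\int[mu]_x (f x * (sinc 1 0 x * (p n).[cos (pi * x)]))%:E)%E @[n --> \oo]
     --> (\int[mu]_x (f x * (sinc 1 0 x * (x < a)%R%:R))%:E)%E by exact: h.
rewrite /Rintegral; have <- : 0%E = (\int[mu]_x (f x * (sinc 1 0 x * (x < a)%R%:R))%:E)%E.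
  apply: cvg_unique _ h => //.
  have -> : (fun n => (\int[mu]_x (f x * (sinc 1 0 x * (p n).[cos (pi * x)]))%:E)%E) = cst 0%E.
    apply/funext => n; rewrite -[RHS]/(0%:E) -(int_sinc_poly (p n) 0) /Rintegral fineK//.
    apply: integrable_fin_num => //; apply: (intx _ (measurable_hornerc (p n)) (p1 n)).
  exact: cvg_cst.
by [].
Qed.

Lemma int01_congr (g1 g2 : R -> R) :
  measurable_fun [set: measurableTypeR R] g1 ->
  measurable_fun [set: measurableTypeR R] g2 ->
  (forall x, 0 < x < 1 -> g1 x = g2 x) -> \int[mu]_x g1 x = \int[mu]_x g2 x.
Proof.
move=> m1 m2 g12; apply: ip_congr => //.
have : {ae mu, forall x : measurableTypeR R, g1 x = g2 x}.
  apply: ae01; apply: aeW => x /=; rewrite in_itv/=; exact: g12.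
by apply: filterS => x -> _.
Qed.

Lemma measurable_lt_ind (y : R) :
  measurable_fun [set: measurableTypeR R] (fun x : R => (x < y)%R%:R : R).
Proof.
rewrite (_ : (fun _ => _) = \1_(`]-oo, y[%classic : set (measurableTypeR R))); last first.
  by apply/funext => x; rewrite indicE mem_setE in_itv.
by apply: measurable_indic; exact: measurable_itv.
Qed.

Lemma measurable_le_ind (y : R) :
  measurable_fun [set: measurableTypeR R] (fun x : R => (x <= y)%R%:R : R).
Proof.
rewrite (_ : (fun _ => _) = \1_(`]-oo, y]%classic : set (measurableTypeR R))); last first.
  by apply/funext => x; rewrite indicE mem_setE in_itv.
by apply: measurable_indic; exact: measurable_itv.
Qed.

Lemma int_seg (y : R) : \int[mu]_x (f x * (sinc 1 0 x * (x <= y)%R%:R)) = 0.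
Proof.
have mg (g : R -> R) : measurable_fun [set: measurableTypeR R] g ->
    measurable_fun [set: measurableTypeR R] (fun x => f x * (sinc 1 0 x * g x)).
  move=> h; apply: measurable_funM; first exact: measurable_L2.
  by apply: measurable_funM => //; exact: measurable_sinc.
have [y0|y0] := leP y 0.
  rewrite (@int01_congr _ (cst 0)).
  - by rewrite /Rintegral integral0.
  - by apply: mg; exact: measurable_le_ind.
  - exact: measurable_cst.
  - by move=> x /andP[x0 x1]; rewrite leNgt (le_lt_trans y0 x0) !mulr0.
have [y1|y1] := leP 1 y.
  rewrite -[RHS](int_sinc0 1 0); apply: int01_congr.
  - by apply: mg; exact: measurable_le_ind.
  - by apply: measurable_funM; [exact: measurable_L2|exact: measurable_sinc].
  - by move=> x /andP[x0 x1]; rewrite (ltW (lt_le_trans x1 y1)) mulr1.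
rewrite -(@int_initial_seg y) ?y0//; apply: ip_congr.
- by apply: mg; exact: measurable_le_ind.
- by apply: mg; exact: measurable_lt_ind.
- have : {ae mu, forall x : measurableTypeR R, (x <= y)%R = (x < y)%R}.
    apply: ae01; exists [set y]; split => //; first exact: lebesgue_measure_set1.
    move=> x /=; apply: contra_notP => xy _.
    by rewrite le_eqVlt; case: eqP => //= xy'; case: xy.
  by apply: filterS => x -> _.
Qed.

(** The primitive of f(x) sin (pi x), cut off outside (0, 1), vanishes identically, so by Lebesgue
    differentiation this product is 0 almost everywhere; on (0, 1) the sine is positive. *)
Lemma sine_complete : f = 0.
Proof.
pose m : R -> R := (fun x => f x * sinc 1 0 x) \_ I01.
have mm : measurable_fun [set: measurableTypeR R] (fun x => f x * sinc 1 0 x).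
  by apply: measurable_funM; [exact: measurable_L2|exact: measurable_sinc].
have intm0 : leb.-integrable I01 (EFin \o (fun x => f x * sinc 1 0 x)).
  have /integrableP[h1 h2] := integrable_L2M f (measurable_sinc 1 0) (@sinc_le1 1 0).
  apply/integrableP; split; first exact: measurable_funS h1.
  by move: h2; rewrite integral01//; exact: measurableT_comp.
have intm : leb.-integrable setT (EFin \o m).
  rewrite /m -restrict_EFin.
  exact: (integrable_mkcond _ (@measurable_I01 R)).1 intm0.
have locm : locally_integrable setT m.
  by apply: open_integrable_locally => //; exact: openT.
have intmy y : leb.-integrable `]-oo, y] (EFin \o m).
  by apply: integrableS intm => //; exact: measurable_itv.
have F0 y : \int[leb]_(t in `]-oo, y]) m t = 0.
  rewrite -[RHS](int_seg y) /Rintegral; congr fine.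
  rewrite integral01; last first.
    apply/measurable_EFinP; apply: measurable_funM; first exact: measurable_L2.
    by apply: measurable_funM; [exact: measurable_sinc|exact: measurable_le_ind].
  rewrite integral_mkcond [RHS]integral_mkcond; apply: eq_integral => x _.
  rewrite /m !patchE !mem_setE !in_itv/=.
  by case: (x <= y); case: (0 < x < 1) => //; rewrite ?mulr1 ?mulr0.
have h := FTC1Ny intmy locm.
have {}h : {ae leb, forall x, m x = 0}.
  apply: ae_mono h => x /= [_ <-].
  have -> : (fun y => \int[leb]_(t in `]-oo, y]) m t) = cst 0 by apply/funext.
  by rewrite derive1_cst.
apply: LspaceP.
have : {ae mu, forall x : measurableTypeR R, f x = 0 :> R}.
  apply: ae01; apply: ae_mono h => x mx; rewrite /= in_itv/= => x01.
  move: mx; rewrite /m patchE mem_setE in_itv/= x01 => /eqP.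
  rewrite mulf_eq0 => /orP[/eqP//|]; rewrite /sinc expr0 mulr1 mul1r.
  case/andP: x01 => x0 x1; rewrite gt_eqF// sin_gt0_pi//.
  by rewrite mulr_gt0 ?pi_gt0//= gtr_pMr ?pi_gt0.
have := LzeroE mu (lee1n 2); apply: filterS2 => x /(_ I) h1 h2 _.
by rewrite h2; symmetry; exact: h1.
Qed.

End orthogonal.
End SineComplete.

(** * Spectral calculus *)

Lemma cvg_nat_le (R : realType) (u : nat -> R) (l M : R) :
  u n @[n --> \oo] --> l -> (forall n, u n <= M) -> l <= M.
Proof.
move=> ul uM; rewrite -(cvg_lim (@Rhausdorff R) ul); apply: limr_le.
  by apply/cvg_ex; exists l.
exact: nearW.
Qed.

Section Coordinates.
Variable R : realType.
Local Notation H := (L2_01 R).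
Local Notation e := (eigf R).
Implicit Types (u v : H) (a : nat -> R) (k n : nat).

Definition cf k u : R := ip (e k) u.
Definition fsum n a : H := \sum_(1 <= k < n.+1) a k *: e k.

Lemma cfD k u v : cf k (u + v) = cf k u + cf k v. Proof. exact: ipDr. Qed.
Lemma cfB k u v : cf k (u - v) = cf k u - cf k v. Proof. exact: ipBr. Qed.
Lemma cfZ k b u : cf k (b *: u) = b * cf k u. Proof. exact: ipZr. Qed.
Lemma cf0 k : cf k 0 = 0. Proof. exact: ip0r. Qed.
Lemma cf_sum k (I : Type) (r : seq I) (P : pred I) (F : I -> H) :
  cf k (\sum_(i <- r | P i) F i) = \sum_(i <- r | P i) cf k (F i).
Proof. exact: ip_sumr. Qed.

Lemma cf_fsum k n a : (0 < k)%N -> cf k (fsum n a) = (k <= n)%N%:R * a k.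
Proof.
move=> k0; rewrite /fsum cf_sum.
under eq_big_nat => i /andP[i0 _] do rewrite cfZ /cf eigf_ortho//.
have [kn|kn] := leqP k n.
  rewrite (bigD1_seq k)/= ?iota_uniq ?mem_index_iota ?k0//= eqxx mulr1.
  rewrite big1 ?addr0 ?mul1r// => i ik.
  by rewrite eq_sym (negbTE ik) mulr0.
rewrite mul0r big_nat big1// => i /andP[i0 ik].
by case: eqP => [ki|_]; [by move: ik; rewrite -ki ltnS leqNgt kn|rewrite mulr0].
Qed.

Lemma ip_fsum n a u : ip (fsum n a) u = \sum_(1 <= k < n.+1) a k * cf k u.
Proof. by rewrite /fsum ip_suml; apply: eq_bigr => k _; rewrite ipZl. Qed.

Lemma norm_fsum n a : `|fsum n a| ^+ 2 = \sum_(1 <= k < n.+1) a k ^+ 2.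
Proof.
rewrite norm_sqr ip_fsum big_nat [RHS]big_nat; apply: eq_bigr => k /andP[k0 kn].
by rewrite cf_fsum// -ltnS kn mul1r expr2.
Qed.

Lemma PprojE n u : Pproj n u = fsum n (fun k => cf k u).
Proof. by []. Qed.

Lemma cf_Pproj k n u : (0 < k)%N -> cf k (Pproj n u) = (k <= n)%N%:R * cf k u.
Proof. by move=> k0; rewrite PprojE cf_fsum. Qed.

Lemma norm_Pproj n u : `|Pproj n u| ^+ 2 = \sum_(1 <= k < n.+1) cf k u ^+ 2.
Proof. by rewrite PprojE norm_fsum. Qed.

Lemma bessel n u : \sum_(1 <= k < n.+1) cf k u ^+ 2 <= `|u| ^+ 2.
Proof.
have := sqr_ge0 `|u - Pproj n u|; rewrite normB_sqr norm_Pproj.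
rewrite ipC PprojE ip_fsum.
under eq_bigr do rewrite -expr2.
lra.
Qed.

Lemma sqrtD_sum (a : nat -> R) m n : (m <= n)%N ->
  \sum_(1 <= k < n.+1) a k ^+ 2 =
  \sum_(1 <= k < m.+1) a k ^+ 2 + \sum_(m.+1 <= k < n.+1) a k ^+ 2.
Proof. by move=> mn; rewrite -big_cat_nat. Qed.

Lemma fsumB n m a : (m <= n)%N -> `|fsum n a - fsum m a| ^+ 2 =
  \sum_(1 <= k < n.+1) a k ^+ 2 - \sum_(1 <= k < m.+1) a k ^+ 2.
Proof.
move=> mn; rewrite normB_sqr !norm_fsum ip_fsum.
rewrite [\sum_(1 <= k < n.+1) a k * _](@big_cat_nat _ _ _ m.+1)//= (sqrtD_sum _ mn).
rewrite (_ : \sum_(1 <= i < m.+1) a i * cf i (fsum m a) = \sum_(1 <= k < m.+1) a k ^+ 2);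
  last first.
  rewrite big_nat [RHS]big_nat; apply: eq_bigr => k /andP[k0 km].
  by rewrite cf_fsum// -ltnS km mul1r expr2.
rewrite (_ : \sum_(m.+1 <= i < n.+1) a i * cf i (fsum m a) = 0); last first.
  rewrite big_nat big1// => k /andP[km _].
  by rewrite cf_fsum ?(leq_ltn_trans _ km)// leqNgt km mul0r mulr0.
ring.
Qed.

(** By [fsumB] squared distances of partial sums are increments of a bounded monotone real
    sequence. *)
Lemma fsum_cvg a (M : R) : (forall n, \sum_(1 <= k < n.+1) a k ^+ 2 <= M) ->
  exists v : H, fsum n a @[n --> \oo] --> v.
Proof.
move=> aM; apply: L2_complete => eps eps0.
pose s n := \sum_(1 <= k < n.+1) a k ^+ 2.
have snd : {homo s : m n / (m <= n)%N >-> m <= n}.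
  move=> m n mn; rewrite /s (sqrtD_sum _ mn) lerDl sumr_ge0// => i _.
  exact: sqr_ge0.
have /cvg_ex[l sl] : cvgn s.
  apply: nondecreasing_is_cvgn => //; exists M => _ [n _ <-]; exact: aM.
have e2 : 0 < (eps / 2) ^+ 2 by rewrite exprn_gt0// divr_gt0.
have /cvgrPdist_lt/(_ _ e2)[N _ hN] := sl.
have key n m : (N <= m)%N -> (m <= n)%N -> `|fsum n a - fsum m a| < eps.
  move=> Nm mn; rewrite -(@ltr_pXn2r _ 2)// ?nnegrE// ?ltW// fsumB//.
  have h1 := hN _ Nm; have h2 := hN _ (leq_trans Nm mn).
  rewrite /= -/(s n) -/(s m) in h1 h2 *.
  have := ler_norm (s n - s m).
  have -> : s n - s m = (l - s m) - (l - s n) by ring.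
  have := ler_normB (l - s m) (l - s n).
  have : (eps / 2) ^+ 2 * 2 <= eps ^+ 2 by rewrite !expr2; nra.
  lra.
exists N => m n Nm Nn; have [mn|nm] := leqP m n.
  by rewrite distrC; exact: key.
by apply: key => //; exact: ltnW.
Qed.

Lemma cvg_cf k (u_ : nat -> H) u : u_ n @[n --> \oo] --> u ->
  cf k (u_ n) @[n --> \oo] --> cf k u.
Proof. exact: ip_continuous. Qed.

Lemma cf_lim_fsum a v k : (0 < k)%N -> fsum n a @[n --> \oo] --> v ->
  cf k v = a k.
Proof.
move=> k0 /(cvg_cf (k := k)) h; apply: (cvg_unique _ h) => //.
apply: cvg_near_cst; near=> n.
rewrite cf_fsum// (_ : (k <= n)%N) ?mul1r//; near: n; exact: nbhs_infty_ge.
Unshelve. all: by end_near. Qed.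

Lemma cf_inj u v : (forall k, (0 < k)%N -> cf k u = cf k v) -> u = v.
Proof.
move=> uv; apply/subr0_eq; apply: sine_complete => k k0.
by rewrite -/(cf k _) cfB uv// subrr.
Qed.

Lemma parseval_cvg u : Pproj n u @[n --> \oo] --> u.
Proof.
have [v hv] := fsum_cvg (fun n => bessel n u).
have E : v = u.
  by apply: cf_inj => k k0; rewrite (cf_lim_fsum k0 hv).
by rewrite -[X in _ --> X]E.
Qed.

Lemma cvg_norm_sqr (u_ : nat -> H) u : u_ n @[n --> \oo] --> u ->
  `|u_ n| ^+ 2 @[n --> \oo] --> `|u| ^+ 2.
Proof.
move=> /cvg_norm h; rewrite expr2; under eq_fun do rewrite expr2.
exact: cvgM.
Qed.

Lemma parseval u : \sum_(1 <= k < n.+1) cf k u ^+ 2 @[n --> \oo] --> `|u| ^+ 2.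
Proof.
under eq_fun do rewrite -norm_Pproj.
exact/cvg_norm_sqr/parseval_cvg.
Qed.

Lemma norm_le_cf u (M : R) : 0 <= M ->
  (forall n, \sum_(1 <= k < n.+1) cf k u ^+ 2 <= M ^+ 2) -> `|u| <= M.
Proof.
move=> M0 h; rewrite -(@ler_pXn2r _ 2)// ?nnegrE//.
by have := cvg_nat_le (@parseval u) h.
Qed.

End Coordinates.

Section Spectral.
Variable R : realType.
Local Notation H := (L2_01 R).
Local Notation e := (eigf R).
Implicit Types (u v : H) (a : nat -> R) (k n : nat).
Variable c : R.
Hypothesis c0 : 0 < c.
Local Notation L := (lam c).

Lemma lam_ge0 k : 0 <= L k.
Proof. by rewrite !mulr_ge0 ?(ltW c0)// ?exprn_ge0// pi_ge0. Qed.

Lemma lam_gt0 k : (0 < k)%N -> 0 < L k.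
Proof. by move=> k0; rewrite /lam !mulr_gt0 ?exprn_gt0 ?pi_gt0 ?ltr0n. Qed.

Lemma le_lam j k : (j <= k)%N -> L j <= L k.
Proof.
move=> jk; rewrite ler_wpM2l//.
  by rewrite mulr_ge0 ?(ltW c0)// exprn_ge0// pi_ge0.
by rewrite ler_pXn2r ?nnegrE// ler_nat.
Qed.

(** Bounds uniform in n replace the extended-real series from here on; the terms are squares, so
    such a bound is the same as finiteness of the sum. *)
Lemma specA_domP (f : R -> R) v : specA_dom c f v <->
  exists M, forall n, \sum_(1 <= k < n.+1) (f (- L k) * cf k v) ^+ 2 <= M.
Proof.
rewrite /specA_dom /=.
have E n : (\sum_(1 <= k < n) (`|f (- L k) * ip (e k) v| ^+ 2)%:E)%E =
    (\sum_(1 <= k < n) (f (- L k) * cf k v) ^+ 2)%:E.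
  by rewrite sumEFin; congr EFin; apply: eq_bigr => k _; rewrite real_normK ?num_real.
split.
  set S := (X in (X < _)%E) => Sy.
  have S0 : (0 <= S)%E by apply: nneseries_ge0 => k _ _; rewrite lee_fin sqr_ge0.
  exists (fine S) => n; rewrite -lee_fin fineK ?ge0_fin_numE// -E.
  by apply: nneseries_lim_ge => k _ _; rewrite lee_fin sqr_ge0.
move=> [M hM]; apply: (@le_lt_trans _ _ M%:E); last exact: ltry.
apply: lime_le; first by apply: is_cvg_nneseries => k _ _; rewrite lee_fin sqr_ge0.
apply: nearW => n; rewrite E lee_fin; apply: le_trans (hM n).
case: n => [|n]; first by rewrite !big_geq.
by rewrite [leRHS]big_nat_recr//= lerDl sqr_ge0.
Qed.

Lemma cf_specA (f : R -> R) v k : (0 < k)%N -> specA_dom c f v ->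
  cf k (specA c f v) = f (- L k) * cf k v.
Proof.
move=> k0 /specA_domP[M hM].
have [w hw] := fsum_cvg hM.
rewrite /specA (_ : limn _ = w); last exact/cvg_lim.
by rewrite (cf_lim_fsum k0 hw).
Qed.

Lemma specA_dom_bdd (f : R -> R) (M : R) v :
  (forall k, (0 < k)%N -> `|f (- L k)| <= M) -> specA_dom c f v.
Proof.
move=> fM; apply/specA_domP; exists (M ^+ 2 * `|v| ^+ 2) => n.
apply: (le_trans _ (ler_wpM2l (sqr_ge0 M) (bessel n v))).
rewrite mulr_sumr big_nat [leRHS]big_nat; apply: ler_sum => k /andP[k0 _].
rewrite exprMn ler_wpM2r ?sqr_ge0//.
by rewrite -[leLHS]real_normK ?num_real// ler_pXn2r ?nnegrE// ?fM// (le_trans _ (fM k k0)).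
Qed.

Lemma cf_expA t k u : 0 <= t -> (0 < k)%N ->
  cf k (expA c t u) = expR (- (t * L k)) * cf k u.
Proof.
move=> t0 k0; rewrite cf_specA// ?mulrN//.
apply: (@specA_dom_bdd _ 1) => j j0.
by rewrite ger0_norm ?expR_ge0// -expR0 ler_expR mulrN oppr_le0 mulr_ge0// lam_ge0.
Qed.

Lemma cf_powA r k u : (0 < k)%N -> Hdom c r u -> cf k (powA c r u) = L k `^ r * cf k u.
Proof. by move=> k0 h; rewrite cf_specA// opprK. Qed.

Lemma HdomP r u : Hdom c r u <->
  exists M, forall n, \sum_(1 <= k < n.+1) (L k `^ r * cf k u) ^+ 2 <= M.
Proof.
have E k : (fun z : R => (- z) `^ r) (- L k) = L k `^ r by rewrite opprK.
split.
  move=> /specA_domP[M hM]; exists M => n; apply: le_trans (hM n).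
  by under [leRHS]eq_bigr do rewrite opprK.
move=> [M hM]; apply/specA_domP; exists M => n; apply: le_trans (hM n).
by under eq_bigr do rewrite opprK.
Qed.

Lemma Hnorm_ge0 r u : 0 <= Hnorm c r u. Proof. exact: normr_ge0. Qed.

Lemma Hnorm_bessel r n u : Hdom c r u ->
  \sum_(1 <= k < n.+1) (L k `^ r * cf k u) ^+ 2 <= Hnorm c r u ^+ 2.
Proof.
move=> h; apply: le_trans (bessel n _).
rewrite big_nat [leRHS]big_nat; apply: ler_sum => k /andP[k0 _].
by rewrite cf_powA.
Qed.

(** Membership is delivered together with the bound because outside the domain [powA] is the limit
    of a divergent sequence, and [Hnorm] then carries no information. *)
Lemma Hnorm_le r u (M : R) : 0 <= M ->
  (forall n, \sum_(1 <= k < n.+1) (L k `^ r * cf k u) ^+ 2 <= M ^+ 2) ->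
  Hdom c r u /\ Hnorm c r u <= M.
Proof.
move=> M0 h; have hd : Hdom c r u by apply/HdomP; exists (M ^+ 2).
split => //; apply: norm_le_cf => // n; apply: le_trans (h n).
rewrite big_nat [leRHS]big_nat; apply: ler_sum => k /andP[k0 _].
by rewrite cf_powA.
Qed.

Lemma Hdom_Pproj r n u : Hdom c r (Pproj n u).
Proof.
apply/HdomP; exists (\sum_(1 <= k < n.+1) (L k `^ r * cf k u) ^+ 2) => m.
have [mn|nm] := leqP m n.
  rewrite (sqrtD_sum _ mn) (_ : \sum_(1 <= k < m.+1) _ = \sum_(1 <= k < m.+1) (L k `^ r * cf k u) ^+ 2).
    by rewrite lerDl sumr_ge0// => k _; exact: sqr_ge0.
  rewrite big_nat [RHS]big_nat; apply: eq_bigr => k /andP[k0 km].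
  by rewrite cf_Pproj// (leq_trans _ mn) ?mul1r.
rewrite (sqrtD_sum _ (ltnW nm)) [X in _ + X](_ : _ = 0) ?addr0.
  rewrite big_nat [leRHS]big_nat; apply: ler_sum => k /andP[k0 km].
  by rewrite cf_Pproj// -ltnS km mul1r.
rewrite big_nat big1// => k /andP[kn _].
by rewrite cf_Pproj ?(leq_ltn_trans _ kn)// leqNgt kn mul0r mulr0 expr0n.
Qed.

Lemma Hnorm_Pproj r n u :
  Hnorm c r (Pproj n u) ^+ 2 = \sum_(1 <= k < n.+1) (L k `^ r * cf k u) ^+ 2.
Proof.
have hd := Hdom_Pproj r n u.
have E : powA c r (Pproj n u) = fsum n (fun k => L k `^ r * cf k u).
  apply: cf_inj => k k0; rewrite cf_powA// cf_fsum// cf_Pproj//; ring.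
by rewrite /Hnorm E norm_fsum.
Qed.

Lemma Pproj_range n u : range (@Pproj R n) u -> Pproj n u = u.
Proof.
move=> [v _ <-]; apply: cf_inj => k k0; rewrite !cf_Pproj//.
by case: leqP => _; rewrite ?mul1r ?mul0r.
Qed.

Lemma Hnorm_range r n u : range (@Pproj R n) u ->
  Hnorm c r u ^+ 2 = \sum_(1 <= k < n.+1) (L k `^ r * cf k u) ^+ 2.
Proof. by move=> /Pproj_range {1}<-; exact: Hnorm_Pproj. Qed.

Lemma norm_range n u : range (@Pproj R n) u ->
  `|u| ^+ 2 = \sum_(1 <= k < n.+1) cf k u ^+ 2.
Proof. by move=> /Pproj_range {1}<-; exact: norm_Pproj. Qed.

Lemma Hdom_range r n u : range (@Pproj R n) u -> Hdom c r u.
Proof. by move=> /Pproj_range <-; exact: Hdom_Pproj. Qed.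

Lemma rangeD n u v : range (@Pproj R n) u -> range (@Pproj R n) v ->
  range (@Pproj R n) (u + v).
Proof.
move=> /Pproj_range hu /Pproj_range hv; exists (u + v) => //.
apply: cf_inj => k k0; rewrite cf_Pproj// !cfD mulrDr -!cf_Pproj//.
by rewrite hu hv.
Qed.

Lemma rangeZ n (b : R) u : range (@Pproj R n) u -> range (@Pproj R n) (b *: u).
Proof.
move=> /Pproj_range hu; exists (b *: u) => //.
apply: cf_inj => k k0; rewrite cf_Pproj// !cfZ mulrCA -cf_Pproj//.
by rewrite hu.
Qed.

Lemma range_fsum n a : range (@Pproj R n) (fsum n a).
Proof.
exists (fsum n a) => //; apply: cf_inj => k k0.
by rewrite cf_Pproj// cf_fsum//; case: leqP => _; rewrite ?mul1r ?mul0r.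
Qed.

Lemma cf_range0 n k u : range (@Pproj R n) u -> (n < k)%N -> cf k u = 0.
Proof.
move=> /Pproj_range <- nk.
by rewrite cf_Pproj ?(leq_ltn_trans _ nk)// leqNgt nk mul0r.
Qed.

Lemma HdomB r u v : Hdom c r u -> Hdom c r v -> Hdom c r (u - v).
Proof.
move=> /HdomP[M hM] /HdomP[N hN]; apply/HdomP; exists (2 * M + 2 * N) => n.
apply: (le_trans _ (lerD (ler_wpM2l _ (hM n)) (ler_wpM2l _ (hN n)))) => //.
rewrite !mulr_sumr -big_split/=; apply: ler_sum => k _.
rewrite cfB mulrBr.
set a := _ * cf k u; set b := _ * cf k v.
have := sqr_ge0 (a + b); nra.
Qed.

Lemma powAB r u v : Hdom c r u -> Hdom c r v ->
  powA c r (u - v) = powA c r u - powA c r v.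
Proof.
move=> hu hv; apply: cf_inj => k k0.
rewrite (cf_powA k0 (HdomB hu hv)) [cf k (u - v)]cfB mulrBr.
by rewrite -(cf_powA k0 hu) -(cf_powA k0 hv) -cfB.
Qed.

End Spectral.

(** * Operators on the completion $H_{-\alpha}$ *)

Section Extension.
Variable R : realType.
Local Notation H := (L2_01 R).
Local Notation e := (eigf R).
Implicit Types (u : H) (k n : nat).
Variables (c alpha : R) (c0 : 0 < c) (ha : 0 <= alpha <= 1 / 2).
Variables (V : completeNormedModType R) (iota : {linear H -> V}).
Hypothesis hV : is_Hcompletion c (- alpha) iota.
Local Notation L := (lam c).

Lemma powR_expRN_le1 (a x : R) : 0 <= a <= 1 -> 0 <= x -> x `^ a * expR (- x) <= 1.
Proof.
move=> /andP[a0 a1] x0.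
have [x1|x1] := leP x 1.
  rewrite -[leRHS]mulr1; apply: ler_pM; rewrite ?powR_ge0 ?expR_ge0//.
    have := ge0_ler_powR a0 x0 ler01 x1; rewrite powR1; exact.
  by rewrite -expR0 ler_expR oppr_le0.
apply: (@le_trans _ _ (x * expR (- x))).
  rewrite ler_wpM2r ?expR_ge0// -[leRHS]powRr1//; apply: ler_powR => //; exact: ltW.
rewrite expRN ler_pdivrMr ?expR_gt0// mul1r.
apply: le_trans (expR_ge1Dx x); lra.
Qed.

(** The smoothing estimate of the semigroup for one eigenvalue; for a in [0, 1] the constant is 1
    because x^a exp (- x) <= 1. *)
Lemma powR_expRN_le (a t x : R) : 0 <= a <= 1 -> 0 < t -> 0 <= x ->
  x `^ a * expR (- (t * x)) <= t `^ (- a).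
Proof.
move=> a01 t0 x0; have := @powR_expRN_le1 a (t * x) a01.
rewrite mulr_ge0 ?(ltW t0)// => /(_ isT).
rewrite powRM ?(ltW t0)// -mulrA => h.
rewrite powRN -[leRHS]mul1r ler_pdivlMr ?powR_gt0//.
by rewrite mulrC.
Qed.

Lemma Hdom_neg u : Hdom c (- alpha) u.
Proof.
have /andP[a0 _] := ha.
apply: (specA_dom_bdd (M := L 1 `^ (- alpha))) => k k0.
rewrite ger0_norm ?powR_ge0// opprK powRN powRN lef_pV2 ?posrE ?powR_gt0 ?lam_gt0//.
by apply: ge0_ler_powR; rewrite ?nnegrE ?lam_ge0// le_lam.
Qed.

Lemma iota_bessel n u :
  \sum_(1 <= k < n.+1) (L k `^ (- alpha) * cf k u) ^+ 2 <= `|iota u| ^+ 2.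
Proof. by have [-> _] := hV; exact: Hnorm_bessel (Hdom_neg u). Qed.

Lemma dense_seq (v : V) : exists u_ : nat -> H, iota (u_ n) @[n --> \oo] --> v.
Proof.
have /choice[u_ hu] : forall n : nat, exists u, `|v - iota u| < n.+1%:R^-1.
  move=> n; have [_ /(_ (ball v n.+1%:R^-1))] := hV.
  case; first by exists v; exact: ballxx.
    exact: ball_open.
  by move=> w [hw [u _ uw]]; exists u; rewrite uw; rewrite -ball_normE in hw.
exists u_; apply/cvgrPdist_lt => eps eps0; near=> n.
apply: lt_trans (hu n) _; near: n.
have /cvgrPdist_lt/(_ _ eps0) := @cvg_harmonic R; apply: filterS => n.
by rewrite /harmonic/= sub0r normrN ger0_norm ?invr_ge0.
Unshelve. all: by end_near. Qed.

Section bounded_extension.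
Variables (f : H -> H) (C : R).
Hypothesis fB : forall u v, f (u - v) = f u - f v.
Hypothesis fC : forall u, `|f u| <= C * `|iota u|.

Lemma extend_cvg_ex (v : V) (u_ : nat -> H) : iota (u_ n) @[n --> \oo] --> v ->
  exists y : H, f (u_ n) @[n --> \oo] --> y.
Proof.
move=> hu; apply: L2_complete => eps eps0.
have C1 : 0 < `|C| + 1 by rewrite ltr_wpDl.
have e1 : 0 < eps / (`|C| + 1) / 2 by rewrite !divr_gt0.
have /cvgrPdist_lt/(_ _ e1)[N _ hN] := hu.
exists N => m n Nm Nn; rewrite -fB (le_lt_trans (fC _))//.
have d : `|iota (u_ m - u_ n)| < eps / (`|C| + 1).
  rewrite linearB -(subrKA v) (le_lt_trans (ler_normD _ _))//.
  by rewrite [ltRHS]splitr ltrD// ?hN// distrC hN.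
apply: (@le_lt_trans _ _ ((`|C| + 1) * `|iota (u_ m - u_ n)|)).
  rewrite ler_wpM2r// (le_trans (ler_norm _))// lerDl//.
by rewrite mulrC -ltr_pdivlMr.
Qed.

Lemma extend_cvg0 (u_ : nat -> H) : iota (u_ n) @[n --> \oo] --> (0 : V) ->
  f (u_ n) @[n --> \oo] --> (0 : H).
Proof.
move=> hu; apply/cvgrPdist_lt => eps eps0.
have C1 : 0 < `|C| + 1 by rewrite ltr_wpDl.
have e1 : 0 < eps / (`|C| + 1) by rewrite divr_gt0.
have /cvgrPdist_lt/(_ _ e1) := hu; apply: filterS => n; rewrite !sub0r !normrN => d.
apply: le_lt_trans (fC _) _.
apply: (@le_lt_trans _ _ ((`|C| + 1) * `|iota (u_ n)|)).
  rewrite ler_wpM2r// (le_trans (ler_norm _))// lerDl//.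
by rewrite mulrC -ltr_pdivlMr.
Qed.

(** [extend] is a choice among limits along approximating sequences. The bound by [iota] makes this
    limit the same for all of them, because the difference of two approximating sequences tends to 0
    in V. *)
Lemma extend_cvg (v : V) (u_ : nat -> H) : iota (u_ n) @[n --> \oo] --> v ->
  f (u_ n) @[n --> \oo] --> extend iota f v.
Proof.
move=> hu; have [y hy] := extend_cvg_ex hu.
have : [set y | exists u_ : nat -> H, iota (u_ n) @[n --> \oo] --> v /\
   f (u_ n) @[n --> \oo] --> y] (extend iota f v).
  by apply: getPex; exists y, u_.
move=> [w_ [hw1 hw2]].
have d0 : f (u_ n - w_ n) @[n --> \oo] --> (0 : H).
  apply: extend_cvg0; under eq_fun do rewrite linearB.
  by rewrite -(subrr v); exact: cvgB.
have := cvgD d0 hw2; rewrite add0r.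
rewrite (_ : _ + _ = f \o u_); first exact.
by apply/funext => n; rewrite /GRing.add /= fB subrK.
Qed.

Lemma cf_extend k (m : R) (v : V) (u_ : nat -> H) :
  (forall u, cf k (f u) = m * cf k u) ->
  iota (u_ n) @[n --> \oo] --> v ->
  m * cf k (u_ n) @[n --> \oo] --> cf k (extend iota f v).
Proof.
move=> fm /extend_cvg/(cvg_cf (k := k)).
by under eq_fun do rewrite fm.
Qed.

End bounded_extension.

Lemma PprojB n u v : Pproj n (u - v) = Pproj n u - Pproj n v.
Proof.
apply: cf_inj => k k0; rewrite cf_Pproj// !cfB !cf_Pproj//; ring.
Qed.

Lemma Pproj_iota n u : `|Pproj n u| <= L n `^ alpha * `|iota u|.
Proof.
have /andP[a0 _] := ha.
rewrite -(@ler_pXn2r _ 2)// ?nnegrE ?mulr_ge0 ?powR_ge0//.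
rewrite norm_Pproj exprMn.
apply: (le_trans _ (ler_wpM2l (sqr_ge0 _) (iota_bessel n u))).
rewrite mulr_sumr big_nat [leRHS]big_nat; apply: ler_sum => k /andP[k0 kn].
rewrite -exprMn mulrA -[leLHS]real_normK ?num_real//.
rewrite -[leRHS]real_normK ?num_real// ler_pXn2r ?nnegrE// normrM ler_peMl//.
rewrite ger0_norm ?mulr_ge0 ?powR_ge0// powRN.
rewrite ler_pdivlMr ?powR_gt0 ?lam_gt0// mul1r.
by apply: ge0_ler_powR; rewrite ?nnegrE ?lam_ge0// le_lam// -ltnS.
Qed.

(* The k-th coefficient of an element of H_(-alpha). *)
Definition co k (v : V) : R := cf k (extend iota (@Pproj R k) v).

Lemma co_cvg k (v : V) (u_ : nat -> H) : (0 < k)%N ->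
  iota (u_ n) @[n --> \oo] --> v -> cf k (u_ n) @[n --> \oo] --> co k v.
Proof.
move=> k0 hu.
have := @cf_extend _ _ (PprojB k) (Pproj_iota k) k 1 v u_ _ hu.
under eq_fun do rewrite mul1r; apply => u.
by rewrite cf_Pproj// leqnn.
Qed.

(** Every operator to be extended is diagonal, so on the completion it is known from its
    multipliers, and computations in $H_{-\alpha}$ become computations with the numbers [co k]. *)
Lemma cf_extend_co (f : H -> H) (C : R) k (m : R) (v : V) : (0 < k)%N ->
  (forall u w, f (u - w) = f u - f w) -> (forall u, `|f u| <= C * `|iota u|) ->
  (forall u, cf k (f u) = m * cf k u) ->
  cf k (extend iota f v) = m * co k v.
Proof.
move=> k0 fB fC fm; have [u_ hu] := dense_seq v.
have h1 := @cf_extend _ _ fB fC k m v u_ fm hu.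
have h2 := co_cvg k0 hu.
apply: (cvg_unique _ h1) => //; apply: cvgM => //; exact: cvg_cst.
Qed.

Lemma cf_extend_Pproj k n (v : V) : (0 < k)%N ->
  cf k (extend iota (@Pproj R n) v) = (k <= n)%N%:R * co k v.
Proof.
move=> k0; apply: (cf_extend_co v k0 (PprojB n) (Pproj_iota n)) => u.
exact: cf_Pproj.
Qed.

Lemma expAB t u v : 0 <= t -> expA c t (u - v) = expA c t u - expA c t v.
Proof.
move=> t0; apply: cf_inj => k k0.
rewrite (cf_expA c0 (u - v) t0 k0) [cf k (u - v)]cfB mulrBr.
by rewrite -(cf_expA c0 u t0 k0) -(cf_expA c0 v t0 k0) -cfB.
Qed.

Lemma expA_iota t u : 0 < t -> `|expA c t u| <= t `^ (- alpha) * `|iota u|.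
Proof.
have /andP[a0 a1] := ha.
move=> t0; apply: norm_le_cf; first by rewrite mulr_ge0 ?powR_ge0.
move=> n; rewrite exprMn.
apply: (le_trans _ (ler_wpM2l (sqr_ge0 _) (iota_bessel n u))).
rewrite mulr_sumr big_nat [leRHS]big_nat; apply: ler_sum => k /andP[k0 kn].
rewrite (cf_expA c0 u (ltW t0) k0) -exprMn [_ * (_ * cf k u)]mulrA -[leLHS]real_normK ?num_real//.
rewrite -[leRHS]real_normK ?num_real// ler_pXn2r ?nnegrE// !normrM ler_wpM2r//.
rewrite !ger0_norm ?mulr_ge0 ?powR_ge0 ?expR_ge0//.
rewrite (powRN (L k)) ler_pdivlMr ?powR_gt0 ?lam_gt0// mulrC.
apply: powR_expRN_le => //; last exact: lam_ge0.
rewrite a0/=; lra.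
Qed.

Lemma cf_extend_expA k t (v : V) : (0 < k)%N -> 0 < t ->
  cf k (extend iota (expA c t) v) = expR (- (t * L k)) * co k v.
Proof.
move=> k0 t0; apply: (cf_extend_co v k0 _ (fun u => expA_iota u t0)).
  by move=> u w; exact/expAB/ltW.
by move=> u; rewrite (cf_expA c0 u (ltW t0) k0).
Qed.

Lemma coB k (v w : V) : (0 < k)%N -> co k (v - w) = co k v - co k w.
Proof.
move=> k0; have [u_ hu] := dense_seq v; have [w_ hw] := dense_seq w.
have h1 := cvgB (co_cvg k0 hu) (co_cvg k0 hw).
have h2 : cf k (u_ n - w_ n) @[n --> \oo] --> co k (v - w).
  by apply: co_cvg => //; under eq_fun do rewrite linearB; exact: cvgB.
have h3 : cf k (u_ n - w_ n) @[n --> \oo] --> co k v - co k w.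
  by under eq_fun do rewrite cfB; exact: h1.
exact: (cvg_unique _ h2 h3).
Qed.

Lemma coZ k (a : R) (v : V) : (0 < k)%N -> co k (a *: v) = a * co k v.
Proof.
move=> k0; have [u_ hu] := dense_seq v.
have h1 : a * cf k (u_ n) @[n --> \oo] --> a * co k v.
  by apply: cvgM; [exact: cvg_cst|exact: co_cvg].
have h2 : cf k (a *: u_ n) @[n --> \oo] --> co k (a *: v).
  apply: co_cvg => //; under eq_fun do rewrite linearZ.
  by apply: cvgZ => //; exact: cvg_cst.
have h3 : cf k (a *: u_ n) @[n --> \oo] --> a * co k v.
  by under eq_fun do rewrite cfZ; exact: h1.
exact: (cvg_unique _ h2 h3).
Qed.

Lemma co_bessel n (v : V) :
  \sum_(1 <= k < n.+1) (L k `^ (- alpha) * co k v) ^+ 2 <= `|v| ^+ 2.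
Proof.
have [u_ hu] := dense_seq v.
have h1 : \sum_(1 <= k < n.+1) (L k `^ (- alpha) * cf k (u_ m)) ^+ 2 @[m --> \oo] -->
    \sum_(1 <= k < n.+1) (L k `^ (- alpha) * co k v) ^+ 2.
  elim: n => [|n IH].
    by rewrite big_geq//; under eq_fun do rewrite big_geq//; exact: cvg_cst.
  rewrite big_nat_recr//=; under eq_fun do rewrite big_nat_recr//=.
  apply: cvgD => //; under eq_fun do rewrite expr2; rewrite expr2.
  by apply: cvgM; apply: cvgM; (exact: cvg_cst || exact: co_cvg).
have h2 : `|iota (u_ m)| ^+ 2 @[m --> \oo] --> `|v| ^+ 2.
  under eq_fun do rewrite expr2; rewrite expr2.
  by apply: cvgM; exact: cvg_norm.
apply: (ler_cvg_to h1 h2); apply: nearW => m; exact: iota_bessel.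
Qed.

End Extension.

(** * Bochner integrals of right-continuous functions *)

Section RealIntegrals.
Variable R : realType.
Local Notation leb := (@lebesgue_measure R).

Lemma RintE d (T : measurableType d) (mu : {measure set T -> \bar R})
  (D : set T) (f : T -> R) : measurable D -> mu.-integrable D (EFin \o f) ->
  ((\int[mu]_(x in D) f x)%:E = \int[mu]_(x in D) (f x)%:E)%E.
Proof. by move=> mD h; rewrite /Rintegral fineK//; exact: integrable_fin_num. Qed.

Lemma is_derive_cont (F : R -> R) (x l : R) : is_derive x 1 F l -> {for x, continuous F}.
Proof.
move=> h; apply: differentiable_continuous; apply/derivable1_diffP.
exact: ex_derive.
Qed.

Lemma measurable_itv_cont (f : R -> R) (a b : R) :
  (forall x, a < x < b -> {for x, continuous f}) ->
  measurable_fun (`]a, b[ : set (measurableTypeR R)) f.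
Proof.
move=> cf; apply: open_continuous_measurable_fun; first exact: interval_open.
by move=> x; rewrite inE /= in_itv/=; exact: cf.
Qed.

Lemma integral_oo_FTC (f F : R -> R) (a b : R) : a < b ->
  (forall x, a <= x <= b -> is_derive x 1 F (f x)) ->
  (forall x, a <= x <= b -> {for x, continuous f}) ->
  (\int[leb]_(x in `]a, b[) (f x)%:E = (F b - F a)%:E)%E.
Proof.
move=> ab dF cf.
rewrite -(@integral_itv_bndoo _ _ _ _ true false); last first.
  apply/measurable_EFinP; apply: measurable_itv_cont => x /andP[h1 h2].
  by apply: cf; rewrite !ltW.
rewrite (@continuous_FTC2 _ f F)//.
- apply: continuous_in_subspaceT => x; rewrite inE/= in_itv/=; exact: cf.
- split.
  + move=> x; rewrite in_itv/= => /andP[h1 h2].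
    have d := dF x; apply: ex_derive; apply: d; by rewrite !ltW.
  + apply: cvg_at_right_filter; apply: (is_derive_cont (dF a _)).
    by rewrite lexx ltW.
  + apply: cvg_at_left_filter; apply: (is_derive_cont (dF b _)).
    by rewrite lexx ltW.
- move=> x; rewrite in_itv/= => /andP[h1 h2].
  rewrite derive1E; have d : is_derive x 1 F (f x) by apply: dF; rewrite !ltW.
  exact: derive_val.
Qed.

Lemma is_derive_rev (t x : R) : is_derive x 1 (fun s : R => t - s) (- 1).
Proof.
have h := is_deriveB (is_derive_cst t x 1) (is_derive_id x (1:R)).
by rewrite -[X in is_derive _ _ _ X](add0r (-1)).
Qed.

Lemma is_derive_powRrev (a t s : R) : a != 1 -> s < t ->
  is_derive s 1 (fun x => - ((t - x) `^ (1 - a) / (1 - a))) ((t - s) `^ (- a)).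
Proof.
move=> a1 st; have ts : 0 < t - s by rewrite subr_gt0.
have h1 := is_derive1_powR (1 - a) ts.
have h2 := @is_derive1_comp _ (fun y => y `^ (1 - a)) (fun x => t - x) s _ _ h1 (is_derive_rev t s).
have h3 := is_deriveZ (- (1 - a)^-1) h2.
have E : (fun x => - ((t - x) `^ (1 - a) / (1 - a))) =
   (- (1 - a)^-1) \*: ((fun y => y `^ (1 - a)) \o (fun x => t - x)).
  by apply/funext => x /=; rewrite /GRing.scale/= mulNr mulrC.
rewrite E; have -> // : (t - s) `^ (- a) = - (1 - a)^-1 *: ((1 - a) * (t - s) `^ (1 - a - 1) * -1).
rewrite /GRing.scale/= (_ : 1 - a - 1 = - a); last by ring.
by field; rewrite subr_eq0 eq_sym.
Qed.

Lemma cont_powRrev (a t s : R) : s < t -> {for s, continuous (fun x => (t - x) `^ a)}.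
Proof.
move=> st; have ts : 0 < t - s by rewrite subr_gt0.
apply: (is_derive_cont (l := _)).
exact: (@is_derive1_comp _ (fun y => y `^ a) (fun x => t - x) s _ _ (is_derive1_powR a ts) (is_derive_rev t s)).
Qed.

Lemma measurable_powRrev (a t : R) (b : R) :
  measurable_fun (`]b, t[ : set (measurableTypeR R)) (fun x => ((t - x) `^ a)%:E).
Proof.
apply/measurable_EFinP; apply: measurable_itv_cont => x /andP[_ h].
exact: cont_powRrev.
Qed.

(** The singularity at t is approached by the intervals ]0, t - t / (n + 2)[, on which the
    fundamental theorem of calculus applies; monotone convergence gives the limit. *)
Lemma integral_powRrev (a t : R) : 0 < t -> a < 1 ->
  (\int[leb]_(s in `]0%R, t[) ((t - s) `^ (- a))%:E <= (t `^ (1 - a) / (1 - a))%:E)%E.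
Proof.
move=> t0 a1.
pose I n : set (measurableTypeR R) := `]0%R, (t - t / n.+2%:R)%R[%classic.
have IU : \bigcup_i I i = `]0%R, t[%classic.
  apply/seteqP; split => x /=.
    move=> [n _]; rewrite /I /= !in_itv/= => /andP[-> h] /=.
    by apply: lt_le_trans h _; rewrite gerBl divr_ge0// ltW.
  rewrite in_itv/= => /andP[x0 xt].
  have tx : 0 < (t - x) / t by rewrite divr_gt0// subr_gt0.
  have /cvgrPdist_lt/(_ _ tx)[N _ /(_ N (leqnn N))] := @cvg_harmonic R.
  rewrite /harmonic/= sub0r normrN ger0_norm ?invr_ge0// => hN.
  exists N => //; rewrite /I /= in_itv/= x0/=.
  have : N.+2%:R^-1 < (t - x) / t.
    by apply: le_lt_trans hN; rewrite lef_pV2 ?posrE// ler_nat.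
  rewrite ltr_pdivlMr// [X in X < _]mulrC => hh.
  by rewrite ltrBrDr -ltrBrDl.
rewrite -IU.
have mI i : measurable (I i) by exact: measurable_itv.
have ndI : nondecreasing_seq I.
  apply/nondecreasing_seqP => n; rewrite subsetEset => x; rewrite /I /= !in_itv/=.
  move=> /andP[-> h]/=; apply: lt_le_trans h _; rewrite lerB// ler_wpM2l ?(ltW t0)//.
  by rewrite lef_pV2 ?posrE// ler_nat.
have lt1 n : t - t / n.+2%:R < t by rewrite ltrBlDr ltrDl divr_gt0.
have mf i : measurable_fun (I i) (fun x => ((t - x) `^ (- a))%:E).
  apply/measurable_EFinP; apply: measurable_itv_cont => x /andP[_ h].
  by apply: cont_powRrev; exact: (lt_trans h (lt1 _)).
have hc := @ge0_nondecreasing_set_cvg_integral _ _ _ I _ leb ndI mI mf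
  (fun i x _ => (powR_ge0 _ _ : (0 <= ((t - x) `^ (- a))%:E)%E)).
rewrite -(cvg_lim _ hc)//; apply: lime_le; first by apply/cvg_ex; eexists; exact: hc.
apply: nearW => n.
have p0 : 0 < t - t / n.+2%:R by rewrite subr_gt0 gtr_pMr// invf_lt1// ltr1n.
have d1 x : 0 <= x <= t - t / n.+2%:R -> is_derive x 1
    (fun x => - ((t - x) `^ (1 - a) / (1 - a))) ((t - x) `^ (- a)).
  move=> /andP[_ h]; apply: is_derive_powRrev; first by rewrite lt_eqF.
  exact: le_lt_trans h (lt1 _).
have c1 x : 0 <= x <= t - t / n.+2%:R -> {for x, continuous (fun x => (t - x) `^ (- a))}.
  move=> /andP[_ h]; apply: cont_powRrev; exact: le_lt_trans h (lt1 _).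
rewrite /I (integral_oo_FTC p0 d1 c1) lee_fin subr0 opprK.
have : 0 <= (t - (t - t / n.+2%:R)) `^ (1 - a) / (1 - a).
  by rewrite divr_ge0 ?powR_ge0// subr_ge0 ltW.
lra.
Qed.

Lemma integrable_powRrev (a t : R) : 0 < t -> a < 1 ->
  leb.-integrable `]0%R, t[ (fun s => ((t - s) `^ (- a))%:E).
Proof.
move=> t0 a1; apply/integrableP; split; first exact: measurable_powRrev.
under eq_integral do rewrite gee0_abs ?lee_fin ?powR_ge0//.
by apply: le_lt_trans (integral_powRrev t0 a1) _; rewrite ltry.
Qed.

End RealIntegrals.

(** * Weak measurability of $L^2$-valued maps *)

Section WeakMeasurability.
Context d (T : measurableType d) (R : realType).
Local Notation H := (L2_01 R).
Variable D : set T.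
Hypothesis mD : measurable D.

(** Chosen instead of Borel measurability: it passes to differences and pointwise limits by testing
    against one vector at a time, and Parseval's identity still makes the norm measurable. *)
Definition wmeas (F : T -> H) := forall g : H, measurable_fun D (fun x => ip g (F x)).

Lemma wmeasB (F G : T -> H) : wmeas F -> wmeas G -> wmeas (fun x => F x - G x).
Proof.
move=> hF hG g; under eq_fun do rewrite ipBr; exact: measurable_funB.
Qed.

Lemma wmeasZ (a : T -> R) (v : H) : measurable_fun D a -> wmeas (fun x => a x *: v).
Proof.
move=> ha g; under eq_fun do rewrite ipZr; exact: measurable_funM.
Qed.

Lemma wmeas_norm2 (F : T -> H) : wmeas F -> measurable_fun D (fun x => `|F x| ^+ 2).
Proof.
move=> h; apply: (@measurable_fun_cvg _ _ _ D
   (fun n x => \sum_(k <- index_iota 1 n.+1) cf k (F x) ^+ 2)).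
  by move=> n; apply: measurable_sum => k; apply: measurable_funX; exact: h.
by move=> x _; exact: parseval.
Qed.

Lemma wmeas_norm (F : T -> H) : wmeas F -> measurable_fun D (fun x => `|F x|).
Proof.
move=> /wmeas_norm2 h.
under eq_fun do rewrite -[`|_|]ger0_norm// -sqrtr_sqr.
apply: (@measurableT_comp _ _ _ _ _ _ (@Num.sqrt R)) => //.
by apply: continuous_measurable_fun; exact: sqrt_continuous.
Qed.

Lemma wmeas_cvg (F_ : nat -> T -> H) (F : T -> H) : (forall n, wmeas (F_ n)) ->
  (forall x, D x -> F_ n x @[n --> \oo] --> F x) -> wmeas F.
Proof.
move=> h hc g; apply: (measurable_fun_cvg (fun n => h n g)) => x Dx.
exact: ip_continuous (hc x Dx).
Qed.

End WeakMeasurability.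

Lemma In_map (A B : Type) (f : A -> B) (s : seq A) (y : B) :
  List.In y (map f s) -> exists x, f x = y /\ List.In x s.
Proof.
elim: s => //= x s IH [<-|/IH[z [zy zs]]]; first by exists x; split => //; left.
by exists z; split => //; right.
Qed.

Lemma In_cat (A : Type) (s1 s2 : seq A) (y : A) :
  List.In y (s1 ++ s2) -> List.In y s1 \/ List.In y s2.
Proof.
elim: s1 => [|x s IH] /=; first by right.
by case=> [->|/IH[]]; [left; left|left; right|right].
Qed.

Section Bochner.
Variable R : realType.
Local Notation H := (L2_01 R).
Local Notation leb := (@lebesgue_measure R).
Local Notation TR := (measurableTypeR R).

Section functional.
Variables (D : set TR) (mD : measurable D).

Definition okpieces (s : seq (set TR * H)) := forall i, List.In i s ->
  [/\ measurable i.1, i.1 `<=` D & (leb i.1 < +oo)%E].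

Lemma okpieces_cons i s : okpieces (i :: s) ->
  [/\ measurable i.1, i.1 `<=` D, (leb i.1 < +oo)%E & okpieces s].
Proof.
move=> h; have [h1 h2 h3] := h i (or_introl erefl); split => // j js.
by apply: h; right.
Qed.

Lemma simple_eval_cons i s (x : TR) :
  simple_eval (i :: s) x = \1_(i.1) x *: i.2 + simple_eval s x :> H.
Proof. by rewrite /simple_eval big_cons. Qed.

Lemma simple_functional (s : seq (set TR * H)) (g : H) : okpieces s ->
  leb.-integrable D (EFin \o (fun x => ip g (simple_eval s x))) /\
  \int[leb]_(x in D) ip g (simple_eval s x) = ip g (simple_integral leb s).
Proof.
elim: s => [_|i s IH /okpieces_cons[mi iD ioo /IH[ints eqs]]].
  under eq_fun do rewrite /simple_eval big_nil ip0r.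
  rewrite /simple_integral big_nil ip0r; split; first exact: integrable0.
  by rewrite /Rintegral integral0.
have int1 : leb.-integrable D (EFin \o (\1_(i.1) : TR -> R)).
  apply/integrableP; split.
    by apply/measurable_EFinP; exact: measurable_indic.
  under eq_integral do rewrite /= normr_indic || rewrite /= ger0_norm ?indicE//.
  by rewrite integral_indic// setIidl.
have E : (fun x => ip g (simple_eval (i :: s) x)) =
    (fun x => ip g i.2 * \1_(i.1) x + ip g (simple_eval s x)).
  by apply/funext => x; rewrite simple_eval_cons ipDr ipZr mulrC.
have int2 : leb.-integrable D (EFin \o (fun x => ip g i.2 * \1_(i.1) x)).
  by have := integrableZl mD (ip g i.2) int1.
split; first by rewrite E; have := integrableD mD int2 ints.
rewrite E RintegralD// RintegralZl// eqs /simple_integral big_cons ipDr ipZr.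
congr (_ + _); rewrite mulrC; congr (_ * _); rewrite /Rintegral.
by rewrite integral_indic// setIidl.
Qed.

(** Functionals pass through the defining limit because the error is at most |g| times the L^1
    error. Coefficients of Bochner integrals thereby become real integrals, whatever value [get] has
    chosen. *)
Lemma bochner_functional (f : TR -> H) (y g : H) :
  is_bochner_integral leb D f y ->
  leb.-integrable D (EFin \o (fun x => ip g (f x))) ->
  ip g y = \int[leb]_(x in D) ip g (f x).
Proof.
move=> [s [oks ms hs hy]] intf.
have h1 := ip_continuous (v := g) hy.
suff h2 : ip g (simple_integral leb (s n)) @[n --> \oo] -->
    \int[leb]_(x in D) ip g (f x) by exact: (cvg_unique _ h1 h2).
have bnd n : (`|(ip g (simple_integral leb (s n)) - \int[leb]_(x in D) ip g (f x))%:E| <=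
    `|g|%:E * \int[leb]_(x in D) `|f x - simple_eval (s n) x|%:E)%E.
  have [ints <-] := simple_functional g (oks n).
  rewrite -RintegralB// abse_EFin.
  have intd : leb.-integrable D (EFin \o (fun x => ip g (simple_eval (s n) x) - ip g (f x))).
    by have := integrableB mD ints intf.
  apply: (@le_trans _ _ (\int[leb]_(x in D) `|ip g (simple_eval (s n) x) - ip g (f x)|)%:E).
    by rewrite lee_fin le_normr_Rintegral.
  rewrite RintE//; last by have := integrable_norm intd.
  rewrite -ge0_integralZl//; last first.
    exact/measurable_EFinP.
  apply: ge0_le_integral => //.
  - by have /integrableP[] := integrable_norm intd.
  - by apply: measurable_funeM; exact/measurable_EFinP.
  - move=> x _; rewrite -EFinM lee_fin -ipBr distrC.
    exact: cauchy_schwarz.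
have h3 : (`|g|%:E * \int[leb]_(x in D) `|f x - simple_eval (s n) x|%:E)%E @[n --> \oo] --> 0%E.
  by rewrite -(mule0 `|g|%:E); apply: cvgeZl.
have h4 : (`|(ip g (simple_integral leb (s n)) - \int[leb]_(x in D) ip g (f x))%:E|)%E @[n --> \oo] --> 0%E.
  apply: (@squeeze_cvge _ _ _ _ (cst 0%E) _ _ _ _ (@cvg_cst _ _ _ _ _) h3).
  by apply: nearW => n; rewrite abse_ge0/=; exact: bnd.
apply/cvgrPdist_lt => eps eps0.
have /fine_cvgP[_ /cvgrPdist_lt/(_ _ eps0)] := h4; apply: filterS => n /=.
by rewrite sub0r normrN normr_id distrC.
Qed.

End functional.

Section existence.
Variables (t : R) (f : TR -> H) (M a : R).
Hypothesis t0 : 0 < t.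
Hypothesis a01 : 0 <= a < 1.
Hypothesis frc : forall s, 0 < s < t -> forall eps : R, 0 < eps ->
  exists2 delta : R, 0 < delta &
    forall r, s <= r < s + delta -> r < t -> `|f r - f s| < eps.
Hypothesis fM : forall s, 0 < s < t -> `|f s| <= M * (t - s) `^ (- a).
Local Notation D := (`]0%R, t[%classic : set TR).

Let mD : measurable D. Proof. exact: measurable_itv. Qed.

Let h n : R := t / n.+2%:R.
Let piece n (i : nat) : set TR := `](i%:R * h n), (i.+1%:R * h n)]%classic.

(* Right endpoints of the uniform partition, so that right continuity suffices; the
   last cell is dropped because of the singularity at t. *)
Definition right_steps n : seq (set TR * H) :=
  [seq (piece n i, f (i.+1%:R * h n)) | i <- iota 0 n.+1].

Let h0 n : 0 < h n. Proof. by rewrite divr_gt0. Qed.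

Let hn n : n.+2%:R * h n = t.
Proof. by rewrite /h mulrC divfK. Qed.

Let hlt n i : (i <= n)%N -> i.+1%:R * h n < t.
Proof. by move=> i_n; rewrite -[ltRHS](hn n) ltr_pM2r// ltr_nat ltnS. Qed.

Lemma simple_eval_right n i x : (i <= n)%N ->
  i%:R * h n < x <= i.+1%:R * h n -> simple_eval (right_steps n) x = f (i.+1%:R * h n).
Proof.
move=> i_n /andP[x1 x2]; rewrite /simple_eval big_map (bigD1_seq i) ?iota_uniq ?mem_iota//=.
rewrite indicE mem_setE in_itv/= x1 x2 scale1r big1 ?addr0// => j ji.
rewrite indicE mem_setE in_itv/=; case: (ltngtP i j) ji => // ij _.
  have le1 : i.+1%:R * h n <= j%:R * h n by rewrite ler_pM2r// ler_nat.
  by rewrite ltNge (le_trans x2 le1) scale0r.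
have le1 : j.+1%:R * h n <= i%:R * h n by rewrite ler_pM2r// ler_nat.
by rewrite [x <= _]leNgt (le_lt_trans le1 x1) andbF scale0r.
Qed.

Lemma simple_eval_right0 n x : n.+1%:R * h n < x -> simple_eval (right_steps n) x = 0.
Proof.
move=> xn; rewrite /simple_eval big_map big_seq big1// => i; rewrite mem_iota /= add0n => i_n.
rewrite indicE mem_setE in_itv/= [x <= _]leNgt.
have le1 : i.+1%:R * h n <= n.+1%:R * h n by rewrite ler_pM2r// ler_nat.
by rewrite (le_lt_trans le1 xn) andbF scale0r.
Qed.

Lemma right_cell n x : 0 < x <= n.+1%:R * h n ->
  exists2 i, (i <= n)%N & i%:R * h n < x <= i.+1%:R * h n.
Proof.
move=> /andP[x0 xn].
have ex : exists i, x <= i.+1%:R * h n by exists n.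
exists (ex_minn ex); case: ex_minnP => m xm hm; first exact: hm.
rewrite xm andbT; case: m xm hm => [|m] xm hm; first by rewrite mul0r.
by rewrite ltNge; apply/negP => /hm; rewrite ltnn.
Qed.

(** The right end r of the cell of x satisfies t - r >= (t - x) / 2, since dropping the last cell
    leaves r at least one mesh away from t; hence the factor 2^a. *)
Lemma right_steps_bound n x : 0 < x < t ->
  `|simple_eval (right_steps n) x| <= `|M| * 2 `^ a * (t - x) `^ (- a).
Proof.
move=> /andP[x0 xt]; have [xn|xn] := leP x (n.+1%:R * h n); last first.
  by rewrite simple_eval_right0// normr0 !mulr_ge0 ?powR_ge0.
have [|i i_n hi] := @right_cell n x; first by rewrite x0.
rewrite (simple_eval_right i_n hi).
have lt1 := hlt i_n.
apply: (le_trans (fM _)); first by rewrite lt1 mulr_gt0.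
apply: (le_trans (ler_wpM2r (powR_ge0 _ _) (ler_norm M))).
rewrite -mulrA ler_wpM2l//.
have /andP[a0 _] := a01.
have tx : 0 < t - x by rewrite subr_gt0.
have d2 : (t - x) / 2 <= t - i.+1%:R * h n.
  have /andP[h1 h2] := hi; have := hn n; have := h0 n.
  have : i.+2%:R * h n <= t by rewrite -(hn n) ler_pM2r// ler_nat.
  rewrite -(natr1 i.+1) -(natr1 i) => h3 h4 h5; nra.
apply: (@le_trans _ _ (((t - x) / 2) `^ (- a))).
  rewrite !powRN lef_pV2 ?posrE ?powR_gt0 ?divr_gt0 ?subr_gt0//.
  by apply: ge0_ler_powR; rewrite ?nnegrE ?divr_ge0 ?subr_ge0// ltW.
rewrite powRM ?invr_ge0 ?(ltW tx)// [leLHS]mulrC ler_wpM2r ?powR_ge0//.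
by rewrite -powR_inv1// -powRrM mulN1r opprK.
Qed.

Lemma right_steps_cvg x : 0 < x < t ->
  simple_eval (right_steps n) x @[n --> \oo] --> f x.
Proof.
move=> xt; have /andP[x0 x1] := xt; apply/cvgrPdist_lt => eps eps0.
have [del del0 hdel] := frc xt eps0.
have e1 : 0 < Num.min (del / t) ((t - x) / t).
  by rewrite lt_min !divr_gt0// subr_gt0.
have /cvgrPdist_lt/(_ _ e1)[N _ hN] := @cvg_harmonic R.
exists N => // n Nn /=; have := hN n Nn.
rewrite /harmonic/= sub0r normrN ger0_norm ?invr_ge0// lt_min => /andP[n1 n2].
have hl : n.+2%:R^-1 < n.+1%:R^-1 :> R by rewrite ltf_pV2 ?posrE// ltr_nat.
have hd : h n < del.
  rewrite /h mulrC -ltr_pdivlMr//; exact: lt_trans n1.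
have ht : h n < t - x.
  rewrite /h mulrC -ltr_pdivlMr//; exact: lt_trans n2.
have xn : x <= n.+1%:R * h n.
  have := hn n; rewrite -(natr1 n.+1) mulrDl mul1r => hh; lra.
have [|i i_n hi] := @right_cell n x; first by rewrite x0.
rewrite (simple_eval_right i_n hi) distrC; apply: hdel; last exact: hlt.
have /andP[h1 h2] := hi; rewrite h2 /= -natr1 mulrDl mul1r; lra.
Qed.

Lemma okpieces_right n : okpieces D (right_steps n).
Proof.
move=> i hi; have [j [<- jn]] := In_map hi.
have {}jn : (j <= n)%N.
  suff : j \in iota 0 n.+1 by rewrite mem_iota.
  move: jn; elim: (iota 0 n.+1) => [//|k s IH] /= [->|/IH]; rewrite inE ?eqxx// => ->.
  by rewrite orbT.
rewrite /=.
split; first exact: measurable_itv.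
  move=> x; rewrite /piece /= !in_itv/= => /andP[h1 h2].
  rewrite (le_lt_trans h2 (hlt jn)) andbT (le_lt_trans _ h1)//.
  by rewrite mulr_ge0// ltW.
by rewrite lebesgue_measure_itv /=; case: ifP => _; rewrite -?EFinD ltry.
Qed.

Lemma wmeas_right n : wmeas D (simple_eval (right_steps n)).
Proof.
move=> g; have [/integrableP[mi _] _] := simple_functional mD g (@okpieces_right n).
exact/measurable_EFinP.
Qed.

Lemma wmeas_f : wmeas D f.
Proof.
apply: (wmeas_cvg wmeas_right) => x; rewrite /= in_itv/=; exact: right_steps_cvg.
Qed.

Lemma right_steps_L1 :
  (\int[leb]_(x in D) `|f x - simple_eval (right_steps n) x|%:E)%E @[n --> \oo] --> 0%E.
Proof.
have md n : measurable_fun D (fun x => `|f x - simple_eval (right_steps n) x|%:E).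
  apply/measurable_EFinP; apply: wmeas_norm.
  apply: wmeasB; [exact: wmeas_f|exact: wmeas_right].
have ig : leb.-integrable D (fun x => ((`|M| + `|M| * 2 `^ a) * (t - x) `^ (- a))%:E).
  have /andP[_ a1] := a01.
  by have := integrableZl mD (`|M| + `|M| * 2 `^ a) (integrable_powRrev t0 a1).
have c0 : {ae leb, forall x : TR, D x ->
   `|f x - simple_eval (right_steps n) x|%:E @[n --> \oo] --> (0:R)%:E}.
  apply: aeW => x; rewrite /= in_itv/= => /right_steps_cvg hx.
  apply: cvg_natE; rewrite -(normr0 H); apply: cvg_norm.
  by rewrite -(subrr (f x)); apply: cvgB => //; exact: cvg_cst.
have dom : {ae leb, forall (x : TR) n, D x ->
   (`| (`|f x - simple_eval (right_steps n) x|)%:E | <=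
     ((`|M| + `|M| * 2 `^ a) * (t - x) `^ (- a))%:E)%E}.
  apply: aeW => x n; rewrite /= in_itv/= => xt.
  rewrite lee_fin normr_id (le_trans (ler_normB _ _))// mulrDl lerD//.
    apply: le_trans (fM xt) _; rewrite ler_wpM2r ?powR_ge0// ler_norm//.
  exact: right_steps_bound.
have [_ _] := dominated_convergence mD md (measurable_cst (0:R)%:E) c0 ig dom.
by rewrite integral0.
Qed.

(** Pieces may overlap, so a triangle inequality over the pieces would lose too much; pairing with
    the integral y itself writes |y|^2 as the integral of <y, s(x)>. *)
Lemma simple_norm (s : seq (set TR * H)) : okpieces D s ->
  (`|simple_integral leb s|%:E <= \int[leb]_(x in D) `|simple_eval s x|%:E)%E.
Proof.
move=> oks; set y := simple_integral leb s.
have [->|y0] := eqVneq y 0; first by rewrite normr0 integral_ge0.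
have ny : 0 < `|y| by rewrite normr_gt0.
have [ints E] := simple_functional mD y oks.
have mn : measurable_fun D (fun x => `|simple_eval s x|).
  apply: wmeas_norm => g.
  have [/integrableP[mi _] _] := simple_functional mD g oks.
  exact/measurable_EFinP.
rewrite -(@lee_pmul2l _ `|y|%:E) ?lte_fin// -EFinM -expr2 norm_sqr -E.
apply: (@le_trans _ _ (\int[leb]_(x in D) `|ip y (simple_eval s x)|)%:E).
  by rewrite lee_fin (le_trans (ler_norm _))// le_normr_Rintegral.
rewrite RintE//; [|by have := integrable_norm ints].
rewrite -ge0_integralZl//; last first.
  exact/measurable_EFinP.
apply: ge0_le_integral => //.
- by have /integrableP[] := integrable_norm ints.
- by apply: measurable_funeM; exact/measurable_EFinP.
- by move=> x _; rewrite -EFinM lee_fin; exact: cauchy_schwarz.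
Qed.

Lemma bochner_exists : exists y, is_bochner_integral leb D f y.
Proof.
have md n : measurable_fun D (fun x => `|f x - simple_eval (right_steps n) x|).
  by apply: wmeas_norm; apply: wmeasB; [exact: wmeas_f|exact: wmeas_right].
suff [y hy] : exists y : H, simple_integral leb (right_steps n) @[n --> \oo] --> y.
  exists y, right_steps; split => //.
  - by move=> n i; exact: okpieces_right.
  - exact: right_steps_L1.
apply: L2_complete => eps eps0.
have e2 : 0 < eps / 2 by rewrite divr_gt0.
have /fine_cvgP[[N1 _ hN1] /cvgrPdist_lt/(_ _ e2)[N2 _ hN2]] := right_steps_L1.
have small n : (maxn N1 N2 <= n)%N ->
   (\int[leb]_(x in D) `|f x - simple_eval (right_steps n) x|%:E < (eps / 2)%:E)%E.
  rewrite geq_max => /andP[n1 n2]; rewrite -[ltLHS]fineK ?lte_fin//; last exact: hN1.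
  have := hN2 n n2; rewrite /= sub0r normrN; apply: le_lt_trans; exact: ler_norm.
exists (maxn N1 N2) => m n Nm Nn.
(* The difference of two step functions is again a list of pieces, with overlaps: the second list is
   negated and appended. *)
pose neg (s : seq (set TR * H)) := [seq (i.1, - i.2) | i <- s].
pose s := right_steps m ++ neg (right_steps n).
have Es x : simple_eval s x = simple_eval (right_steps m) x - simple_eval (right_steps n) x.
  rewrite /simple_eval /s big_cat; congr (_ + _).
  by rewrite big_map -sumrN; apply: eq_bigr => i _; rewrite scalerN.
have Is : simple_integral leb s =
   simple_integral leb (right_steps m) - simple_integral leb (right_steps n).
  rewrite /simple_integral /s big_cat; congr (_ + _).
  by rewrite big_map -sumrN; apply: eq_bigr => i _; rewrite scalerN.
have oks : okpieces D s.
  move=> i hi; have [hi'|hi'] := In_cat hi; first exact: okpieces_right hi'.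
  have [j [<- /= jn]] := In_map hi'; exact: okpieces_right jn.
rewrite -lte_fin -Is (le_lt_trans (simple_norm oks))//.
have -> : eps%:E = ((eps / 2)%:E + (eps / 2)%:E)%E by rewrite -EFinD -splitr.
apply: (@le_lt_trans _ _ (\int[leb]_(x in D) (`|f x - simple_eval (right_steps m) x|%:E +
    `|f x - simple_eval (right_steps n) x|%:E))%E).
  apply: ge0_le_integral => //.
  - apply/measurable_EFinP; apply: wmeas_norm => g.
    have [/integrableP[mi _] _] := simple_functional mD g oks.
    exact/measurable_EFinP.
  - by apply: emeasurable_funD; exact/measurable_EFinP.
  - move=> x _; rewrite -EFinD lee_fin Es -(subrKA (f x)) (le_trans (ler_normD _ _))//.
    by rewrite distrC.
rewrite ge0_integralD//; try exact/measurable_EFinP.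
by apply: lteD; exact: small.
Qed.

Lemma bochner_integralP : is_bochner_integral leb D f (bochner_integral leb D f).
Proof. by have := bochner_exists; exact: getPex. Qed.

Lemma ip_bochner_integrable (g : H) :
  leb.-integrable D (EFin \o (fun x => ip g (f x))).
Proof.
have /andP[_ a1] := a01.
have ig := integrableZl mD (`|g| * M) (integrable_powRrev t0 a1).
apply: le_integrable ig; first exact: measurable_itv.
  by apply/measurable_EFinP; exact: wmeas_f.
move=> x; rewrite /= in_itv/= => xt; rewrite lee_fin.
apply: (le_trans (cauchy_schwarz _ _)); apply: (le_trans _ (ler_norm _)).
by rewrite -mulrA ler_wpM2l// fM.
Qed.

Lemma ip_bochner (g : H) :
  ip g (bochner_integral leb D f) = \int[leb]_(x in D) ip g (f x).
Proof.
apply: bochner_functional; [exact: measurable_itv|exact: bochner_integralP|].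
exact: ip_bochner_integrable.
Qed.

End existence.
End Bochner.

(** * Gaussian moments of Wiener integrals *)

Import HBNNSimple.

(** * Transfer of laws, independence and exponential moments *)

Section WeightedTransfer.
Context (R : realType).
Local Notation TR := (measurableTypeR R).

Section one_side.
Context d (T : measurableType d) (mu : {measure set T -> \bar R}).
Variables (X : T -> TR) (h : T -> R).
Hypothesis mX : measurable_fun [set: T] X.
Hypothesis mh : measurable_fun [set: T] h.
Hypothesis h0 : forall x, 0 <= h x.

Lemma weighted_sfun (f : {nnsfun TR >-> R}) :
  (\int[mu]_x (f (X x) * h x)%:E =
   \sum_(k \in range f) k%:E * \int[mu]_x (\1_(f @^-1` [set k]) (X x) * h x)%:E)%E.
Proof.
have mk k : measurable_fun [set: T] (fun x => \1_(f @^-1` [set k]) (X x) : R).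
  have mA : measurable (f @^-1` [set k]).
    by rewrite -[X in measurable X]setTI; exact: (measurable_funP f).
  by apply: (measurableT_comp _ mX); exact: measurable_indic.
transitivity (\int[mu]_x (\sum_(k \in range f) (k * \1_(f @^-1` [set k]) (X x) * h x)%:E))%E.
  apply: eq_integral => x _; rewrite fsumEFin//; congr EFin.
  by rewrite {1}(fimfunE f (X x)) fsumr_mull || rewrite {1}(fimfunE f (X x)) mulr_fsuml.
rewrite ge0_integral_fsum//; last 2 first.
- move=> k; apply/measurable_EFinP; apply: measurable_funM => //.
  by apply: measurable_funM.
- move=> k x _; rewrite lee_fin mulr_ge0//.
  by have := nnfun_muleindic_ge0 f k (X x); rewrite lee_fin.
apply: eq_fsbigr => k _.
have [k0|k0] := leP 0 k.
  rewrite -ge0_integralZl//; last 2 first.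
  - by apply/measurable_EFinP; apply: measurable_funM.
  - by move=> x _; rewrite lee_fin mulr_ge0.
  by apply: eq_integral => x _; rewrite -EFinM mulrA.
rewrite preimage_nnfun0// integral0_eq; last by move=> x _; rewrite indic0 mulr0 mul0r.
by rewrite integral0_eq ?mule0// => x _; rewrite indic0 mul0r.
Qed.

Lemma weighted_lim (g_ : {nnsfun TR >-> R}^nat) (phi : TR -> R) :
  nondecreasing_seq (g_ : nat -> TR -> R) ->
  (forall y, EFin \o g_^~ y @ \oo --> (phi y)%:E) ->
  ((\int[mu]_x (phi (X x) * h x)%:E)%E = limn (fun n => \int[mu]_x (g_ n (X x) * h x)%:E)%E).
Proof.
move=> nd hc; rewrite -monotone_convergence//.
- apply: eq_integral => x _; apply/esym/cvg_lim => //.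
  have := hc (X x) => /fine_cvgP[_ hx].
  apply: cvg_natE; apply: cvgM; [exact: hx|exact: cvg_cst].
- move=> n; apply/measurable_EFinP; apply: measurable_funM => //.
  by apply: (measurableT_comp _ mX); exact: measurable_funP.
- by move=> n x _; rewrite lee_fin mulr_ge0.
- by move=> x _ m n mn; rewrite lee_fin ler_wpM2r//; exact/lefP/nd.
Qed.

End one_side.

(** Equality on indicators extends to simple functions and, by monotone limits, to nonnegative
    [phi]. The weights let one statement cover both the passage to a density and independence. *)
Lemma weighted_transfer d1 (T1 : measurableType d1) d2 (T2 : measurableType d2)
  (m1 : {measure set T1 -> \bar R}) (m2 : {measure set T2 -> \bar R})
  (X1 : T1 -> TR) (X2 : T2 -> TR) (h1 : T1 -> R) (h2 : T2 -> R) (phi : TR -> R) :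
  measurable_fun [set: T1] X1 -> measurable_fun [set: T2] X2 ->
  measurable_fun [set: T1] h1 -> measurable_fun [set: T2] h2 ->
  (forall x, 0 <= h1 x) -> (forall x, 0 <= h2 x) ->
  measurable_fun [set: TR] phi -> (forall y, 0 <= phi y) ->
  (forall A : set TR, measurable A ->
    (\int[m1]_x (\1_A (X1 x) * h1 x)%:E = \int[m2]_x (\1_A (X2 x) * h2 x)%:E)%E) ->
  (\int[m1]_x (phi (X1 x) * h1 x)%:E = \int[m2]_x (phi (X2 x) * h2 x)%:E)%E.
Proof.
move=> mX1 mX2 mh1 mh2 h10 h20 mphi phi0 hA.
have [g_ [nd hc]] := @approximation _ _ _ setT measurableT (EFin \o phi)
  (proj2 (measurable_EFinP _ _) mphi) (fun x _ => phi0 x : (0 <= (phi x)%:E)%E).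
have hc' y : EFin \o g_^~ y @ \oo --> (phi y)%:E by exact: hc.
rewrite (weighted_lim m1 mX1 mh1 h10 nd hc') (weighted_lim m2 mX2 mh2 h20 nd hc').
congr (limn _); apply/funext => n.
rewrite (weighted_sfun m1 mX1 mh1 h10) (weighted_sfun m2 mX2 mh2 h20).
apply: eq_fsbigr => k _; congr (_ * _)%E; apply: hA.
by rewrite -[X in measurable X]setTI; exact: (measurable_funP (g_ n)).
Qed.

Lemma integral_indic_comp d (T : measurableType d) (mu : {measure set T -> \bar R})
  (X : T -> TR) (A : set TR) : measurable_fun [set: T] X -> measurable A ->
  (\int[mu]_x (\1_A (X x))%:E = mu (X @^-1` A))%E.
Proof.
move=> mX mA; have mXA : measurable (X @^-1` A).
  by rewrite -[X in measurable X]setTI; exact: mX.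
transitivity (\int[mu]_x (\1_(X @^-1` A) x)%:E)%E; first exact: eq_integral.
by rewrite integral_indic// setIT.
Qed.

(** Two transfers: [phi] is reduced to an indicator under the weight psi (Y), then [psi] to an
    indicator under the weight 1_A (X), where the product formula for events applies. *)
Lemma indep_integral d (T : measurableType d) (P : probability T R)
  (X Y : T -> TR) (phi psi : TR -> R) :
  measurable_fun [set: T] X -> measurable_fun [set: T] Y ->
  measurable_fun [set: TR] phi -> measurable_fun [set: TR] psi ->
  (forall y, 0 <= phi y) -> (forall y, 0 <= psi y) ->
  (forall A B : set TR, measurable A -> measurable B ->
     P (X @^-1` A `&` Y @^-1` B) = (P (X @^-1` A) * P (Y @^-1` B))%E) ->
  forall e : R, (\int[P]_x (psi (Y x))%:E = e%:E)%E ->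
  (\int[P]_x (phi (X x) * psi (Y x))%:E = \int[P]_x (phi (X x))%:E * e%:E)%E.
Proof.
move=> mX mY mphi mpsi phi0 psi0 ind e he.
have e0 : 0 <= e.
  by rewrite -lee_fin -he; apply: integral_ge0 => x _; rewrite lee_fin.
have mphiX : measurable_fun [set: T] (fun x => phi (X x)) by exact: measurableT_comp mX.
have mpsiY : measurable_fun [set: T] (fun x => psi (Y x)) by exact: measurableT_comp mY.
have mA_ (A : set TR) (mA : measurable A) : measurable (X @^-1` A).
  by rewrite -[X in measurable X]setTI; exact: mX.
have mB_ (A : set TR) (mA : measurable A) : measurable (Y @^-1` A).
  by rewrite -[X in measurable X]setTI; exact: mY.
have mi (A : set TR) (mA : measurable A) : measurable_fun [set: T] (fun x => \1_A (X x) : R).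
  by apply: (measurableT_comp _ mX); exact: measurable_indic.
have miY (A : set TR) (mA : measurable A) : measurable_fun [set: T] (fun x => \1_A (Y x) : R).
  by apply: (measurableT_comp _ mY); exact: measurable_indic.
transitivity (\int[P]_x (phi (X x) * e)%:E)%E; last first.
  under eq_integral do rewrite EFinM.
  rewrite ge0_integralZr//; last by move=> x _; rewrite lee_fin.
  exact/measurable_EFinP.
apply: (weighted_transfer (h2 := fun=> e)) => //.
move=> A mA.
have -> : (\int[P]_x (\1_A (X x) * e)%:E = P (X @^-1` A) * e%:E)%E.
  under eq_integral do rewrite EFinM.
  rewrite ge0_integralZr ?lee_fin//; last exact/measurable_EFinP/mi.
  by rewrite integral_indic_comp.
rewrite -he.
pose p : R := fine (P (X @^-1` A)).
have pE : P (X @^-1` A) = p%:E by rewrite /p fineK// fin_num_measure//; exact: mA_.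
have p0 : 0 <= p by rewrite /p fine_ge0.
transitivity (\int[P]_x (psi (Y x) * p)%:E)%E; last first.
  under eq_integral do rewrite mulrC EFinM.
  rewrite ge0_integralZl ?lee_fin//; last 2 first.
  - exact/measurable_EFinP.
  - by move=> x _; rewrite lee_fin.
  by rewrite pE.
under eq_integral do rewrite mulrC.
apply: (weighted_transfer (h2 := fun=> p)) => //; first exact: mi.
move=> B mB.
under [RHS]eq_integral do rewrite mulrC EFinM.
rewrite ge0_integralZl ?lee_fin//; last exact/measurable_EFinP/miY.
rewrite integral_indic_comp// -pE -ind//.
transitivity (\int[P]_x (\1_(X @^-1` A `&` Y @^-1` B) x)%:E)%E.
  by apply: eq_integral => x _; rewrite setIC indicI.
rewrite integral_indic ?setIT//.
by apply: measurableI; [exact: mA_|exact: mB_].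
Qed.

(** Completing the square: exp x times the centred density of deviation s is exp (s^2 / 2) times the
    density with mean s^2. *)
Lemma normal_mgf (s : R) : 0 < s ->
  (\int[@lebesgue_measure R]_x (expR x * normal_pdf 0 s x)%:E = (expR (s ^+ 2 / 2))%:E)%E.
Proof.
move=> s0; have sn0 : s != 0 by rewrite gt_eqF.
rewrite -[RHS]mule1 -(integral_normal_pdf (s ^+ 2) s).
rewrite -ge0_integralZl; last 4 first.
- exact: measurableT.
- by apply/measurable_EFinP; exact: measurable_normal_pdf.
- by move=> x _; rewrite lee_fin normal_pdf_ge0.
- by rewrite lee_fin expR_ge0.
apply: eq_integral => x _; rewrite -EFinM; congr EFin.
rewrite !normal_pdfE// mulrCA [RHS]mulrCA; congr (_ * _).
rewrite /normal_fun -!expRD; congr expR.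
by field.
Qed.

Lemma normal_expR d (T : measurableType d) (P : probability T R) (Y : T -> TR) (s : R) :
  measurable_fun [set: T] Y -> 0 < s ->
  (forall B : set TR, measurable B -> P (Y @^-1` B) = normal_prob 0 s B) ->
  (\int[P]_x (expR (Y x))%:E = (expR (s ^+ 2 / 2))%:E)%E.
Proof.
move=> mY s0 hY; rewrite -(normal_mgf s0).
transitivity (\int[P]_x (expR (Y x) * 1)%:E)%E.
  by apply: eq_integral => x _; rewrite mulr1.
apply: (weighted_transfer (X2 := id) (h1 := fun=> 1)) => //.
- exact: measurable_normal_pdf.
- by move=> x; exact: normal_pdf_ge0.
move=> A mA; under eq_integral do rewrite mulr1.
transitivity (P (Y @^-1` A)); first exact: integral_indic_comp.
rewrite hY// /normal_prob [LHS]integral_mkcond.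
apply: eq_integral => x _; rewrite patchE indicE; case: ifP => _.
  by rewrite mul1r.
by rewrite mul0r.
Qed.

End WeightedTransfer.

(** * Exponential moments of step integrals *)

Section StepIntegrals.
Context d (Omega : measurableType d) (R : realType).
Variables (P : probability Omega R) (T : R).
Local Notation H := (L2_01 R).
Local Notation leb := (@lebesgue_measure R).
Local Notation TR := (measurableTypeR R).
Variable W : R -> H -> Omega -> R.
Hypothesis T0 : 0 < T.
Hypothesis hW : is_cylindrical_wiener P T W.

(* A term ((a, b), (c, g)) stands for the step s |-> \1_(]a, b]) s * c *: g. *)
Definition sterm := ((R * R) * (R * H))%type.
Implicit Types (E : seq sterm) (x : sterm).

Definition okterms E := forall x, List.In x E -> 0 <= x.1.1 <= x.1.2 /\ x.1.2 <= T.
Definition sint E (w : Omega) : R :=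
  \sum_(x <- E) x.2.1 * increment W x.1.1 x.1.2 x.2.2 w.
Definition sfun E (s : R) : H :=
  \sum_(x <- E) (\1_(`]x.1.1, x.1.2]%classic : set TR) s * x.2.1) *: x.2.2.
(** Cutting both ends at t turns an interval beyond t into the empty ]t, t] with zero increment, so
    the integral up to time t is again the integral of a list of terms. *)
Definition stopx (t : R) x : sterm := ((Num.min x.1.1 t, Num.min x.1.2 t), x.2).
Definition stop (t : R) E := [seq stopx t x | x <- E].

Lemma okterms_cons x E : okterms (x :: E) -> (0 <= x.1.1 <= x.1.2 /\ x.1.2 <= T) /\ okterms E.
Proof. by move=> h; split; [apply: h; left|move=> y yE; apply: h; right]. Qed.

Lemma W0_ae (t : R) : 0 <= t <= T -> {ae P, forall w, W t 0 w = 0}.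
Proof.
move=> tT; have := cyl_linear hW 1 0 0 tT; apply: filterS => w.
rewrite scaler0 addr0 mul1r => h.
by apply: (addrI (W t 0 w)); rewrite addr0 -h.
Qed.

Lemma W_lin (t : R) E (p : pred sterm) : 0 <= t <= T ->
  {ae P, forall w, \sum_(x <- E | p x) x.2.1 * W t x.2.2 w =
     W t (\sum_(x <- E | p x) x.2.1 *: x.2.2) w}.
Proof.
move=> tT; elim: E => [|x E IH].
  by have := W0_ae tT; apply: filterS => w; rewrite !big_nil.
case px : (p x); last by move: IH; apply: filterS => w; rewrite !big_cons px.
have := cyl_linear hW x.2.1 x.2.2 (\sum_(x <- E | p x) x.2.1 *: x.2.2) tT.
by move: IH; apply: filterS2 => w h1 h2; rewrite !big_cons px h1 h2.
Qed.

Section one_step.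
Variables (t t' : R) (E : seq sterm).
Hypothesis t0 : 0 <= t.
Hypothesis tt' : t < t'.
Hypothesis t'T : t' <= T.
Hypothesis okE : okterms E.
Hypothesis gap : forall x, List.In x E ->
  (x.1.1 <= t \/ t' <= x.1.1) /\ (x.1.2 <= t \/ t' <= x.1.2).
Definition active x := (x.1.1 <= t) && (t' <= x.1.2).
Definition actv : H := \sum_(x <- E | active x) x.2.1 *: x.2.2.

Lemma sint_stop w : sint (stop t' E) w = sint (stop t E) w +
  \sum_(x <- E | active x) x.2.1 * increment W t t' x.2.2 w.
Proof.
rewrite /sint /stop; move: okE gap; elim: (E) => [|x s IH] ok g.
  by rewrite !big_nil addr0.
have [[/andP[x0 x1] x2] oks] := okterms_cons ok.
have [g1 g2] := g x (or_introl erefl).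
rewrite !map_cons !big_cons IH//; last by move=> y ys; apply: g; right.
rewrite /active /increment /stopx /=.
have tt := ltW tt'.
case la : (x.1.1 <= t); case hb : (t' <= x.1.2) => /=.
- rewrite (min_l (le_trans la tt)) (min_l la).
  rewrite (min_r hb) (min_r (le_trans tt hb)); ring.
- have h2 : x.1.2 <= t by case: g2 => // h; rewrite h in hb.
  rewrite (min_l (le_trans la tt)) (min_l la).
  rewrite (min_l h2) (min_l (le_trans h2 tt)); ring.
- have h1 : t' <= x.1.1 by case: g1 => // h; rewrite h in la.
  rewrite (min_r h1) (min_r (le_trans tt h1)) (min_r hb) (min_r (le_trans tt hb)); ring.
- have h1 : t' <= x.1.1 by case: g1 => // h; rewrite h in la.
  by rewrite (le_trans h1 x1) in hb.
Qed.

Lemma sint_stop_ae : {ae P, forall w, sint (stop t' E) w =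
   sint (stop t E) w + increment W t t' actv w}.
Proof.
have t1 : 0 <= t <= T by rewrite t0 (le_trans (ltW tt')).
have t2 : 0 <= t' <= T by rewrite t'T (le_trans t0 (ltW tt')).
have := W_lin E active t1; have := W_lin E active t2.
apply: filterS2 => w h1 h2; rewrite sint_stop; congr (_ + _).
rewrite /increment -h1 -h2 -sumrB.
by apply: eq_bigr => x _; rewrite mulrBr.
Qed.

Lemma sfun_actv (s : R) : t < s <= t' -> sfun E s = actv.
Proof.
move=> /andP[ts st']; rewrite /sfun /actv [RHS]big_mkcond/=.
move: gap; elim: (E) => [|x r IH] g; first by rewrite !big_nil.
rewrite !big_cons IH; last by move=> y ys; apply: g; right.
congr (_ + _); have [g1 g2] := g x (or_introl erefl).
rewrite indicE mem_setE in_itv/= /active.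
have -> : (x.1.1 < s) = (x.1.1 <= t).
  apply/idP/idP => h; last exact: le_lt_trans ts.
  by case: g1 => // h'; have := lt_le_trans h (le_trans st' h'); rewrite ltxx.
have -> : (s <= x.1.2) = (t' <= x.1.2).
  apply/idP/idP => h; last exact: le_trans h.
  by case: g2 => // h'; have := lt_le_trans ts (le_trans h h'); rewrite ltxx.
by case: ifP => _; rewrite ?mul1r ?mul0r ?scale0r.
Qed.

(** A stopped sum only reads W at times at most t; the generated sigma-algebra is the form in which
    [cyl_indep] accepts past events. *)
Lemma measurable_past (A : set TR) : measurable A ->
  wiener_past W t (sint (stop t E) @^-1` A).
Proof.
move=> mA.
pose G := [set C : set Omega | exists (r : R) (g : H) (B : set TR),
        [/\ 0 <= r <= t, measurable B & C = W r g @^-1` B]].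
have mW r g : 0 <= r <= t -> measurable_fun [set: g_sigma_algebraType G] (W r g : _ -> TR).
  move=> rt _ B mB; rewrite setTI; apply: sub_sigma_algebra.
  by exists r, g, B.
suff : measurable_fun [set: g_sigma_algebraType G] (sint (stop t E) : _ -> TR).
  by move=> /(_ measurableT A mA); rewrite setTI.
rewrite /sint /stop; move: okE; elim: (E) => [|x s IH] ok.
  by under eq_fun do rewrite big_nil; exact: measurable_cst.
have [[/andP[x0 x1] x2] oks] := okterms_cons ok.
under eq_fun do rewrite map_cons big_cons.
apply: measurable_funD; last exact: IH.
apply: measurable_funM; first exact: measurable_cst.
have m1 (r : R) : 0 <= r -> 0 <= Num.min r t <= t.
  by move=> r0; rewrite ge_min lexx orbT le_min r0 t0.
apply: measurable_funB; apply: mW; apply: m1 => //.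
exact: le_trans x1.
Qed.

Lemma measurable_sint E' : okterms E' -> measurable_fun [set: Omega] (sint E').
Proof.
elim: E' => [|x s IH] ok.
  by rewrite /sint; under eq_fun do rewrite big_nil; exact: measurable_cst.
have [[/andP[x0 x1] x2] oks] := okterms_cons ok.
rewrite /sint; under eq_fun do rewrite big_cons.
apply: measurable_funD; last exact: IH.
apply: measurable_funM; first exact: measurable_cst.
have hi : 0 <= x.1.2 <= T by rewrite x2 (le_trans x0 x1).
have lo : 0 <= x.1.1 <= T by rewrite x0 (le_trans x1 x2).
by apply: measurable_funB; apply: (cyl_measurable hW).
Qed.

Lemma okterms_stop (r : R) : 0 <= r -> okterms (stop r E).
Proof.
move=> r0 y hy; have [x [<- xE]] := In_map hy; rewrite /=.
have [/andP[x0 x1] x2] := okE xE.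
split; last by rewrite ge_min x2.
rewrite le_min x0 r0 /= le_min ge_min x1 /= ge_min lexx orbT //.
Qed.

(** On ]t, t'] the integrand is the constant vector [actv], so the new contribution is one
    increment, independent of the past and Gaussian with variance (t' - t) |actv|^2. The zero vector
    is treated apart because [cyl_gaussian] excludes the degenerate law. *)
Lemma mgf_step (e : R) : (\int[P]_w (expR (sint (stop t E) w))%:E = e%:E)%E ->
  (\int[P]_w (expR (sint (stop t' E) w))%:E = (e * expR ((t' - t) * `|actv| ^+ 2 / 2))%:E)%E.
Proof.
move=> he.
have t1 : 0 <= t <= T by rewrite t0 (le_trans (ltW tt')).
have t2 : 0 <= t' <= T by rewrite t'T (le_trans t0 (ltW tt')).
have mS : measurable_fun [set: Omega] (sint (stop t E)) by exact/measurable_sint/okterms_stop.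
have mS' : measurable_fun [set: Omega] (sint (stop t' E)).
  by apply/measurable_sint/okterms_stop; exact: le_trans (ltW tt').
have mY : measurable_fun [set: Omega] (increment W t t' actv).
  by apply: measurable_funB; apply: (cyl_measurable hW).
have mexp (X : Omega -> R) : measurable_fun [set: Omega] X ->
    measurable_fun [set: Omega] (fun w => (expR (X w))%:E).
  by move=> mX; apply/measurable_EFinP; exact: (measurableT_comp (@measurable_expR R) mX).
rewrite (@ae_eq_integral _ _ _ P setT
  (fun w => (expR (sint (stop t E) w) * expR (increment W t t' actv w))%:E))//; last 3 first.
- exact: mexp.
- by under eq_fun do rewrite EFinM; apply: emeasurable_funM; exact: mexp.
- by have := sint_stop_ae; apply: filterS => w -> _; rewrite expRD.
have tt0 : 0 <= t < t' by rewrite t0.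
have hY : (\int[P]_w (expR (increment W t t' actv w))%:E =
    (expR ((t' - t) * `|actv| ^+ 2 / 2))%:E)%E.
  have [v0|v0] := eqVneq actv 0.
    rewrite v0 normr0 expr0n mulr0 mul0r expR0.
    rewrite (@ae_eq_integral _ _ _ P setT (fun w => 1%:E))//.
    - by rewrite integral_cst//= mul1e probability_setT.
    - by rewrite -v0; exact: mexp.
    - have := W0_ae t2; have := W0_ae t1; apply: filterS2 => w h1 h2 _.
      by rewrite /increment h1 h2 subrr expR0.
  have s0 : 0 < Num.sqrt (t' - t) * `|actv|.
    by rewrite mulr_gt0 ?normr_gt0// sqrtr_gt0 subr_gt0.
  rewrite (normal_expR mY s0); last first.
    by move=> B mB; exact: (cyl_gaussian hW tt0 t'T v0 mB).
  by rewrite exprMn sqr_sqrtr// subr_ge0 ltW.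
have [v0|v0] := eqVneq actv 0.
  rewrite v0 normr0 expr0n mulr0 mul0r expR0 mulr1 -he.
  apply: ae_eq_integral => //.
  - by under eq_fun do rewrite EFinM; apply: emeasurable_funM; apply: mexp => //; rewrite -v0.
  - exact: mexp.
  - have := W0_ae t2; have := W0_ae t1; apply: filterS2 => w h1 h2 _.
    by rewrite /increment h1 h2 subrr expR0 mulr1.
rewrite (@indep_integral _ _ _ P (sint (stop t E)) (increment W t t' actv) expR expR mS mY
  (@measurable_expR R) (@measurable_expR R) (@expR_ge0 R) (@expR_ge0 R) _ _ hY).
  by rewrite he EFinM.
move=> A B mA mB.
exact: (cyl_indep hW actv tt0 t'T (measurable_past mA) mB).
Qed.

End one_step.

Lemma sfun_wmeas E : wmeas [set: TR] (sfun E).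
Proof.
move=> g; rewrite /sfun; elim: E => [|x E IH].
  by under eq_fun do rewrite big_nil ip0r; exact: measurable_cst.
under eq_fun do rewrite big_cons ipDr.
apply: measurable_funD => //; under eq_fun do rewrite ipZr.
by apply: measurable_funM => //; apply: measurable_funM.
Qed.

Lemma measurable_sfun2 E (D : set TR) : measurable D ->
  measurable_fun D (fun s => (`|sfun E s| ^+ 2)%:E).
Proof.
move=> mD; apply/measurable_EFinP; apply: (measurable_funS measurableT) => //.
by apply: wmeas_norm2; exact: sfun_wmeas.
Qed.

(** All endpoints are sorted into one list, so that no term starts or stops between neighbours; the
    factors of [mgf_step] then multiply up to exp (q / 2), even though terms may overlap. *)
Lemma sint_mgf E : okterms E -> exists q : R,
  (\int[leb]_(s in `]0%R, T]) (`|sfun E s| ^+ 2)%:E = q%:E)%E /\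
  (\int[P]_w (expR (sint E w))%:E = (expR (q / 2))%:E)%E.
Proof.
move=> okE.
pose raw : seq R := 0 :: T :: flatten [seq [:: x.1.1; x.1.2] | x <- E].
pose pts := sort <=%R raw.
have mem_pts r : (r \in pts) = (r \in raw) by rewrite mem_sort.
have inpts x : List.In x E -> x.1.1 \in pts /\ x.1.2 \in pts.
  rewrite !mem_pts !inE => xE.
  suff : x.1.1 \in flatten [seq [:: x.1.1; x.1.2] | x <- E] /\
         x.1.2 \in flatten [seq [:: x.1.1; x.1.2] | x <- E].
    by move=> [-> ->]; rewrite !orbT.
  elim: (E) xE => //= y s IH [->|/IH[h1 h2]]; rewrite !inE ?eqxx ?orbT//.
  by rewrite h1 h2 !orbT.
have ptsT r : r \in pts -> 0 <= r <= T.
  rewrite mem_pts !inE => /or3P[/eqP->|/eqP->|]; rewrite ?lexx ?(ltW T0)//.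
  move: okE; elim: (E) => //= y s IH /okterms_cons[[/andP[h1 h2] h3] oks].
  rewrite !inE => /or3P[/eqP->|/eqP->|/(IH oks)//].
    by rewrite h1 (le_trans h2 h3).
  by rewrite h3 (le_trans h1 h2).
have srt : sorted <=%R pts by apply: sort_sorted; exact: le_total.
have szp : (0 < size pts)%N by rewrite size_sort.
pose tt i := nth 0 pts i.
have ttin i : (i < size pts)%N -> tt i \in pts by exact: mem_nth.
have mono i j : (i <= j)%N -> (j < size pts)%N -> tt i <= tt j.
  move=> ij js; apply: (sorted_leq_nth (@le_trans _ _) (@lexx _ _) 0 srt) => //.
  by rewrite inE (leq_ltn_trans ij).
have tt00 : tt 0%N = 0.
  have /andP[h1 _] := ptsT _ (ttin 0%N szp).
  apply/eqP; rewrite eq_le h1 andbT.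
  have z0 : 0 \in pts by rewrite mem_pts inE eqxx.
  have := mono 0%N (index 0 pts) (leq0n _); rewrite index_mem => /(_ z0).
  by rewrite /tt nth_index.
suff key i : (i < size pts)%N -> exists q : R,
    (\int[leb]_(s in `]0%R, (tt i)]) (`|sfun E s| ^+ 2)%:E = q%:E)%E /\
    (\int[P]_w (expR (sint (stop (tt i) E) w))%:E = (expR (q / 2))%:E)%E.
  have TT : T \in pts by rewrite mem_pts !inE eqxx orbT.
  have := key (index T pts); rewrite index_mem => /(_ TT).
  rewrite /tt (nth_index 0 TT) => -[q [h1 h2]]; exists q; split; first exact: h1.
  rewrite -h2; apply: eq_integral => w _; congr (expR _)%:E.
  rewrite /sint /stop; move: okE; elim: (E) => [|x s IH] ok; first by rewrite !big_nil.
  have [[/andP[x0 x1] x2] oks] := okterms_cons ok.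
  rewrite map_cons !big_cons -IH//; congr (_ + _).
  by rewrite /stopx/= (min_l x2) (min_l (le_trans x1 x2)).
elim: i => [|i IH] ip.
  exists 0; rewrite tt00 set_itvoc0 integral_set0; split => //.
  rewrite mul0r expR0 -(probability_setT P) -[RHS]mul1e -integral_cst//.
  apply: eq_integral => w _; rewrite /sint /stop; congr EFin.
  rewrite -[RHS]expR0; congr expR.
  move: okE; elim: (E) => [|x s IHs] ok; first by rewrite big_nil.
  have [[/andP[x0 x1] x2] oks] := okterms_cons ok.
  rewrite map_cons big_cons IHs// addr0 /stopx /increment /=.
  by rewrite (min_r x0) (min_r (le_trans x0 x1)) subrr mulr0.
have [q [h1 h2]] := IH (ltnW ip).
have := mono i i.+1 (leqnSn i) ip; rewrite le_eqVlt => /predU1P[<-|lt]; first by exists q.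
have /andP[ti0 _] := ptsT _ (ttin i (ltnW ip)).
have /andP[_ tiT] := ptsT _ (ttin i.+1 ip).
have sep r : r \in pts -> r <= tt i \/ tt i.+1 <= r.
  move=> rp; have [ri|ri] := leqP (index r pts) i.
    by left; rewrite -(nth_index 0 rp); apply: mono => //; exact: ltnW.
  by right; rewrite -[leRHS](nth_index 0 rp); apply: mono => //; rewrite index_mem.
have gp x : List.In x E -> (x.1.1 <= tt i \/ tt i.+1 <= x.1.1) /\
    (x.1.2 <= tt i \/ tt i.+1 <= x.1.2).
  by move=> /inpts[p1 p2]; split; exact: sep.
exists (q + (tt i.+1 - tt i) * `|actv (tt i) (tt i.+1) E| ^+ 2); split; last first.
  by rewrite (mgf_step ti0 lt tiT okE gp h2) -expRD -mulrDl.
rewrite (_ : `]0, (tt i.+1)]%classic = `]0, (tt i)] `|` `](tt i), (tt i.+1)]); last first.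
  by rewrite -itv_bndbnd_setU// bnd_simp// ltW.
rewrite ge0_integral_setU//; last 2 first.
- by apply: measurable_sfun2; apply: measurableU; exact: measurable_itv.
- apply/disj_setPS => s /=; rewrite !in_itv/= => -[/andP[_ s1] /andP[s2 _]].
  by have := le_lt_trans s1 s2; rewrite ltxx.
rewrite h1 [RHS]EFinD; congr (_ + _)%E.
rewrite (eq_integral (cst (`|actv (tt i) (tt i.+1) E| ^+ 2)%:E)); last first.
  by move=> s; rewrite inE/= in_itv/= => sI; rewrite (sfun_actv gp sI).
rewrite integral_cst//=.
by rewrite lebesgue_measure_itv/= lte_fin lt -EFinD -EFinM mulrC.
Qed.

End StepIntegrals.

Lemma cvg_nat_ge (R : realType) (u : nat -> R) (l M : R) :
  u n @[n --> \oo] --> l -> (forall n, M <= u n) -> M <= l.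
Proof.
move=> ul uM; rewrite -lerN2; apply: (cvg_nat_le (u := fun n => - u n)).
  exact: cvgN.
by move=> n; rewrite lerN2.
Qed.

Section RealValuedIntegrals.
Context d (T : measurableType d) (R : realType) (mu : {measure set T -> \bar R}).
Variables (D : set T) (mD : measurable D).
Implicit Types f g : T -> R.

Lemma intZ (k : R) f : 0 <= k -> measurable_fun D f -> (forall x, 0 <= f x) ->
  (\int[mu]_(x in D) (k * f x)%:E = k%:E * \int[mu]_(x in D) (f x)%:E)%E.
Proof.
move=> k0 mf f0; rewrite -ge0_integralZl//.
- exact/measurable_EFinP.
- by move=> x _; rewrite lee_fin.
Qed.

Lemma intD f g : measurable_fun D f -> measurable_fun D g ->
  (forall x, 0 <= f x) -> (forall x, 0 <= g x) ->
  (\int[mu]_(x in D) (f x + g x)%:E =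
   \int[mu]_(x in D) (f x)%:E + \int[mu]_(x in D) (g x)%:E)%E.
Proof.
move=> mf mg f0 g0; rewrite -ge0_integralD//.
- by move=> x _; rewrite lee_fin.
- exact/measurable_EFinP.
- by move=> x _; rewrite lee_fin.
- exact/measurable_EFinP.
Qed.

Lemma int_le f g : measurable_fun D f -> measurable_fun D g ->
  (forall x, D x -> 0 <= f x) -> (forall x, D x -> f x <= g x) ->
  (\int[mu]_(x in D) (f x)%:E <= \int[mu]_(x in D) (g x)%:E)%E.
Proof.
move=> mf mg f0 fg; apply: ge0_le_integral => //.
- exact/measurable_EFinP.
- exact/measurable_EFinP.
Qed.

Lemma int_ge0 f : (forall x, 0 <= f x) -> (0 <= \int[mu]_(x in D) (f x)%:E)%E.
Proof. by move=> f0; apply: integral_ge0 => x _; rewrite lee_fin. Qed.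

End RealValuedIntegrals.

Lemma integral_prob_cst d (Omega : measurableType d) (R : realType)
  (P : probability Omega R) (a : R) : (\int[P]_w a%:E = a%:E)%E.
Proof.
transitivity (a%:E * P setT)%E; first exact: (integral_cst P measurableT a%:E).
by rewrite probability_setT mule1.
Qed.

(** * Gaussian variables as mean square limits of step integrals *)

Section GaussianFamily.
Context d (Omega : measurableType d) (R : realType).
Variables (P : probability Omega R) (T : R).
Local Notation H := (L2_01 R).
Local Notation leb := (@lebesgue_measure R).
Local Notation TR := (measurableTypeR R).
Variable W : R -> H -> Omega -> R.
Hypothesis T0 : 0 < T.
Hypothesis hW : is_cylindrical_wiener P T W.

(* y is a version of the Wiener integral of <f, dW>. *)
Definition isG (f : TR -> H) (y : Omega -> R) := [/\ measurable_fun [set: Omega] y,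
  wmeas [set: TR] f &
  exists E_ : nat -> seq (sterm R), [/\ forall n, okterms T (E_ n),
    (\int[leb]_s (`|f s - sfun (E_ n) s| ^+ 2)%:E)%E @[n --> \oo] --> 0%E &
    (\int[P]_w ((y w - sint W (E_ n) w) ^+ 2)%:E)%E @[n --> \oo] --> 0%E]].

Definition scaleE (a : R) (E : seq (sterm R)) : seq (sterm R) :=
  [seq (x.1, (a * x.2.1, x.2.2)) | x <- E].

Lemma sfun_scale a E s : sfun (scaleE a E) s = a *: sfun E s.
Proof.
rewrite /sfun /scaleE big_map scaler_sumr; apply: eq_bigr => x _ /=.
by rewrite scalerA mulrCA.
Qed.

Lemma sint_scale a E w : sint W (scaleE a E) w = a * sint W E w.
Proof.
rewrite /sint /scaleE big_map mulr_sumr; apply: eq_bigr => x _ /=.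
by rewrite mulrA.
Qed.

Lemma sfun_cat E1 E2 (s : R) : sfun (E1 ++ E2) s = sfun E1 s + sfun E2 s :> H.
Proof. by rewrite /sfun big_cat. Qed.

Lemma sint_cat E1 E2 w : sint W (E1 ++ E2) w = sint W E1 w + sint W E2 w.
Proof. by rewrite /sint big_cat. Qed.

Lemma okterms_scale a E : okterms T E -> okterms T (scaleE a E).
Proof. by move=> ok x xE; have [y [<- yE]] := In_map xE; have := ok y yE. Qed.

Lemma okterms_cat E1 E2 : okterms T E1 -> okterms T E2 -> okterms T (E1 ++ E2).
Proof. by move=> h1 h2 x xE; have [] := In_cat xE; [exact: h1|exact: h2]. Qed.

Lemma sqr_lin_le (a x y : R) : (a * x + y) ^+ 2 <= 2 * a ^+ 2 * x ^+ 2 + 2 * y ^+ 2.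
Proof. have := sqr_ge0 (a * x - y); nra. Qed.

Lemma normsqr_lin_le (a : R) (u v : H) :
  `|a *: u + v| ^+ 2 <= 2 * a ^+ 2 * `|u| ^+ 2 + 2 * `|v| ^+ 2.
Proof.
apply: (@le_trans _ _ ((`|a| * `|u| + `|v|) ^+ 2)).
  by rewrite ler_pXn2r ?nnegrE ?addr_ge0 ?mulr_ge0// -normrZ ler_normD.
by apply: le_trans (sqr_lin_le _ _ _) _; rewrite real_normK ?num_real.
Qed.

Lemma cvg_lin0 d' (T' : measurableType d') (mu : {measure set T' -> \bar R})
  (F1 F2 G : nat -> T' -> R) (b : R) : 0 <= b ->
  (forall n, measurable_fun [set: T'] (F1 n)) -> (forall n, measurable_fun [set: T'] (F2 n)) ->
  (forall n, measurable_fun [set: T'] (G n)) ->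
  (forall n x, 0 <= F1 n x) -> (forall n x, 0 <= F2 n x) -> (forall n x, 0 <= G n x) ->
  (forall n x, G n x <= b * F1 n x + 2 * F2 n x) ->
  (\int[mu]_x (F1 n x)%:E)%E @[n --> \oo] --> 0%E ->
  (\int[mu]_x (F2 n x)%:E)%E @[n --> \oo] --> 0%E ->
  (\int[mu]_x (G n x)%:E)%E @[n --> \oo] --> 0%E.
Proof.
move=> b0 m1 m2 mG p1 p2 pG h c1 c2.
have hc : (b%:E * \int[mu]_x (F1 n x)%:E + 2%:E * \int[mu]_x (F2 n x)%:E)%E @[n --> \oo] --> 0%E.
  rewrite -[X in _ --> X](adde0 0%E); apply: cvgeD => //.
    by rewrite -(mule0 b%:E); exact: cvgeZl.
  by rewrite -(mule0 2%:E); exact: cvgeZl.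
apply: (@squeeze_cvge _ _ _ _ (cst 0%E) _ _ _ _ (@cvg_cst _ _ _ _ _) hc).
apply: nearW => n; apply/andP; split.
  by apply: integral_ge0 => x _; rewrite lee_fin.
rewrite -!ge0_integralZl//; try (by move=> x _; rewrite lee_fin); try exact/measurable_EFinP.
rewrite -ge0_integralD//; last 4 first.
- by move=> x _; rewrite -EFinM lee_fin mulr_ge0.
- by apply: measurable_funeM; exact/measurable_EFinP.
- by move=> x _; rewrite -EFinM lee_fin mulr_ge0.
- by apply: measurable_funeM; exact/measurable_EFinP.
apply: ge0_le_integral => //.
- by move=> x _; rewrite lee_fin.
- exact/measurable_EFinP.
- by apply: emeasurable_funD; apply: measurable_funeM; exact/measurable_EFinP.
- by move=> x _; rewrite -!EFinM -EFinD lee_fin.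
Qed.

Lemma isG_lin (a : R) f1 y1 f2 y2 : isG f1 y1 -> isG f2 y2 ->
  isG (fun s => a *: f1 s + f2 s) (fun w => a * y1 w + y2 w).
Proof.
move=> [my1 wf1 [E1 [ok1 cf1 cy1]]] [my2 wf2 [E2 [ok2 cf2 cy2]]]; split.
- by apply: measurable_funD => //; apply: measurable_funM.
- by move=> g; under eq_fun do rewrite ipDr ipZr;
    apply: measurable_funD => //; apply: measurable_funM.
have b0 : 0 <= 2 * a ^+ 2 by rewrite mulr_ge0// sqr_ge0.
exists (fun n => scaleE a (E1 n) ++ E2 n); split.
- by move=> n; apply: okterms_cat => //; exact: okterms_scale.
- have mm f E : wmeas [set: TR] f -> measurable_fun [set: TR] (fun s => `|f s - sfun E s| ^+ 2).
    by move=> wf; apply: wmeas_norm2; apply: wmeasB => //; exact: sfun_wmeas.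
  apply: (cvg_lin0 b0 _ _ _ _ _ _ _ cf1 cf2).
  + by move=> n; exact: mm.
  + by move=> n; exact: mm.
  + move=> n; apply: (mm (fun s => a *: f1 s + f2 s)) => g.
    under eq_fun do rewrite ipDr ipZr.
    by apply: measurable_funD => //; apply: measurable_funM.
  + by move=> n x; exact: sqr_ge0.
  + by move=> n x; exact: sqr_ge0.
  + by move=> n x; exact: sqr_ge0.
  + move=> n x; rewrite sfun_cat sfun_scale.
    rewrite (_ : _ - _ = a *: (f1 x - sfun (E1 n) x) + (f2 x - sfun (E2 n) x)).
      exact: normsqr_lin_le.
    by rewrite scalerBr opprD addrACA.
- have mm (y : Omega -> R) E : measurable_fun [set: Omega] y -> okterms T E ->
     measurable_fun [set: Omega] (fun w => (y w - sint W E w) ^+ 2).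
    move=> my okE; apply: measurable_funX; apply: measurable_funB => //.
    exact: measurable_sint hW _ okE.
  apply: (cvg_lin0 b0 _ _ _ _ _ _ _ cy1 cy2).
  + by move=> n; exact: mm.
  + by move=> n; exact: mm.
  + move=> n; apply: (mm (fun w => a * y1 w + y2 w)).
      by apply: measurable_funD => //; apply: measurable_funM.
    by apply: okterms_cat => //; exact: okterms_scale.
  + by move=> n x; exact: sqr_ge0.
  + by move=> n x; exact: sqr_ge0.
  + by move=> n x; exact: sqr_ge0.
  + move=> n x; rewrite sint_cat sint_scale.
    rewrite (_ : _ - _ = a * (y1 x - sint W (E1 n) x) + (y2 x - sint W (E2 n) x)).
      exact: sqr_lin_le.
    ring.
Qed.

Lemma isG0 : isG (fun=> 0) (fun=> 0).
Proof.
split; [exact: measurable_cst| |].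
  by move=> g; under eq_fun do rewrite ip0r; exact: measurable_cst.
exists (fun=> [::]); split; first by move=> n x [].
- rewrite (_ : (fun _ => _) = cst 0%E); first exact: cvg_cst.
  apply/funext => n; apply: integral0_eq => s _.
  by rewrite /sfun big_nil subr0 normr0 expr0n.
- rewrite (_ : (fun _ => _) = cst 0%E); first exact: cvg_cst.
  apply/funext => n; apply: integral0_eq => s _.
  by rewrite /sint big_nil subr0 expr0n.
Qed.

Lemma isG_Z (a : R) f y : isG f y -> isG (fun s => a *: f s) (fun w => a * y w).
Proof.
move=> h; have := isG_lin a h isG0.
by under [X in isG X _]eq_fun do rewrite addr0;
   under [X in isG _ X]eq_fun do rewrite addr0.
Qed.

Lemma near_small (u : nat -> \bar R) (eps : R) : 0 < eps -> u n @[n --> \oo] --> 0%E ->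
  \forall n \near \oo, (u n < eps%:E)%E.
Proof.
move=> e0 /fine_cvgP[uf /cvgrPdist_lt/(_ _ e0) h].
near=> n; have un : u n \is a fin_num by near: n.
rewrite -(fineK un) lte_fin.
have : `|0 - (fine \o u) n| < eps by near: n.
by rewrite sub0r normrN; apply: le_lt_trans; exact: ler_norm.
Unshelve. all: by end_near. Qed.

(** The step integrals converge merely in mean square, which controls no exponential; truncation at
    K repairs this. First the approximation parameter s tends to 0, then K to infinity by Fatou's
    lemma. *)
Lemma isG_mgf f y (q : R) : isG f y -> 0 <= q ->
  (\int[leb]_s (`|f s| ^+ 2)%:E <= q%:E)%E ->
  (\int[P]_w (expR (y w))%:E <= (expR (q / 2))%:E)%E.
Proof.
move=> [my wf [E [ok cf cy]]] q0 hq.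
have mexp (X : Omega -> R) : measurable_fun [set: Omega] X ->
    measurable_fun [set: Omega] (fun w => (expR (X w))%:E).
  by move=> mX; apply/measurable_EFinP; exact: (measurableT_comp (@measurable_expR R) mX).
have mE n : measurable_fun [set: Omega] (sint W (E n)) by exact: measurable_sint hW _ (ok n).
have mmin (K : R) : measurable_fun [set: Omega] (fun w => Num.min (y w) K).
  exact: measurable_minr.
(* For a step integral v at mean square distance below s from y and z = min y K, convexity gives exp
   z <= exp v + exp K (s + (y - v)^2 / s), and the bracket has mean at most 2 s. *)
have bnd (K s : R) : 0 < s -> (\int[P]_w (expR (Num.min (y w) K))%:E <=
    (expR (((1 + s) * q + s + s ^+ 2) / 2) + expR K * (2 * s))%:E)%E.
  move=> s0; have s2 : 0 < s ^+ 2 by rewrite exprn_gt0.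
  have [n [hn1 hn2]] : exists n, (\int[leb]_t (`|f t - sfun (E n) t| ^+ 2)%:E < (s ^+ 2)%:E)%E /\
     (\int[P]_w ((y w - sint W (E n) w) ^+ 2)%:E < (s ^+ 2)%:E)%E.
    have [N1 _ h1] := near_small s2 cf; have [N2 _ h2] := near_small s2 cy.
    exists (maxn N1 N2); split; [apply: h1|apply: h2]; by rewrite /= ?leq_maxl ?leq_maxr.
  have [qn [hqn hmgf]] := sint_mgf T0 hW (ok n).
  have qn_le : qn <= (1 + s) * q + s + s ^+ 2.
    rewrite -lee_fin -hqn.
    apply: (@le_trans _ _ (\int[leb]_t (`|sfun (E n) t| ^+ 2)%:E)%E).
      by apply: ge0_subset_integral => //; exact: measurable_sfun2.
    have si : 0 < s^-1 by rewrite invr_gt0.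
    have m1 : measurable_fun [set: TR] (fun t => `|f t| ^+ 2) by exact: wmeas_norm2.
    have m2 : measurable_fun [set: TR] (fun t => `|f t - sfun (E n) t| ^+ 2).
      by apply: wmeas_norm2; apply: wmeasB => //; exact: sfun_wmeas.
    apply: (@le_trans _ _ (\int[leb]_t ((1 + s) * `|f t| ^+ 2 +
       (1 + s^-1) * `|f t - sfun (E n) t| ^+ 2)%:E)%E).
      apply: int_le => //.
      - by apply: wmeas_norm2; exact: sfun_wmeas.
      - by apply: measurable_funD; apply: measurable_funM.
      - move=> t _; set u := f t; set v := sfun (E n) t.
        have h1 : `|v| <= `|u| + `|u - v|.
          by rewrite -{1}(subKr u v) ler_normB.
        apply: (@le_trans _ _ ((`|u| + `|u - v|) ^+ 2)).
          by rewrite ler_pXn2r ?nnegrE ?addr_ge0.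
        have := sqr_ge0 (s * `|u| - `|u - v|).
        move: (`|u|) (`|u - v|) => a b hab.
        rewrite -subr_ge0 (_ : _ - _ = (s * a - b) ^+ 2 / s); last by field; rewrite gt_eqF.
        by rewrite divr_ge0// ltW.
    have p1 : 0 <= 1 + s by rewrite addr_ge0// ltW.
    have p2 : 0 <= 1 + s^-1 by rewrite addr_ge0// ltW.
    rewrite intD//; last 4 first.
    - exact: measurable_funM.
    - exact: measurable_funM.
    - by move=> t; rewrite mulr_ge0 ?sqr_ge0.
    - by move=> t; rewrite mulr_ge0 ?sqr_ge0.
    rewrite !intZ//; try (by move=> t; exact: sqr_ge0).
    have -> : ((1 + s) * q + s + s ^+ 2)%:E = ((1 + s)%:E * q%:E + (1 + s^-1)%:E * (s ^+ 2)%:E)%E.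
      by rewrite -!EFinM -EFinD; congr EFin; field; rewrite gt_eqF.
    by apply: leeD; apply: lee_wpmul2l; rewrite ?lee_fin//; exact: ltW.
  have md : measurable_fun [set: Omega] (fun w => (y w - sint W (E n) w) ^+ 2).
    by apply: measurable_funX; exact: measurable_funB.
  have mr : measurable_fun [set: Omega] (fun w => s^-1 * (y w - sint W (E n) w) ^+ 2).
    exact: measurable_funM.
  have mex : measurable_fun [set: Omega] (fun w => expR (sint W (E n) w)).
    exact: (measurableT_comp (@measurable_expR R) (mE n)).
  have si : 0 <= s^-1 by rewrite invr_ge0 ltW.
  have p1 w : 0 <= s^-1 * (y w - sint W (E n) w) ^+ 2 by rewrite mulr_ge0 ?sqr_ge0.
  have p2 w : 0 <= s + s^-1 * (y w - sint W (E n) w) ^+ 2 by rewrite addr_ge0// ltW.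
  apply: (@le_trans _ _ (\int[P]_w (expR (sint W (E n) w) +
     expR K * (s + s^-1 * (y w - sint W (E n) w) ^+ 2))%:E)%E).
    apply: int_le => //.
    - exact: (measurableT_comp (@measurable_expR R) (mmin K)).
    - by apply: measurable_funD => //; apply: measurable_funM => //; apply: measurable_funD.
    - move=> w _; have h4 := p2 w; move: h4.
      set z := Num.min _ _; set v := sint _ _ _ => h4.
      have zy : z <= y w by rewrite /z ge_min lexx.
      have zK : z <= K by rewrite /z ge_min lexx orbT.
      have h1 : expR z * (1 + (v - z)) <= expR v.
        have -> : expR v = expR z * expR (v - z) by rewrite -expRD addrC subrK.
        by rewrite ler_wpM2l ?expR_ge0 ?expR_ge1Dx.
      have h2 : z - v <= s + s^-1 * (y w - v) ^+ 2.
        apply: (@le_trans _ _ (y w - v)); first by rewrite lerB.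
        have := sqr_ge0 (s - (y w - v)).
        move: (y w - v) => b hb.
        rewrite -subr_ge0 (_ : _ - _ = ((s - b) ^+ 2 + s * b) / s); last by field; rewrite gt_eqF.
        rewrite divr_ge0 ?(ltW s0)//.
        have [b0|b0] := leP 0 b; first by rewrite addr_ge0// mulr_ge0// ltW.
        nra.
      have h3 : expR z <= expR K by rewrite ler_expR.
      have := ler_wpM2l (expR_ge0 z) h2; have := ler_wpM2r h4 h3.
      have -> : expR z = expR z * (1 + (v - z)) + expR z * (z - v) by ring.
      lra.
  rewrite intD//; last 2 first.
  - by apply: measurable_funM => //; apply: measurable_funD.
  - by move=> w; rewrite mulr_ge0 ?expR_ge0.
  rewrite hmgf EFinD; apply: leeD.
    by rewrite lee_fin ler_expR ler_wpM2r.
  rewrite intZ ?expR_ge0//; last by apply: measurable_funD.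
  rewrite EFinM lee_wpmul2l ?lee_fin ?expR_ge0//.
  rewrite intD//; last by move=> w; exact: ltW.
  rewrite integral_prob_cst intZ//; last by move=> w; exact: sqr_ge0.
  have -> : (2 * s)%:E = (s%:E + (s^-1)%:E * (s ^+ 2)%:E)%E.
    by rewrite -EFinM -EFinD; congr EFin; field; rewrite gt_eqF.
  by rewrite leeD2l// lee_wpmul2l ?lee_fin// ltW.
have bnd0 (K : R) : (\int[P]_w (expR (Num.min (y w) K))%:E <= (expR (q / 2))%:E)%E.
  set A := (X in (X <= _)%E).
  have A0 : (0 <= A)%E by apply: integral_ge0 => w _; rewrite lee_fin expR_ge0.
  have Af : A \is a fin_num.
    by rewrite ge0_fin_numE// (le_lt_trans (bnd K 1 ltr01))// ltry.
  rewrite -(fineK Af) lee_fin.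
  pose g (s : R) := expR (((1 + s) * q + s + s ^+ 2) / 2) + expR K * (2 * s).
  have -> : expR (q / 2) = g 0.
    rewrite /g; rewrite expr0n !addr0 mulr0 mulr0 addr0 mul1r; by [].
  have cg : {for 0, continuous g}.
    rewrite /g; apply: cvgD; last by apply: cvgM; [exact: cvg_cst|apply: cvgM; [exact: cvg_cst|exact: cvg_id]].
    apply: continuous_comp; last exact: continuous_expR.
    apply: cvgM; last exact: cvg_cst.
    apply: cvgD; last exact: exprn_continuous.
    apply: cvgD; last exact: cvg_id.
    apply: cvgM; last exact: cvg_cst.
    by apply: cvgD; [exact: cvg_cst|exact: cvg_id].
  have hc : g (harmonic n) @[n --> \oo] --> g 0.
    by apply: (continuous_cvg _ cg); exact: cvg_harmonic.
  apply: (cvg_nat_ge hc) => n.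
  by rewrite -lee_fin (fineK Af); apply: bnd; rewrite /harmonic/= invr_gt0.
apply: (@ae_fatou _ _ _ P (fun n w => (expR (Num.min (y w) n%:R))%:E)).
- by move=> n; exact: mexp.
- exact: mexp.
- by move=> n w; rewrite lee_fin expR_ge0.
- apply: aeW => w; apply: cvg_near_cst; near=> n.
  rewrite min_l//; near: n.
  exists (Num.truncn `|y w|).+1 => // n /= hn.
  apply: (le_trans (ler_norm _)); apply: ltW.
  apply: (lt_le_trans (truncnS_gt _)); by rewrite ler_nat.
- by apply: nearW => n; exact: bnd0.
Unshelve. all: by end_near. Qed.

End GaussianFamily.

(** * Coordinates of Hilbert-space-valued Wiener integrals *)

Section WienerIntegralGaussian.
Context d (Omega : measurableType d) (R : realType).
Variables (P : probability Omega R) (T : R).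
Local Notation H := (L2_01 R).
Local Notation leb := (@lebesgue_measure R).
Local Notation TR := (measurableTypeR R).
Variable W : R -> H -> Omega -> R.
Hypothesis T0 : 0 < T.
Hypothesis hW : is_cylindrical_wiener P T W.

Lemma open_ip_gt (g : H) (a : R) : open [set u : H | a < ip g u].
Proof.
rewrite openE => u /= au; apply/nbhs_ballP.
have e0 : 0 < (ip g u - a) / (`|g| + 1) by rewrite divr_gt0 ?subr_gt0// ltr_wpDl.
exists ((ip g u - a) / (`|g| + 1)) => // v; rewrite -ball_normE /= => uv.
have := ip_le g (u - v); rewrite ipBr => h.
have : `|g| * `|u - v| < ip g u - a.
  apply: (@le_lt_trans _ _ ((`|g| + 1) * `|u - v|)).
    by rewrite ler_wpM2r// lerDl.
  by rewrite mulrC -ltr_pdivlMr// ltr_wpDl.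
lra.
Qed.

Lemma measurable_ip_rv (Y : Omega -> H) (g : H) : borel_rv Y ->
  measurable_fun [set: Omega] (fun w => ip g (Y w)).
Proof.
move=> hY; apply: (measurability _ (RGenOInfty.measurableE R)) => //.
move=> _ [_ [a ->] <-]; rewrite setTI.
rewrite (_ : _ @^-1` _ = Y @^-1` [set u : H | a < ip g u]); last first.
  by apply/seteqP; split => w /=; rewrite in_itv/= andbT.
by apply: hY; apply: sub_sigma_algebra; exact: open_ip_gt.
Qed.

Lemma wmeas_rv (Y : Omega -> H) : borel_rv Y -> wmeas [set: Omega] Y.
Proof. by move=> hY g; exact: measurable_ip_rv. Qed.

(** The adjoint of <inp, .> out applied to e_k, namely <e_k, out> inp: pairing W with it gives the
    k-th coordinate of the term. *)
Definition toterm (k : nat) (x : step_term R) : sterm R :=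
  ((st_lo x, st_hi x), (cf k (st_out x), st_in x)).

Lemma cf_sfun_toterm (k j : nat) (E : seq (step_term R)) (s : R) :
  cf j (sfun (map (toterm k) E) s) = cf k (step_eval E s (eigf R j)).
Proof.
rewrite /sfun /step_eval big_map !cf_sum; apply: eq_bigr => x _ /=.
by rewrite !cfZ /cf (ipC _ (st_in x)); ring.
Qed.

Lemma sint_toterm (k : nat) (E : seq (step_term R)) (w : Omega) :
  sint W (map (toterm k) E) w = cf k (step_integral W E w).
Proof.
rewrite /sint /step_integral big_map cf_sum; apply: eq_bigr => x _ /=.
by rewrite cfZ mulrC.
Qed.

Lemma parseval_lee (u : H) (S : \bar R) :
  (forall n, (\sum_(1 <= k < n.+1) cf k u ^+ 2)%:E <= S)%E -> ((`|u| ^+ 2)%:E <= S)%E.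
Proof.
move=> h; have hc := cvg_natE (@parseval _ u).
rewrite -(cvg_lim _ hc)//; apply: lime_le; first by apply/cvg_ex; eexists; exact: hc.
exact: nearW.
Qed.

Lemma cf_sqr_le (k : nat) (u : H) : (0 < k)%N -> cf k u ^+ 2 <= `|u| ^+ 2.
Proof.
move=> k0; apply: le_trans (bessel k u).
by rewrite big_nat_recr//= lerDr sumr_ge0// => i _; exact: sqr_ge0.
Qed.

(** One row of an operator is dominated by its Hilbert-Schmidt norm, so the operators approximating
    the integrand yield approximations of the k-th coordinate; the diagonal form of [Phi] makes its
    k-th row a multiple of e_k. *)
Lemma isG_wiener (t : R) (k : nat) (Phi : R -> H -> H) (Y : Omega -> H) (m : R -> R) :
  0 <= t <= T -> (0 < k)%N ->
  is_wiener_integral P W t Phi Y ->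
  measurable_fun [set: TR] m ->
  (forall s u, 0 < s < t -> cf k (Phi s u) = m s * cf k u) ->
  isG P T W (fun s => ((0 < s < t)%R%:R * m s) *: eigf R k) (fun w => cf k (Y w)).
Proof.
move=> /andP[t0 tT] k0 [hY [E [okE mE cE cY]]] mm hm.
have mI : measurable_fun [set: TR] (fun s : R => (0 < s < t)%R%:R : R).
  rewrite (_ : (fun _ => _) = \1_(`]0, t[%classic : set TR)).
    by apply: measurable_indic; exact: measurable_itv.
  by apply/funext => s; rewrite indicE mem_setE in_itv.
have wf : wmeas [set: TR] (fun s => ((0 < s < t)%R%:R * m s) *: eigf R k).
  by apply: wmeasZ; exact: measurable_funM.
split => //; first exact: measurable_ip_rv.
exists (fun n => map (toterm k) (E n)).
have ok n : okterms T (map (toterm k) (E n)).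
  move=> x xE; have [y [<- yE]] := In_map xE; have [h1 h2] := okE n y yE.
  by split => //=; exact: le_trans tT.
split => //.
- have md n : measurable_fun [set: TR]
      (fun s => (`|((0 < s < t)%R%:R * m s) *: eigf R k - sfun (map (toterm k) (E n)) s| ^+ 2)%:E).
    by apply/measurable_EFinP; apply: wmeas_norm2; apply: wmeasB => //; exact: sfun_wmeas.
  apply: (@squeeze_cvge _ _ _ _ (cst 0%E) _ _ _ _ (@cvg_cst _ _ _ _ _) cE).
  apply: nearW => n; apply/andP; split.
    by apply: integral_ge0 => s _; rewrite lee_fin sqr_ge0.
  rewrite [leLHS](_ : _ = \int[leb]_(s in `]0%R, t[)
     (`|((0 < s < t)%R%:R * m s) *: eigf R k - sfun (map (toterm k) (E n)) s| ^+ 2)%:E)%E; last first.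
    rewrite [RHS]integral_mkcond; apply: ae_eq_integral => //.
      by apply/(measurable_restrictT _ _).1; [exact: measurable_itv|apply: measurable_funS (md n)].
    (* The approximating intervals are closed on the right and may contain t, whereas the integral
       runs over the open interval; the point t is null. *)
    exists [set t]; split => //; first exact: lebesgue_measure_set1.
    move=> s /=; apply: contra_notP => st _; rewrite patchE mem_setE in_itv/=.
    have [sI|sI] := boolP ((0 < s < t)%R); first by [].
    rewrite mul0r scale0r sub0r normrN.
    rewrite (_ : sfun _ _ = 0) ?normr0 ?expr0n//.
    rewrite /sfun big_map; move: (okE n); elim: (E n) => [|x r IH] okr; first by rewrite big_nil.
    rewrite big_cons IH ?addr0; last by move=> y yr; apply: okr; right.
    have [/andP[l0 lh] ht] := okr x (or_introl erefl).
    rewrite /= indicE mem_setE in_itv/= (_ : (_ < _ <= _) = false) ?mul0r ?scale0r//.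
    apply/negbTE; apply: contra sI => /andP[h1 h2]; rewrite (le_lt_trans l0 h1)/=.
    by rewrite lt_neqAle (le_trans h2 ht) andbT; apply/eqP.
  apply: ge0_le_integral => //.
  + by apply: measurable_funS (md n).
  + exact: mE.
  + move=> s; rewrite /= in_itv/= => sI; rewrite sI mul1r.
    apply: parseval_lee => N; rewrite /hs2.
    apply: (@le_trans _ _ (\sum_(1 <= j < N.+1) (`|Phi s (eigf R j) - step_eval (E n) s (eigf R j)| ^+ 2)%:E)%E).
      rewrite sumEFin lee_fin big_nat [leRHS]big_nat; apply: ler_sum => j /andP[j0 _].
      apply: le_trans (cf_sqr_le _ k0).
      rewrite !cfB cf_sfun_toterm hm// cfZ /cf eigf_ortho// eigf_ortho//.
      by rewrite eq_sym.
    by apply: nneseries_lim_ge => j _ _; rewrite lee_fin sqr_ge0.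
- have mS n : measurable_fun [set: Omega] (fun w => (cf k (Y w) - sint W (map (toterm k) (E n)) w) ^+ 2).
    apply: measurable_funX; apply: measurable_funB; first exact: measurable_ip_rv.
    exact: measurable_sint hW _ (ok n).
  have mY n : measurable_fun [set: Omega] (fun w => `|Y w - step_integral W (E n) w| ^+ 2).
    apply: wmeas_norm2; apply: wmeasB; first exact: wmeas_rv.
    move=> g; rewrite /step_integral; move: (okE n); elim: (E n) => [|x r IH] okr.
      by under eq_fun do rewrite big_nil ip0r; exact: measurable_cst.
    under eq_fun do rewrite big_cons ipDr ipZr.
    apply: measurable_funD; last by apply: IH => y yr; apply: okr; right.
    have [/andP[l0 lh] ht] := okr x (or_introl erefl).
    apply: measurable_funM => //; apply: measurable_funB; apply: (cyl_measurable hW).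
      by rewrite (le_trans l0 lh) (le_trans ht tT).
    by rewrite l0 (le_trans lh (le_trans ht tT)).
  apply: (@squeeze_cvge _ _ _ _ (cst 0%E) _ _ _ _ (@cvg_cst _ _ _ _ _) cY).
  apply: nearW => n; apply/andP; split; first by apply: int_ge0 => w; exact: sqr_ge0.
  apply: int_le => //; first by move=> w _; exact: sqr_ge0.
  by move=> w _; rewrite sint_toterm -cfB; exact: cf_sqr_le.
Qed.

Lemma cosh_ge (x : R) : x ^+ 2 / 4 <= expR x + expR (- x) - 2.
Proof.
wlog x0 : x / 0 <= x => [hw|].
  have [x0|x0] := leP 0 x; first exact: hw.
  have := hw (- x); rewrite oppr_ge0 ltW// opprK sqrrN => /(_ isT).
  by rewrite [expR (- x) + _]addrC.
pose a := x / 2; have a0 : 0 <= a by rewrite divr_ge0.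
have h1 := expR_ge1Dx a; have p1 : 0 < 1 + a by rewrite ltr_pwDl.
have h2 : expR (- a) <= (1 + a)^-1 by rewrite expRN lef_pV2 ?posrE ?expR_gt0.
have h3 : a <= expR a - expR (- a).
  have : a <= 1 + a - (1 + a)^-1.
    rewrite -subr_ge0 (_ : _ - _ = a / (1 + a)); last by field; rewrite gt_eqF.
    by rewrite divr_ge0// ltW.
  lra.
have e1 : expR x = expR a ^+ 2 by rewrite -expRM_natl; congr expR; rewrite /a; field.
have e2 : expR (- x) = expR (- a) ^+ 2.
  by rewrite -expRM_natl; congr expR; rewrite /a; field.
have e3 : expR a * expR (- a) = 1 by rewrite -expRD subrr expR0.
have -> : expR x + expR (- x) - 2 = (expR a - expR (- a)) ^+ 2.
  by rewrite e1 e2 sqrrB e3; ring.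
have -> : x ^+ 2 / 4 = a ^+ 2 by rewrite /a; field.
by rewrite ler_pXn2r ?nnegrE// (le_trans a0).
Qed.

(** The difference D has integrand 0, so exp D and exp (- D) have mean at most 1, and [cosh_ge]
    gives E[D^2 / 4] <= 0. This takes the place of the Ito isometry for uniqueness. *)
Lemma isG_eq f y1 y2 : isG P T W f y1 -> isG P T W f y2 -> {ae P, forall w, y1 w = y2 w}.
Proof.
move=> h1 h2; have h := isG_lin hW (-1) h1 h2.
have hn := isG_Z hW (-1) h.
have z : (\int[leb]_s (`|-1 *: f s + f s| ^+ 2)%:E <= 0%:E)%E.
  by rewrite integral0_eq// => s _; rewrite scaleN1r addNr normr0 expr0n.
have zn : (\int[leb]_s (`|-1 *: (-1 *: f s + f s)| ^+ 2)%:E <= 0%:E)%E.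
  by rewrite integral0_eq// => s _; rewrite [in X in X *: _]scaleN1r || rewrite (scaleN1r (f s)) addNr scaler0 normr0 expr0n.
have e1 := isG_mgf T0 hW h (lexx 0) z.
have e2 := isG_mgf T0 hW hn (lexx 0) zn.
rewrite mul0r expR0 in e1 e2.
have [my _ _] := h.
pose D w := -1 * y1 w + y2 w.
have mexp (X : Omega -> R) : measurable_fun [set: Omega] X ->
    measurable_fun [set: Omega] (fun w => expR (X w)).
  by move=> mX; exact: (measurableT_comp (@measurable_expR R) mX).
have mD2 : measurable_fun [set: Omega] (fun w => D w ^+ 2 / 4).
  by apply: measurable_funM => //; apply: measurable_funX.
have sq0 w : 0 <= D w ^+ 2 / 4 by rewrite divr_ge0// sqr_ge0.
have I0 : (\int[P]_w (D w ^+ 2 / 4)%:E = 0)%E.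
  apply/eqP; rewrite eq_le int_ge0// andbT.
  have : (\int[P]_w (D w ^+ 2 / 4 + 2)%:E <= \int[P]_w (expR (D w) + expR (-1 * D w))%:E)%E.
    apply: int_le => //.
    - by apply: measurable_funD.
    - by apply: measurable_funD; apply: mexp => //; apply: measurable_funM.
    - by move=> w _; rewrite addr_ge0.
    - by move=> w _; have := cosh_ge (D w); rewrite mulN1r; lra.
  rewrite intD// integral_prob_cst.
  have m1 : measurable_fun [set: Omega] (fun w => expR (D w)) by exact: mexp.
  have m2 : measurable_fun [set: Omega] (fun w => expR (-1 * D w)).
    by apply: mexp; apply: measurable_funM.
  have p1 w : 0 <= expR (D w) by exact: expR_ge0.
  have p2 w : 0 <= expR (-1 * D w) by exact: expR_ge0.
  rewrite (intD _ _ m1 m2 p1 p2)//.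
  move=> /le_trans/(_ (leeD e1 e2)); rewrite -EFinD => hle.
  have : (\int[P]_w (D w ^+ 2 / 4)%:E + 2%:E <= 0 + 2%:E)%E by rewrite add0e (_ : 2%:E = (1 + 1)%:E).
  by rewrite leeD2rE.
have mDE : measurable_fun [set: Omega] (fun w => (D w ^+ 2 / 4)%:E) by exact/measurable_EFinP.
have := (ae_eq_integral_abs P measurableT mDE).1.
under eq_integral do rewrite gee0_abs ?lee_fin//.
move=> /(_ I0); apply: filterS => w /(_ I) /= [] /eqP.
rewrite mulf_eq0 invr_eq0 (_ : 4 == 0 = false) ?orbF ?pnatr_eq0// sqrf_eq0 /D mulN1r.
by rewrite addrC subr_eq0 eq_sym => /eqP.
Qed.

Lemma expr_le_cosh (p : nat) (x : R) : (0 < p)%N ->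
  x ^+ (2 * p) <= (2 * p)%:R ^+ (2 * p) * (expR x + expR (- x)).
Proof.
move=> p0.
wlog x0 : x / 0 <= x => [hw|].
  have [x0|x0] := leP 0 x; first exact: hw.
  have := hw (- x); rewrite oppr_ge0 ltW// opprK => /(_ isT).
  by rewrite [expR (- x) + _]addrC exprM sqrrN -exprM.
pose n := (2 * p)%N; have n0 : (0 < n)%N by rewrite muln_gt0.
have nR : 0 < n%:R :> R by rewrite ltr0n.
have h : x / n%:R <= expR (x / n%:R) by apply: le_trans (expR_ge1Dx _); rewrite lerDr.
have h2 : (x / n%:R) ^+ n <= expR x.
  have -> : expR x = expR (x / n%:R) ^+ n.
    by rewrite -expRM_natl; congr expR; field; rewrite gt_eqF.
  by rewrite ler_pXn2r ?nnegrE ?expR_ge0// divr_ge0// ltW.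
have -> : x ^+ n = n%:R ^+ n * (x / n%:R) ^+ n.
  by rewrite -exprMn mulrCA divff ?mulr1// gt_eqF.
rewrite ler_wpM2l ?exprn_ge0 ?(ltW nR)//.
by apply: le_trans h2 _; rewrite lerDl expR_ge0.
Qed.

Definition momC (p : nat) : R := (2 * p)%:R ^+ (2 * p) * (2 * expR (1 / 2)).

Lemma momC_ge0 p : 0 <= momC p.
Proof. by rewrite mulr_ge0 ?exprn_ge0 ?mulr_ge0 ?expR_ge0. Qed.

(** y / sqrt q and its negative have exponential moments at most exp (1/2), and [expr_le_cosh] turns
    these into powers. The crude constant is harmless, since only the power q^p matters later. *)
Lemma isG_moment f y (q : R) (p : nat) : isG P T W f y -> 0 < q -> (0 < p)%N ->
  (\int[leb]_s (`|f s| ^+ 2)%:E <= q%:E)%E ->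
  (\int[P]_w (y w ^+ (2 * p))%:E <= (momC p * q ^+ p)%:E)%E.
Proof.
move=> h q0 p0 hq; pose r := Num.sqrt q.
have r0 : 0 < r by rewrite sqrtr_gt0.
have r2 : r ^+ 2 = q by rewrite sqr_sqrtr// ltW.
have [my wf _] := h.
have one (b : R) : b ^+ 2 = 1 -> (\int[P]_w (expR (b * (y w / r)))%:E <= (expR (1 / 2))%:E)%E.
  move=> b2; have hh := isG_Z hW (b / r) h.
  rewrite (_ : (fun w => _ * y w) = (fun w => b * (y w / r))) in hh; last first.
    by apply/funext => w; rewrite mulrA mulrAC.
  have := isG_mgf T0 hW hh ler01.
  apply.
  have br : 0 <= (b / r) ^+ 2 by exact: sqr_ge0.
  rewrite (@eq_integral _ _ _ leb setT (fun s => ((b / r) ^+ 2 * `|f s| ^+ 2)%:E)); last first.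
    by move=> s _; rewrite normrZ exprMn real_normK ?num_real.
  rewrite intZ//; last exact: wmeas_norm2.
  apply: (@le_trans _ _ (((b / r) ^+ 2)%:E * q%:E)%E); first exact: lee_wpmul2l.
  by rewrite -EFinM lee_fin exprMn b2 mul1r exprVn r2 mulVf// gt_eqF.
have mexp (b : R) : measurable_fun [set: Omega] (fun w => expR (b * (y w / r))).
  apply: (measurableT_comp (@measurable_expR R)); apply: measurable_funM => //.
  exact: measurable_funM.
have c0 : 0 <= (2 * p)%:R ^+ (2 * p) * q ^+ p :> R.
  by rewrite mulr_ge0 ?exprn_ge0// ltW.
apply: (@le_trans _ _ (\int[P]_w ((2 * p)%:R ^+ (2 * p) * q ^+ p *
   (expR (1 * (y w / r)) + expR (-1 * (y w / r))))%:E)%E).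
  apply: int_le => //.
  - exact: measurable_funX.
  - by apply: measurable_funM => //; apply: measurable_funD.
  - by move=> w _; rewrite exprM exprn_ge0// sqr_ge0.
  - move=> w _; rewrite mul1r mulN1r mulrAC.
    have -> : y w ^+ (2 * p) = (y w / r) ^+ (2 * p) * q ^+ p.
      by rewrite -r2 -exprM -exprMn divfK// gt_eqF.
    by rewrite ler_wpM2r ?exprn_ge0 ?(ltW q0)//; exact: expr_le_cosh.
rewrite intZ//; last exact: measurable_funD.
have m1 := mexp 1; have m2 := mexp (-1).
have p1 w : 0 <= expR (1 * (y w / r)) by exact: expR_ge0.
have p2 w : 0 <= expR (-1 * (y w / r)) by exact: expR_ge0.
rewrite (intD _ _ m1 m2 p1 p2)//.
have -> : (momC p * q ^+ p)%:E =
   (((2 * p)%:R ^+ (2 * p) * q ^+ p)%:E * ((expR (1 / 2))%:E + (expR (1 / 2))%:E))%E.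
  by rewrite -EFinD -EFinM /momC; congr EFin; ring.
apply: lee_wpmul2l; first by rewrite lee_fin.
by apply: leeD; apply: one; rewrite ?expr1n// sqrrN expr1n.
Qed.

End WienerIntegralGaussian.

(** * Pathwise convergence of the scheme *)

Section Convolution.
Variable R : realType.
Local Notation H := (L2_01 R).
Local Notation leb := (@lebesgue_measure R).
Local Notation TR := (measurableTypeR R).
Variables (c alpha : R) (c0 : 0 < c) (ha : 0 <= alpha <= 1 / 2).
Variables (V : completeNormedModType R) (iota : {linear H -> V}).
Hypothesis hV : is_Hcompletion c (- alpha) iota.
Local Notation L := (lam c).
Local Notation ext t := (extend iota (expA c t)).

Lemma powR_mulN (x a : R) : 0 < x -> x `^ a * x `^ (- a) = 1.
Proof. by move=> x0; rewrite powRN divff// gt_eqF// powR_gt0. Qed.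

(** The norm of a diagonal operator from $H_{-\alpha}$ to H is governed by lam^alpha |m|, as the
    weights lam^(-alpha) in the norm of v have to be undone. *)
Lemma mult_co_le (u : H) (v : V) (m : nat -> R) (C : R) : 0 <= C ->
  (forall k, (0 < k)%N -> cf k u = m k * co iota k v) ->
  (forall k, (0 < k)%N -> L k `^ alpha * `|m k| <= C) -> `|u| <= C * `|v|.
Proof.
move=> C0 um mC; apply: norm_le_cf; first by rewrite mulr_ge0.
move=> n; rewrite exprMn.
apply: (le_trans _ (ler_wpM2l (sqr_ge0 C) (co_bessel c0 ha hV n v))).
rewrite mulr_sumr big_nat [leRHS]big_nat; apply: ler_sum => k /andP[k0 _].
have E : m k * co iota k v = L k `^ alpha * m k * (L k `^ (- alpha) * co iota k v).
  by rewrite mulrACA [_ * L k `^ _](powR_mulN _ (lam_gt0 c0 k0)) mul1r.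
rewrite (um k k0) E exprMn ler_wpM2r ?sqr_ge0//.
rewrite -[leLHS]real_normK ?num_real// ler_pXn2r ?nnegrE//.
by rewrite normrM ger0_norm ?powR_ge0// mC.
Qed.

Lemma extend_expA_le (t : R) (v : V) : 0 < t -> `|ext t v| <= t `^ (- alpha) * `|v|.
Proof.
have /andP[a0 a1] := ha.
move=> t0; apply: (mult_co_le (m := fun k => expR (- (t * L k)))).
- exact: powR_ge0.
- by move=> k k0; rewrite (cf_extend_expA c0 ha hV v k0 t0).
- move=> k k0; rewrite ger0_norm ?expR_ge0//; apply: powR_expRN_le => //.
  + by rewrite a0/=; lra.
  + exact: lam_ge0.
Qed.

Lemma extend_expAB (t : R) (v w : V) : 0 < t -> ext t (v - w) = ext t v - ext t w.
Proof.
move=> t0; apply: cf_inj => k k0.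
rewrite (cfB k (ext t v) (ext t w)) (cf_extend_expA c0 ha hV v k0 t0).
rewrite (cf_extend_expA c0 ha hV w k0 t0) (cf_extend_expA c0 ha hV _ k0 t0).
by rewrite (coB c0 ha hV v w k0) mulrBr.
Qed.

(** A Lipschitz constant in time of the semigroup from $H_{-\alpha}$ to H: exp (- t lam) is split
    into two halves, one absorbing the factor lam of the time derivative and the other lam^alpha. *)
Definition lipK (t : R) : R := (t / 2) `^ (- 1) * (t / 2) `^ (- alpha).

Lemma extend_expA_lip (t t' : R) (v : V) : 0 < t' -> t' <= t ->
  `|ext t v - ext t' v| <= (t - t') * lipK t' * `|v|.
Proof.
have /andP[a0 a1] := ha.
move=> t'0 tt'; have t0 : 0 < t by exact: lt_le_trans tt'.
have h2 : 0 < t' / 2 by rewrite divr_gt0.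
apply: (mult_co_le (m := fun k => expR (- (t * L k)) - expR (- (t' * L k)))).
- by rewrite !mulr_ge0 ?powR_ge0// subr_ge0.
- move=> k k0; rewrite (cfB k (ext t v) (ext t' v)) mulrBl.
  by congr (_ - _); [exact: (cf_extend_expA c0 ha hV v k0 t0)|exact: (cf_extend_expA c0 ha hV v k0 t'0)].
- move=> k k0; have L0 := lam_ge0 c0 k.
  have h1 : `|expR (- (t * L k)) - expR (- (t' * L k))| <= (t - t') * (L k * expR (- (t' * L k))).
    have -> : expR (- (t * L k)) = expR (- (t' * L k)) * expR (- ((t - t') * L k)).
      by rewrite -expRD; congr expR; ring.
    have := expR_ge1Dx (- ((t - t') * L k)).
    have : expR (- ((t - t') * L k)) <= 1.
      by rewrite -expR0 ler_expR oppr_le0 mulr_ge0// subr_ge0.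
    move: (expR (- ((t - t') * L k))) (expR_ge0 (- (t' * L k))) => y.
    move: (expR (- (t' * L k))) => z z0 y1 yx.
    rewrite -[X in _ - X]mulr1 -mulrBr normrM (ger0_norm z0) distrC ger0_norm; last by rewrite subr_ge0.
    have : z * (1 - y) <= z * ((t - t') * L k) by rewrite ler_wpM2l//; lra.
    by move=> /le_trans; apply; rewrite mulrCA [z * _]mulrC.
  apply: (le_trans (ler_wpM2l (powR_ge0 _ _) h1)).
  have -> : L k `^ alpha * ((t - t') * (L k * expR (- (t' * L k)))) =
     (t - t') * ((L k `^ 1 * expR (- (t' / 2 * L k))) * (L k `^ alpha * expR (- (t' / 2 * L k)))).
    have -> : expR (- (t' * L k)) = expR (- (t' / 2 * L k)) * expR (- (t' / 2 * L k)).
      by rewrite -expRD; congr expR; field.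
    rewrite powRr1//; ring.
  rewrite ler_wpM2l ?subr_ge0//; apply: ler_pM.
  + by rewrite mulr_ge0 ?powR_ge0 ?expR_ge0.
  + by rewrite mulr_ge0 ?powR_ge0 ?expR_ge0.
  + by apply: powR_expRN_le => //; rewrite ler01 lexx.
  + by apply: powR_expRN_le => //; rewrite a0/=; lra.
Qed.

Section integrand.
Variables (t M : R) (G : R -> V).
Hypothesis t0 : 0 < t.
Hypothesis Grc : forall s, 0 < s < t -> forall eps : R, 0 < eps ->
  exists2 delta : R, 0 < delta &
    forall r, s <= r < s + delta -> r < t -> `|G r - G s| < eps.
Hypothesis GM : forall s, 0 < s < t -> `|G s| <= M.
Local Notation D := (`]0%R, t[%classic : set TR).
Local Notation f := (fun s : R => ext (t - s) (G s)).

Lemma conv_bound s : 0 < s < t -> `|f s| <= M * (t - s) `^ (- alpha).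
Proof.
move=> /[dup] h /andP[s0 st]; have ts : 0 < t - s by rewrite subr_gt0.
by apply: (le_trans (extend_expA_le _ ts)); rewrite mulrC ler_wpM2r ?powR_ge0// GM.
Qed.

Lemma lipK_anti (b x : R) : 0 < b -> b <= x -> lipK x <= lipK b.
Proof.
have /andP[a0 a1] := ha; move=> b0 bx.
have x0 : 0 < x by exact: lt_le_trans bx.
have anti (a : R) : 0 <= a -> (x / 2) `^ (- a) <= (b / 2) `^ (- a).
  move=> a'0; rewrite !powRN lef_pV2 ?posrE ?powR_gt0 ?divr_gt0//.
  by rewrite ge0_ler_powR ?nnegrE ?divr_ge0 ?(ltW b0) ?(ltW x0)// ler_wpM2r.
by apply: ler_pM; rewrite ?powR_ge0// anti.
Qed.

Lemma conv_rc s : 0 < s < t -> forall eps : R, 0 < eps ->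
  exists2 delta : R, 0 < delta &
    forall r, s <= r < s + delta -> r < t -> `|f r - f s| < eps.
Proof.
have /andP[a0 a1] := ha.
(* Below the midpoint between s and t the distance t - r stays at least [b], away from the
   singularity of the semigroup at time 0. *)
move=> /[dup] hs /andP[s0 st] eps e0; pose b := (t - s) / 2.
have b0 : 0 < b by rewrite divr_gt0// subr_gt0.
have p0 : 0 < b `^ (- alpha) by rewrite powR_gt0.
have e1 : 0 < eps / 2 / b `^ (- alpha) by rewrite !divr_gt0.
have [d1 d10 h1] := Grc hs e1.
have K0 : 0 <= lipK b by rewrite mulr_ge0 ?powR_ge0.
have K1 : 0 < lipK b * `|G s| + 1 by apply: ltr_wpDl => //; apply: mulr_ge0.
pose d2 := eps / 2 / (lipK b * `|G s| + 1).
have d20 : 0 < d2 by rewrite !divr_gt0.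
exists (Num.min d1 (Num.min d2 b)); first by rewrite !lt_min d10 d20 b0.
move=> r /andP[sr rd] rt.
have rd1 : r < s + d1 by apply: (lt_le_trans rd); rewrite lerD2l ge_min lexx.
have rd2 : r - s < d2 by rewrite ltrBlDl; apply: (lt_le_trans rd); rewrite lerD2l !ge_min lexx orbT.
have rb : b <= t - r.
  have : r < s + b by apply: (lt_le_trans rd); rewrite lerD2l !ge_min lexx !orbT.
  by rewrite /b; lra.
have tr : 0 < t - r by exact: lt_le_trans rb.
have -> : ext (t - r) (G r) - ext (t - s) (G s) =
    ext (t - r) (G r - G s) - (ext (t - s) (G s) - ext (t - r) (G s)).
  by rewrite extend_expAB// opprB addrA subrK.
apply: (le_lt_trans (ler_normB _ _)).
have A : `|ext (t - r) (G r - G s)| <= eps / 2.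
  apply: (le_trans (extend_expA_le _ tr)).
  have h3 : (t - r) `^ (- alpha) <= b `^ (- alpha).
    rewrite !powRN lef_pV2 ?posrE ?powR_gt0//.
    by rewrite ge0_ler_powR ?nnegrE ?(ltW b0) ?(ltW tr).
  apply: (le_trans (ler_wpM2r (normr_ge0 _) h3)).
  rewrite mulrC -ler_pdivlMr//; apply: ltW; apply: h1 => //.
  by rewrite sr.
have B : `|ext (t - s) (G s) - ext (t - r) (G s)| < eps / 2.
  apply: (@le_lt_trans _ _ ((r - s) * (lipK b * `|G s| + 1))).
    have le1 : t - r <= t - s by lra.
    apply: (le_trans (extend_expA_lip _ tr le1)).
    have -> : t - s - (t - r) = r - s by ring.
    rewrite -mulrA ler_wpM2l ?subr_ge0//.
    apply: (@le_trans _ _ (lipK b * `|G s|)); last by rewrite lerDl.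
    by rewrite ler_wpM2r// lipK_anti.
  by rewrite -ltr_pdivlMr.
lra.
Qed.

Let a01 : 0 <= alpha < 1. Proof. by have /andP[a0 a1] := ha; rewrite a0/=; lra. Qed.

Lemma conv_coef_eq k : (0 < k)%N -> {in D, forall s,
  cf k (f s) = expR (- ((t - s) * L k)) * co iota k (G s)}.
Proof.
move=> k0 s; rewrite inE/= in_itv/= => /andP[_ st].
by rewrite (cf_extend_expA c0 ha hV) ?subr_gt0.
Qed.

Lemma ip_conv g : ip g (bochner_integral leb D f) = \int[leb]_(s in D) ip g (f s).
Proof. exact: (ip_bochner t0 a01 conv_rc conv_bound). Qed.

Lemma ip_conv_integrable g : leb.-integrable D (EFin \o (fun s => ip g (f s))).
Proof. exact: (ip_bochner_integrable t0 a01 conv_rc conv_bound). Qed.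

Lemma cf_conv k : (0 < k)%N -> cf k (bochner_integral leb D f) =
  \int[leb]_(s in D) (expR (- ((t - s) * L k)) * co iota k (G s)).
Proof. by move=> k0; rewrite /cf ip_conv; apply: eq_Rintegral; exact: conv_coef_eq. Qed.

Lemma conv_coef_integrable k : (0 < k)%N ->
  leb.-integrable D (EFin \o (fun s => expR (- ((t - s) * L k)) * co iota k (G s))).
Proof.
move=> k0; have mD : measurable D by exact: measurable_itv.
have hI := ip_conv_integrable (eigf R k).
move: hI; apply: eq_integrable => //.
by move=> s sD /=; rewrite -(conv_coef_eq k0 sD).
Qed.

Lemma cf_conv_Pproj n k : (0 < k)%N ->
  cf k (bochner_integral leb D (fun s => Pproj n (f s))) =
  (k <= n)%N%:R * \int[leb]_(s in D) (expR (- ((t - s) * L k)) * co iota k (G s)).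
Proof.
move=> k0.
have Ple (u : H) : `|Pproj n u| <= `|u|.
  rewrite -(@ler_pXn2r _ 2)// ?nnegrE// norm_Pproj; exact: bessel.
have rc s : 0 < s < t -> forall eps : R, 0 < eps ->
  exists2 delta : R, 0 < delta &
    forall r, s <= r < s + delta -> r < t -> `|Pproj n (f r) - Pproj n (f s)| < eps.
  move=> hs eps e0; have [d d0 hd] := conv_rc hs e0; exists d => // r h1 h2.
  by rewrite -PprojB; apply: (le_lt_trans (Ple _)); exact: hd.
have bd s : 0 < s < t -> `|Pproj n (f s)| <= M * (t - s) `^ (- alpha).
  by move=> hs; apply: (le_trans (Ple _)); exact: conv_bound.
rewrite {1}/cf (ip_bochner t0 a01 rc bd).
have mD : measurable D by exact: measurable_itv.
rewrite -(RintegralZl _ mD (conv_coef_integrable k0)).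
apply: eq_Rintegral => s sD.
by rewrite -(conv_coef_eq k0 sD) -(cf_Pproj n (f s) k0).
Qed.

End integrand.

(** The integral is a chosen value, so even over an empty interval uniqueness has to be shown: every
    admissible piece is empty. *)
Lemma bochner_integral_set0 (f : R -> H) :
  bochner_integral leb (`]0%R, 0%R[%classic : set TR) f = 0.
Proof.
have E : (`]0%R, 0%R[%classic : set TR) = set0 by rewrite set_itvoo0.
rewrite E /bochner_integral; apply/get_unique.
  exists (fun=> [::]); split.
  - by move=> n i [].
  - by move=> n; exact: measurable_fun_set0.
  - by under eq_fun do rewrite integral_set0; exact: cvg_cst.
  - by under eq_fun do rewrite /simple_integral big_nil; exact: cvg_cst.
move=> y [s [ok _ _ hy]].
apply: (cvg_unique _ hy) => //.
rewrite (_ : (fun n => _) = (fun=> 0)); first exact: cvg_cst.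
apply/funext => n; rewrite /simple_integral; move: (ok n).
elim: (s n) => [|x r IH] okr; first by rewrite big_nil.
rewrite big_cons IH ?addr0; last by move=> i ir; apply: okr; right.
have [_ x0 _] := okr x (or_introl erefl).
by rewrite (_ : x.1 = set0) ?measure0 ?scale0r//; by apply/seteqP; split => // z /x0.
Qed.

End Convolution.

(** * Uniform continuity of paths *)

Section UniformContinuity.
Variables (R : realType) (E : normedModType R) (T : R) (g : R -> E).
Hypothesis T0 : 0 < T.
Hypothesis gc : forall t : R, 0 <= t <= T -> forall eps : R, 0 < eps ->
  exists2 delta : R, 0 < delta &
    forall s : R, 0 <= s <= T -> `|s - t| < delta -> `|g s - g t| < eps.

(** Heine-Cantor for continuity stated by epsilon and delta on [0, T]: the supremum of the x for
    which uniformity holds on [0, x] must be T, since continuity at the supremum carries uniformity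
    beyond it. *)
Lemma path_unif (eps : R) : 0 < eps -> exists2 delta : R, 0 < delta &
  forall s r : R, 0 <= s <= T -> 0 <= r <= T -> `|s - r| < delta -> `|g s - g r| < eps.
Proof.
move=> e0.
pose good x := exists2 delta : R, 0 < delta & forall s r : R, 0 <= s <= x -> 0 <= r <= x ->
  `|s - r| < delta -> `|g s - g r| < eps.
pose S := [set x : R | 0 <= x <= T /\ good x].
have S0 : S 0.
  split; first by rewrite lexx ltW.
  exists 1 => // s r; rewrite -!eq_le => /eqP <- /eqP <- _.
  by rewrite subrr normr0.
have Sub : ubound S T by move=> x [/andP[]].
have hs : has_sup S by split; [exists 0|exists T].
pose m := sup S.
have mT : m <= T by apply: ge_sup => //; exists 0.
have m0 : 0 <= m by apply: ub_le_sup => //; exists T.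
have e2 : 0 < eps / 2 by rewrite divr_gt0.
have [d0 d00 hd] : exists2 delta : R, 0 < delta &
    forall s : R, 0 <= s <= T -> `|s - m| < delta -> `|g s - g m| < eps / 2.
  by apply: gc => //; rewrite m0.
have d2 : 0 < d0 / 2 by rewrite divr_gt0.
have [x [/andP[x0 xT] [dx dx0 hx]] mx] := sup_adherent d2 hs.
rewrite -/m in mx.
pose y := Num.min T (m + d0 / 2).
have yT : y <= T by rewrite /y ge_min lexx.
have ym : y <= m + d0 / 2 by rewrite /y ge_min lexx orbT.
have y0 : 0 <= y by rewrite /y le_min (ltW T0) addr_ge0// ltW.
have gy : good y.
  exists (Num.min dx (d0 / 2)); first by rewrite lt_min dx0.
  move=> s r /andP[s0 sy] /andP[r0 ry]; rewrite lt_min => /andP[sr1].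
  rewrite ltr_norml => /andP[sr2 sr3].
  have far : m - d0 < s -> m - d0 < r -> `|g s - g r| < eps.
    move=> ms mr.
    have h1 : `|g s - g m| < eps / 2.
      by apply: hd; [rewrite s0/=; lra|rewrite ltr_norml; lra].
    have h2 : `|g r - g m| < eps / 2.
      by apply: hd; [rewrite r0/=; lra|rewrite ltr_norml; lra].
    rewrite distrC in h2; apply: (le_lt_trans (ler_distD (g m) _ _)); lra.
  have [sx|sx] := leP s x; last by apply: far; lra.
  have [rx|rx] := leP r x; last by apply: far; lra.
    by apply: hx => //; rewrite ?s0 ?r0.
have Sy : S y by split => //; rewrite y0.
have ylem : y <= m by apply: ub_le_sup => //; exists T.
have yE : y = T.
  move: ylem; rewrite /y; case: (leP T (m + d0 / 2)) => //; lra.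
by move: gy; rewrite yE.
Qed.

Lemma path_bounded : exists M : R, forall s, 0 <= s <= T -> `|g s| <= M.
Proof.
have [d d0 hd] := path_unif ltr01.
have d2 : 0 < d / 2 by rewrite divr_gt0.
have step n : forall s, 0 <= s <= T -> s < n%:R * (d / 2) -> `|g s| <= `|g 0| + n%:R.
  elim: n => [|n IH] s /andP[s0 sT] sn; first by rewrite mul0r in sn; lra.
  have [hsd|hsd] := leP (d / 2) s.
    have h1 : `|g (s - d / 2)| <= `|g 0| + n%:R.
      by apply: IH; [lra|rewrite -natr1 mulrDl mul1r in sn; lra].
    have h2 : `|g s - g (s - d / 2)| < 1.
      apply: hd; [by rewrite s0|lra|].
      by rewrite opprB addrC subrK ger0_norm; lra.
    have h3 : `|g s| <= `|g (s - d / 2)| + `|g s - g (s - d / 2)|.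
      by rewrite -[X in `|X| <= _](subrK (g (s - d / 2))) addrC ler_normD.
    by rewrite -natr1; lra.
  have h2 : `|g s - g 0| < 1.
    apply: hd; [by rewrite s0|by rewrite lexx ltW|].
    by rewrite subr0 ger0_norm//; lra.
  have h3 : `|g s| <= `|g 0| + `|g s - g 0|.
    by rewrite -[X in `|X| <= _](subrK (g 0)) addrC ler_normD.
  by rewrite -natr1; have := ler0n R n; lra.
exists (`|g 0| + (Num.truncn (T / (d / 2))).+1%:R) => s /[dup] hs /andP[s0 sT].
apply: step => //; apply: (le_lt_trans sT).
by rewrite -ltr_pdivrMr// truncnS_gt.
Qed.

End UniformContinuity.

(** * The scale of spaces $H_r$ *)

Section Scale.
Variable R : realType.
Local Notation H := (L2_01 R).
Variables (c : R) (c0 : 0 < c).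
Local Notation L := (lam c).
Implicit Types (u v w : H) (r s : R).

Lemma le_of_sqr (x y : R) : 0 <= y -> x ^+ 2 <= y ^+ 2 -> x <= y.
Proof. by move=> y0 h; rewrite leNgt; apply/negP => yx; nra. Qed.

Lemma norm_Pproj_le n u : `|Pproj n u| <= `|u|.
Proof. by apply: le_of_sqr => //; rewrite norm_Pproj; exact: bessel. Qed.

Lemma powA_cut r n u : Hdom c r u -> powA c r (Pproj n u) = Pproj n (powA c r u).
Proof.
move=> hu; apply: cf_inj => k k0.
rewrite (cf_powA k0 (Hdom_Pproj c r n u)) (cf_Pproj _ _ k0) (cf_Pproj _ _ k0).
by rewrite (cf_powA k0 hu) mulrCA.
Qed.

Lemma Hnorm_Pproj_le r n u : Hdom c r u -> Hnorm c r (Pproj n u) <= Hnorm c r u.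
Proof.
by move=> hu; rewrite /Hnorm (powA_cut n hu); exact: norm_Pproj_le.
Qed.

Lemma Hnorm_sub_proj r n u : Hdom c r u ->
  Hnorm c r (Pproj n u - u) = `|Pproj n (powA c r u) - powA c r u|.
Proof.
move=> hu; rewrite /Hnorm (powAB (Hdom_Pproj c r n u) hu).
by rewrite (powA_cut n hu).
Qed.

Lemma Hnorm_le_add r u v : Hdom c r u -> Hdom c r v ->
  Hnorm c r u <= Hnorm c r v + Hnorm c r (u - v).
Proof.
move=> hu hv; rewrite /Hnorm (powAB hu hv).
by rewrite -[X in `|X| <= _](subrK (powA c r v)) addrC ler_normD.
Qed.

Lemma Hnorm_distD r u v w : Hdom c r u -> Hdom c r v -> Hdom c r w ->
  Hnorm c r (u - w) <= Hnorm c r (u - v) + Hnorm c r (v - w).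
Proof. by move=> hu hv hw; rewrite /Hnorm (powAB hu hw) (powAB hu hv) (powAB hv hw) ler_distD. Qed.

Lemma Hnorm_distC r u v : Hdom c r u -> Hdom c r v ->
  Hnorm c r (u - v) = Hnorm c r (v - u).
Proof. move=> hu hv.
transitivity `|powA c r u - powA c r v|; first exact: (congr1 Num.norm (powAB hu hv)).
by rewrite distrC; exact: (congr1 Num.norm (esym (powAB hv hu))). Qed.

(** Without modes below m only eigenvalues at least lam m occur, and lam^(r - s) is nonincreasing in
    lam. The case [m = 1] gives the embeddings and [m = n.+1] the truncation error. *)
Lemma Hnorm_high r s m u : r <= s -> (0 < m)%N -> Hdom c s u ->
  (forall k, (0 < k < m)%N -> cf k u = 0) ->
  Hdom c r u /\ Hnorm c r u <= L m `^ (r - s) * Hnorm c s u.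
Proof.
move=> rs m0 hu um; apply: Hnorm_le; first by rewrite mulr_ge0 ?powR_ge0 ?Hnorm_ge0.
move=> n; rewrite exprMn.
apply: (le_trans _ (ler_wpM2l (sqr_ge0 _) (Hnorm_bessel n hu))).
rewrite mulr_sumr big_nat [leRHS]big_nat; apply: ler_sum => k /andP[k0 _].
have [km|mk] := ltnP k m; first by rewrite um ?k0// !mulr0 expr0n mulr0.
have E : L k `^ r = L k `^ (r - s) * L k `^ s.
  by rewrite -powRD ?subrK// (gt_eqF (lam_gt0 c0 k0)) implybT.
rewrite E -exprMn -[leLHS]real_normK ?num_real// -[leRHS]real_normK ?num_real//.
rewrite -(mulrA (L k `^ (r - s))) !(normrM _ (L k `^ s * cf k u)).
apply: lerXn2r; rewrite ?nnegrE ?mulr_ge0//; apply: ler_wpM2r => //.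
rewrite !ger0_norm ?powR_ge0// -(opprB s r) !powRN lef_pV2 ?posrE ?powR_gt0 ?lam_gt0//.
by apply: ge0_ler_powR; rewrite ?nnegrE ?lam_ge0 ?subr_ge0// le_lam.
Qed.

Lemma Hnorm_mono r s u : r <= s -> Hdom c s u ->
  Hdom c r u /\ Hnorm c r u <= L 1 `^ (r - s) * Hnorm c s u.
Proof. by move=> rs hu; apply: Hnorm_high => // k; case: k => [|[]]. Qed.

Lemma Hnorm_tail r s n u : r <= s -> Hdom c s u ->
  Hdom c r (u - Pproj n u) /\ Hnorm c r (u - Pproj n u) <= L n.+1 `^ (r - s) * Hnorm c s u.
Proof.
move=> rs hu; have hd := HdomB hu (Hdom_Pproj c s n u).
have [h1 h2] : Hdom c r (u - Pproj n u) /\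
    Hnorm c r (u - Pproj n u) <= L n.+1 `^ (r - s) * Hnorm c s (u - Pproj n u).
  apply: Hnorm_high => // k /andP[k0]; rewrite ltnS => kn.
  by rewrite (cfB k u (Pproj n u)) (cf_Pproj _ _ k0) kn mul1r subrr.
split; first exact: h1.
apply: (le_trans h2); apply: (ler_wpM2l (powR_ge0 _ _)).
rewrite (Hnorm_distC hu (Hdom_Pproj c s n u)) (Hnorm_sub_proj n hu).
apply: le_of_sqr; first exact: Hnorm_ge0.
rewrite /Hnorm.
set w := powA c s u; rewrite distrC normB_sqr norm_Pproj.
have -> : ip w (Pproj n w) = \sum_(1 <= k < n.+1) cf k w ^+ 2.
  by rewrite ipC PprojE ip_fsum; apply: eq_bigr => k _; rewrite expr2.
set z := \sum_(_ <= _ < _) _.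
have : 0 <= z by apply: sumr_ge0 => i _; exact: sqr_ge0.
by move: z (`|w| ^+ 2) => {h1 h2} z q z0; lra.
Qed.

Section Lipschitz.
Variables (V : completeNormedModType R) (F : H -> V).
Variables (rho varrho theta vartheta : R).
Hypothesis rhole : rho <= varrho.
Hypothesis theta0 : 0 < theta.
Hypothesis vt0 : 0 < vartheta.
Hypothesis hF : Hcontinuous c varrho F.
Hypothesis hlip : forall n, (0 < n)%N -> forall v w : L2_01 R,
  range (@Pproj R n) v -> range (@Pproj R n) w ->
  `|F v - F w| <= theta *
    (1 + Hnorm c rho v `^ vartheta + Hnorm c rho w `^ vartheta) *
    Hnorm c rho (v - w).

Lemma F_cvg u : Hdom c varrho u -> F (Pproj n u) @[n --> \oo] --> F u.
Proof.
move=> hu; apply/cvgrPdist_lt => e e0.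
have [d d0 hd] := hF hu e0.
have := @parseval_cvg _ (powA c varrho u).
move=> /cvgrPdist_lt/(_ d d0); apply: filterS => n hn.
rewrite distrC; apply: hd; first exact: Hdom_Pproj.
by rewrite (Hnorm_sub_proj n hu) distrC.
Qed.

(** The bound is assumed on the ranges of the projections only. The left side passes to the limit by
    continuity of F on $H_\varrho$, and on the right projecting decreases the norms. *)
Lemma F_lip u v : Hdom c varrho u -> Hdom c varrho v ->
  `|F u - F v| <= theta *
    (1 + Hnorm c rho u `^ vartheta + Hnorm c rho v `^ vartheta) * Hnorm c rho (u - v).
Proof.
move=> hu hv; have [hu' _] := Hnorm_mono rhole hu; have [hv' _] := Hnorm_mono rhole hv.
have hc : `|F (Pproj n.+1 u) - F (Pproj n.+1 v)| @[n --> \oo] --> `|F u - F v|.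
  apply: cvg_norm; apply: cvgB.
    by have := F_cvg hu; rewrite -cvg_shiftS.
  by have := F_cvg hv; rewrite -cvg_shiftS.
apply: (cvg_nat_le hc) => n; apply: (le_trans (hlip (ltn0Sn n) _ _)).
- by exists u.
- by exists v.
have pw x : Hdom c rho x -> Hnorm c rho (Pproj n.+1 x) `^ vartheta <= Hnorm c rho x `^ vartheta.
  by move=> hx; apply: (ge0_ler_powR (ltW vt0)) (Hnorm_Pproj_le n.+1 hx); exact: Hnorm_ge0.
have p1 x : 0 <= Hnorm c rho x `^ vartheta by exact: powR_ge0.
apply: ler_pM.
- by rewrite mulr_ge0 ?(ltW theta0)// !addr_ge0.
- exact: Hnorm_ge0.
- apply: (ler_wpM2l (ltW theta0)).
  by apply: lerD (pw _ hv'); apply: lerD (pw _ hu').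
- by rewrite -PprojB; exact: Hnorm_Pproj_le (HdomB hu' hv').
Qed.

End Lipschitz.
End Scale.

(** * Convolution estimates in $H_\varrho$ and the time grid *)

Section Pathwise.
Variable R : realType.
Local Notation H := (L2_01 R).
Local Notation leb := (@lebesgue_measure R).
Local Notation TR := (measurableTypeR R).
Variables (c alpha : R) (c0 : 0 < c) (ha : 0 <= alpha <= 1 / 2).
Variables (V : completeNormedModType R) (iota : {linear H -> V}).
Hypothesis hV : is_Hcompletion c (- alpha) iota.
Variables (rho varrho theta vartheta : R).
Hypothesis hrho : 0 <= rho < varrho.
Hypothesis hvarrho : varrho < 1 / 4.
Local Notation L := (lam c).
Local Notation ext t := (extend iota (expA c t)).
Local Notation N := (Hnorm c varrho).
Local Notation kap := (alpha + varrho).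

Section convolution_norm.
Variables (t M a1 a2 : R) (G : R -> V).
Hypothesis t0 : 0 < t.
Hypothesis a10 : 0 <= a1.
Hypothesis a20 : 0 <= a2.
Hypothesis Grc : forall s, 0 < s < t -> forall eps : R, 0 < eps ->
  exists2 delta : R, 0 < delta &
    forall r, s <= r < s + delta -> r < t -> `|G r - G s| < eps.
Hypothesis GM : forall s, 0 < s < t -> `|G s| <= M.
Hypothesis Ga : forall s, 0 < s < t -> (t - s) `^ (- kap) * `|G s| <=
  a1 * (t - s) `^ (- kap) + a2 * (t - s) `^ (- (kap + 1 / 8)).
Local Notation D := (`]0%R, t[%classic : set TR).
Local Notation f := (fun s : R => ext (t - s) (G s)).

(** By duality: the squared norm is <u, B> with u in the range of P_n, and the pairing commutes with
    the integral, so the smoothing of lam^(alpha + varrho) acts under it. The coefficients [a1] and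
    [a2] separate a constant part of the integrand from one carrying the extra singularity of the
    exponential weight. *)
Lemma conv_norm n : N (Pproj n (bochner_integral leb D f)) <=
  a1 * (t `^ (1 - kap) / (1 - kap)) +
  a2 * (t `^ (1 - (kap + 1 / 8)) / (1 - (kap + 1 / 8))).
Proof.
have /andP[al0 al1] := ha; have /andP[r0 rv] := hrho; have vr := hvarrho.
have kap0 : 0 <= kap by lra.
have k1 : kap < 1 by lra.
have k2 : kap + 1 / 8 < 1 by lra.
have mD : measurable D by exact: measurable_itv.
set B := bochner_integral leb D f.
set n0 := N (Pproj n B).
have n00 : 0 <= n0 by exact: Hnorm_ge0.
have hn : n0 ^+ 2 = \sum_(1 <= k < n.+1) (L k `^ varrho * cf k B) ^+ 2 by exact: Hnorm_Pproj.
pose u := fsum n (fun k => L k `^ varrho * (L k `^ varrho * cf k B)).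
have uB : ip u B = n0 ^+ 2.
  by rewrite ip_fsum hn; apply: eq_bigr => k _; rewrite expr2; ring.
pose psi (s : R) := a1 * (t - s) `^ (- kap) + a2 * (t - s) `^ (- (kap + 1 / 8)).
have i1 := integrable_powRrev t0 k1; have i2 := integrable_powRrev t0 k2.
have j1 : leb.-integrable D (EFin \o (fun s => a1 * (t - s) `^ (- kap))).
  exact: (integrableZl mD a1 i1).
have j2 : leb.-integrable D (EFin \o (fun s => a2 * (t - s) `^ (- (kap + 1 / 8)))).
  exact: (integrableZl mD a2 i2).
have ipsi : leb.-integrable D (EFin \o psi) by exact: (integrableD mD j1 j2).
have psi_le : \int[leb]_(s in D) psi s <= a1 * (t `^ (1 - kap) / (1 - kap)) +
  a2 * (t `^ (1 - (kap + 1 / 8)) / (1 - (kap + 1 / 8))).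
  rewrite (RintegralD mD j1 j2) (RintegralZl a1 mD i1) (RintegralZl a2 mD i2).
  apply: lerD; apply: ler_wpM2l => //; rewrite -lee_fin (RintE mD)//; exact: integral_powRrev.
have uf s : D s -> ip u (f s) <= n0 * psi s.
  rewrite /= in_itv/= => /[dup] hs /andP[s0 st].
  have ts : 0 < t - s by rewrite subr_gt0.
  pose b k := L k `^ varrho * expR (- ((t - s) * L k)) * co iota k (G s).
  have -> : ip u (f s) = ip (fsum n (fun k => L k `^ varrho * cf k B)) (fsum n b).
    rewrite !ip_fsum big_nat [RHS]big_nat; apply: eq_bigr => k /andP[k0 kn].
    rewrite (cf_extend_expA c0 ha hV _ k0 ts) (cf_fsum _ _ k0) -ltnS kn mul1r /b; ring.
  apply: (le_trans (ip_le _ _)).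
  have -> : `|fsum n (fun k => L k `^ varrho * cf k B)| = n0.
    by apply/eqP; rewrite -(@eqrXn2 _ 2)// norm_fsum hn.
  apply: (ler_wpM2l n00); apply: le_trans (Ga hs).
  apply: (mult_co_le c0 ha hV (m := fun k => (k <= n)%N%:R * (L k `^ varrho * expR (- ((t - s) * L k))))).
  - exact: powR_ge0.
  - by move=> k k0; rewrite (cf_fsum _ _ k0) /b mulrA.
  - move=> k k0; rewrite normrM mulrCA (@ger0_norm _ (L k `^ varrho * _)); last first.
      exact: mulr_ge0 (powR_ge0 _ _) (expR_ge0 _).
    have le1 : `|(k <= n)%N%:R : R| <= 1 by case: leqP; rewrite ?normr1 ?normr0.
    rewrite -[leRHS]mul1r; apply: ler_pM => //.
      by apply: mulr_ge0; [exact: powR_ge0|apply: mulr_ge0; [exact: powR_ge0|exact: expR_ge0]].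
    rewrite mulrA -powRD; last by rewrite (gt_eqF (lam_gt0 c0 k0)) implybT.
    apply: powR_expRN_le => //; last exact: lam_ge0.
    by rewrite kap0 ltW.
have main : n0 ^+ 2 <= n0 * \int[leb]_(s in D) psi s.
  rewrite -uB (ip_conv c0 ha hV t0 Grc GM) -(RintegralZl n0 mD ipsi).
  apply: le_Rintegral => //.
  - exact: (ip_conv_integrable c0 ha hV t0 Grc GM).
  - exact: (integrableZl mD n0 ipsi).
have [n0z|n0p] := eqVneq n0 0; last first.
  apply: le_trans psi_le; have n0pos : 0 < n0 by rewrite lt_neqAle eq_sym n0p.
  by rewrite -(ler_pM2l n0pos) -expr2.
rewrite n0z; apply: addr_ge0; apply: mulr_ge0 => //; apply: divr_ge0; (try exact: powR_ge0); lra.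
Qed.

End convolution_norm.

Lemma powR_small (r eps : R) : 0 < r -> 0 < eps -> exists2 Y : R, 0 < Y &
  forall x, Y <= x -> x `^ (- r) <= eps.
Proof.
move=> r0 e0; have Y0 : 0 < (eps^-1) `^ (r^-1) by rewrite powR_gt0// invr_gt0.
exists ((eps^-1) `^ (r^-1)) => // x Yx.
have x0 : 0 < x by exact: lt_le_trans Yx.
rewrite powRN -[leRHS]invrK lef_pV2 ?posrE ?powR_gt0 ?invr_gt0//.
have h := ge0_ler_powR (ltW r0) (ltW Y0) (ltW x0) Yx.
by move: h; rewrite -powRrM mulVf ?gt_eqF// powRr1// invr_ge0 ltW.
Qed.

Lemma powR_big (r Y : R) : 0 < r -> exists2 h0 : R, 0 < h0 &
  forall h, 0 < h <= h0 -> Y <= h `^ (- r).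
Proof.
move=> r0; pose Z := `|Y| + 1.
have Z0 : 0 < Z by rewrite ltr_wpDl.
have p0 : 0 < Z `^ (r^-1) by rewrite powR_gt0.
exists (Z `^ (r^-1))^-1; first by rewrite invr_gt0.
move=> h /andP[h0 hh].
apply: (@le_trans _ _ Z); first by apply: (le_trans (ler_norm _)); rewrite lerDl.
have hi : 0 < h^-1 by rewrite invr_gt0.
have hle : Z `^ (r^-1) <= h^-1 by rewrite -[leLHS]invrK lef_pV2 ?posrE// invr_gt0.
have := ge0_ler_powR (ltW r0) (ltW p0) (ltW hi) hle.
rewrite -powRrM mulVf ?gt_eqF// powRr1 ?(ltW Z0)//.
by rewrite -powR_inv1 ?(ltW h0)// -powRrM mulN1r.
Qed.

Lemma lam_large (Y : R) : exists n0, forall n, (n0 <= n)%N -> Y <= L n.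
Proof.
have p0 : 0 < c * pi ^+ 2 :> R by rewrite mulr_gt0 ?exprn_gt0 ?pi_gt0.
exists (Num.truncn (`|Y| / (c * pi ^+ 2))).+1 => n hn.
rewrite /lam; apply: (@le_trans _ _ (c * pi ^+ 2 * n%:R)).
  rewrite mulrC -ler_pdivrMr//; apply: (@le_trans _ _ (`|Y| / (c * pi ^+ 2))).
    by rewrite ler_wpM2r ?invr_ge0 ?(ltW p0)// ler_norm.
  by apply: ltW; apply: (lt_le_trans (truncnS_gt _)); rewrite ler_nat.
rewrite ler_wpM2l ?(ltW p0)// -natrX ler_nat.
by case: n hn => // n _; rewrite leq_pmulr.
Qed.

Lemma grid_floor_nat (h s : R) : 0 < h -> 0 <= s ->
  grid_floor h s = (Num.truncn (s / h))%:R * h.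
Proof.
move=> h0 s0; rewrite grid_floorE//; congr (_ * _).
have sh : 0 <= s / h by rewrite divr_ge0// ltW.
by rewrite truncn_floor sh -[RHS]/(_%:R) pmulrn gez0_abs// floor_ge0.
Qed.

Lemma truncn_grid (h s : R) (j : nat) : 0 < h -> j%:R * h <= s < j.+1%:R * h ->
  Num.truncn (s / h) = j.
Proof.
move=> h0 /andP[h1 h2]; apply: truncn_def.
by rewrite ler_pdivlMr// ltr_pdivrMr// h1.
Qed.

Lemma grid_truncn (h s : R) : 0 < h -> 0 <= s ->
  (Num.truncn (s / h))%:R * h <= s < (Num.truncn (s / h)).+1%:R * h.
Proof.
move=> h0 s0; have sh : 0 <= s / h by rewrite divr_ge0// ltW.
by rewrite -ler_pdivlMr// -ltr_pdivrMr// truncn_itv.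
Qed.

End Pathwise.

Lemma subACA (G : zmodType) (a b c d : G) : a - b - (c - d) = (a - c) - (b - d).
Proof. by rewrite !opprB [LHS]addrACA [RHS]addrACA [- b + _]addrC. Qed.

(** * Solution and scheme along one path *)

Section PathwiseConvergence.
Variable R : realType.
Local Notation H := (L2_01 R).
Local Notation leb := (@lebesgue_measure R).
Local Notation TR := (measurableTypeR R).
Variables (c alpha : R) (c0 : 0 < c) (ha : 0 <= alpha <= 1 / 2).
Variables (V : completeNormedModType R) (iota : {linear H -> V}).
Hypothesis hV : is_Hcompletion c (- alpha) iota.
Variables (rho varrho theta vartheta chi T : R).
Hypothesis hrho : 0 <= rho < varrho.
Hypothesis hvarrho : varrho < 1 / 4.
Hypothesis theta0 : 0 < theta.
Hypothesis vt0 : 0 < vartheta.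
Hypothesis chi0 : 0 < chi.
Hypothesis T0 : 0 < T.
Variables (F : H -> V) (xi : H).
Hypothesis hF : Hcontinuous c varrho F.
Hypothesis hlip : forall n, (0 < n)%N -> forall v w : L2_01 R,
  range (@Pproj R n) v -> range (@Pproj R n) w ->
  `|F v - F w| <= theta *
    (1 + Hnorm c rho v `^ vartheta + Hnorm c rho w `^ vartheta) *
    Hnorm c rho (v - w).
Local Notation L := (lam c).
Local Notation ext t := (extend iota (expA c t)).
Local Notation N := (Hnorm c varrho).
Local Notation kap := (alpha + varrho).
Local Notation boch t f := (bochner_integral leb (`]0%R, t[%classic : set TR) f).

Definition sol (x : R -> H) (t : R) (z : H) :=
  x t = expA c t xi + boch t (fun s : R => ext (t - s) (F (x s))) + z.

Definition taming n (h : R) (y o : R -> H) (s : R) : bool :=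
  N (y s) + N (o s + Pproj n (expA c s xi)) <= `|h| `^ (- chi).

Definition scheme n (h : R) (y o : R -> H) (t : R) :=
  y t = Pproj n (expA c t xi) + boch t (fun s : R =>
          let s' := grid_floor h s in
          Pproj n (ext (t - s) ((taming n h y o s')%:R *: F (y s')))) + o t.

Let rhole : rho <= varrho. Proof. by have /andP[_ /ltW] := hrho. Qed.

Lemma F_bounded (B : R) : 0 <= B -> exists2 M, 0 <= M & forall u, Hdom c varrho u ->
  N u <= B -> `|F u| <= M.
Proof.
move=> B0; pose C := L 1 `^ (rho - varrho) * B.
have C0 : 0 <= C by apply: mulr_ge0 => //; exact: powR_ge0.
exists (`|F 0| + theta * (1 + C `^ vartheta + C `^ vartheta) * C).
  apply: addr_ge0 => //; apply: mulr_ge0 => //; apply: mulr_ge0; first exact: ltW.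
  by rewrite !addr_ge0 ?powR_ge0.
have h0 : Hdom c varrho (0 : H).
  by apply/HdomP; exists 0 => n; rewrite big1// => k _; rewrite cf0 mulr0 expr0n.
have h0' : Hdom c rho (0 : H).
  by apply/HdomP; exists 0 => n; rewrite big1// => k _; rewrite cf0 mulr0 expr0n.
have z0 : Hnorm c rho (0 : H) = 0.
  by have := powAB h0' h0'; rewrite !subrr /Hnorm => ->; rewrite normr0.
move=> u hu uB.
have [hu' uC] := Hnorm_mono c0 rhole hu.
have {}uC : Hnorm c rho u <= C.
  by apply: (le_trans uC); apply: ler_wpM2l => //; exact: powR_ge0.
have h1 := F_lip c0 rhole theta0 vt0 hF hlip hu h0.
rewrite z0 subr0 in h1.
have h2 : `|F u| <= `|F 0| + `|F u - F 0|.
  by rewrite -[X in `|X| <= _](subrK (F 0)) addrC ler_normD.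
apply: (le_trans h2); rewrite lerD2l; apply: (le_trans h1).
have n0 : 0 <= Hnorm c rho u by exact: Hnorm_ge0.
have p1 : Hnorm c rho u `^ vartheta <= C `^ vartheta.
  exact: (ge0_ler_powR (ltW vt0) n0 C0 uC).
have p2 : 0 `^ vartheta <= C `^ vartheta :> R.
  exact: (ge0_ler_powR (ltW vt0) (lexx 0) C0 C0).
apply: ler_pM => //.
  apply: mulr_ge0; first exact: ltW.
  by rewrite !addr_ge0 ?powR_ge0.
exact: (ler_wpM2l (ltW theta0) (lerD (lerD (lexx _) p1) p2)).
Qed.

Lemma F_lip_ball (B : R) : 0 <= B -> exists2 LF, 0 <= LF & forall u v,
  Hdom c varrho u -> Hdom c varrho v -> N u <= B -> N v <= B ->
  `|F u - F v| <= LF * Hnorm c rho (u - v).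
Proof.
move=> B0; pose C := L 1 `^ (rho - varrho) * B.
have C0 : 0 <= C by apply: mulr_ge0 => //; exact: powR_ge0.
exists (theta * (1 + C `^ vartheta + C `^ vartheta)).
  apply: mulr_ge0; first exact: ltW.
  by rewrite !addr_ge0 ?powR_ge0.
have aux u : Hdom c varrho u -> N u <= B -> Hnorm c rho u `^ vartheta <= C `^ vartheta.
  move=> hu uB; have [hu' uC] := Hnorm_mono c0 rhole hu.
  apply: (ge0_ler_powR (ltW vt0) (Hnorm_ge0 _ _ _) C0).
  by apply: (le_trans uC); apply: ler_wpM2l => //; exact: powR_ge0.
move=> u v hu hv uB vB.
apply: (le_trans (F_lip c0 rhole theta0 vt0 hF hlip hu hv)).
apply: (ler_wpM2r (Hnorm_ge0 _ _ _)); apply: (ler_wpM2l (ltW theta0)).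
exact: (lerD (lerD (lexx _) (aux u hu uB)) (aux v hv vB)).
Qed.

Section path.
Variable x : R -> H.
Hypothesis xdom : forall t, Hdom c varrho (x t).
Hypothesis xc : Hcontinuous_path c varrho T x.

Lemma x_unif (eps : R) : 0 < eps -> exists2 delta : R, 0 < delta &
  forall s r : R, 0 <= s <= T -> 0 <= r <= T -> `|s - r| < delta -> N (x s - x r) < eps.
Proof.
move=> e0; have gc t : 0 <= t <= T -> forall e : R, 0 < e ->
  exists2 delta : R, 0 < delta & forall s : R, 0 <= s <= T -> `|s - t| < delta ->
   `|powA c varrho (x s) - powA c varrho (x t)| < e.
  move=> ht e e1; have [d d0 hd] := xc ht e1; exists d => // s hs st.
  by rewrite -(powAB (xdom s) (xdom t)); exact: hd.
have [d d0 hd] := path_unif T0 gc e0; exists d => // s r hs hr sr.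
by rewrite /Hnorm (powAB (xdom s) (xdom r)); exact: hd.
Qed.

Lemma x_bounded : exists2 B : R, 0 <= B & forall s, 0 <= s <= T -> N (x s) <= B.
Proof.
have gc t : 0 <= t <= T -> forall e : R, 0 < e ->
  exists2 delta : R, 0 < delta & forall s : R, 0 <= s <= T -> `|s - t| < delta ->
   `|powA c varrho (x s) - powA c varrho (x t)| < e.
  move=> ht e e1; have [d d0 hd] := xc ht e1; exists d => // s hs st.
  by rewrite -(powAB (xdom s) (xdom t)); exact: hd.
have [M hM] := path_bounded T0 gc; exists M => //.
by apply: (le_trans (normr_ge0 (powA c varrho (x 0)))); apply: hM; rewrite lexx ltW.
Qed.

Lemma Fx_rc t : t <= T -> forall s, 0 < s < t -> forall eps : R, 0 < eps ->
  exists2 delta : R, 0 < delta &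
    forall r, s <= r < s + delta -> r < t -> `|F (x r) - F (x s)| < eps.
Proof.
move=> tT s /andP[s0 st] eps e0.
have [d d0 hd] := hF (xdom s) e0.
have [d' d'0 hd'] := x_unif d0; exists d' => // r /andP[sr rs] rt.
apply: hd; first exact: xdom.
apply: hd'.
- by rewrite (le_trans (ltW s0) sr)/=; lra.
- by rewrite (ltW s0)/=; lra.
- by rewrite ger0_norm ?subr_ge0//; lra.
Qed.

End path.

Section schemepath.
Variables (n : nat) (h : R) (y o : R -> H).
Hypothesis h0 : 0 < h.
Local Notation Gy := (fun s : R => let s' := grid_floor h s in (taming n h y o s')%:R *: F (y s')).

Lemma Gy_rc t : forall s, 0 < s < t -> forall eps : R, 0 < eps ->
  exists2 delta : R, 0 < delta &
    forall r, s <= r < s + delta -> r < t -> `|Gy r - Gy s| < eps.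
Proof.
move=> s /andP[s0 st] eps e0; have /andP[j1 j2] := grid_truncn h0 (ltW s0).
set j := Num.truncn _ in j1 j2.
exists (j.+1%:R * h - s); first by rewrite subr_gt0.
move=> r /andP[sr]; rewrite addrC subrK => rj rt.
have r0 : 0 <= r by exact: le_trans (ltW s0) sr.
have -> : grid_floor h r = grid_floor h s.
  rewrite (grid_floor_nat h0 r0) (grid_floor_nat h0 (ltW s0)) -/j.
  by rewrite (@truncn_grid _ h r j)// (le_trans j1).
by rewrite subrr normr0.
Qed.

Lemma Gy_bounded t : exists M, forall s, 0 < s < t -> `|Gy s| <= M.
Proof.
exists (\sum_(j < (Num.truncn (t / h)).+1) `|F (y (j%:R * h))|) => s /andP[s0 st] /=.
rewrite (grid_floor_nat h0 (ltW s0)); set j := Num.truncn _.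
have jt : (j < (Num.truncn (t / h)).+1)%N.
  by rewrite ltnS; apply: le_truncn; rewrite ler_wpM2r ?invr_ge0 ?ltW.
rewrite (bigD1 (Ordinal jt))//= normrZ.
apply: (@le_trans _ _ `|F (y (j%:R * h))|); last by rewrite lerDl sumr_ge0.
by case: (taming _ _ _ _ _); rewrite ?normr1 ?mul1r// normr0 mul0r.
Qed.

End schemepath.

Section coupling.
Variable x : R -> H.
Hypothesis xdom : forall t, Hdom c varrho (x t).
Hypothesis xc : Hcontinuous_path c varrho T x.

(* The common noise is only compared on its first n coefficients, which suffices
   because both equations are projected by P_n. *)
Definition coupled n (h : R) (y o : R -> H) (t : R) := exists z,
  [/\ sol x t z, scheme n h y o t & forall k, (0 < k <= n)%N -> cf k z = cf k (o t)].

Let al1 : 0 <= kap /\ kap + 1 / 8 < 1.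
Proof. by have /andP[h1 h2] := ha; have /andP[h3 h4] := hrho; have h5 := hvarrho; lra. Qed.

Lemma Fx_bounded : exists2 M, 0 <= M & forall s, 0 <= s <= T -> `|F (x s)| <= M.
Proof.
have [B B0 hB] := x_bounded xdom xc; have [M M0 hM] := F_bounded B0.
by exists M => // s hs; apply: hM; [exact: xdom|exact: hB].
Qed.

Section fixed.
Variables (n : nat) (h : R) (y o : R -> H) (t : R).
Hypothesis h0 : 0 < h.
Hypothesis tT : t <= T.
Hypothesis yr : range (@Pproj R n) (y t).
Hypothesis or : range (@Pproj R n) (o t).
Hypothesis hc : coupled n h y o t.
Local Notation Gy := (fun s : R => let s' := grid_floor h s in (taming n h y o s')%:R *: F (y s')).
Local Notation Delta := (fun s : R => F (x s) - Gy s).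

Lemma FxM : exists M, forall s, 0 < s < t -> `|F (x s)| <= M.
Proof.
have [M _ hM] := Fx_bounded; exists M => s /andP[s0 st]; apply: hM.
by rewrite (ltW s0)/=; exact: (le_trans (ltW st) tT).
Qed.

Lemma Delta_rc : forall s, 0 < s < t -> forall eps : R, 0 < eps ->
  exists2 delta : R, 0 < delta &
    forall r, s <= r < s + delta -> r < t -> `|Delta r - Delta s| < eps.
Proof.
move=> s hs eps e0; have e2 : 0 < eps / 2 by rewrite divr_gt0.
have [d1 d10 h1] := Fx_rc xdom xc tT hs e2.
have [d2 d20 h2] := Gy_rc n y o h0 hs e2.
exists (Num.min d1 d2); first by rewrite lt_min d10.
move=> r /andP[sr]; rewrite -ltrBlDl lt_min => /andP[r1 r2] rt.
have {}h1 : `|F (x r) - F (x s)| < eps / 2 by apply: h1 => //; rewrite sr -ltrBlDl.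
have {}h2 : `|Gy r - Gy s| < eps / 2 by apply: h2 => //; rewrite sr -ltrBlDl.
have -> : Delta r - Delta s = (F (x r) - F (x s)) - (Gy r - Gy s) by exact: subACA.
apply: (le_lt_trans (ler_normB _ _)); rewrite (splitr eps); exact: ltrD.
Qed.

Lemma Delta_bounded : exists M, forall s, 0 < s < t -> `|Delta s| <= M.
Proof.
have [M1 hM1] := FxM; have [M2 hM2] := Gy_bounded n y o h0 t.
exists (M1 + M2) => s hs; apply: (le_trans (ler_normB _ _)).
by apply: lerD; [exact: hM1|exact: hM2].
Qed.

(** In the first n coefficients the initial value and the noise are the same in both equations and
    cancel; the convolution of the drift difference remains. *)
Lemma coupled_diff : 0 < t -> Pproj n (x t) - y t =
  Pproj n (boch t (fun s => ext (t - s) (Delta s))).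
Proof.
move=> t0; have [z [hsol hsch hz]] := hc.
have [M1 hM1] := FxM; have [M2 hM2] := Gy_bounded n y o h0 t.
have [M3 hM3] := Delta_bounded.
have mD : measurable (`]0%R, t[%classic : set TR) by exact: measurable_itv.
apply: cf_inj => k k0; rewrite (cfB k (Pproj n (x t)) (y t)) !(cf_Pproj _ _ k0).
have [kn|nk] := leqP k n; last by rewrite !mul0r sub0r (cf_range0 yr nk) oppr0.
rewrite !mul1r (cf_conv c0 ha hV t0 Delta_rc hM3 k0).
have E1 : cf k (x t) = cf k (expA c t xi) +
    \int[leb]_(s in `]0, t[) (expR (- ((t - s) * L k)) * co iota k (F (x s))) + cf k (o t).
  rewrite hsol !cfD -(hz k); last by rewrite k0.
  congr (_ + _ + _); exact: (cf_conv c0 ha hV t0 (Fx_rc xdom xc tT) hM1 k0).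
have E2 : cf k (y t) = cf k (expA c t xi) +
    \int[leb]_(s in `]0, t[) (expR (- ((t - s) * L k)) * co iota k (Gy s)) + cf k (o t).
  rewrite hsch !cfD; congr (_ + _ + _); first by rewrite (cf_Pproj _ _ k0) kn mul1r.
  have := cf_conv_Pproj c0 ha hV t0 (Gy_rc n y o h0 (t := t)) hM2 n k0.
  by rewrite kn mul1r.
have i1 := conv_coef_integrable c0 ha hV t0 (Fx_rc xdom xc tT) hM1 k0.
have i2 := conv_coef_integrable c0 ha hV t0 (Gy_rc n y o h0 (t := t)) hM2 k0.
have alg (p q r q' : R) : (p + q + r) - (p + q' + r) = q - q' by ring.
apply: (etrans (congr2 (fun p q => p - q) E1 E2)); apply: (etrans (alg _ _ _ _)).
apply: (etrans (esym (RintegralB mD i1 i2))); apply: eq_Rintegral => s _.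
by rewrite (coB c0 ha hV (F (x s)) (Gy s) k0) mulrBr.
Qed.

Lemma coupled_diff0 : t = 0 -> Pproj n (x t) - y t = 0.
Proof.
move=> t0; have [z [hsol hsch hz]] := hc.
apply: cf_inj => k k0; rewrite (cfB k (Pproj n (x t)) (y t)) (cf_Pproj _ _ k0) cf0.
have [kn|nk] := leqP k n; last by rewrite mul0r sub0r (cf_range0 yr nk) oppr0.
rewrite mul1r hsol hsch !cfD (cf_Pproj _ _ k0) kn mul1r hz ?k0// t0.
by rewrite !bochner_integral_set0 subrr.
Qed.

(** The second taming term needs a pathwise bound on the noise that does not depend on n. It is read
    off from the solution: noise plus initial part equals P_n x minus the projected drift
    convolution. *)
Lemma noise_bound (B M : R) : 0 <= t -> 0 <= M -> N (x t) <= B ->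
  (forall s, 0 <= s <= T -> `|F (x s)| <= M) ->
  N (o t + Pproj n (expA c t xi)) <= B + M * (T `^ (1 - kap) / (1 - kap)).
Proof.
move=> t0 M0 xB hM; have [z [hsol _ hz]] := hc; have [kap0 kap1] := al1.
set I := boch t (fun s => ext (t - s) (F (x s))).
have E : o t + Pproj n (expA c t xi) = Pproj n (x t) - Pproj n I.
  apply: cf_inj => k k0; rewrite (cfB k (Pproj n (x t)) (Pproj n I)) (cfD k (o t)).
  rewrite !(cf_Pproj _ _ k0).
  have [kn|nk] := leqP k n; last by rewrite !mul0r subr0 addr0 (cf_range0 or nk).
  rewrite !mul1r -(hz k); last by rewrite k0.
  have alg (p q r : R) : p + q = q + r + p - r by ring.
  have E : cf k (x t) = cf k (expA c t xi) + cf k I + cf k z by rewrite hsol !cfD.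
  apply: (etrans (alg _ _ (cf k I))); congr (_ - _); exact: esym.
have hP := Hdom_Pproj c varrho n (x t); have hI := Hdom_Pproj c varrho n I.
rewrite E /Hnorm (powAB hP hI); apply: (le_trans (ler_normB _ _)); apply: lerD.
  exact: (le_trans (Hnorm_Pproj_le n (xdom t)) xB).
have [t00|t00] := eqVneq t 0.
  have -> : Pproj n I = 0.
    apply: cf_inj => k k0; rewrite (cf_Pproj _ _ k0) /I t00 bochner_integral_set0.
    by rewrite cf0 mulr0.
  have h00 : Hdom c varrho (0 : H) by have := hI; rewrite -[0](subrr (Pproj n I)); move=> h1; exact: HdomB.
  have := powAB h00 h00; rewrite !subrr => ->; rewrite normr0.
  by apply: mulr_ge0 => //; apply: divr_ge0; [exact: powR_ge0|lra].
have tp : 0 < t by rewrite lt_neqAle eq_sym t00.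
have hMt s : 0 < s < t -> `|F (x s)| <= M.
  by move=> /andP[s0 st]; apply: hM; rewrite (ltW s0)/=; exact: (le_trans (ltW st) tT).
apply: (le_trans (conv_norm c0 ha hV hrho hvarrho tp M0 (lexx 0) (Fx_rc xdom xc tT) hMt _ n)).
  move=> s hs; rewrite mul0r addr0 mulrC.
  by apply: (ler_wpM2r (powR_ge0 _ _)); exact: hMt.
rewrite mul0r addr0; apply: (ler_wpM2l M0); apply: ler_wpM2r; first by rewrite invr_ge0; lra.
by apply: ge0_ler_powR; rewrite ?nnegrE ?(ltW T0)//; lra.
Qed.

End fixed.
End coupling.
End PathwiseConvergence.

(** * Weighted Gronwall argument and continuation over the grid *)

Section PathwiseMain.
Variable R : realType.
Local Notation H := (L2_01 R).
Local Notation leb := (@lebesgue_measure R).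
Local Notation TR := (measurableTypeR R).
Variables (c alpha : R) (c0 : 0 < c) (ha : 0 <= alpha <= 1 / 2).
Variables (V : completeNormedModType R) (iota : {linear H -> V}).
Hypothesis hV : is_Hcompletion c (- alpha) iota.
Variables (rho varrho theta vartheta chi T : R).
Hypothesis hrho : 0 <= rho < varrho.
Hypothesis hvarrho : varrho < 1 / 4.
Hypothesis theta0 : 0 < theta.
Hypothesis vt0 : 0 < vartheta.
Hypothesis chi0 : 0 < chi.
Hypothesis T0 : 0 < T.
Variables (F : H -> V) (xi : H).
Hypothesis hF : Hcontinuous c varrho F.
Hypothesis hlip : forall n, (0 < n)%N -> forall v w : L2_01 R,
  range (@Pproj R n) v -> range (@Pproj R n) w ->
  `|F v - F w| <= theta *
    (1 + Hnorm c rho v `^ vartheta + Hnorm c rho w `^ vartheta) *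
    Hnorm c rho (v - w).
Local Notation L := (lam c).
Local Notation N := (Hnorm c varrho).
Local Notation Nr := (Hnorm c rho).
Local Notation kap := (alpha + varrho).
Variable x : R -> H.
Hypothesis xdom : forall t, Hdom c varrho (x t).
Hypothesis xc : Hcontinuous_path c varrho T x.
Local Notation coup := (coupled c iota varrho chi F xi x).

Let rhole : rho <= varrho. Proof. by have /andP[_ /ltW] := hrho. Qed.
Let Cr := L 1 `^ (rho - varrho).
Let Cr0 : 0 <= Cr. Proof. exact: powR_ge0. Qed.

Lemma Nr_le u : Hdom c varrho u -> Nr u <= Cr * N u.
Proof. by move=> hu; have [] := Hnorm_mono c0 rhole hu. Qed.

(* A weight exp (a t) with a large makes the Volterra operator of the scheme a
   contraction; the exponent 1/8 is spare, since alpha + varrho < 3/4. *)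
Lemma expR_weight (a b t s : R) : 0 < b -> a = b ^+ 8 -> s < t ->
  expR (a * s) <= expR (a * t) * (b^-1 * (t - s) `^ (- (1 / 8))).
Proof.
move=> b0 ab st; have ts : 0 < t - s by rewrite subr_gt0.
have a0 : 0 <= a by rewrite ab exprn_ge0 ?ltW.
have h := @powR_expRN_le R (1 / 8) (t - s) a _ ts a0.
have ab' : a `^ (1 / 8) = b.
  rewrite ab -powR_mulrn ?ltW// -powRrM (_ : 8%:R * (1 / 8) = 1) ?powRr1 ?ltW//.
  by field.
have -> : expR (a * s) = expR (a * t) * expR (- ((t - s) * a)).
  by rewrite -expRD; congr expR; ring.
rewrite ler_wpM2l ?expR_ge0// [leRHS]mulrC ler_pdivlMr// mulrC.
by move: h; rewrite ab'; apply; lra.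
Qed.

Section step.
Variables (B MF LF M a b e : R).
Let K1 := T `^ (1 - kap) / (1 - kap).
Let K2 := T `^ (1 - (kap + 1 / 8)) / (1 - (kap + 1 / 8)).
Hypothesis B0 : 0 <= B.
Hypothesis xB : forall s, 0 <= s <= T -> N (x s) <= B.
Hypothesis MF0 : 0 <= MF.
Hypothesis FM : forall s, 0 <= s <= T -> `|F (x s)| <= MF.
Hypothesis LF0 : 0 <= LF.
Hypothesis FL : forall u v, Hdom c varrho u -> Hdom c varrho v ->
  N u <= B + 1 -> N v <= B + 1 -> `|F u - F v| <= LF * Nr (u - v).
Hypothesis ME : M = LF * K1 + 1.
Hypothesis bE : b = LF * 2 * Cr * K2 + 1.
Hypothesis aE : a = b ^+ 8.
Hypothesis e0 : 0 < e.
Hypothesis esmall : 2 * M * e * expR (a * T) <= 1.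
Variables (n : nat) (h : R) (y o : R -> H).
Hypothesis h0 : 0 < h.
Hypothesis xosc : forall s r, 0 <= s <= T -> 0 <= r <= T -> `|s - r| <= h ->
  Cr * N (x s - x r) <= e / 2.
Hypothesis tail : L n.+1 `^ (rho - varrho) * B <= e / 2.
Hypothesis tame : B + 1 + (B + MF * K1) <= h `^ (- chi).
Hypothesis yr : forall t, 0 <= t <= T -> range (@Pproj R n) (y t).
Hypothesis or : forall t, 0 <= t <= T -> range (@Pproj R n) (o t).

(** [esmall] keeps earlier errors below 1, hence y in the ball of radius B + 1, where the constant
    [LF] is valid and [tame] makes the indicator equal to 1. The bound closes because [M] absorbs LF
    K1 and [b] the constant of the feedback term, each into one half of 2 M e exp (a t). *)
Lemma path_step (t : R) : 0 <= t <= T -> coup n h y o t ->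
  (forall j : nat, j%:R * h < t -> coup n h y o (j%:R * h) /\
    N (Pproj n (x (j%:R * h)) - y (j%:R * h)) <= 2 * M * e * expR (a * (j%:R * h))) ->
  N (Pproj n (x t) - y t) <= 2 * M * e * expR (a * t).
Proof.
move=> /andP[t0 tT] hc IH.
have /andP[al0 al1] := ha; have /andP[r0 rv] := hrho; have vr := hvarrho.
have kap0 : 0 <= kap by lra.
have k1 : 0 < 1 - kap by lra.
have k2 : 0 < 1 - (kap + 1 / 8) by lra.
have K10 : 0 <= K1 by apply: divr_ge0; [exact: powR_ge0|exact: ltW].
have K20 : 0 <= K2 by apply: divr_ge0; [exact: powR_ge0|exact: ltW].
have M1 : 1 <= M by rewrite ME lerDr; exact: mulr_ge0.
have b1 : 1 <= b by rewrite bE lerDr; do 2?[apply: mulr_ge0 => //]; exact: mulr_ge0.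
have b0 : 0 < b by exact: lt_le_trans b1.
have a0 : 0 <= a by rewrite aE; apply: exprn_ge0; exact: ltW.
have M0 : 0 <= M by exact: le_trans M1.
have Me0 : 0 <= 2 * M * e by apply: mulr_ge0; [exact: mulr_ge0|exact: ltW].
have ot : range (@Pproj R n) (o t) by apply: or; rewrite t0.
have yt : range (@Pproj R n) (y t) by apply: yr; rewrite t0.
have [t00|t00] := eqVneq t 0.
  apply: (eq_ind_r (fun z => N z <= _) _ (coupled_diff0 yt hc t00)).
  have h00 : Hdom c varrho (0 : H).
    by have h1 := HdomB (xdom 0) (xdom 0); rewrite subrr in h1.
  have := powAB h00 h00; rewrite !subrr /Hnorm => ->; rewrite normr0.
  by apply: mulr_ge0 => //; exact: expR_ge0.
have tp : 0 < t by rewrite lt_neqAle eq_sym t00.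
apply: (eq_ind_r (fun z => N z <= _) _ (coupled_diff c0 ha hV hrho theta0 vt0 T0 hF hlip xdom xc h0 tT yt hc tp)).
pose E := expR (a * t).
have E1 : 1 <= E by rewrite -expR0 ler_expR; exact: mulr_ge0.
have E0 : 0 <= E by exact: expR_ge0.
pose a1 := LF * e; pose a2 := LF * (2 * Cr * M * e * E * b^-1).
have a10 : 0 <= a1 by apply: mulr_ge0 => //; exact: ltW.
have bi0 : 0 <= b^-1 by rewrite invr_ge0 ltW.
have a20 : 0 <= a2.
  apply: mulr_ge0 => //; apply: mulr_ge0 => //; apply: mulr_ge0 => //.
  by apply: mulr_ge0; [do 2?[apply: mulr_ge0 => //]|exact: ltW].
have [M3 hM3] := Delta_bounded c0 chi hrho theta0 vt0 T0 xi hF hlip xdom xc n y o h0 tT.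
have hrc := Delta_rc chi T0 xi hF xdom xc n y o h0 tT.
have key s : 0 < s < t -> (t - s) `^ (- kap) *
    `|F (x s) - (taming c varrho chi xi n h y o (grid_floor h s))%:R *: F (y (grid_floor h s))| <=
  a1 * (t - s) `^ (- kap) + a2 * (t - s) `^ (- (kap + 1 / 8)).
  move=> /andP[s0 st]; have ts : 0 < t - s by rewrite subr_gt0.
  have sT : 0 <= s <= T by rewrite (ltW s0) (le_trans (ltW st) tT).
  rewrite (grid_floor_nat h0 (ltW s0)); have /andP[j1 j2] := grid_truncn h0 (ltW s0).
  set j := Num.truncn _ in j1 j2 *.
  have [cj Dj] := IH j (le_lt_trans j1 st).
  set sj := j%:R * h in j1 j2 cj Dj *.
  have sj0 : 0 <= sj by apply: mulr_ge0 => //; exact: ltW.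
  have sjT : 0 <= sj <= T by rewrite sj0 (le_trans j1) //; have /andP[] := sT.
  have dP := Hdom_Pproj c varrho n (x sj).
  have dy : Hdom c varrho (y sj) := Hdom_range c varrho (yr sjT).
  have PB : N (Pproj n (x sj)) <= B.
    exact: le_trans (Hnorm_Pproj_le n (xdom sj)) (xB sjT).
  have Ds1 : N (Pproj n (x sj) - y sj) <= 1.
    apply: (le_trans Dj); apply: le_trans esmall; apply: ler_wpM2l => //.
    by rewrite ler_expR; apply: ler_wpM2l => //; have /andP[] := sjT.
  have yB : N (y sj) <= B + 1.
    apply: (le_trans (Hnorm_le_add dy dP)); rewrite (Hnorm_distC dy dP).
    exact: lerD PB Ds1.
  have tm : taming c varrho chi xi n h y o sj.
    rewrite /taming (gtr0_norm h0); apply: le_trans tame; apply: lerD yB _.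
    have /andP[_ sjT'] := sjT.
    exact: (noise_bound c0 ha hV hrho hvarrho T0 hF xdom xc sjT' (or sjT) cj sj0 MF0 (xB sjT) FM).
  have EG : (taming c varrho chi xi n h y o sj)%:R *: F (y sj) = F (y sj) by rewrite tm scale1r.
  rewrite EG.
  have B1 : B <= B + 1 by rewrite lerDl.
  have Fd := FL (xdom s) dy (le_trans (xB sT) B1) yB.
  have [dxr _] := Hnorm_mono c0 rhole (xdom s).
  have [dxj _] := Hnorm_mono c0 rhole (xdom sj).
  have [dPr _] := Hnorm_mono c0 rhole dP.
  have [dyr _] := Hnorm_mono c0 rhole dy.
  (* Three errors: oscillation of the path within a cell, spectral truncation, and the error carried
     over from the grid point. *)
  have d1 : Nr (x s - x sj) <= e / 2.
    apply: (le_trans (Nr_le (HdomB (xdom s) (xdom sj)))).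
    apply: xosc => //; rewrite ger0_norm ?subr_ge0// lerBlDl; apply: ltW.
    by rewrite -[j.+1]addn1 natrD mulrDl mul1r -/sj in j2.
  have d2 : Nr (x sj - Pproj n (x sj)) <= e / 2.
    have [_ ht] := Hnorm_tail c0 n rhole (xdom sj).
    by apply: (le_trans ht); apply: le_trans tail; apply: (ler_wpM2l (powR_ge0 _ _)); exact: xB.
  have d3 : Nr (Pproj n (x sj) - y sj) <= Cr * (2 * M * e * expR (a * sj)).
    by apply: (le_trans (Nr_le (HdomB dP dy))); apply: ler_wpM2l.
  have dd : Nr (x s - y sj) <= e + Cr * (2 * M * e * expR (a * s)).
    apply: (le_trans (Hnorm_distD dxr dPr dyr)).
    apply: (@le_trans _ _ (e / 2 + e / 2 + Cr * (2 * M * e * expR (a * sj)))).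
      apply: lerD d3; apply: (le_trans (Hnorm_distD dxr dxj dPr)); exact: lerD d1 d2.
    rewrite -splitr lerD2l; apply: ler_wpM2l => //; apply: ler_wpM2l => //.
    by rewrite ler_expR ler_wpM2l.
  have wt := expR_weight b0 aE st.
  have p0 : 0 <= (t - s) `^ (- kap) by exact: powR_ge0.
  apply: (le_trans (ler_wpM2l p0 Fd)).
  have dd2 : Nr (x s - y sj) <= e + Cr * (2 * M * e * (E * (b^-1 * (t - s) `^ (- (1 / 8))))).
    apply: (le_trans dd); rewrite lerD2l; apply: ler_wpM2l => //; exact: ler_wpM2l.
  apply: (le_trans (ler_wpM2l p0 (ler_wpM2l LF0 dd2))).
  have -> : (t - s) `^ (- (kap + 1 / 8)) = (t - s) `^ (- kap) * (t - s) `^ (- (1 / 8)).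
    by rewrite -powRD ?opprD// (gt_eqF ts) implybT.
  rewrite /a1 /a2 le_eqVlt; apply/orP; left; apply/eqP.
  move: ((t - s) `^ (- kap)) ((t - s) `^ (- (1 / 8))) => p q; ring.
apply: (le_trans (conv_norm c0 ha hV hrho hvarrho tp a10 a20 hrc hM3 key n)).
have pw r : 0 <= r -> t `^ r <= T `^ r.
  by move=> rr; apply: (ge0_ler_powR rr _ _ tT) => //; exact: ltW.
apply: (@le_trans _ _ (a1 * K1 + a2 * K2)).
  apply: lerD; [apply: (ler_wpM2l a10)|apply: (ler_wpM2l a20)];
    apply: ler_wpM2r; rewrite ?invr_ge0; try exact: ltW; apply: pw; exact: ltW.
rewrite /a1 /a2 -/E.
have LK : LF * e * K1 <= M * e * E.
  have -> : LF * e * K1 = (LF * K1) * e * 1 by ring.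
  apply: ler_pM => //; first by apply: mulr_ge0; [exact: mulr_ge0|exact: ltW].
  by apply: ler_wpM2r; [exact: ltW|rewrite ME lerDl].
have LK2 : LF * (2 * Cr * M * e * E * b^-1) * K2 <= M * e * E.
  have -> : LF * (2 * Cr * M * e * E * b^-1) * K2 = M * e * E * ((LF * 2 * Cr * K2) / b) by ring.
  rewrite -[leRHS]mulr1; apply: ler_wpM2l; first by do 2?[apply: mulr_ge0 => //]; exact: ltW.
  by rewrite ler_pdivrMr// mul1r bE lerDl.
have -> : 2 * M * e * E = M * e * E + M * e * E by ring.
exact: lerD.
Qed.

(** The drift reads grid values only, so strong induction over the grid points comes first; an
    arbitrary t then costs one more step. *)
Lemma path_bound (t : R) : 0 <= t <= T -> coup n h y o t ->
  (forall j : nat, j%:R * h <= T -> coup n h y o (j%:R * h)) ->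
  N (Pproj n (x t) - y t) <= 2 * M * e * expR (a * t).
Proof.
move=> ht hc hg; have /andP[t0 tT] := ht.
have jpos (j : nat) : 0 <= j%:R * h by apply: mulr_ge0 => //; exact: ltW.
have grid : forall j : nat, j%:R * h <= T ->
  N (Pproj n (x (j%:R * h)) - y (j%:R * h)) <= 2 * M * e * expR (a * (j%:R * h)).
  elim/ltn_ind => j IH jT; apply: path_step; [by rewrite jpos|exact: hg|].
  move=> i ij; have iT : i%:R * h <= T by exact: le_trans (ltW ij) jT.
  split; first exact: hg.
  by apply: IH => //; move: ij; rewrite ltr_pM2r// ltr_nat.
apply: path_step => // j jt; have jT : j%:R * h <= T by exact: le_trans (ltW jt) tT.
by split; [exact: hg|exact: grid].
Qed.

End step.

(** The thresholds depend on the path and on eps, but neither on t nor on y and o; this is what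
    permits times varying with n. *)
Lemma pathwise (eps : R) : 0 < eps -> exists n0, exists2 h0 : R, 0 < h0 &
  forall n h y o, (n0 <= n)%N -> 0 < h <= h0 ->
  (forall t, 0 <= t <= T -> range (@Pproj R n) (y t)) ->
  (forall t, 0 <= t <= T -> range (@Pproj R n) (o t)) ->
  forall t, 0 <= t <= T -> coup n h y o t ->
  (forall j : nat, j%:R * h <= T -> coup n h y o (j%:R * h)) ->
  `|x t - y t| <= eps.
Proof.
move=> eps0; have /andP[r0 rv] := hrho; have vr := hvarrho.
have [B B0 hB] := x_bounded T0 xdom xc.
have [MF MF0 hMF] := Fx_bounded c0 hrho theta0 vt0 T0 hF hlip xdom xc.
have B10 : 0 <= B + 1 by apply: addr_ge0.
have [LF LF0 hLF] := F_lip_ball c0 hrho theta0 vt0 hF hlip B10.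
pose K1 := T `^ (1 - kap) / (1 - kap).
pose K2 := T `^ (1 - (kap + 1 / 8)) / (1 - (kap + 1 / 8)).
pose M := LF * K1 + 1; pose b := LF * 2 * Cr * K2 + 1; pose a := b ^+ 8.
have kk : 0 < 1 - kap by have /andP[al0 al1] := ha; lra.
have K10 : 0 <= K1 by apply: divr_ge0; [exact: powR_ge0|exact: ltW].
have M1 : 1 <= M by rewrite lerDr; exact: mulr_ge0.
have M0 : 0 < M by exact: lt_le_trans M1.
pose C0 := L 1 `^ (0 - varrho).
have C00 : 0 <= C0 by exact: powR_ge0.
(* The entry 1 is the margin of the continuation argument; the other one turns the bound in
   $H_\varrho$ into eps / 2 in H. *)
pose m := Num.min 1 (eps / 2 / (C0 + 1)).
have C1 : 0 < C0 + 1 by apply: ltr_wpDl.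
have m0 : 0 < m by rewrite lt_min ltr01 divr_gt0// divr_gt0.
have E0 : 0 < expR (a * T) by exact: expR_gt0.
pose e := m / (2 * M * expR (a * T)).
have D0 : 0 < 2 * M * expR (a * T) by apply: mulr_gt0 => //; exact: mulr_gt0.
have e0 : 0 < e by exact: divr_gt0.
have eE : 2 * M * e * expR (a * T) = m by rewrite /e; field; rewrite !gt_eqF.
have e20 : 0 < e / 2 by rewrite divr_gt0.
have Cr1 : 0 < Cr + 1 by apply: ltr_wpDl.
have [d d0 hd] := x_unif T0 xdom xc (divr_gt0 e20 Cr1).
have B11 : 0 < B + 1 by apply: ltr_wpDl.
have rv0 : 0 < varrho - rho by rewrite subr_gt0.
have [Y Y0 hY] := powR_small rv0 (divr_gt0 e20 B11).
have v0 : 0 < varrho by exact: le_lt_trans rv.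
have [Y2 Y20 hY2] := powR_small v0 (divr_gt0 eps0 (mulr_gt0 (ltr0Sn R 1) B11)).
have [n1 hn1] := lam_large c0 (Num.max Y Y2).
have [h1 h10 hh1] := powR_big (B + 1 + (B + MF * K1)) chi0.
exists n1; exists (Num.min (d / 2) h1); first by rewrite lt_min divr_gt0.
move=> n h y o nn /andP[h0]; rewrite le_min => /andP[hd2 hh] yr or t ht hc hg.
have Ln : Num.max Y Y2 <= L n.+1 by apply: hn1; exact: leqW.
have LY : Y <= L n.+1 by apply: le_trans Ln; rewrite le_max lexx.
have LY2 : Y2 <= L n.+1 by apply: le_trans Ln; rewrite le_max lexx orbT.
have xosc s r : 0 <= s <= T -> 0 <= r <= T -> `|s - r| <= h -> Cr * N (x s - x r) <= e / 2.
  move=> hs hr sr; have h3 : N (x s - x r) <= e / 2 / (Cr + 1).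
    by apply/ltW/hd => //; apply: (le_lt_trans sr); apply: (le_lt_trans hd2); lra.
  apply: (le_trans (ler_wpM2l Cr0 h3)).
  by rewrite mulrA ler_pdivrMr// mulrC ler_wpM2l ?(ltW e20)// lerDl.
have tail : L n.+1 `^ (rho - varrho) * B <= e / 2.
  have h3 : L n.+1 `^ (rho - varrho) <= e / 2 / (B + 1) by rewrite -opprB; exact: hY.
  apply: (le_trans (ler_wpM2r B0 h3)).
  by rewrite mulrAC ler_pdivrMr// ler_wpM2l ?(ltW e20)// lerDl.
have tame : B + 1 + (B + MF * K1) <= h `^ (- chi) by apply: hh1; rewrite h0.
have esm : 2 * M * e * expR (a * T) <= 1 by rewrite eE /m ge_min lexx.
have pb := path_bound hB MF0 hMF LF0 hLF erefl erefl erefl e0 esm h0 xosc tail tame yr or ht hc hg.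
have /andP[t0 tT] := ht.
have b1 : 0 <= b.
  apply: addr_ge0 => //; apply: mulr_ge0; first by do 2?[apply: mulr_ge0 => //].
  by apply: divr_ge0; [exact: powR_ge0|have /andP[al0 al1] := ha; lra].
have a0 : 0 <= a by exact: exprn_ge0.
have pb2 : N (Pproj n (x t) - y t) <= m.
  apply: (le_trans pb); rewrite -eE; apply: ler_wpM2l.
    by apply: mulr_ge0; [apply: mulr_ge0 => //; exact: ltW|exact: ltW].
  by rewrite ler_expR; apply: ler_wpM2l.
have n0E u : Hdom c 0 u -> `|u| <= Hnorm c 0 u.
  move=> hu; apply: norm_le_cf; first exact: Hnorm_ge0.
  move=> k; apply: le_trans (Hnorm_bessel k hu).
  by rewrite big_nat [leRHS]big_nat; apply: ler_sum => i _; rewrite powRr0 mul1r.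
have dP := Hdom_Pproj c varrho n (x t).
have dy : Hdom c varrho (y t) := Hdom_range c varrho (yr t ht).
have A1 : `|x t - Pproj n (x t)| <= eps / 2.
  have [z1 z2] := Hnorm_tail c0 n (ltW v0) (xdom t).
  apply: (le_trans (n0E _ z1)); apply: (le_trans z2).
  have h3 : L n.+1 `^ (0 - varrho) <= eps / (2 * (B + 1)) by rewrite sub0r; exact: hY2.
  apply: (@le_trans _ _ (eps / (2 * (B + 1)) * B)).
    by apply: ler_pM => //; [exact: powR_ge0|exact: Hnorm_ge0|exact: hB].
  rewrite -subr_ge0 (_ : _ - _ = eps / (2 * (B + 1))); last by field; rewrite gt_eqF.
  by rewrite divr_ge0 ?(ltW eps0)// mulr_ge0.
have A2 : `|Pproj n (x t) - y t| <= eps / 2.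
  have [z1 z2] := Hnorm_mono c0 (ltW v0) (HdomB dP dy).
  apply: (le_trans (n0E _ z1)); apply: (le_trans z2); rewrite -/C0.
  apply: (le_trans (ler_wpM2l C00 pb2)).
  apply: (@le_trans _ _ ((C0 + 1) * (eps / 2 / (C0 + 1)))).
    apply: ler_pM => //; [exact: ltW|by rewrite lerDl|by rewrite /m ge_min lexx orbT].
  by rewrite mulrC divfK// gt_eqF.
rewrite (splitr eps); apply: le_trans (lerD A1 A2); exact: ler_distD.
Qed.

End PathwiseMain.

(** * The smoothed noise *)

Section RealInequalities.
Variable R : realType.

(* Chebyshev's sum inequality gives the inductive step. *)
Lemma jensen_sum (I : Type) (r : seq I) (p z : I -> R) (q : nat) :
  (forall i, 0 <= p i) -> (forall i, 0 <= z i) ->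
  (\sum_(i <- r) p i * z i) ^+ q.+1 <=
  (\sum_(i <- r) p i) ^+ q * \sum_(i <- r) p i * z i ^+ q.+1.
Proof.
move=> p0 z0; set P := \sum_(i <- r) p i.
pose A m := \sum_(i <- r) p i * z i ^+ m.
have P0 : 0 <= P by exact: sumr_ge0.
have A0 m : 0 <= A m by apply: sumr_ge0 => i _; rewrite mulr_ge0 ?exprn_ge0.
have cheb m : A 1%N * A m <= P * A m.+1.
  have : 0 <= \sum_(i <- r) \sum_(j <- r) p i * p j * ((z i - z j) * (z i ^+ m - z j ^+ m)).
    apply: sumr_ge0 => i _; apply: sumr_ge0 => j _; apply: mulr_ge0; first exact: mulr_ge0.
    have [ij|ji] := leP (z i) (z j).
      by rewrite -mulrNN mulr_ge0// ?opprB subr_ge0// lerXn2r// nnegrE.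
    apply: mulr_ge0; rewrite subr_ge0; first exact: ltW.
    by apply: lerXn2r; rewrite ?nnegrE//; exact: ltW.
  have -> : \sum_(i <- r) \sum_(j <- r) p i * p j * ((z i - z j) * (z i ^+ m - z j ^+ m)) =
      2 * (P * A m.+1 - A 1%N * A m).
    transitivity (\sum_(i <- r) \sum_(j <- r) ((p i * z i ^+ m.+1) * p j - (p i * z i) * (p j * z j ^+ m)
       - (p i * z i ^+ m) * (p j * z j) + p i * (p j * z j ^+ m.+1))).
      by apply: eq_bigr => i _; apply: eq_bigr => j _; rewrite !exprS; ring.
    transitivity (A m.+1 * P - A 1%N * A m - A m * A 1%N + P * A m.+1); last by ring.
    rewrite /A /P !mulr_suml -!sumrB -big_split /=; apply: eq_bigr => i _.
    rewrite !mulr_sumr -!sumrB -big_split /=; apply: eq_bigr => j _.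
    by rewrite expr1.
  lra.
have -> : \sum_(i <- r) p i * z i = A 1%N by apply: eq_bigr => i _; rewrite expr1.
rewrite -/(A q.+1); elim: q => [|q IH]; first by rewrite expr1 expr0 mul1r.
rewrite exprSr; apply: (le_trans (ler_wpM2r (A0 1%N) IH)).
rewrite exprSr -!mulrA ler_wpM2l ?exprn_ge0// mulrC; exact: cheb.
Qed.

(** Comparison with the telescoping differences of k^(1 - s) / (s - 1), which is minus a primitive
    of k^(-s). *)
Lemma sum_powR (s : R) : 1 < s -> exists2 C : R, 0 <= C &
  forall n, \sum_(1 <= k < n.+1) k%:R `^ (- s) <= C.
Proof.
move=> s1; have s0 : 0 < s - 1 by rewrite subr_gt0.
exists (1 + (s - 1)^-1); first by rewrite addr_ge0// invr_ge0 ltW.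
pose g (k : nat) : R := k%:R `^ (1 - s) / (s - 1).
have step k : (0 < k)%N -> k.+1%:R `^ (- s) <= g k - g k.+1.
  move=> k0; have kR : 0 < k%:R :> R by rewrite ltr0n.
  have k1R : 0 < k.+1%:R :> R by rewrite ltr0n.
  have -> : k.+1%:R `^ (- s) = k.+1%:R `^ (1 - s) / k.+1%:R.
    by rewrite -[X in _ / X]powRr1 ?ltW// -powRN -powRD ?(gt_eqF k1R) ?implybT//; congr (_ `^ _); ring.
  rewrite /g -mulrBl ler_pdivlMr// mulrAC mulrC.
  have -> : k%:R `^ (1 - s) = k.+1%:R `^ (1 - s) * (k%:R / k.+1%:R) `^ (1 - s).
    by rewrite -powRM ?ltW ?divr_gt0//; congr (_ `^ _); field; rewrite gt_eqF.
  have hB : 1 + (s - 1) / k.+1%:R <= (k%:R / k.+1%:R) `^ (1 - s) :> R.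
    rewrite /powR (gt_eqF (divr_gt0 kR k1R)).
    apply: le_trans (expR_ge1Dx _); rewrite lerD2l.
    have h1 : ln (k%:R / k.+1%:R) <= - (k.+1%:R^-1) :> R.
      have := expR_ge1Dx (- (k.+1%:R^-1) : R); rewrite (_ : 1 + _ = k%:R / k.+1%:R); last first.
        by rewrite -natr1; field; rewrite natr1 gt_eqF.
      move=> h; have := @ler_ln R (k%:R / k.+1%:R) (expR (- k.+1%:R^-1)).
      by rewrite !posrE divr_gt0// expR_gt0 => /(_ isT isT); rewrite h expRK.
    have -> : (1 - s) * ln (k%:R / k.+1%:R) = (s - 1) * - ln (k%:R / k.+1%:R) by ring.
    by rewrite ler_wpM2l ?(ltW s0)// lerNr.
  set A := k.+1%:R `^ (1 - s); have A0 : 0 <= A by exact: powR_ge0.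
  move: hB; set B := _ `^ _ => hB.
  rewrite -subr_ge0 (_ : _ - _ = A * (B - (1 + (s - 1) / k.+1%:R))); last by ring.
  by rewrite mulr_ge0// subr_ge0.
have g0 k : 0 <= g k by rewrite divr_ge0 ?powR_ge0// ltW.
have main n : \sum_(1 <= k < n.+2) k%:R `^ (- s) <= 1 + g 1%N - g n.+1.
  elim: n => [|n IH].
    by rewrite big_nat1 powR1 addrK.
  rewrite big_nat_recr//=; apply: (le_trans (lerD IH (step n.+1 isT))).
  by rewrite addrA subrK.
case=> [|n]; first by rewrite big_geq// addr_ge0// invr_ge0 ltW.
apply: (le_trans (main n)); rewrite -addrA lerD2l {1}/g powR1 mul1r.
by rewrite gerBl.
Qed.

(** Interpolates between the bounds 1 and x; for one eigenvalue this is the Hölder continuity in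
    time of the semigroup. *)
Lemma one_sub_exp_le (x r : R) : 0 <= x -> 0 <= r <= 1 -> 1 - expR (- x) <= x `^ r.
Proof.
move=> x0 /andP[r0 r1]; have [x1|x1] := leP 1 x.
  apply: (@le_trans _ _ 1); first by rewrite gerBl expR_ge0.
  by have := ge0_ler_powR r0 ler01 x0 x1; rewrite powR1.
have [->|xn0] := eqVneq x 0.
  by rewrite oppr0 expR0 subrr powR_ge0.
have xp : 0 < x by rewrite lt_neqAle eq_sym xn0.
apply: (@le_trans _ _ x); first by have := expR_ge1Dx (- x); lra.
rewrite -[leLHS]powRr1//.
by rewrite /powR (negbTE xn0) ler_expR; have := ln_le0 (ltW x1); nra.
Qed.

(** * Energy of the linear flow on one cell *)

Section Cell.
Variables (n : nat) (lam_ v0 f : nat -> R).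
Hypothesis lam0 : forall k, (0 < k)%N -> 0 < lam_ k.

(* Solution at time s of v_k' = - lam_k v_k + f_k, v_k(0) = v0 k. *)
Definition flow k (s : R) : R :=
  expR (- (s * lam_ k)) * v0 k + f k * ((1 - expR (- (s * lam_ k))) / lam_ k).

Lemma is_derive_expRl (a x : R) : is_derive x 1 (fun s : R => expR (- (s * a))) (- a * expR (- (x * a))).
Proof.
have h1 : is_derive x 1 (fun s : R => - (s * a)) (- a).
  have h := is_deriveN (is_deriveM (is_derive_id x (1 : R)) (is_derive_cst a x 1)).
  by apply: (is_derive_eq h); rewrite scaler0 add0r /GRing.scale/= mulr1.
have h2 := is_derive_expR (- (x * a)).
have h := @is_derive1_comp _ (@expR R) (fun s => - (s * a)) x _ _ h2 h1.
by apply: (is_derive_eq h); rewrite mulrC.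
Qed.

Lemma is_derive_flow k (s : R) : (0 < k)%N ->
  is_derive s 1 (flow k) (- lam_ k * flow k s + f k).
Proof.
move=> k0; have lk := lam0 k0.
have h := is_derive_expRl (lam_ k) s.
have h1 : is_derive s 1 (fun s => (v0 k - f k / lam_ k) * expR (- (s * lam_ k)) + f k / lam_ k)
   ((v0 k - f k / lam_ k) * (- lam_ k * expR (- (s * lam_ k)))).
  have hm := is_deriveD (is_deriveZ (v0 k - f k / lam_ k) h) (is_derive_cst (f k / lam_ k) s 1).
  by apply: (is_derive_eq hm); rewrite addr0.
rewrite (_ : flow k = (fun s => (v0 k - f k / lam_ k) * expR (- (s * lam_ k)) + f k / lam_ k)).
  by apply: (is_derive_eq h1); field; rewrite gt_eqF.
by apply/funext => x; rewrite /flow; field; rewrite gt_eqF.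
Qed.

Let S (s : R) := \sum_(1 <= k < n.+1) flow k s ^+ 2.

Lemma is_derive_S (s : R) :
  is_derive s 1 S (\sum_(1 <= k < n.+1) 2 * flow k s * (- lam_ k * flow k s + f k)).
Proof.
rewrite /S; elim: n => [|m IH].
  rewrite (_ : (fun s0 => _) = cst 0); last by apply/funext => x; rewrite big_geq.
  by rewrite big_geq//; exact: is_derive_cst.
rewrite (_ : (fun s0 => _) = (fun s0 => \sum_(1 <= k < m.+1) flow k s0 ^+ 2 + flow m.+1 s0 ^+ 2)).
  have hf := @is_derive_flow m.+1 s isT.
  have h := is_deriveD IH (is_deriveM hf hf).
  rewrite big_nat_recr//=; move: h.
  rewrite (_ : (fun s0 => _ + _ ^+ 2) = (fun s0 => \sum_(1 <= k < m.+1) flow k s0 ^+ 2) + (flow m.+1 * flow m.+1)).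
    by move=> h; apply: (is_derive_eq h); congr (_ + _); rewrite /GRing.scale/=; ring.
  by apply/funext => x; rewrite /= expr2.
by apply/funext => x; rewrite big_nat_recr.
Qed.

(** The linear part dissipates exactly the sum of lam flow^2, so the hypothesis may spend that
    amount. What is left is S' <= 2 a S + 2 b, integrated by showing that exp (- 2 a s) S(s) - 2 b s
    does not increase. *)
Lemma cell_energy (a b d : R) : 0 <= a -> 0 <= b -> 0 <= d ->
  (forall s, 0 <= s <= d -> \sum_(1 <= k < n.+1) flow k s * f k <=
    a * S s + \sum_(1 <= k < n.+1) lam_ k * flow k s ^+ 2 + b) ->
  S d <= expR (2 * a * d) * (\sum_(1 <= k < n.+1) v0 k ^+ 2 + 2 * b * d).
Proof.
move=> a0 b0 d0 hab.
have S0 : S 0 = \sum_(1 <= k < n.+1) v0 k ^+ 2.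
  by apply: eq_bigr => k _; rewrite /flow mul0r oppr0 expR0 subrr mul0r mulr0 addr0 mul1r.
have [d00|dn0] := eqVneq d 0.
  by rewrite d00 !mulr0 expR0 mul1r addr0 S0.
have dp : 0 < d by rewrite lt_neqAle eq_sym dn0.
pose g s := expR (- (s * (2 * a))) * S s - 2 * b * s.
pose dS s := \sum_(1 <= k < n.+1) 2 * flow k s * (- lam_ k * flow k s + f k).
pose dg s := expR (- (s * (2 * a))) * (dS s - 2 * a * S s) - 2 * b.
have gd (s : R) : is_derive s 1 g (dg s).
  have h1 := is_deriveM (is_derive_expRl (2 * a) s) (is_derive_S s).
  have h2 := is_deriveB h1 (is_deriveZ (2 * b) (is_derive_id s (1 : R))).
  apply: (is_derive_eq h2); rewrite /dg /dS /GRing.scale/=; ring.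
have gc : {within `[0, d], continuous g}.
  apply: continuous_subspaceT => s; exact: is_derive_cont (gd s).
have [s sd gE] := MVT dp (fun s _ => gd s) gc.
move: sd; rewrite in_itv/= => /andP[s0 sd].
have dg0 : dg s <= 0.
  have hs : dS s <= 2 * a * S s + 2 * b.
    have := hab s; rewrite (ltW s0) (ltW sd) => /(_ isT) h.
    have -> : dS s = 2 * \sum_(1 <= k < n.+1) flow k s * f k - 2 * \sum_(1 <= k < n.+1) lam_ k * flow k s ^+ 2.
      by rewrite !mulr_sumr -sumrB; apply: eq_bigr => k _; ring.
    lra.
  have e1 : expR (- (s * (2 * a))) <= 1.
    by rewrite -expR0 ler_expR oppr_le0 mulr_ge0 ?(ltW s0)// mulr_ge0.
  have e0 := expR_ge0 (- (s * (2 * a))).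
  rewrite /dg subr_le0; apply: (@le_trans _ _ (expR (- (s * (2 * a))) * (2 * b))).
    by rewrite ler_wpM2l//; lra.
  by rewrite -[leRHS]mul1r ler_wpM2r// mulr_ge0.
have gle : g d <= g 0.
  by rewrite -subr_le0 gE subr0; apply: mulr_le0_ge0.
move: gle; rewrite /g mul0r oppr0 expR0 mul1r mulr0 subr0 S0 => gle.
have -> : 2 * a * d = d * (2 * a) by ring.
have E : expR (d * (2 * a)) * expR (- (d * (2 * a))) = 1 by rewrite -expRD subrr expR0.
have gle' : expR (- (d * (2 * a))) * S d <= \sum_(1 <= k < n.+1) v0 k ^+ 2 + 2 * b * d by rewrite -lerBlDr.
by have := ler_wpM2l (expR_ge0 (d * (2 * a))) gle'; rewrite [_ * (_ * S d)]mulrA E mul1r.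
Qed.

End Cell.
End RealInequalities.

(** * Sup norms of sine polynomials and chaining *)

Section SupNorm.
Variable R : realType.
Local Notation H := (L2_01 R).
Local Notation leb := (@lebesgue_measure R).
Local Notation TR := (measurableTypeR R).
Implicit Types (a : nat -> R) (n : nat).

Definition ftrig n a (x : R) : R := \sum_(1 <= k < n.+1) a k * sine_fun k x.

Lemma ftrig_cont n a (x : R) : {for x, continuous (ftrig n a)}.
Proof.
rewrite /ftrig; elim: n => [|n IH].
  rewrite (_ : (fun x => _) = cst 0); last by apply/funext => y; rewrite big_geq.
  exact: cvg_cst.
rewrite (_ : (fun x => _) = (fun x => ftrig n a x + a n.+1 * sine_fun n.+1 x)).
  apply: cvgD => //; apply: cvgM; first exact: cvg_cst.
  exact: continuous_sine.
by apply/funext => y; rewrite big_nat_recr.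
Qed.

Lemma sine_fun_le k (x : R) : `|sine_fun k x| <= 2 :> R.
Proof.
rewrite /sine_fun normrM ger0_norm ?sqrtr_ge0//.
apply: (@le_trans _ _ (Num.sqrt 2 * 1)).
  rewrite ler_wpM2l ?sqrtr_ge0//.
  by rewrite ler_norml sin_geN1 sin_le1.
rewrite mulr1; apply: le_of_sqr => //; rewrite sqr_sqrtr//; lra.
Qed.

Lemma ftrig_le n a (x : R) : `|ftrig n a x| <= \sum_(1 <= k < n.+1) `|a k| * 2.
Proof.
apply: (le_trans (ler_norm_sum _ _ _)); apply: ler_sum => k _.
by rewrite normrM ler_wpM2l// sine_fun_le.
Qed.

Definition supn n a : R := sup [set `|ftrig n a x| | x in `[0, 1]%classic].

Lemma supn_has_sup n a : has_sup [set `|ftrig n a x| | x in `[0, 1]%classic].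
Proof.
split; first by exists `|ftrig n a 0|; exists 0 => //=; rewrite in_itv/= lexx ler01.
by exists (\sum_(1 <= k < n.+1) `|a k| * 2) => _ [x _ <-]; exact: ftrig_le.
Qed.

Lemma supn_ub n a (x : R) : 0 <= x <= 1 -> `|ftrig n a x| <= supn n a.
Proof.
move=> hx; apply: ub_le_sup; first by have [] := supn_has_sup n a.
by exists x => //=; rewrite in_itv.
Qed.

Lemma supn_ge0 n a : 0 <= supn n a.
Proof. by apply: (le_trans (normr_ge0 (ftrig n a 0))); apply: supn_ub; rewrite lexx ler01. Qed.

Lemma fsum_ae n a : ae_eq (lebesgue01 R) setT (fsum n a : TR -> R) (ftrig n a).
Proof.
rewrite /fsum /ftrig; elim: n => [|n IH].
  have := @LzeroE _ TR R (lebesgue01 R) 2%:E (lee1n 2).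
  rewrite big_geq//; apply: filterS => x /(_ I) h _; rewrite big_geq//; exact: h.
have E : (\sum_(1 <= k < n.+2) a k *: eigf R k : H) =
    \sum_(1 <= k < n.+1) a k *: eigf R k + a n.+1 *: eigf R n.+1 by rewrite big_nat_recr.
rewrite E.
have h1 := LaddE (\sum_(1 <= i < n.+1) a i *: eigf R i) (a n.+1 *: eigf R n.+1).
have h2 := LscaleE (a n.+1) (eigf R n.+1).
have h3 := LclassE (Lfun_Sub (lee1n 2) (@sine_fun_Lfun R n.+1)).
move: h1 IH h2 h3; apply: filterS4 => x /(_ I) e1 /(_ I) e2 /(_ I) e3 /(_ I) e4 _.
rewrite [RHS]big_nat_recr//; apply: (etrans e1); rewrite e2; congr (_ + _).
by apply: (etrans e3); congr (_ * _); exact: e4.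
Qed.

(** The representative is a choice; two continuous functions differing at an interior point differ
    on an interval of positive measure, which equality almost everywhere excludes. *)
Lemma cont_reprE n (u : H) (x : R) : range (@Pproj R n) u -> 0 < x < 1 ->
  cont_repr u x = ftrig n (fun k => cf k u) x.
Proof.
move=> hu /andP[x0 x1].
have uE : u = fsum n (fun k => cf k u) by rewrite -PprojE (Pproj_range hu).
have hex : [set f : R -> R | {within `]0%R, 1%R[%classic, continuous f} /\
    ae_eq (lebesgue01 R) setT (u : R -> R) f] (ftrig n (fun k => cf k u)).
  split; first by apply: continuous_subspaceT => y; exact: ftrig_cont.
  by rewrite {1}uE; exact: fsum_ae.
have [gc gae] := getPex (ex_intro _ _ hex).
rewrite -/(cont_repr u) in gc gae.
pose g y := cont_repr u y - ftrig n (fun k => cf k u) y.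
have gx : {for x, continuous (cont_repr u)}.
  have xi : x \in `]0%R, 1%R[%classic by rewrite inE/= in_itv/= x0.
  have oI : open (`]0%R, 1%R[%classic : set R) by exact: interval_open.
  by move: gc; rewrite (continuous_open_subspace _ oI) => /(_ x xi).
have gcx : {for x, continuous g} by apply: cvgB => //; exact: ftrig_cont.
have gz : ae_eq (lebesgue01 R) setT (g : TR -> R) (fun=> 0).
  have [_ uae] := hex; move: gae uae; apply: filterS2 => y /(_ I) e1 /(_ I) e2 _.
  by rewrite /g -e1 -e2 subrr.
suff : g x = 0 by move/eqP; rewrite subr_eq0 => /eqP.
apply/eqP; apply: contraT => gn0.
have ge0 : 0 < `|g x| by rewrite normr_gt0.
have /cvgrPdist_lt/(_ _ ge0) := gcx.
rewrite near_nbhs => /nbhs_ballP[r /= r0 hr].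
pose lo := Num.max 0 (x - r); pose hi := Num.min 1 (x + r).
have lh : lo < hi.
  by rewrite /lo /hi lt_min !gt_max; lra.
have sub : `]lo, hi[%classic `<=` ~` [set y : TR | setT y -> g y = (fun=> 0) y].
  move=> y; rewrite /= in_itv/= /lo /hi lt_min !gt_max => /andP[/andP[y0 ylo] /andP[y1 yhi]] /(_ I) gy.
  have : ball x r y by rewrite /ball/= ltr_distl; lra.
  by move/hr => /=; rewrite gy subr0 ltxx.
have [N [mN N0 subN]] := gz.
have : (lebesgue01 R `]lo, hi[%classic <= lebesgue01 R N)%E.
  by apply: le_measure; rewrite ?inE//; exact: subset_trans sub subN.
have -> : lebesgue01 R N = 0%E by exact: N0.
have -> : lebesgue01 R `]lo, hi[%classic = (hi - lo)%:E.
  have -> : (lebesgue01 R : set TR -> \bar R) `]lo, hi[%classic = leb (`]lo, hi[%classic `&` `]0%R, 1%R[%classic) by [].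
  rewrite setIidl; last first.
    move=> y; rewrite /= !in_itv/= /lo /hi lt_min !gt_max; lra.
  by rewrite lebesgue_measure_itv/= lte_fin lh EFinD EFinN.
by rewrite lee_fin subr_le0 leNgt lh.
Qed.

(** A general increasing [p] serves both the square in [phi] and the power gamma in [Phi]. *)
Lemma sup_cont_repr n (u : H) (p : R -> R) : range (@Pproj R n) u ->
  (forall x y, 0 <= x -> x <= y -> p x <= p y) ->
  sup [set p `|cont_repr u x| | x in `]0%R, 1%R[%classic] <= p (supn n (fun k => cf k u)).
Proof.
move=> hu pm; apply: ge_sup.
  exists (p `|cont_repr u (1 / 2)|); exists (1 / 2) => //=; rewrite in_itv/=; lra.
move=> _ [x /= + <-]; rewrite in_itv/= => hx; apply: pm => //.
rewrite (cont_reprE hu hx); apply: supn_ub; have /andP[x0 x1] := hx.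
by rewrite !ltW.
Qed.

Section chaining.
Variables (n : nat) (a : nat -> R).
Local Notation f := (ftrig n a).
Let node l (i : nat) : R := i%:R / (4 ^ l)%:R.
Definition gdiff (l i : nat) : R := f (i.+1%:R / (4 ^ l)%:R) - f (i%:R / (4 ^ l)%:R).
Definition gmax l : R := \big[Num.max/0]_(i < (4 ^ l).+1) `|f (i%:R / (4 ^ l)%:R)|.
Definition dmax l : R := \big[Num.max/0]_(i < 4 ^ l) `|gdiff l i|.

Let p4 l : (0 : R) < (4 ^ l)%:R. Proof. by rewrite ltr0n expn_gt0. Qed.

Lemma ftrig0 : f 0 = 0.
Proof. by rewrite /ftrig big1// => k _; rewrite /sine_fun mulr0 sin0 !mulr0. Qed.

Lemma dmax_ge0 l : 0 <= dmax l. Proof. exact: bigmax_ge_id. Qed.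

Lemma gdiff_le l i : (i < 4 ^ l)%N -> `|gdiff l i| <= dmax l.
Proof. by move=> il; have := @le_bigmax _ _ _ 0 (fun i : 'I_(4 ^ l) => `|gdiff l i|) (Ordinal il). Qed.

(** A node of level l + 1 lies at most three steps to the right of a node of level l, whence the
    factor 3; the chain ends at level 0, where the value at 0 vanishes. *)
Lemma node_le l (i : nat) : (i <= 4 ^ l)%N -> `|f (node l i)| <= \sum_(m < l.+1) 3 * dmax m.
Proof.
elim: l i => [|l IH] i il.
  rewrite big_ord_recr big_ord0 /= add0r; case: i il => [_|[_|//]].
    by rewrite /node mul0r ftrig0 normr0 mulr_ge0// dmax_ge0.
  have := @gdiff_le 0 0 isT; rewrite /gdiff mul0r ftrig0 subr0 => h.
  by apply: (le_trans h); rewrite ler_peMl ?dmax_ge0//; lra.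
rewrite big_ord_recr /=; set D := dmax l.+1; have D0 : 0 <= D by exact: dmax_ge0.
have step (j m : nat) : (j + m <= 4 ^ l.+1)%N -> `|f (node l.+1 (j + m))| <= `|f (node l.+1 j)| + m%:R * D.
  elim: m => [|m IHm] jm; first by rewrite addn0 mul0r addr0.
  have h1 : (j + m < 4 ^ l.+1)%N by rewrite -addnS.
  have h2 := IHm (ltnW h1); have h3 := gdiff_le h1.
  rewrite addnS.
  have : `|f (node l.+1 (j + m).+1)| <= `|f (node l.+1 (j + m))| + `|gdiff l.+1 (j + m)|.
    by rewrite -[X in `|X| <= _](subrK (f (node l.+1 (j + m)))) addrC ler_normD.
  by move: h3; rewrite -/D -natr1 mulrDl mul1r; lra.
have iE := divn_eq i 4; set j := (i %/ 4)%N in iE; set r := (i %% 4)%N in iE.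
have r4 : (r < 4)%N by exact: ltn_pmod.
have jl : (j <= 4 ^ l)%N by rewrite /j; apply: (leq_trans (leq_div2r 4 il)); rewrite expnSr mulnK.
have nodeE : node l.+1 (j * 4) = node l j.
  rewrite /node expnSr !natrM; field; by rewrite gt_eqF.
have := step (j * 4)%N r; rewrite -iE => /(_ il); rewrite nodeE => h.
apply: (le_trans h); apply: lerD; first exact: IH.
by apply: ler_wpM2r => //; rewrite (ler_nat R r 3) -ltnS.
Qed.

Lemma gmax_le l : gmax l <= \sum_(m < l.+1) 3 * dmax m.
Proof.
apply: bigmax_le => [|i _].
  by apply: sumr_ge0 => m _; rewrite mulr_ge0// dmax_ge0.
by apply: node_le; rewrite -ltnS.
Qed.

Lemma dmaxX l q : (0 < q)%N -> dmax l ^+ q <= \sum_(i < 4 ^ l) `|gdiff l i| ^+ q.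
Proof.
move=> q0; rewrite /dmax; set S := \sum_(i < _) _.
have S0 : 0 <= S by apply: sumr_ge0 => i _; rewrite exprn_ge0.
suff [] : let x := \big[Num.max/0]_(i < 4 ^ l) `|gdiff l i| in 0 <= x /\ x ^+ q <= S by [].
apply: (big_ind (fun x => 0 <= x /\ x ^+ q <= S)).
- by rewrite expr0n gtn_eqF.
- by move=> x y [x0 hx] [y0 hy]; case: (leP x y).
- move=> i _; split => //; rewrite /S (bigD1 i)//= lerDl.
  by apply: sumr_ge0 => j _; rewrite exprn_ge0.
Qed.

Lemma gmax_chain l q : gmax l ^+ q.+1 <= 3 ^+ q.+1 * 10 ^+ q *
  \sum_(m < l.+1) (10 / 9) ^+ (q.+1 * m) * \sum_(i < 4 ^ m) `|gdiff m i| ^+ q.+1.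
Proof.
have g0 : 0 <= gmax l by exact: bigmax_ge_id.
apply: (@le_trans _ _ ((\sum_(m < l.+1) 3 * dmax m) ^+ q.+1)).
  by apply: lerXn2r; rewrite ?nnegrE ?gmax_le// (le_trans g0)// gmax_le.
rewrite -mulr_sumr exprMn -[leRHS]mulrA ler_wpM2l ?exprn_ge0//.
have E : \sum_(m < l.+1) dmax m = \sum_(m < l.+1) (9 / 10) ^+ m * ((10 / 9) ^+ m * dmax m).
  apply: eq_bigr => m _; rewrite mulrA -exprMn (_ : 9 / 10 * (10 / 9) = 1) ?expr1n ?mul1r//.
  by field.
have p0 (m : 'I_l.+1) : 0 <= (9 / 10) ^+ m :> R by rewrite exprn_ge0.
have z0 (m : 'I_l.+1) : 0 <= (10 / 9) ^+ m * dmax m by rewrite mulr_ge0 ?exprn_ge0 ?dmax_ge0.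
rewrite E; apply: (le_trans (jensen_sum _ q p0 z0)).
have geo k : \sum_(m < k) (9 / 10) ^+ m <= 10 * (1 - (9 / 10) ^+ k) :> R.
  elim: k => [|k IH]; first by rewrite big_ord0 expr0 subrr mulr0.
  by rewrite big_ord_recr/= exprS; lra.
apply: ler_pM.
- by rewrite exprn_ge0// sumr_ge0.
- by apply: sumr_ge0 => m _; rewrite mulr_ge0// exprn_ge0.
- apply: lerXn2r; rewrite ?nnegrE ?sumr_ge0//.
  apply: (le_trans (geo _)); rewrite ger_pMr// gerBl exprn_ge0//.
- apply: ler_sum => m _; rewrite [(_ * dmax _) ^+ _]exprMn -exprM mulnC.
  have le1 : (9 / 10) ^+ m <= 1 :> R by rewrite exprn_ile1//; lra.
  rewrite -[leRHS]mul1r; apply: ler_pM => //.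
    by rewrite mulr_ge0 ?exprn_ge0 ?dmax_ge0.
  by rewrite ler_wpM2l ?exprn_ge0// dmaxX.
Qed.

Lemma gmax_cvg : gmax l @[l --> \oo] --> supn n a.
Proof.
apply/cvgrPdist_lt => eps e0; have e2 : 0 < eps / 2 by rewrite divr_gt0.
have [_ [x /= + <-] hx] := sup_adherent e2 (supn_has_sup n a).
rewrite in_itv/= => /andP[x0 x1]; rewrite -/(supn n a) in hx.
have /cvgrPdist_lt/(_ _ e2) := @ftrig_cont n a x.
rewrite near_nbhs => /nbhs_ballP[r /= r0 hr].
have ri : 0 < r^-1 by rewrite invr_gt0.
exists (Num.truncn r^-1).+1 => // l /= hl.
have l4 : r^-1 < (4 ^ l)%:R.
  apply: (lt_le_trans (truncnS_gt _)); rewrite ler_nat.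
  by apply: (leq_trans hl); apply: ltnW; exact: ltn_expl.
have rl : ((4 ^ l)%:R)^-1 < r by rewrite -[ltRHS]invrK ltf_pV2 ?posrE.
have xl0 : 0 <= x * (4 ^ l)%:R by rewrite mulr_ge0// ltW.
pose i := Num.truncn (x * (4 ^ l)%:R).
have /andP[i1 i2] := truncn_itv xl0; rewrite -/i in i1 i2.
have il : (i <= 4 ^ l)%N.
  by rewrite -(ler_nat R); apply: (le_trans i1); rewrite ler_piMl// ltW.
have b1 : i%:R / (4 ^ l)%:R <= x by rewrite ler_pdivrMr.
have b2 : x < i%:R / (4 ^ l)%:R + ((4 ^ l)%:R)^-1.
  by rewrite -[X in _ < _ + X]mul1r -mulrDl ltr_pdivlMr// natr1.
have : ball x r (i%:R / (4 ^ l)%:R) by rewrite /ball/= ltr_distl; lra.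
move/hr => /= hf.
have il' : (i < (4 ^ l).+1)%N by rewrite ltnS.
have g1 : `|f (i%:R / (4 ^ l)%:R)| <= gmax l.
  exact: (@le_bigmax _ _ _ 0 (fun i : 'I_(4 ^ l).+1 => `|f (i%:R / (4 ^ l)%:R)|) (Ordinal il')).
have g2 : gmax l <= supn n a.
  apply: bigmax_le => [|j _]; first exact: supn_ge0.
  apply: supn_ub; rewrite divr_ge0//= ler_pdivrMr// mul1r ler_nat -ltnS; exact: ltn_ord.
have h3 : `|f x| <= `|f (i%:R / (4 ^ l)%:R)| + `|f x - f (i%:R / (4 ^ l)%:R)|.
  by rewrite -[X in `|X| <= _](subrK (f (i%:R / (4 ^ l)%:R))) addrC ler_normD.
rewrite ger0_norm ?subr_ge0//; lra.
Qed.

End chaining.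
End SupNorm.

(** * Moments of the Gaussian coordinates *)

Section Moments.
Context d (Omega : measurableType d) (R : realType).
Variables (P : probability Omega R).
Local Notation H := (L2_01 R).
Local Notation leb := (@lebesgue_measure R).
Local Notation TR := (measurableTypeR R).

Lemma int_sum_le (I : Type) (r : seq I) (p b : I -> R) (f : I -> Omega -> R) :
  (forall i, 0 <= p i) -> (forall i, measurable_fun [set: Omega] (f i)) ->
  (forall i w, 0 <= f i w) -> (forall i, (\int[P]_w (f i w)%:E <= (b i)%:E)%E) ->
  (\int[P]_w (\sum_(i <- r) p i * f i w)%:E <= (\sum_(i <- r) p i * b i)%:E)%E.
Proof.
move=> p0 mf f0 fb; elim: r => [|i r IH].
  under eq_integral do rewrite big_nil.
  by rewrite big_nil integral_cst// mul0e.
under eq_integral do rewrite big_cons.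
have mS : measurable_fun [set: Omega] (fun w => \sum_(j <- r) p j * f j w).
  by apply: measurable_sum => j; exact: measurable_funM.
have m1 : measurable_fun [set: Omega] (fun w => p i * f i w) by exact: measurable_funM.
have z1 w : 0 <= p i * f i w by exact: mulr_ge0.
have z2 w : 0 <= \sum_(j <- r) p j * f j w by apply: sumr_ge0 => j _; exact: mulr_ge0.
rewrite (intD _ _ m1 mS z1 z2)// big_cons EFinD; apply: leeD => //.
rewrite (intZ _ measurableT (p0 i) (mf i) (f0 i)) EFinM.
by apply: lee_wpmul2l; [rewrite lee_fin|exact: fb].
Qed.

Lemma sin_lip (x y : R) : `|sin x - sin y| <= `|x - y|.
Proof.
wlog xy : x y / x <= y => [hw|].
  have [xy|yx] := leP x y; first exact: hw.
  by rewrite distrC [leRHS]distrC; apply: hw; exact: ltW.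
move: xy; rewrite le_eqVlt => /predU1P[->|xy]; first by rewrite !subrr.
have sc : {within `[x, y], continuous sin}.
  by apply: continuous_subspaceT => z; exact: continuous_sin.
have [z _ E] := MVT xy (fun z _ => is_derive_sin z) sc.
rewrite distrC E normrM [leRHS]distrC ler_piMl//.
by rewrite ler_norml cos_geN1 cos_le1.
Qed.

Lemma pi_le4 : pi <= 4 :> R.
Proof. by have /andP[_ /ltW h] := @pihalf_02 R; move: h; rewrite ler_pdivrMr//; lra. Qed.

(** Interpolation between boundedness and the Lipschitz bound: with u = k 4^-l the square is at most
    a constant times min (1, u^2), hence times u^(1/2). The resulting k^(1/2) still leaves a
    summable k^(-5/4) against [inv_lam_le]. *)
Lemma sine_diff (k l : nat) (x y : R) : (0 < k)%N -> `|x - y| <= ((4 ^ l)%:R)^-1 ->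
  (sine_fun k x - sine_fun k y) ^+ 2 <= 32 * (k%:R `^ (1 / 2) * (2 ^+ l)^-1).
Proof.
move=> k0 xy.
have kR : 0 < k%:R :> R by rewrite ltr0n.
pose u : R := k%:R * ((4 ^ l)%:R)^-1.
have p4 : 0 < ((4 ^ l)%:R)^-1 :> R by rewrite invr_gt0 ltr0n expn_gt0.
have u0 : 0 < u by rewrite mulr_gt0.
have E : k%:R `^ (1 / 2) * (2 ^+ l)^-1 = u `^ (1 / 2).
  rewrite /u powRM ?ltW//; congr (_ * _).
  have -> : ((4 ^ l)%:R)^-1 = ((2 ^+ l)^-1) ^+ 2 :> R.
    have e4 : 4%:R = 2 ^+ 2 :> R by rewrite -natrX.
    by rewrite natrX e4 exprVn -!exprM mulnC.
  have s0 : 0 <= (2 ^+ l)^-1 :> R by rewrite invr_ge0 exprn_ge0.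
  rewrite -(powR_mulrn 2 s0) -powRrM (_ : 2%:R * (1 / 2) = 1); last by field.
  by rewrite powRr1.
rewrite E.
have s2 : Num.sqrt 2 ^+ 2 = 2 :> R by rewrite sqr_sqrtr.
have F : (sine_fun k x - sine_fun k y) ^+ 2 = 2 * (sin (k%:R * pi * x) - sin (k%:R * pi * y)) ^+ 2.
  by rewrite /sine_fun -mulrBr exprMn s2.
rewrite F; set D := sin _ - sin _.
have D2 : D ^+ 2 <= 4.
  have : `|D| <= 2.
    apply: (le_trans (ler_normB _ _)).
    have h z : `|sin z| <= 1 :> R by rewrite ler_norml sin_geN1 sin_le1.
    have := h (k%:R * pi * x); have := h (k%:R * pi * y); lra.
  by rewrite -[D ^+ 2]real_normK ?num_real//; have := normr_ge0 D; nra.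
have Du : D ^+ 2 <= 16 * u ^+ 2.
  have h : `|D| <= 4 * u.
    apply: (le_trans (sin_lip _ _)); rewrite -mulrBr normrM ger0_norm; last first.
      by rewrite mulr_ge0 ?pi_ge0// ltW.
    rewrite -mulrA mulrCA; apply: ler_pM; rewrite ?pi_ge0 ?pi_le4 ?mulr_ge0 ?(ltW kR)//.
    by rewrite /u ler_wpM2l ?(ltW kR).
  rewrite -[D ^+ 2]real_normK ?num_real//.
  have -> : 16 * u ^+ 2 = (4 * u) ^+ 2 by ring.
  by apply: lerXn2r; rewrite ?nnegrE// mulr_ge0// ltW.
have [u1|u1] := leP 1 u.
  have : 1 <= u `^ (1 / 2).
    by have := ge0_ler_powR (_ : 0 <= 1 / 2 :> R) ler01 (ltW u0) u1; rewrite powR1; apply; lra.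
  lra.
have : u ^+ 2 <= u `^ (1 / 2).
  rewrite -(powR_mulrn 2 (ltW u0)) /powR (gt_eqF u0) ler_expR.
  have := ln_le0 (ltW u1); lra.
lra.
Qed.

Variables (c : R) (c0 : 0 < c).
Local Notation L := (lam c).

(* The exponent 8 makes etam m^(-1/8) = 2^(-m), the factor gained in the variance. *)
Definition etam (m : nat) : R := 2 ^+ (8 * m).

Lemma etam_gt0 m : 0 < etam m. Proof. exact: exprn_gt0. Qed.

Lemma etam_root m : etam m `^ (1 / 8) = 2 ^+ m.
Proof.
rewrite /etam mulnC exprM -powR_mulrn ?exprn_ge0// -powRrM (_ : 8%:R * (1 / 8) = 1); last by field.
by rewrite powRr1 ?exprn_ge0.
Qed.

Lemma lam_powR k (s : R) : L k `^ s = (c * pi ^+ 2) `^ s * k%:R `^ (2 * s).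
Proof.
have cp : 0 <= c * pi ^+ 2 by rewrite mulr_ge0 ?exprn_ge0 ?pi_ge0// ltW.
have k2 : 0 <= k%:R ^+ 2 :> R by exact: exprn_ge0.
by rewrite /lam (powRM _ cp k2) -(powR_mulrn 2 (ler0n R k)) -powRrM.
Qed.

(** lam^(7/8) eta^(1/8) is at most the larger of the two, hence at most lam + eta. The small power
    of eta gains 2^-m, and lam^(-7/8), of order k^(-7/4), leaves room for regularity in space. *)
Lemma inv_lam_le (k m : nat) : (0 < k)%N ->
  (L k + etam m)^-1 <= (c * pi ^+ 2) `^ (- (7 / 8)) * k%:R `^ (- (7 / 4)) * (2 ^+ m)^-1.
Proof.
move=> k0; have Lp := lam_gt0 c0 k0.
have kR : 0 < k%:R :> R by rewrite ltr0n.
have e0 := etam_gt0 m; set e := etam m in e0 *.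
have E1 : (c * pi ^+ 2) `^ (- (7 / 8)) * k%:R `^ (- (7 / 4)) = L k `^ (- (7 / 8)).
  by rewrite lam_powR; congr (_ * _ `^ _); field.
have E2 : (2 ^+ m)^-1 = e `^ (- (1 / 8)) by rewrite powRN etam_root.
rewrite E1 E2 !powRN -invfM lef_pV2 ?posrE; [|exact: addr_gt0|by rewrite mulr_gt0 ?powR_gt0].
have h (M : R) : 0 < M -> L k <= M -> e <= M -> M <= L k + e -> L k `^ (7 / 8) * e `^ (1 / 8) <= L k + e.
  move=> M0 LM eM Me; apply: le_trans Me.
  have -> : M = M `^ (7 / 8) * M `^ (1 / 8).
    rewrite -powRD ?(gt_eqF M0) ?implybT// (_ : 7 / 8 + 1 / 8 = 1); last by field.
    by rewrite powRr1// ltW.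
  apply: ler_pM; rewrite ?powR_ge0//; apply: ge0_ler_powR; rewrite ?nnegrE ?(ltW Lp) ?(ltW M0) ?(ltW e0)//; lra.
have [le1|le1] := leP (L k) e; first by apply: (h e) => //; rewrite lerDr ltW.
by apply: (h (L k)) => //; [exact: ltW|rewrite lerDl ltW].
Qed.

Lemma var_inc : exists2 C : R, 0 < C & forall (n l m : nat) (x y : R),
  `|x - y| <= ((4 ^ l)%:R)^-1 ->
  \sum_(1 <= k < n.+1) (sine_fun k x - sine_fun k y) ^+ 2 / (L k + etam m) <=
  C * (2 ^+ m)^-1 * (2 ^+ l)^-1.
Proof.
have s1 : 1 < 5 / 4 :> R by lra.
have [C1 C10 hC1] := sum_powR s1.
pose K := (c * pi ^+ 2) `^ (- (7 / 8)).
have K0 : 0 <= K by exact: powR_ge0.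
exists (32 * K * C1 + 1); first by rewrite ltr_wpDl// !mulr_ge0.
move=> n l m x y xy.
have pm : 0 <= (2 ^+ m)^-1 :> R by rewrite invr_ge0 exprn_ge0.
have pl : 0 <= (2 ^+ l)^-1 :> R by rewrite invr_ge0 exprn_ge0.
apply: (@le_trans _ _ (\sum_(1 <= k < n.+1) 32 * K * (2 ^+ m)^-1 * (2 ^+ l)^-1 * k%:R `^ (- (5 / 4)))).
  rewrite big_nat [leRHS]big_nat; apply: ler_sum => k /andP[k0 _].
  have h1 := sine_diff k0 xy; have h2 := inv_lam_le m k0.
  have kR : 0 < k%:R :> R by rewrite ltr0n.
  have i0 : 0 <= (L k + etam m)^-1.
    by rewrite invr_ge0 addr_ge0//; [exact: lam_ge0|exact/ltW/etam_gt0].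
  apply: (le_trans (ler_pM (sqr_ge0 _) i0 h1 h2)).
  have -> : k%:R `^ (- (5 / 4)) = k%:R `^ (1 / 2) * k%:R `^ (- (7 / 4)) :> R.
    by rewrite -powRD ?(gt_eqF kR) ?implybT//; congr (_ `^ _); field.
  by rewrite le_eqVlt; apply/orP; left; apply/eqP; rewrite -/K; ring.
rewrite -mulr_sumr.
have h := ler_wpM2l (_ : 0 <= 32 * K * (2 ^+ m)^-1 * (2 ^+ l)^-1) (hC1 n).
apply: (le_trans (h _)); first by rewrite !mulr_ge0.
have : 0 <= (2 ^+ m)^-1 * (2 ^+ l)^-1 :> R by exact: mulr_ge0.
nra.
Qed.

Variable T : R.
Variable W : R -> H -> Omega -> R.
Hypothesis T0 : 0 < T.
Hypothesis hW : is_cylindrical_wiener P T W.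

(* The coordinates w k are jointly Gaussian with covariance at most
   diag (1 / (lam k + eta)). *)
Definition gauss_coords n (eta : R) (w : nat -> Omega -> R) :=
  (forall k, measurable_fun [set: Omega] (w k)) /\
  forall a : nat -> R, exists2 f : TR -> H,
    isG P T W f (fun om => \sum_(1 <= k < n.+1) a k * w k om) &
    (\int[leb]_s (`|f s| ^+ 2)%:E <= (\sum_(1 <= k < n.+1) a k ^+ 2 / (L k + eta))%:E)%E.

Lemma supn_measurable n (w : nat -> Omega -> R) :
  (forall k, measurable_fun [set: Omega] (w k)) ->
  (forall l, measurable_fun [set: Omega] (fun om => gmax n (w^~ om) l)) /\
  measurable_fun [set: Omega] (fun om => supn n (w^~ om)).
Proof.
move=> mw.
have mf (x : R) : measurable_fun [set: Omega] (fun om => `|ftrig n (w^~ om) x|).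
  apply: measurableT_comp => //.
  by apply: measurable_sum => k; apply: measurable_funM.
have mg l : measurable_fun [set: Omega] (fun om => gmax n (w^~ om) l).
  rewrite /gmax; elim: (index_enum _) => [|i r IH].
    by under eq_fun do rewrite big_nil; exact: measurable_cst.
  under eq_fun do rewrite big_cons; exact: measurable_maxr.
split => //; apply: (@measurable_fun_cvg _ _ _ setT (fun l om => gmax n (w^~ om) l)) => //.
by move=> om _; exact: gmax_cvg.
Qed.

(** Each of the 4^j increments of level j has a moment of order (2^-m 2^-j)^Q, so the chain
    converges geometrically once (10/9)^(2 Q) 4 2^-Q < 1, which [3 < Q] ensures. Fatou's lemma
    passes from grid maxima to the supremum. *)
Lemma supn_moment (Q : nat) : (3 < Q)%N -> exists2 K : R, 0 <= K &
  forall n m w, gauss_coords n (etam m) w ->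
  (\int[P]_om (supn n (w^~ om) ^+ (2 * Q))%:E <= (K * (2 ^+ m)^-1 ^+ Q)%:E)%E.
Proof.
move=> Q3; have [C C0 hC] := var_inc.
have Q0 : (0 < Q)%N by exact: leq_trans Q3.
pose q := (2 * Q).-1; have qE : q.+1 = (2 * Q)%N by rewrite prednK// muln_gt0.
pose K := 3 ^+ q.+1 * 10 ^+ q * (momC R Q * C ^+ Q * (5 / 2)).
have M0 := momC_ge0 R Q.
have K0 : 0 <= K by rewrite !mulr_ge0 ?exprn_ge0// ltW.
exists K => // n m w [mw gw].
have [mg ms] := supn_measurable n mw.
have bnd l : (\int[P]_om (gmax n (w^~ om) l ^+ (2 * Q))%:E <= (K * (2 ^+ m)^-1 ^+ Q)%:E)%E.
  have mgd j i : measurable_fun [set: Omega] (fun om => `|gdiff n (w^~ om) j i| ^+ (2 * Q)).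
    apply: measurable_funX; apply: measurableT_comp => //.
    by apply: measurable_funB; apply: measurable_sum => k; apply: measurable_funM.
  have mom (j : nat) i : (\int[P]_om (`|gdiff n (w^~ om) j i| ^+ (2 * Q))%:E <=
      (momC R Q * (C * (2 ^+ m)^-1 * (2 ^+ j)^-1) ^+ Q)%:E)%E.
    pose x : R := i.+1%:R / (4 ^ j)%:R; pose y : R := i%:R / (4 ^ j)%:R.
    have xy : `|x - y| <= ((4 ^ j)%:R)^-1.
      by rewrite /x /y -mulrBl -natr1 [_ + 1]addrC addrK mul1r ger0_norm// invr_ge0.
    have [f fG fv] := gw (fun k => sine_fun k x - sine_fun k y).
    have q0 : 0 < C * (2 ^+ m)^-1 * (2 ^+ j)^-1 by rewrite !mulr_gt0 ?invr_gt0 ?exprn_gt0.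
    have fv' : (\int[leb]_s (`|f s| ^+ 2)%:E <= (C * (2 ^+ m)^-1 * (2 ^+ j)^-1)%:E)%E.
      by apply: (le_trans fv); rewrite lee_fin; exact: hC.
    have := isG_moment T0 hW fG q0 Q0 fv'.
    rewrite (@eq_integral _ _ _ P setT (fun om => (`|gdiff n (w^~ om) j i| ^+ (2 * Q))%:E))//.
    move=> om _; congr EFin; rewrite exprM [RHS]exprM real_normK ?num_real//; congr ((_ ^+ _) ^+ _).
    rewrite /gdiff /ftrig -sumrB; apply: eq_bigr => k _; rewrite -/x -/y; ring.
  apply: (@le_trans _ _ (\int[P]_om (\sum_(j < l.+1) (3 ^+ q.+1 * 10 ^+ q * (10 / 9) ^+ (q.+1 * j)) *
      \sum_(i < 4 ^ j) 1 * `|gdiff n (w^~ om) j i| ^+ (2 * Q))%:E)%E).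
    apply: int_le => //.
    - exact: measurable_funX.
    - apply: measurable_sum => j; apply: measurable_funM => //.
      by apply: measurable_sum => i; apply: measurable_funM.
    - by move=> om _; rewrite exprM exprn_ge0// sqr_ge0.
    - move=> om _; have := gmax_chain n (w^~ om) l q; rewrite qE => /le_trans; apply.
      rewrite -qE mulr_sumr; apply: ler_sum => j _; rewrite mulrA.
      by apply: ler_wpM2l; [rewrite !mulr_ge0 ?exprn_ge0|apply: ler_sum => i _; rewrite mul1r].
  apply: (@le_trans _ _ (\sum_(j < l.+1) (3 ^+ q.+1 * 10 ^+ q * (10 / 9) ^+ (q.+1 * j)) *
      \sum_(i < 4 ^ j) 1 * (momC R Q * (C * (2 ^+ m)^-1 * (2 ^+ j)^-1) ^+ Q))%:E).
    apply: (@int_sum_le _ _ _ (fun j : 'I_l.+1 => \sum_(i < 4 ^ j) 1 * (momC R Q * (C * (2 ^+ m)^-1 * (2 ^+ j)^-1) ^+ Q))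
      (fun (j : 'I_l.+1) om => \sum_(i < 4 ^ j) 1 * `|gdiff n (w^~ om) j i| ^+ (2 * Q))).
    - by move=> j; rewrite !mulr_ge0 ?exprn_ge0.
    - by move=> j; apply: measurable_sum => i; apply: measurable_funM.
    - by move=> j om; apply: sumr_ge0 => i _; rewrite mul1r exprn_ge0.
    - by move=> j; apply: (@int_sum_le _ _ (fun=> 1)) => // i om; rewrite exprn_ge0.
  rewrite lee_fin.
  have term j : (3 ^+ q.+1 * 10 ^+ q * (10 / 9) ^+ (q.+1 * j)) *
      (\sum_(i < 4 ^ j) 1 * (momC R Q * (C * (2 ^+ m)^-1 * (2 ^+ j)^-1) ^+ Q)) <=
      3 ^+ q.+1 * 10 ^+ q * (momC R Q * C ^+ Q) * (2 ^+ m)^-1 ^+ Q * (3 / 5) ^+ j.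
    set y := _ ^+ Q; have -> : \sum_(i < 4 ^ j) 1 * (momC R Q * y) = 4 ^+ j * (momC R Q * y).
      by rewrite sumr_const card_ord mul1r -[LHS]mulr_natl natrX.
    rewrite /y qE !(exprMn Q).
    (* At Q = 4 the ratio is about 0.58; every further unit of Q multiplies it by 50/81. *)
    have r0 : (10 / 9) ^+ (2 * Q) * 4 * (2^-1) ^+ Q <= 3 / 5 :> R.
      have [Q' ->] : exists Q', Q = (4 + Q')%N by exists (Q - 4)%N; rewrite subnKC.
      rewrite exprM mulrAC -exprMn exprD.
      have le1 : ((10 / 9) ^+ 2 * 2^-1) ^+ Q' <= 1 :> R by rewrite exprn_ile1//; lra.
      have ge0 : 0 <= ((10 / 9) ^+ 2 * 2^-1) ^+ Q' :> R by rewrite exprn_ge0//; lra.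
      have x4 : ((10 / 9) ^+ 2 * 2^-1) ^+ 4 * 4 <= 3 / 5 :> R by lra.
      move: le1 ge0 x4; move: (_ ^+ Q') (_ ^+ 4) => u v u1 u0 hv.
      rewrite mulrAC; apply: (@le_trans _ _ (3 / 5 * u)); first exact: ler_wpM2r.
      lra.
    have r00 : 0 <= (10 / 9) ^+ (2 * Q) * 4 * (2^-1) ^+ Q :> R.
      by rewrite !mulr_ge0 ?exprn_ge0.
    have hj := lerXn2r j r00 (_ : 0 <= 3 / 5 :> R) r0.
    have E : (10 / 9) ^+ (2 * Q * j) * 4 ^+ j * ((2 ^+ j)^-1) ^+ Q =
       ((10 / 9) ^+ (2 * Q) * 4 * (2^-1) ^+ Q) ^+ j :> R.
      have e1 : (2 ^+ j)^-1 ^+ Q = (2^-1 ^+ Q) ^+ j :> R by rewrite -exprVn -!exprM mulnC.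
      by rewrite e1 exprM -!exprMn.
    apply: (@le_trans _ _ (3 ^+ (2 * Q) * 10 ^+ q * (momC R Q * C ^+ Q) * (2 ^+ m)^-1 ^+ Q *
       ((10 / 9) ^+ (2 * Q * j) * 4 ^+ j * ((2 ^+ j)^-1) ^+ Q))).
      by rewrite le_eqVlt; apply/orP; left; apply/eqP; ring.
    rewrite E ler_wpM2l//; last by apply: hj; lra.
    by rewrite !mulr_ge0 ?exprn_ge0 ?invr_ge0 ?exprn_ge0// ltW.
  apply: (le_trans (ler_sum _ (fun (j : 'I_l.+1) _ => term j))).
  rewrite -mulr_sumr.
  have geo k : \sum_(j < k) (3 / 5) ^+ j <= 5 / 2 * (1 - (3 / 5) ^+ k) :> R.
    elim: k => [|k IH]; first by rewrite big_ord0 expr0 subrr mulr0.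
    by rewrite big_ord_recr/= exprS; lra.
  have geo' : \sum_(j < l.+1) (3 / 5) ^+ j <= 5 / 2 :> R.
    by apply: (le_trans (geo _)); rewrite ger_pMr// gerBl exprn_ge0//; lra.
  have A0 : 0 <= 3 ^+ q.+1 * 10 ^+ q * (momC R Q * C ^+ Q) * (2 ^+ m)^-1 ^+ Q.
    by rewrite !mulr_ge0 ?exprn_ge0 ?invr_ge0 ?exprn_ge0// ltW.
  apply: (le_trans (ler_wpM2l A0 geo')); rewrite /K le_eqVlt; apply/orP; left; apply/eqP; ring.
apply: (@ae_fatou _ _ _ P (fun l om => (gmax n (w^~ om) l ^+ (2 * Q))%:E)).
- by move=> l; apply/measurable_EFinP; exact: measurable_funX.
- by apply/measurable_EFinP; exact: measurable_funX.
- by move=> l om; rewrite lee_fin exprM exprn_ge0// sqr_ge0.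
- apply: aeW => om; apply: cvg_natE.
  have hg := @gmax_cvg R n (w^~ om).
  elim: (2 * Q)%N => [|k IH]; first by under eq_fun do rewrite expr0; exact: cvg_cst.
  by rewrite exprS; under eq_fun do rewrite exprS; exact: cvgM.
- by apply: nearW => l; exact: bnd.
Qed.

(** The variables lam_k w_k^2 have bounded moments and enter with the weights lam_k^(2 varrho - 1),
    of order k^(4 varrho - 2), which are summable because varrho < 1/4; Jensen's inequality does the
    rest. *)
Lemma Hnorm_moment (varrho : R) (Q : nat) : varrho < 1 / 4 -> (0 < Q)%N ->
  exists2 K : R, 0 <= K & forall n eta w, 0 <= eta -> gauss_coords n eta w ->
  (\int[P]_om ((\sum_(1 <= k < n.+1) (L k `^ varrho * w k om) ^+ 2) ^+ Q)%:E <= K%:E)%E.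
Proof.
move=> v4 Q0.
have s1 : 1 < 2 - 4 * varrho by lra.
have [C1 C10 hC1] := sum_powR s1.
pose A := (c * pi ^+ 2) `^ (2 * varrho - 1).
have A0 : 0 <= A by exact: powR_ge0.
have cp : 0 < c * pi ^+ 2 by rewrite mulr_gt0 ?exprn_gt0 ?pi_gt0.
exists ((A * C1) ^+ Q * momC R Q); first by rewrite mulr_ge0 ?exprn_ge0 ?mulr_ge0 ?momC_ge0.
move=> n eta w eta0 [mw gw].
pose p (k : nat) := if (0 < k)%N then L k `^ (2 * varrho - 1) else 0.
pose z k om := L k * w k om ^+ 2.
have p0 k : 0 <= p k by rewrite /p; case: ifP => // _; exact: powR_ge0.
have z0 k om : 0 <= z k om by rewrite mulr_ge0 ?lam_ge0 ?sqr_ge0.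
have mz k : measurable_fun [set: Omega] (fun om => z k om ^+ Q).
  by apply: measurable_funX; apply: measurable_funM => //; exact: measurable_funX.
have pS : \sum_(1 <= k < n.+1) p k <= A * C1.
  apply: (@le_trans _ _ (\sum_(1 <= k < n.+1) A * k%:R `^ (- (2 - 4 * varrho)))).
    rewrite big_nat [leRHS]big_nat; apply: ler_sum => k /andP[k0 _]; rewrite /p k0.
    have kR : 0 < k%:R :> R by rewrite ltr0n.
    rewrite lam_powR -/A le_eqVlt; apply/orP; left; apply/eqP; congr (_ * _ `^ _); ring.
  by rewrite -mulr_sumr ler_wpM2l.
have pS0 : 0 <= \sum_(1 <= k < n.+1) p k by exact: sumr_ge0.
have mom k : (\int[P]_om (if (0 < k <= n)%N then z k om ^+ Q else 0)%:E <= (momC R Q)%:E)%E.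
  case E : (0 < k <= n)%N; last by rewrite integral0 lee_fin momC_ge0.
  have /andP[k0 kn] := E.
  have Lk := lam_gt0 c0 k0.
  have [f fG fv] := gw (fun j => (j == k)%:R).
  have Li : 0 < (L k)^-1 by rewrite invr_gt0.
  have selE (g : nat -> R) : \sum_(1 <= j < n.+1) (j == k)%:R * g j = g k.
    rewrite (bigD1_seq k) ?iota_uniq ?mem_index_iota ?k0 ?ltnS//= eqxx mul1r big1 ?addr0//.
    by move=> j /negbTE ->; rewrite mul0r.
  have fv' : (\int[leb]_s (`|f s| ^+ 2)%:E <= ((L k)^-1)%:E)%E.
    apply: (le_trans fv); rewrite lee_fin.
    have -> : \sum_(1 <= j < n.+1) (j == k)%:R ^+ 2 / (L j + eta) = \sum_(1 <= j < n.+1) (j == k)%:R * (L j + eta)^-1.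
      by apply: eq_bigr => j _; case: eqP; rewrite ?expr1n// expr0n.
    by rewrite selE lef_pV2 ?posrE ?ltr_wpDr// lerDl.
  have := isG_moment T0 hW fG Li Q0 fv'.
  under eq_integral do rewrite selE.
  move=> h.
  have -> : (\int[P]_om (z k om ^+ Q)%:E = (L k ^+ Q)%:E * \int[P]_om (w k om ^+ (2 * Q))%:E)%E.
    rewrite -intZ ?exprn_ge0 ?(ltW Lk)//; last 2 first.
    - exact: measurable_funX.
    - by move=> om; rewrite exprM exprn_ge0// sqr_ge0.
    by apply: eq_integral => om _; rewrite /z exprMn exprM.
  apply: (le_trans (lee_wpmul2l _ h)); first by rewrite lee_fin exprn_ge0// ltW.
  rewrite -EFinM lee_fin mulrCA -exprMn divff ?gt_eqF// expr1n mulr1//.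
have Q1 : Q = Q.-1.+1 by rewrite prednK.
apply: (@le_trans _ _ (\int[P]_om (\sum_(k <- index_iota 1 n.+1) ((A * C1) ^+ Q.-1 * p k) *
   (if (0 < k <= n)%N then z k om ^+ Q else 0))%:E)%E).
  apply: int_le => //.
  - apply: measurable_funX; apply: measurable_sum => k; apply: measurable_funX.
    exact: measurable_funM.
  - apply: measurable_sum => k; apply: measurable_funM => //.
    by case: (0 < k <= n)%N; [exact: mz|exact: measurable_cst].
  - by move=> om _; apply: exprn_ge0; apply: sumr_ge0 => k _; exact: sqr_ge0.
  - move=> om _.
    have -> : \sum_(1 <= k < n.+1) (L k `^ varrho * w k om) ^+ 2 = \sum_(k <- index_iota 1 n.+1) p k * z k om.
      rewrite big_nat [RHS]big_nat; apply: eq_bigr => k /andP[k0 _]; rewrite /p k0 /z mulrA.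
      have Lk := lam_gt0 c0 k0.
      rewrite exprMn; congr (_ * _); rewrite -[X in _ * X]powRr1 ?(ltW Lk)//.
      rewrite -powRD ?(gt_eqF Lk) ?implybT// -powR_mulrn ?powR_ge0// -powRrM; congr (_ `^ _); ring.
    rewrite Q1; apply: (le_trans (jensen_sum _ Q.-1 p0 (z0^~ om))).
    have -> : \sum_(k <- index_iota 1 n.+1) (A * C1) ^+ Q.-1.+1.-1 * p k * (if (0 < k <= n)%N then z k om ^+ Q.-1.+1 else 0) =
        (A * C1) ^+ Q.-1 * \sum_(k <- index_iota 1 n.+1) p k * z k om ^+ Q.-1.+1.
      rewrite mulr_sumr big_nat [RHS]big_nat; apply: eq_bigr => k /andP[k0 kn].
      by rewrite k0 -ltnS kn/= mulrA.
    apply: ler_wpM2r.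
      by apply: sumr_ge0 => k _; rewrite mulr_ge0// exprn_ge0.
    by apply: lerXn2r; rewrite ?nnegrE ?mulr_ge0.
have AC0 : 0 <= (A * C1) ^+ Q.-1 by rewrite exprn_ge0 ?mulr_ge0.
apply: (@le_trans _ _ (\sum_(k <- index_iota 1 n.+1) ((A * C1) ^+ Q.-1 * p k) * momC R Q)%:E).
  apply: (@int_sum_le _ _ _ (fun=> momC R Q)) => //.
  - by move=> k; rewrite mulr_ge0.
  - by move=> k; case: (0 < k <= n)%N; [exact: mz|exact: measurable_cst].
  - by move=> k om; case: ifP => _ //; exact: exprn_ge0.
rewrite lee_fin -mulr_suml -mulr_sumr ler_wpM2r ?momC_ge0//.
by rewrite [in leRHS]Q1 exprSr ler_wpM2l.
Qed.

End Moments.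

(** * Variance of the damped noise recursion *)

Section SmoothedNoise.
Context d (Omega : measurableType d) (R : realType).
Variables (P : probability Omega R) (c : R) (c0 : 0 < c).
Local Notation H := (L2_01 R).
Local Notation leb := (@lebesgue_measure R).
Local Notation TR := (measurableTypeR R).
Local Notation L := (lam c).
Variable T : R.
Variable W : R -> H -> Omega -> R.
Hypothesis T0 : 0 < T.
Hypothesis hW : is_cylindrical_wiener P T W.

(* Resolvent-damped copy of the noise o sampled at the times tau; the damping
   rate eta makes its variance small. *)
Fixpoint wrec (eta : R) (tau : nat -> R) (o : nat -> nat -> R) (j k : nat) : R :=
  if j is i.+1 then
    (1 + eta * (tau i.+1 - tau i))^-1 *
    (expR (- ((tau i.+1 - tau i) * L k)) * wrec eta tau o i k +
     (o i.+1 k - expR (- ((tau i.+1 - tau i) * L k)) * o i k))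
  else 0.

(** Kernel of the k-th coordinate of the stochastic convolution at time t, extended by 0 so that
    kernels for different times live on the same line. *)
Definition resp (k : nat) (t : R) (s : R) : R := (0 < s < t)%R%:R * expR (- ((t - s) * L k)).

Lemma measurable_resp k t : measurable_fun [set: TR] (resp k t).
Proof.
apply: measurable_funM.
  rewrite (_ : (fun _ => _) = \1_(`]0, t[%classic : set TR)).
    by apply: measurable_indic; exact: measurable_itv.
  by apply/funext => s; rewrite indicE mem_setE in_itv.
apply: (measurableT_comp (@measurable_expR R)).
apply: continuous_measurable_fun => s.
apply: cvgN; apply: cvgM; last exact: cvg_cst.
by apply: cvgB; [exact: cvg_cst|exact: cvg_id].
Qed.

(** The semigroup property removes the past: the noise entering one step of [wrec] is an integral
    over [t, t'[ only, hence orthogonal to everything before t. *)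
Lemma resp_diff k (t t' s : R) : t <= t' ->
  resp k t' s - expR (- ((t' - t) * L k)) * resp k t s =
  (t <= s)%R%:R * resp k t' s.
Proof.
move=> tt'; rewrite /resp; have [ts|st] := leP t s.
  by rewrite mul1r andbF mul0r mulr0 subr0.
rewrite mul0r (lt_le_trans st tt') andbT.
have -> : expR (- ((t' - s) * L k)) = expR (- ((t' - t) * L k)) * expR (- ((t - s) * L k)).
  by rewrite -expRD; congr expR; ring.
by case: (0 < s); rewrite ?mul1r ?mul0r ?mulr0 subrr.
Qed.

Lemma resp_var k (t t' : R) : (0 < k)%N -> t <= t' ->
  (\int[leb]_s (((t <= s)%R%:R * resp k t' s) ^+ 2)%:E <=
   ((1 - expR (- ((t' - t) * L k)) ^+ 2) / (2 * L k))%:E)%E.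
Proof.
move=> k0 tt'; have Lk := lam_gt0 c0 k0.
have [<-|tn] := eqVneq t t'.
  rewrite subrr mul0r oppr0 expR0 expr1n subrr mul0r integral0_eq// => s _.
  rewrite /resp; have [ts|st] := leP t s; last by rewrite mul0r expr0n.
  by rewrite andbF mul0r mulr0 expr0n.
have ltt : t < t' by rewrite lt_neqAle tn.
have mI (A : set TR) : measurable A -> measurable_fun [set: TR] (\1_A : TR -> R).
  by move=> mA; exact: measurable_indic.
have mr : measurable_fun [set: TR] (fun s : TR => ((t <= s)%R%:R * resp k t' s) ^+ 2).
  apply: measurable_funX; apply: measurable_funM; last exact: measurable_resp.
  rewrite (_ : (fun _ => _) = \1_(`[t, +oo[%classic : set TR)).
    by apply: mI; exact: measurable_itv.
  by apply/funext => s; rewrite indicE mem_setE in_itv/= andbT.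
have cg (s : R) : {for s, continuous (fun s : R => expR (- ((t' - s) * (2 * L k))))}.
  apply: continuous_comp; last exact: continuous_expR.
  apply: cvgN; apply: cvgM; last exact: cvg_cst.
  by apply: cvgB; [exact: cvg_cst|exact: cvg_id].
have mg : measurable_fun [set: TR] (fun s : TR => expR (- ((t' - s) * (2 * L k)))).
  exact: continuous_measurable_fun.
apply: (@le_trans _ _ (\int[leb]_(s in (`[t, t'[%classic : set TR)) (expR (- ((t' - s) * (2 * L k))))%:E)%E).
  rewrite [leRHS]integral_mkcond; apply: ge0_le_integral => //.
  - by move=> s _; rewrite lee_fin sqr_ge0.
  - exact/measurable_EFinP.
  - apply/(measurable_restrictT _ _).1; first exact: measurable_itv.
    by apply: measurable_funTS; exact/measurable_EFinP.
  - move=> s _; rewrite patchE mem_setE in_itv/= /resp.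
    have [ts|st] := leP t s; last by rewrite mul0r expr0n.
    have [st'|st'] := ltP s t'; last by rewrite andbF mul0r mulr0 expr0n.
    rewrite andbT mul1r lee_fin exprMn -expRM_natl.
    have -> : 2%:R * - ((t' - s) * L k) = - ((t' - s) * (2 * L k)) by ring.
    by case: (0 < s); rewrite ?expr1n ?mul1r// expr0n mul0r expR_ge0.
rewrite -integral_itv_obnd_cbnd; last by apply: measurable_funTS; exact/measurable_EFinP.
pose F (s : R) := expR (- ((t' - s) * (2 * L k))) / (2 * L k).
have dF (s : R) : is_derive s 1 F (expR (- ((t' - s) * (2 * L k)))).
  have h1 : is_derive s 1 (fun s : R => - ((t' - s) * (2 * L k))) (2 * L k).
    have h := is_deriveN (is_deriveM (is_derive_rev t' s) (is_derive_cst (2 * L k) s 1)).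
    by apply: (is_derive_eq h); rewrite scaler0 add0r /GRing.scale/= mulrN1 opprK.
  have h2 := is_derive_expR (- ((t' - s) * (2 * L k))).
  have h3 := @is_derive1_comp _ (@expR R) (fun s : R => - ((t' - s) * (2 * L k))) s _ _ h2 h1.
  have h4 := is_deriveZ (2 * L k)^-1 h3.
  rewrite (_ : F = (2 * L k)^-1 \*: (@expR R \o (fun s : R => - ((t' - s) * (2 * L k))))).
    by apply: (is_derive_eq h4); rewrite /GRing.scale/=; field; rewrite gt_eqF.
  by apply/funext => x; rewrite /F /GRing.scale/= mulrC.
rewrite (integral_oo_FTC ltt (fun s _ => dF s) (fun s _ => cg s)) lee_fin /F.
rewrite subrr mul0r oppr0 expR0 -mulrBl -expRM_natl.
by rewrite (_ : 2%:R * - ((t' - t) * L k) = - ((t' - t) * (2 * L k)))//; ring.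
Qed.

Section family.
Variables (n : nat) (eta : R) (tau : nat -> R) (o : R -> Omega -> H).
Hypothesis eta0 : 0 <= eta.
Hypothesis tau0 : tau 0%N = 0.
Hypothesis tauS : forall j, tau j <= tau j.+1.
Hypothesis om : forall j, borel_rv (o (tau j)).
Hypothesis oG : forall j k, (0 < k <= n)%N ->
  isG P T W (fun s : TR => resp k (tau j) s *: eigf R k) (fun w => cf k (o (tau j) w)).
Local Notation w j k := (fun om => wrec eta tau (fun i l => cf l (o (tau i) om)) j k).

Lemma wrec_measurable j k : measurable_fun [set: Omega] (w j k).
Proof.
elim: j => [|j IH] /=; first exact: measurable_cst.
have mo i : measurable_fun [set: Omega] (fun om => cf k (o (tau i) om)).
  exact: measurable_ip_rv.
apply: measurable_funM => //; apply: measurable_funD; first exact: measurable_funM.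
by apply: measurable_funB => //; exact: measurable_funM.
Qed.

(** The vanishing of [g] from time tau j on is carried through the induction so that past and new
    noise are orthogonal and their variances add. *)
Lemma wrec_isG j k : (0 < k <= n)%N -> exists g : TR -> R,
  [/\ measurable_fun [set: TR] g,
      isG P T W (fun s => g s *: eigf R k) (w j k),
      forall s : R, tau j <= s -> g s = 0 &
      (\int[leb]_s (g s ^+ 2)%:E <= ((L k + eta)^-1)%:E)%E].
Proof.
move=> kn; have /andP[k0 _] := kn; have Lk := lam_gt0 c0 k0.
have Le : 0 < L k + eta by rewrite ltr_wpDr.
elim: j => [|j [g [mg gG g0 gv]]].
  exists (fun=> 0); split => //.
  - by have := isG0 P T W; under [X in _ -> isG _ _ _ X _]eq_fun do rewrite scale0r.
  - by rewrite integral0_eq// ?lee_fin ?invr_ge0 ?(ltW Le)// => s _; rewrite expr0n.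
set t := tau j in g0 *; set t' := tau j.+1.
have tt' : t <= t' by exact: tauS.
pose E := expR (- ((t' - t) * L k)); pose q := (1 + eta * (t' - t))^-1.
pose r (s : TR) : R := (t <= s)%R%:R * resp k t' s.
have E0 : 0 <= E by exact: expR_ge0.
have E1 : E <= 1 by rewrite -expR0 ler_expR oppr_le0 mulr_ge0 ?subr_ge0// ltW.
have mr : measurable_fun [set: TR] r.
  have -> : r = (fun s : TR => resp k t' s - E * resp k t s).
    by apply/funext => s; rewrite resp_diff.
  apply: measurable_funB; first exact: measurable_resp.
  by apply: measurable_funM => //; exact: measurable_resp.
have gr s : g s * r s = 0.
  by rewrite /r; have [ts|st] := leP t s; rewrite ?(g0 _ ts) ?mul0r// mulr0.
exists (fun s => q * (E * g s + r s)); split.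
- by apply: measurable_funM => //; apply: measurable_funD => //; exact: measurable_funM.
- have h1 := isG_lin hW (- E) (oG j kn) (oG j.+1 kn).
  have h2 := isG_Z hW q (isG_lin hW E gG h1).
  have -> : (fun s : TR => (q * (E * g s + r s)) *: eigf R k) =
     (fun s : TR => q *: (E *: (g s *: eigf R k) + (- E *: (resp k t s *: eigf R k) + resp k t' s *: eigf R k))).
    apply/funext => s; rewrite !scalerA -!scalerDl scalerA; congr (_ *: _); congr (_ * _).
    by rewrite /r -(resp_diff k s tt') -/E; ring.
  have -> : (fun om => wrec eta tau (fun i l => cf l (o (tau i) om)) j.+1 k) =
     (fun om => q * (E * wrec eta tau (fun i l => cf l (o (tau i) om)) j k +
        (- E * cf k (o t om) + cf k (o t' om)))).
    by apply/funext => x /=; rewrite -/t -/t' -/E -/q; congr (_ * (_ + _)); ring.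
  exact: h2.
- move=> s ts; rewrite g0 ?(le_trans tt')// /r /resp (_ : (0 < s < t') = false).
    by rewrite mul0r !mulr0 addr0 mulr0.
  by apply/negbTE; rewrite negb_and -!leNgt ts orbT.
- have q20 : 0 <= q ^+ 2 by exact: sqr_ge0.
  rewrite (@eq_integral _ _ _ leb setT (fun s => (q ^+ 2 * (E ^+ 2 * g s ^+ 2 + r s ^+ 2))%:E)); last first.
    move=> s _; congr EFin; rewrite exprMn; congr (_ * _).
    have -> : (E * g s + r s) ^+ 2 = E ^+ 2 * g s ^+ 2 + r s ^+ 2 + 2 * E * (g s * r s) by ring.
    by rewrite gr mulr0 addr0.
  have mg2 : measurable_fun [set: TR] (fun s => g s ^+ 2) by exact: measurable_funX.
  have mr2 : measurable_fun [set: TR] (fun s => r s ^+ 2) by exact: measurable_funX.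
  have m1 : measurable_fun [set: TR] (fun s => E ^+ 2 * g s ^+ 2) by exact: measurable_funM.
  have z1 (s : TR) : 0 <= E ^+ 2 * g s ^+ 2 by rewrite mulr_ge0 ?sqr_ge0.
  have z2 (s : TR) : 0 <= r s ^+ 2 by exact: sqr_ge0.
  have z3 (s : TR) : 0 <= g s ^+ 2 by exact: sqr_ge0.
  rewrite (intZ _ measurableT q20 (measurable_funD m1 mr2) (fun s => addr_ge0 (z1 s) (z2 s))).
  rewrite (intD _ measurableT m1 mr2 z1 z2) (intZ _ measurableT (sqr_ge0 E) mg2 z3).
  have rv := resp_var k0 tt'; rewrite -/E in rv.
  have dE : 1 - E <= (t' - t) * L k.
    by have := expR_ge1Dx (- ((t' - t) * L k)); rewrite -/E; lra.
  apply: (@le_trans _ _ ((q ^+ 2)%:E * ((E ^+ 2)%:E * ((L k + eta)^-1)%:E + ((1 - E ^+ 2) / (2 * L k))%:E))%E).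
    apply: lee_wpmul2l; first by rewrite lee_fin.
    apply: leeD; last exact: rv.
    by apply: lee_wpmul2l; first by rewrite lee_fin sqr_ge0.
  rewrite [X in (X <= _)%E](_ : _ = (q ^+ 2 * (E ^+ 2 * (L k + eta)^-1 + (1 - E ^+ 2) / (2 * L k)))%:E)//.
  rewrite lee_fin.
  have eh : 0 <= eta * (t' - t) by rewrite mulr_ge0// subr_ge0.
  have q1 : 0 < 1 + eta * (t' - t) by rewrite ltr_pwDl.
  rewrite /q exprVn ler_pdivrMl ?exprn_gt0//.
  (* The damping closes the induction: since 1 - E^2 <= 2 lam (t' - t), the left side is at most 1 +
     eta (t' - t). *)
  have main : E ^+ 2 + (1 - E ^+ 2) * ((L k + eta) / (2 * L k)) <= (1 + eta * (t' - t)) ^+ 2.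
    have -> : (1 - E ^+ 2) * ((L k + eta) / (2 * L k)) = (1 - E ^+ 2) / 2 + eta * ((1 - E ^+ 2) / (2 * L k)).
      by field; rewrite gt_eqF.
    have h1 : (1 - E ^+ 2) / (2 * L k) <= t' - t.
      have h2 : 1 - E ^+ 2 <= 2 * (1 - E) by have := sqr_ge0 (1 - E); lra.
      have h3 : 1 - E ^+ 2 <= (t' - t) * (2 * L k).
        by rewrite mulrCA; apply: (le_trans h2); rewrite ler_wpM2l.
      by rewrite ler_pdivrMr// mulr_gt0.
    have h2 : eta * ((1 - E ^+ 2) / (2 * L k)) <= eta * (t' - t) by rewrite ler_wpM2l.
    nra.
  have -> : E ^+ 2 * (L k + eta)^-1 + (1 - E ^+ 2) / (2 * L k) =
     (E ^+ 2 + (1 - E ^+ 2) * ((L k + eta) / (2 * L k))) / (L k + eta).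
    by field; rewrite !gt_eqF.
  by rewrite ler_wpM2r// invr_ge0 ltW.
Qed.

(** Different coordinates are integrals along the orthogonal vectors e_k, so the variances in a
    linear combination add up. *)
Lemma wrec_gauss j : gauss_coords P c T W n eta (fun k => w j k).
Proof.
split; first by move=> k; exact: wrec_measurable.
move=> a.
have Hk k : exists g : TR -> R, (0 < k <= n)%N ->
  [/\ measurable_fun [set: TR] g,
      isG P T W (fun s => g s *: eigf R k) (w j k) &
      (\int[leb]_s (g s ^+ 2)%:E <= ((L k + eta)^-1)%:E)%E].
  have [kn|kn] := boolP (0 < k <= n)%N; last by exists (fun=> 0).
  by have [g [h1 h2 _ h3]] := wrec_isG j kn; exists g.
have [g hg] := choice Hk.
have main m : (m <= n)%N -> isG P T W (fun s => fsum m (fun k => a k * g k s))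
    (fun om => \sum_(1 <= k < m.+1) a k * wrec eta tau (fun i l => cf l (o (tau i) om)) j k) /\
  (\int[leb]_s (`|fsum m (fun k => a k * g k s)| ^+ 2)%:E <=
   (\sum_(1 <= k < m.+1) a k ^+ 2 / (L k + eta))%:E)%E.
  elim: m => [|m IH] mn.
    split.
      have := isG0 P T W.
      rewrite (_ : (fun s => fsum 0 _) = (fun=> 0)); last by apply/funext => s; rewrite /fsum big_geq.
      by rewrite (_ : (fun om => \sum_(_ <= _ < _) _) = (fun=> 0))//; apply/funext => s; rewrite big_geq.
    rewrite big_geq// integral0_eq// => s _.
    by rewrite /fsum big_geq// normr0 expr0n.
  have [IH1 IH2] := IH (ltnW mn).
  have [mg gG gv] := hg m.+1 mn.
  split.
    rewrite (_ : (fun s => fsum m.+1 _) = (fun s : TR => a m.+1 *: (g m.+1 s *: eigf R m.+1) +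
        fsum m (fun k => a k * g k s))); last first.
      by apply/funext => s; rewrite /fsum big_nat_recr// addrC scalerA.
    rewrite (_ : (fun om => \sum_(_ <= _ < _) _) = (fun om => a m.+1 * wrec eta tau (fun i l => cf l (o (tau i) om)) j m.+1 +
        \sum_(1 <= k < m.+1) a k * wrec eta tau (fun i l => cf l (o (tau i) om)) j k)); last first.
      by apply/funext => s; rewrite big_nat_recr//= addrC.
    have hh := isG_lin hW (a m.+1) gG IH1.
    exact hh.
  have mgk k : (0 < k <= n)%N -> measurable_fun [set: TR] (fun s => (a k * g k s) ^+ 2).
    by move=> kn; have [h _ _] := hg k kn; apply: measurable_funX; exact: measurable_funM.
  have m1 : measurable_fun [set: TR] (fun s => `|fsum m (fun k => a k * g k s)| ^+ 2).
    by have [_ wf _] := IH1; exact: wmeas_norm2.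
  have m2 : measurable_fun [set: TR] (fun s => g m.+1 s ^+ 2) by exact: measurable_funX.
  have m3 : measurable_fun [set: TR] (fun s => a m.+1 ^+ 2 * g m.+1 s ^+ 2) by exact: measurable_funM.
  have z1 (s : TR) : 0 <= `|fsum m (fun k => a k * g k s)| ^+ 2 by exact: sqr_ge0.
  have z2 (s : TR) : 0 <= g m.+1 s ^+ 2 by exact: sqr_ge0.
  have z3 (s : TR) : 0 <= a m.+1 ^+ 2 * g m.+1 s ^+ 2 by rewrite mulr_ge0 ?sqr_ge0.
  rewrite (@eq_integral _ _ _ leb setT (fun s => (`|fsum m (fun k => a k * g k s)| ^+ 2 + a m.+1 ^+ 2 * g m.+1 s ^+ 2)%:E)); last first.
    by move=> s _; rewrite !norm_fsum big_nat_recr//= exprMn.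
  rewrite (intD _ measurableT m1 m3 z1 z3) (intZ _ measurableT (sqr_ge0 _) m2 z2).
  have a20 : (0 <= (a m.+1 ^+ 2)%:E)%E by rewrite lee_fin sqr_ge0.
  rewrite big_nat_recr//; exact: (leeD IH2 (lee_wpmul2l a20 gv)).
have [h1 h2] := main n (leqnn n).
by exists (fun s => fsum n (fun k => a k * g k s)).
Qed.

End family.
End SmoothedNoise.

(** * Energy estimate for the scheme *)

Section SchemeEnergy.
Variable R : realType.
Local Notation H := (L2_01 R).
Local Notation leb := (@lebesgue_measure R).
Local Notation TR := (measurableTypeR R).
Variables (c alpha : R) (c0 : 0 < c) (ha : 0 <= alpha <= 1 / 2).
Variables (V : completeNormedModType R) (iota : {linear H -> V}).
Hypothesis hV : is_Hcompletion c (- alpha) iota.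
Variables (rho varrho theta vartheta chi T : R).
Hypothesis hrho : 0 <= rho < varrho.
Hypothesis hvarrho : varrho < 1 / 4.
Hypothesis theta0 : 0 < theta.
Hypothesis vt0 : 0 < vartheta.
Hypothesis hchi : 0 < chi <= (varrho - rho) / (1 + vartheta).
Hypothesis T0 : 0 < T.
Variables (F : H -> V) (xi : H).
Hypothesis hlip : forall n, (0 < n)%N -> forall v w : L2_01 R,
  range (@Pproj R n) v -> range (@Pproj R n) w ->
  `|F v - F w| <= theta *
    (1 + Hnorm c rho v `^ vartheta + Hnorm c rho w `^ vartheta) *
    Hnorm c rho (v - w).
Local Notation L := (lam c).
Local Notation N := (Hnorm c varrho).
Local Notation Nr := (Hnorm c rho).
Local Notation ext t := (extend iota (expA c t)).
Local Notation boch t f := (bochner_integral leb (`]0%R, t[%classic : set TR) f).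

Section recursion.
Variables (n : nat) (h : R) (y o : R -> H).
Hypothesis h0 : 0 < h.
Local Notation Gy := (fun s : R => let s' := grid_floor h s in
  (taming c varrho chi xi n h y o s')%:R *: F (y s')).

Let I k (t : R) : R := \int[leb]_(s in (`]0%R, t[%classic : set TR))
  (expR (- ((t - s) * L k)) * co iota k (Gy s)).

Lemma I_integrable k (t : R) : (0 < k)%N -> 0 <= t ->
  leb.-integrable (`]0%R, t[%classic : set TR)
    (EFin \o (fun s => expR (- ((t - s) * L k)) * co iota k (Gy s))).
Proof.
move=> k0; rewrite le_eqVlt => /predU1P[<-|t0].
  by rewrite set_itvoo0; exact: integrable_set0.
have [M hM] := Gy_bounded c varrho chi F xi n y o h0 t.
exact: (conv_coef_integrable c0 ha hV t0 (Gy_rc c varrho chi F xi n y o h0 (t := t)) hM k0).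
Qed.

Lemma I_restart k (a b : R) (v : V) : (0 < k)%N -> 0 <= a -> a < b ->
  (forall s, a < s < b -> Gy s = v) ->
  I k b = expR (- ((b - a) * L k)) * I k a +
    co iota k v * ((1 - expR (- ((b - a) * L k))) / L k).
Proof.
move=> k0 a0 ab Gv; have Lk := lam_gt0 c0 k0.
have b0 : 0 <= b by exact: ltW (le_lt_trans a0 ab).
have ib := I_integrable k0 b0; have ia := I_integrable k0 a0.
have mA : measurable (`]0%R, a[%classic : set TR) by exact: measurable_itv.
have mA' : measurable (`]0%R, a]%classic : set TR) by exact: measurable_itv.
have mB : measurable (`]a, b[%classic : set TR) by exact: measurable_itv.
have E : (`]0%R, b[%classic : set TR) = `]0%R, a]%classic `|` `]a, b[%classic.
  apply/seteqP; split => s /=; rewrite !in_itv/=.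
    by move=> /andP[s0 sb]; have [sa|sa] := leP s a; [left; rewrite s0|right].
  by move=> [/andP[s0 sa]|/andP[s0 sb]]; rewrite ?s0 ?(le_lt_trans sa ab)// sb (le_lt_trans a0 s0).
have dj : [disjoint (`]0%R, a]%classic : set TR) & `]a, b[%classic].
  apply/disj_setPLR => s /=; rewrite !in_itv/= => /andP[_ sa]; apply/negP.
  by rewrite negb_and -leNgt sa.
rewrite {1}/I E Rintegral_setU//; last by rewrite -E.
congr (_ + _).
  transitivity (\int[leb]_(s in (`]0%R, a[%classic : set TR)) (expR (- ((b - s) * L k)) * co iota k (Gy s))).
    apply/esym/Rintegral_itv_bndo_bndc.
    have mD : measurable (`]0%R, b[%classic : set TR) by exact: measurable_itv.
    apply: (integrableS mD mA _ ib).
    by move=> s /=; rewrite !in_itv/= => /andP[-> sa]; exact: lt_trans sa ab.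
  rewrite /I -(RintegralZl _ mA ia); apply: eq_Rintegral => s _.
  rewrite mulrA -expRD; congr (expR _ * _); ring.
transitivity (\int[leb]_(s in (`]a, b[%classic : set TR)) (expR (- ((b - s) * L k)) * co iota k v)).
  by apply: eq_Rintegral => s; rewrite inE/= in_itv/= => /Gv /= hv; rewrite hv.
have cg (s : R) : {for s, continuous (fun s : R => expR (- ((b - s) * L k)) * co iota k v)}.
  apply: cvgM; last exact: cvg_cst.
  apply: continuous_comp; last exact: continuous_expR.
  apply: cvgN; apply: cvgM; last exact: cvg_cst.
  by apply: cvgB; [exact: cvg_cst|exact: cvg_id].
pose Fp (s : R) := expR (- ((b - s) * L k)) * (co iota k v / L k).
have dF (s : R) : is_derive s 1 Fp (expR (- ((b - s) * L k)) * co iota k v).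
  have h1 : is_derive s 1 (fun s : R => - ((b - s) * L k)) (L k).
    have hh := is_deriveN (is_deriveM (is_derive_rev b s) (is_derive_cst (L k) s 1)).
    by apply: (is_derive_eq hh); rewrite scaler0 add0r /GRing.scale/= mulrN1 opprK.
  have h2 := is_derive_expR (- ((b - s) * L k)).
  have h3 := @is_derive1_comp _ (@expR R) (fun s : R => - ((b - s) * L k)) s _ _ h2 h1.
  have h4 := is_deriveZ (co iota k v / L k) h3.
  rewrite (_ : Fp = (co iota k v / L k) \*: (@expR R \o (fun s : R => - ((b - s) * L k)))).
    by apply: (is_derive_eq h4); rewrite /GRing.scale/=; field; rewrite gt_eqF.
  by apply/funext => x; rewrite /Fp /GRing.scale/= mulrC.
have FT := integral_oo_FTC ab (fun s _ => dF s) (fun s _ => cg s).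
rewrite /Rintegral FT /Fp /= subrr mul0r oppr0 expR0; ring.
Qed.

Definition drift k (s : R) : R := (taming c varrho chi xi n h y o s)%:R * co iota k (F (y s)).

Lemma scheme_cf k (t : R) : (0 < k <= n)%N -> 0 <= t -> scheme c iota varrho chi F xi n h y o t ->
  cf k (y t) = expR (- (t * L k)) * cf k xi + I k t + cf k (o t).
Proof.
move=> /andP[k0 kn] t0 hs; rewrite hs !cfD (cf_Pproj _ _ k0) kn mul1r (cf_expA c0 xi t0 k0).
congr (_ + _ + _); move: t0; rewrite le_eqVlt => /predU1P[<-|t0].
  by rewrite bochner_integral_set0 cf0 /I set_itvoo0 Rintegral_set0.
have [M hM] := Gy_bounded c varrho chi F xi n y o h0 t.
have := cf_conv_Pproj c0 ha hV t0 (Gy_rc c varrho chi F xi n y o h0 (t := t)) hM n k0.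
by rewrite kn mul1r.
Qed.

(** One step of exponential Euler. Apart from the noise it is the value at time b - a of the
    equation solved by [flow], which replaces the discrete scheme by a differential equation on each
    cell. *)
Lemma scheme_rec k (j : nat) (b : R) : (0 < k <= n)%N -> let a := j%:R * h in
  a < b -> b <= j.+1%:R * h ->
  scheme c iota varrho chi F xi n h y o a -> scheme c iota varrho chi F xi n h y o b ->
  cf k (y b) = expR (- ((b - a) * L k)) * cf k (y a) +
    drift k a * ((1 - expR (- ((b - a) * L k))) / L k) +
    (cf k (o b) - expR (- ((b - a) * L k)) * cf k (o a)).
Proof.
move=> kn a ab bj ha' hb; have /andP[k0 _] := kn.
have a0 : 0 <= a by rewrite mulr_ge0// ltW.
have b0 : 0 <= b by exact: ltW (le_lt_trans a0 ab).
rewrite (scheme_cf kn b0 hb) (scheme_cf kn a0 ha').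
have Gv s : a < s < b -> Gy s = (taming c varrho chi xi n h y o a)%:R *: F (y a).
  move=> /andP[as_ sb]; rewrite (grid_floor_nat h0 (le_trans a0 (ltW as_))).
  by rewrite (@truncn_grid _ h s j)// (ltW as_)/= (lt_le_trans sb).
rewrite (I_restart k0 a0 ab Gv) (coZ c0 ha hV _ _ k0) -/(drift k a).
have -> : expR (- (b * L k)) = expR (- ((b - a) * L k)) * expR (- (a * L k)).
  by rewrite -expRD; congr expR; ring.
by move: (I k a) (cf k xi) (drift k a) => p q r; ring.
Qed.

End recursion.

Lemma fsum_Hnorm_le (r : R) n (a b : nat -> R) (C B : R) : 0 <= C -> 0 <= B ->
  (forall k, (0 < k)%N -> L k `^ r * `|a k| <= C * `|b k|) ->
  \sum_(1 <= k < n.+1) b k ^+ 2 <= B ^+ 2 -> Hnorm c r (fsum n a) <= C * B.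
Proof.
move=> C0 B0 ab bB; apply: le_of_sqr; first exact: mulr_ge0.
rewrite (Hnorm_range c r (range_fsum n a)) exprMn.
apply: le_trans (ler_wpM2l (sqr_ge0 C) bB); rewrite mulr_sumr big_nat [leRHS]big_nat.
apply: ler_sum => k /andP[k0 kn]; rewrite (cf_fsum _ _ k0) -ltnS kn mul1r -exprMn.
rewrite -[leLHS]real_normK ?num_real// -[leRHS]real_normK ?num_real//.
apply: lerXn2r; rewrite ?nnegrE// !normrM (ger0_norm (powR_ge0 _ _)) (ger0_norm C0).
exact: ab.
Qed.

Lemma Hnorm0 (r : R) : Hnorm c r (0 : H) = 0.
Proof.
have h0 : Hdom c r (0 : H).
  by apply/HdomP; exists 0 => n; rewrite big1// => k _; rewrite cf0 mulr0 expr0n.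
by have := powAB h0 h0; rewrite !subrr /Hnorm => ->; rewrite normr0.
Qed.

Lemma Hnorm_leB (r : R) (u v : H) : Hdom c r u -> Hdom c r v ->
  Hnorm c r (u - v) <= Hnorm c r u + Hnorm c r v.
Proof. by move=> hu hv; rewrite /Hnorm (powAB hu hv) ler_normB. Qed.

Let Cr := L 1 `^ (rho - varrho).
Let rhole : rho <= varrho. Proof. by have /andP[_ /ltW] := hrho. Qed.

Lemma powR_anti (h p q : R) : 0 < h <= 1 -> q <= p -> h `^ p <= h `^ q.
Proof.
move=> /andP[h0 h1] qp; rewrite /powR (gt_eqF h0) ler_expR.
by have := ln_le0 h1; nra.
Qed.

(** The scalar budget of one cell. The Lipschitz factor costs h^(- chi vartheta), and the
    displacement gains h^(chi vartheta), by chi (1 + vartheta) <= varrho - rho and, for the drift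
    part, because 1 - alpha - rho exceeds chi (1 + 2 vartheta). Cost and gain cancel and leave
    powers of 1 + z only. *)
Lemma drift_real (h s Nx z nx nu dl Nv Fx D F0 C : R) :
  0 <= F0 -> 0 <= C -> let CF := F0 + theta * (C + C `^ vartheta * C) in let C2 := C + 1 + CF in
  0 < h <= 1 -> 0 <= s <= h -> Nx <= h `^ (- chi) -> 0 <= z -> 0 <= nx <= C * Nx ->
  0 <= Fx <= F0 + theta * (1 + nx `^ vartheta) * nx -> 0 <= Nv <= Nx + z ->
  0 <= dl <= s `^ (varrho - rho) * Nv + s `^ (1 - alpha - rho) * Fx ->
  0 <= nu <= nx + dl -> D <= theta * (1 + nx `^ vartheta + nu `^ vartheta) * dl ->
  D <= theta * (1 + C2 `^ vartheta + C2 `^ vartheta) * (1 + CF) * ((1 + z) `^ vartheta * (1 + z)).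
Proof.
move=> F00 Cr0 CF C2' h01 /andP[s0 sh] Nxh z0 /andP[nx0 nxC] /andP[Fx0 FxB'] /andP[Nv0 Nv1] /andP[dl0 dl1] /andP[nu0 nu1] hD.
have /andP[al0 al1] := ha; have /andP[r0 rv] := hrho; have vr := hvarrho.
have /andP[chi0 chi1] := hchi; have /andP[h0 h1] := h01.
have vt1 : 0 < 1 + vartheta by rewrite addr_gt0.
have chi2 : chi * (1 + vartheta) <= varrho - rho by rewrite -ler_pdivlMr.
have chivt : 0 <= chi * vartheta by rewrite mulr_ge0// ltW.
have chi3 : chi + chi * vartheta <= varrho - rho by rewrite -[X in X + _]mulr1 -mulrDr.
pose Hh := h `^ (- chi).
have Hh1 : 1 <= Hh.
  by have := @powR_anti h 0 (- chi) h01; rewrite powRr0 oppr_le0; apply; exact: ltW.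
have Hh0 : 0 < Hh by exact: lt_le_trans Hh1.
pose g := h `^ (chi * vartheta).
have g0 : 0 <= g by exact: powR_ge0.
have Hh1t : Hh `^ (1 + vartheta) = Hh * Hh `^ vartheta.
  by rewrite powRD ?(gt_eqF Hh0) ?implybT// powRr1// ltW.
have hg1 : h `^ (varrho - rho) * Hh <= g.
  by rewrite /Hh -powRD ?(gt_eqF h0) ?implybT//; apply: powR_anti => //; lra.
have hg2 : h `^ (varrho - rho) <= g by apply: powR_anti => //; lra.
have hg3 : h `^ (1 - alpha - rho) * Hh `^ (1 + vartheta) <= g.
  rewrite /Hh -powRrM -powRD ?(gt_eqF h0) ?implybT//; apply: powR_anti => //.
  by rewrite mulNr; lra.
have g1 : g <= 1.
  by have := @powR_anti h (chi * vartheta) 0 h01; rewrite powRr0; apply.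
have Hg : Hh `^ vartheta * g = 1.
  rewrite /Hh /g -powRrM -powRD ?(gt_eqF h0) ?implybT//.
  by rewrite mulNr addNr powRr0.
have sp r : 0 <= r -> s `^ r <= h `^ r.
  by move=> rr; exact: (ge0_ler_powR rr s0 (ltW h0) sh).
have sp1 : s `^ (varrho - rho) <= h `^ (varrho - rho) by apply: sp; lra.
have sp2 : s `^ (1 - alpha - rho) <= h `^ (1 - alpha - rho) by apply: sp; lra.
have NxH : Nx <= Hh by [].
have p1 : 1 <= Hh `^ vartheta.
  by have := ge0_ler_powR (ltW vt0) ler01 (ltW Hh0) Hh1; rewrite powR1.
move: Nxh sp1 sp2 hg1 hg2 hg3; rewrite Hh1t.
have : 0 <= s `^ (varrho - rho) by exact: powR_ge0.
have : 0 <= s `^ (1 - alpha - rho) by exact: powR_ge0.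
move: dl1; move: (s `^ (varrho - rho)) (s `^ (1 - alpha - rho)) (h `^ (varrho - rho)) (h `^ (1 - alpha - rho)) => s1 s2 h1' h2' dl1 s20 s10 Nxh sp1 sp2 hg1 hg2 hg3.
have h10 : 0 <= h1' by exact: le_trans sp1.
have h20 : 0 <= h2' by exact: le_trans sp2.
have Ct0 : 0 <= C `^ vartheta by exact: powR_ge0.
have CF0 : 0 <= CF.
  by rewrite /CF; apply: addr_ge0 => //; apply: mulr_ge0; [exact: ltW|rewrite addr_ge0 ?mulr_ge0].
have xr : nx <= C * Hh by apply: (le_trans nxC); exact: ler_wpM2l.
have FxB : Fx <= CF * (Hh * Hh `^ vartheta).
  have h4 : nx `^ vartheta <= C `^ vartheta * Hh `^ vartheta.
    by rewrite -powRM ?(ltW Hh0)//; exact: (ge0_ler_powR (ltW vt0) nx0 (le_trans nx0 xr) xr).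
  apply: (le_trans FxB'); rewrite /CF mulrDl; apply: lerD.
    by rewrite ler_peMr// -[1]mulr1; apply: ler_pM.
  rewrite -!mulrA; apply: ler_wpM2l; first exact: ltW.
  rewrite mulrDl mul1r mulrDl; apply: lerD.
    by apply: (le_trans xr); apply: ler_wpM2l => //; rewrite ler_peMr// ltW.
  apply: (@le_trans _ _ (C `^ vartheta * Hh `^ vartheta * (C * Hh))).
    by apply: ler_pM => //; exact: powR_ge0.
  rewrite le_eqVlt; apply/orP; left; apply/eqP.
  by move: (C `^ vartheta) (Hh `^ vartheta) => p q; ring.
pose Z := 1 + z; have Z1 : 1 <= Z by rewrite lerDl.
have Z0 : 0 < Z by exact: lt_le_trans Z1.
have CF1 : 0 <= 1 + CF by exact: addr_ge0.
have dlt : dl <= g * ((1 + CF) * Z).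
  have q1 : s1 * Nv <= g * Z.
    apply: (@le_trans _ _ (h1' * (Hh + z))).
      by apply: ler_pM => //; apply: (le_trans Nv1); exact: lerD.
    rewrite mulrDr /Z mulrDr mulr1; apply: lerD => //; exact: ler_wpM2r.
  have q2 : s2 * Fx <= g * CF.
    apply: (@le_trans _ _ (h2' * (CF * (Hh * Hh `^ vartheta)))); first exact: ler_pM.
    by rewrite mulrCA [g * _]mulrC; apply: ler_wpM2l.
  apply: (le_trans dl1); apply: (le_trans (lerD q1 q2)); rewrite -mulrDr; apply: ler_wpM2l => //.
  by rewrite mulrDl mul1r; apply: lerD => //; rewrite ler_peMr.
have HZ : 1 <= Hh * Z by rewrite -[1]mulr1; apply: ler_pM.
have HZ0 : 0 < Hh * Z by exact: mulr_gt0.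
have C20 : 0 <= C2' by rewrite /C2'; apply: addr_ge0 => //; exact: addr_ge0.
have xC : nx <= C2' * (Hh * Z).
  apply: (le_trans xr); apply: ler_pM => //; [exact: ltW|by rewrite /C2' -addrA lerDl addr_ge0|].
  by rewrite ler_peMr// ltW.
have uC : nu <= C2' * (Hh * Z).
  apply: (le_trans nu1).
  apply: (@le_trans _ _ (C * (Hh * Z) + (1 + CF) * (Hh * Z))).
    apply: lerD.
      by apply: (le_trans xr); apply: ler_wpM2l => //; rewrite ler_peMr// ltW.
    apply: (le_trans dlt).
    apply: (@le_trans _ _ (1 * ((1 + CF) * Z))).
      by apply: ler_wpM2r => //; apply: mulr_ge0 => //; exact: ltW.
    by rewrite mul1r; apply: ler_wpM2l => //; rewrite ler_peMl// ltW.
  by rewrite -mulrDl /C2' addrA.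
have pC u : 0 <= u -> u <= C2' * (Hh * Z) -> u `^ vartheta <= C2' `^ vartheta * (Hh `^ vartheta * Z `^ vartheta).
  move=> u0 uC'; have := ge0_ler_powR (ltW vt0) u0 (le_trans u0 uC') uC'.
  by rewrite (powRM _ C20 (ltW HZ0)) (powRM _ (ltW Hh0) (ltW Z0)).
have pZ : 1 <= Z `^ vartheta.
  by have := ge0_ler_powR (ltW vt0) ler01 (ltW Z0) Z1; rewrite powR1.
have PQ : 1 <= Hh `^ vartheta * Z `^ vartheta by rewrite -[1]mulr1; apply: ler_pM.
have b1 := pC _ nx0 xC; have b2 := pC _ nu0 uC.
apply: (le_trans hD).
apply: (@le_trans _ _ (theta * ((1 + C2' `^ vartheta + C2' `^ vartheta) * (Hh `^ vartheta * Z `^ vartheta)) * (g * ((1 + CF) * Z)))).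
  apply: ler_pM => //.
    by apply: mulr_ge0; [exact: ltW|rewrite !addr_ge0 ?powR_ge0].
  apply: ler_wpM2l; first exact: ltW.
  by rewrite 2!mulrDl mul1r; apply: lerD b2; exact: lerD.
rewrite -/Z le_eqVlt; apply/orP; left; apply/eqP.
rewrite -[RHS]mul1r -Hg; move: (Hh `^ vartheta) (Z `^ vartheta) (C2' `^ vartheta) => p q r; ring.
Qed.

Section drift_difference.
Let CF := `|F 0| + theta * (Cr + Cr `^ vartheta * Cr).
Let C2 := Cr + 1 + CF.

Lemma flow_displacement n (v0 : H) (g : V) (s : R) : range (@Pproj R n) v0 -> 0 <= s ->
  Nr (v0 - fsum n (fun k => flow L (fun k => cf k v0) (fun k => co iota k g) k s)) <=
  s `^ (varrho - rho) * N v0 + s `^ (1 - alpha - rho) * `|g|.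
Proof.
have /andP[al0 al1] := ha; have /andP[r0 rv] := hrho; have vr := hvarrho.
move=> hv s0.
pose A k := (1 - expR (- (s * L k))) * cf k v0.
pose B k := co iota k g * ((1 - expR (- (s * L k))) / L k).
have -> : v0 - fsum n (fun k => flow L (fun k => cf k v0) (fun k => co iota k g) k s) =
    fsum n A - fsum n B.
  apply: cf_inj => k k0; rewrite (cfB k v0) (cfB k (fsum n A)) !(cf_fsum _ _ k0).
  have [kn|nk] := leqP k n; last by rewrite !mul0r !subr0 (cf_range0 hv nk).
  by rewrite !mul1r /flow /A /B; ring.
have dA := Hdom_range c rho (range_fsum n A); have dB := Hdom_range c rho (range_fsum n B).
have onesub k r : 0 <= r <= 1 -> 1 - expR (- (s * L k)) <= (s * L k) `^ r.
  by move=> hr; apply: one_sub_exp_le => //; rewrite mulr_ge0// lam_ge0.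
have os0 k : 0 <= 1 - expR (- (s * L k)).
  by rewrite subr_ge0 -expR0 ler_expR oppr_le0 mulr_ge0// lam_ge0.
apply: (le_trans (Hnorm_leB dA dB)); apply: lerD.
- apply: (@fsum_Hnorm_le _ _ _ (fun k => L k `^ varrho * cf k v0)).
  + exact: powR_ge0.
  + exact: Hnorm_ge0.
  + move=> k k0; have Lk := lam_gt0 c0 k0.
    rewrite /A !normrM (ger0_norm (os0 k)) (ger0_norm (powR_ge0 _ _)) [leLHS]mulrA [leRHS]mulrA.
    apply: ler_wpM2r => //.
    have hr : 0 <= varrho - rho <= 1 by lra.
    have h1 := onesub k _ hr; rewrite powRM ?(ltW Lk)// in h1.
    apply: (le_trans (ler_wpM2l (powR_ge0 _ _) h1)).
    rewrite mulrCA -powRD; last by rewrite (gt_eqF Lk) implybT.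
    by rewrite addrCA subrr addr0.
  + by rewrite -(Hnorm_range c varrho hv).
- apply: (@fsum_Hnorm_le _ _ _ (fun k => L k `^ (- alpha) * co iota k g)).
  + exact: powR_ge0.
  + exact: normr_ge0.
  + move=> k k0; have Lk := lam_gt0 c0 k0.
    rewrite /B !normrM (ger0_norm (os0 k)) (ger0_norm (powR_ge0 _ _)).
    rewrite [`|(L k)^-1|]gtr0_norm ?invr_gt0//.
    have hr : 0 <= 1 - alpha - rho <= 1 by lra.
    have h1 := onesub k _ hr; rewrite powRM ?(ltW Lk)// in h1.
    have E : L k `^ (- alpha) = L k `^ rho * (L k `^ (1 - alpha - rho) * (L k)^-1).
      rewrite -[X in _ * (_ * X)]powR_inv1 ?(ltW Lk)// -!powRD ?(gt_eqF Lk) ?implybT//.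
      by congr (_ `^ _); ring.
    rewrite E.
    have -> : L k `^ rho * (`|co iota k g| * ((1 - expR (- (s * L k))) * (L k)^-1)) =
       (1 - expR (- (s * L k))) * (L k `^ rho * (L k)^-1 * `|co iota k g|) by ring.
    have -> : s `^ (1 - alpha - rho) * (L k `^ rho * (L k `^ (1 - alpha - rho) * (L k)^-1) * `|co iota k g|) =
       s `^ (1 - alpha - rho) * L k `^ (1 - alpha - rho) * (L k `^ rho * (L k)^-1 * `|co iota k g|) by ring.
    apply: ler_wpM2r => //; apply: mulr_ge0 => //; apply: mulr_ge0; first exact: powR_ge0.
    by rewrite invr_ge0 ltW.
  + exact: (co_bessel c0 ha hV).
Qed.

Lemma range0 n : range (@Pproj R n) (0 : H).
Proof. by rewrite -(scale0r (fsum n (fun=> 0))); apply: rangeZ; exact: range_fsum. Qed.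

(* While the taming is inactive N x <= h^(-chi), so the powers of N x lost in the
   Lipschitz bound are paid by the gain h^(varrho - rho) over a single cell. *)
Lemma drift_diff n (h s : R) (x w : H) : (0 < n)%N -> range (@Pproj R n) x -> range (@Pproj R n) w ->
  0 < h <= 1 -> 0 <= s <= h -> N x <= h `^ (- chi) ->
  `|F x - F (fsum n (fun k => flow L (fun k => cf k (x - w)) (fun k => co iota k (F x)) k s) + w)| <=
  theta * (1 + C2 `^ vartheta + C2 `^ vartheta) * (1 + CF) * ((1 + N w) `^ vartheta * (1 + N w)).
Proof.
move=> n0 hx hw h01 hs Nx; have /andP[s0 _] := hs.
have dx r := Hdom_range c r hx; have dw r := Hdom_range c r hw.
have xw : range (@Pproj R n) (x - w).
  by rewrite -scaleN1r; apply: rangeD => //; exact: rangeZ.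
set us := fsum n _.
have usr : range (@Pproj R n) us by exact: range_fsum.
have uw : range (@Pproj R n) (us + w) by exact: rangeD.
have duw r := Hdom_range c r uw.
have E : x - (us + w) = x - w - us by rewrite opprD addrA addrAC.
have key := hlip n0 hx uw.
have [_ xr] := Hnorm_mono c0 rhole (dx varrho).
have FxB : `|F x| <= `|F 0| + theta * (1 + Nr x `^ vartheta) * Nr x.
  have h3 := hlip n0 hx (range0 n).
  rewrite Hnorm0 subr0 powR0 ?gt_eqF// addr0 in h3.
  by rewrite -[X in `|X| <= _](subrK (F 0)) addrC; apply: (le_trans (ler_normD _ _)); rewrite lerD2l.
have nuw : Nr (us + w) <= Nr x + Nr (x - (us + w)).
  rewrite (Hnorm_distC (dx rho) (duw rho)); exact: (Hnorm_le_add (duw rho) (dx rho)).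
have dl := flow_displacement (F x) xw s0; rewrite -/us in dl.
have dl' : Nr (x - (us + w)) <= s `^ (varrho - rho) * N (x - w) + s `^ (1 - alpha - rho) * `|F x|.
  by rewrite E.
apply: (@drift_real h s (N x) (N w) (Nr x) (Nr (us + w)) (Nr (x - (us + w))) (N (x - w)) `|F x| _ `|F 0| Cr).
- exact: normr_ge0.
- exact: powR_ge0.
- exact: h01.
- exact: hs.
- exact: Nx.
- exact: Hnorm_ge0.
- by apply/andP; split; [exact: Hnorm_ge0|exact: xr].
- by apply/andP; split; [exact: normr_ge0|exact: FxB].
- by apply/andP; split; [exact: Hnorm_ge0|exact: (Hnorm_leB (dx varrho) (dw varrho))].
- by apply/andP; split; [exact: Hnorm_ge0|exact: dl'].
- by apply/andP; split; [exact: Hnorm_ge0|exact: nuw].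
- exact: key.
Qed.

End drift_difference.

(** A natural exponent above 1 + vartheta replaces the real one, so that later only integer moments
    of the noise occur. *)
Lemma drift_diff_bound : exists2 C4 : R, 0 <= C4 & exists q0 : nat, forall n (h s : R) (x w : H),
  (0 < n)%N -> range (@Pproj R n) x -> range (@Pproj R n) w ->
  0 < h <= 1 -> 0 <= s <= h -> N x <= h `^ (- chi) ->
  `|F x - F (fsum n (fun k => flow L (fun k => cf k (x - w)) (fun k => co iota k (F x)) k s) + w)| <=
  C4 * (1 + N w) ^+ q0.
Proof.
pose CF := `|F 0| + theta * (Cr + Cr `^ vartheta * Cr); pose C2 := Cr + 1 + CF.
exists (theta * (1 + C2 `^ vartheta + C2 `^ vartheta) * (1 + CF)).
  have Cr0 : 0 <= Cr by exact: powR_ge0.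
  have CF0 : 0 <= CF.
    apply: addr_ge0 => //; apply: mulr_ge0; first exact: ltW.
    by apply: addr_ge0 => //; apply: mulr_ge0 => //; exact: powR_ge0.
  apply: mulr_ge0; last exact: addr_ge0.
  by apply: mulr_ge0; [exact: ltW|rewrite !addr_ge0 ?powR_ge0].
exists (Num.truncn vartheta).+2 => n h s x w n0 hx hw hh hs Nx.
apply: (le_trans (drift_diff n0 hx hw hh hs Nx)); apply: ler_wpM2l.
  have Cr0 : 0 <= Cr by exact: powR_ge0.
  have CF0 : 0 <= CF.
    apply: addr_ge0 => //; apply: mulr_ge0; first exact: ltW.
    by apply: addr_ge0 => //; apply: mulr_ge0 => //; exact: powR_ge0.
  apply: mulr_ge0; last exact: addr_ge0.
  by apply: mulr_ge0; [exact: ltW|rewrite !addr_ge0 ?powR_ge0].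
have Z1 : 1 <= 1 + N w by rewrite lerDl; exact: Hnorm_ge0.
have Z0 : 0 <= 1 + N w by exact: le_trans Z1.
rewrite [leRHS]exprSr; apply: ler_wpM2r => //.
rewrite -(powR_mulrn _ Z0); apply: ler_powR => //.
by apply: ltW; exact: truncnS_gt.
Qed.

End SchemeEnergy.

(** * Coercivity on one cell *)

Section CellBound.
Variable R : realType.
Local Notation H := (L2_01 R).

Lemma ftrig_eq n (a b : nat -> R) : (forall k, (0 < k <= n)%N -> a k = b k) ->
  ftrig n a = ftrig n b.
Proof.
move=> ab; apply/funext => x; rewrite /ftrig big_nat [RHS]big_nat.
by apply: eq_bigr => k hk; rewrite ab.
Qed.

Lemma supn_eq n (a b : nat -> R) : (forall k, (0 < k <= n)%N -> a k = b k) ->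
  supn n a = supn n b.
Proof. by move=> ab; rewrite /supn (ftrig_eq ab). Qed.

Lemma fsum_eq n (a b : nat -> R) : (forall k, (0 < k <= n)%N -> a k = b k) ->
  fsum n a = fsum n b.
Proof.
move=> ab; rewrite /fsum big_nat [RHS]big_nat.
by apply: eq_bigr => k hk; rewrite ab.
Qed.

Lemma flow_eq lam_ (v0 v1 f g : nat -> R) k s : v0 k = v1 k -> f k = g k ->
  flow lam_ v0 f k s = flow lam_ v1 g k s.
Proof. by rewrite /flow => -> ->. Qed.

Lemma sum_mul0 n (a b : nat -> R) : \sum_(1 <= k < n.+1) a k * (false%:R * b k) <= 0.
Proof. by apply: sumr_le0 => k _; rewrite mul0r mulr0. Qed.

Lemma add_mul_le (g p q : R) : 0 <= g -> 1 <= q -> p <= q -> g + g * p <= 2 * g * q.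
Proof. nra. Qed.

Lemma coercive_real (varphi_ gamma_ S0 S1 S2 S3 X1 X2 X3 X4 X5 X6 : R) :
  S0 <= X4 * S2 + varphi_ * S3 + X5 -> S1 <= (1 - varphi_) * S3 + X1 ->
  X4 * S2 <= X6 * S2 -> X1 <= X3 * X2 -> X5 <= 2 * gamma_ * X2 ->
  S0 + S1 <= X6 * S2 + S3 + (2 * gamma_ + X3) * X2.
Proof. lra. Qed.

Lemma lam_powR_le (c alpha : R) k : 0 < c -> 0 <= alpha <= 1 / 2 -> (0 < k)%N ->
  (lam c k `^ alpha) ^+ 2 <= lam c 1 `^ (2 * alpha - 1) * lam c k.
Proof.
move=> c0 ha k0; have Lk := lam_gt0 c0 k0; have L1 := lam_gt0 c0 (isT : (0 < 1)%N).
have L1k := le_lam c0 k0.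
have -> : (lam c k `^ alpha) ^+ 2 = lam c k `^ (2 * alpha - 1) * lam c k.
  rewrite -[X in _ = _ * X]powRr1 ?(ltW Lk)// -powRD ?(gt_eqF Lk) ?implybT//.
  by rewrite subrK mulrC powRrM powR_mulrn ?powR_ge0.
apply: ler_wpM2r; first exact: ltW.
rewrite /powR (gt_eqF L1) (gt_eqF Lk) ler_expR.
have h1 : ln (lam c 1) <= ln (lam c k) by rewrite ler_ln ?posrE.
by have /andP[_ h2] := ha; nra.
Qed.

Variables (c alpha : R) (c0 : 0 < c) (ha : 0 <= alpha <= 1 / 2).
Variables (V : completeNormedModType R) (iota : {linear H -> V}).
Hypothesis hV : is_Hcompletion c (- alpha) iota.
Variables (rho varrho theta vartheta chi gamma varphi : R).
Hypothesis hrho : 0 <= rho < varrho.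
Hypothesis hvarrho : varrho < 1 / 4.
Hypothesis theta0 : 0 < theta.
Hypothesis vt0 : 0 < vartheta.
Hypothesis hchi : 0 < chi <= (varrho - rho) / (1 + vartheta).
Hypothesis gamma0 : 0 < gamma.
Hypothesis hvarphi : 0 <= varphi < 1.
Variables (F : H -> V) (phi Phi : H -> R).
Hypothesis hlip : forall n, (0 < n)%N -> forall v w : L2_01 R,
  range (@Pproj R n) v -> range (@Pproj R n) w ->
  `|F v - F w| <= theta *
    (1 + Hnorm c rho v `^ vartheta + Hnorm c rho w `^ vartheta) *
    Hnorm c rho (v - w).
Hypothesis hphi : forall u, Hdom c 1 u ->
    phi u = gamma + gamma *
      sup [set `|cont_repr u x| ^+ 2 | x in `]0%R, 1%R[%classic].
Hypothesis hPhi : forall u, Hdom c 1 u ->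
    Phi u = gamma + gamma *
      sup [set `|cont_repr u x| `^ gamma | x in `]0%R, 1%R[%classic].
Hypothesis hcoercive : forall n, (0 < n)%N -> forall v w : L2_01 R,
    range (@Pproj R n) v -> range (@Pproj R n) w ->
    ip v (extend iota (@Pproj R n) (F (v + w))) <=
      phi w * `|v| ^+ 2 + varphi * Hnorm c (1 / 2) v ^+ 2 + Phi w.
Local Notation L := (lam c).
Local Notation N := (Hnorm c varrho).

Let Ca := L 1 `^ (2 * alpha - 1).
Let Ca0 : 0 < Ca. Proof. by apply: powR_gt0; exact: lam_gt0. Qed.
Let e := 2 * (1 - varphi) / Ca.
Let e0 : 0 < e.
Proof. by rewrite divr_gt0// mulr_gt0// subr_gt0; have /andP[] := hvarphi. Qed.

(* The spare dissipation (1 - varphi) |u|_(H_1/2)^2 absorbs the perturbation g. *)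
Lemma young_co n (u : nat -> R) (g : V) :
  \sum_(1 <= k < n.+1) u k * co iota k g <=
  (1 - varphi) * (\sum_(1 <= k < n.+1) L k * u k ^+ 2) + (2 * e)^-1 * `|g| ^+ 2.
Proof.
have h := co_bessel c0 ha hV n g.
apply: le_trans (lerD (lexx _) (ler_wpM2l _ h)); last by rewrite invr_ge0 mulr_ge0// ltW.
rewrite !mulr_sumr -big_split /= big_nat [leRHS]big_nat; apply: ler_sum => k /andP[k0 _].
have Lk := lam_gt0 c0 k0; have hl := lam_powR_le c0 ha k0; rewrite -/Ca in hl.
have E : L k `^ alpha * L k `^ (- alpha) = 1.
  by rewrite -powRD ?(gt_eqF Lk) ?implybT// subrr powRr0.
move: (co iota k g) (u k) => q p.
have -> : p * q = (L k `^ alpha * p) * (L k `^ (- alpha) * q).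
  by rewrite -[LHS]mul1r -E; ring.
move: hl; move: (L k `^ alpha) (L k `^ (- alpha)) => A B hl.
have h1 : e / 2 * (A * p) ^+ 2 <= (1 - varphi) * (L k * p ^+ 2).
  have -> : (1 - varphi) * (L k * p ^+ 2) = e / 2 * (Ca * L k * p ^+ 2).
    by rewrite /e; field; rewrite gt_eqF.
  rewrite exprMn; apply: ler_wpM2l; first by rewrite ltW// divr_gt0.
  by apply: ler_wpM2r => //; exact: sqr_ge0.
apply: (le_trans _ (lerD h1 (lexx _))).
rewrite -subr_ge0.
have -> : e / 2 * (A * p) ^+ 2 + (2 * e)^-1 * (B * q) ^+ 2 - A * p * (B * q) =
  (2 * e)^-1 * (e * (A * p) - B * q) ^+ 2 by field; rewrite gt_eqF.
by apply: mulr_ge0; [rewrite invr_ge0 mulr_ge0// ltW|exact: sqr_ge0].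
Qed.

Lemma ip_extend_Pproj n (u : nat -> R) (v : V) :
  ip (fsum n u) (extend iota (@Pproj R n) v) = \sum_(1 <= k < n.+1) u k * co iota k v.
Proof.
apply: (etrans (ip_fsum n u _)); apply: eq_big_nat => k /andP[k0 kn].
apply: (congr1 (fun z => u k * z)); apply: (etrans (cf_extend_Pproj c0 ha hV n v k0)).
by rewrite -ltnS kn mul1r.
Qed.

Lemma Hnorm_half n (u : nat -> R) :
  Hnorm c (1 / 2) (fsum n u) ^+ 2 = \sum_(1 <= k < n.+1) L k * u k ^+ 2.
Proof.
apply: etrans (Hnorm_range c (1 / 2) (range_fsum n u)) _; rewrite big_nat [RHS]big_nat.
apply: eq_bigr => k /andP[k0 kn]; rewrite (cf_fsum _ _ k0) -ltnS kn [true%:R * _]mul1r exprMn; congr (_ * _).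
have h := lam_ge0 c0 k.
rewrite -(powR_mulrn 2 (powR_ge0 (L k) (1 / 2))) -powRrM (_ : 1 / 2 * 2%:R = 1); last by field.
by rewrite powRr1.
Qed.

(** Coercivity speaks about F at flow + w, whereas the cell uses F at its left end x. The difference
    is polynomial in the noise by [drift_diff_bound] and is absorbed through [young_co]. With [b]
    false the drift is absent and the energy cannot grow. *)
Lemma cell_bound : exists2 C5 : R, 0 <= C5 & exists G : nat, forall n (b : bool) (h s : R) (x w : H),
  (0 < n)%N -> range (@Pproj R n) x -> range (@Pproj R n) w ->
  0 < h <= 1 -> 0 <= s <= h -> (b -> N x <= h `^ (- chi)) ->
  let M := supn n (fun k => cf k w) in
  \sum_(1 <= k < n.+1)
    flow L (fun k => cf k (x - w)) (fun k => b%:R * co iota k (F x)) k s ^+ 2 <=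
  expR (2 * (gamma + gamma * M ^+ 2) * s) *
  (\sum_(1 <= k < n.+1) cf k (x - w) ^+ 2 + 2 * (C5 * (1 + M + N w) ^+ G) * s).
Proof.
have [C4 C40 [q0 hC4]] := drift_diff_bound c0 ha hV hrho hvarrho theta0 vt0 hchi hlip.
have ei : 0 <= (2 * e)^-1 by rewrite invr_ge0 mulr_ge0// ltW.
pose C5 := 2 * gamma + (2 * e)^-1 * C4 ^+ 2.
have C50 : 0 <= C5.
  by rewrite addr_ge0// ?mulr_ge0 ?sqr_ge0// ltW.
exists C5 => //.
pose g := (Num.truncn gamma).+1.
exists (g + 2 * q0)%N => n b h s x w n0 hx hw h01 hs hb /=; set M := supn n _.
have M0 : 0 <= M by exact: supn_ge0.
have Nw0 : 0 <= N w by exact: Hnorm_ge0.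
have Z1 : 1 <= 1 + M + N w by rewrite -addrA lerDl addr_ge0.
have Z0 : 0 <= 1 + M + N w by exact: le_trans Z1.
have xw : range (@Pproj R n) (x - w).
  by rewrite -scaleN1r; apply: rangeD => //; exact: rangeZ.
have /andP[s0 sh] := hs.
apply: (@cell_energy _ n L _ _ (fun k k0 => lam_gt0 c0 k0)) => //.
- by rewrite addr_ge0 ?mulr_ge0 ?sqr_ge0// ltW.
- by rewrite mulr_ge0// exprn_ge0.
move=> r /andP[r0 rs].
have Zg : 0 <= C5 * (1 + M + N w) ^+ (g + 2 * q0) by rewrite mulr_ge0// exprn_ge0.
have LS0 (u : nat -> R) : 0 <= \sum_(1 <= k < n.+1) L k * u k ^+ 2.
  by apply: sumr_ge0 => k _; rewrite mulr_ge0 ?sqr_ge0// lam_ge0.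
have SS0 (u : nat -> R) : 0 <= \sum_(1 <= k < n.+1) u k ^+ 2.
  by apply: sumr_ge0 => k _; rewrite sqr_ge0.
have aM0 : 0 <= gamma + gamma * M ^+ 2 by rewrite addr_ge0 ?mulr_ge0 ?sqr_ge0// ltW.
case: b hb => hb; last first.
  apply: (@le_trans _ _ 0).
    exact: sum_mul0.
  apply: addr_ge0 => //; apply: addr_ge0; last exact: LS0.
  exact: (mulr_ge0 aM0 (SS0 _)).
have fE k : flow L (fun k => cf k (x - w)) (fun k => true%:R * co iota k (F x)) k r =
    flow L (fun k => cf k (x - w)) (fun k => co iota k (F x)) k r.
  by apply: flow_eq; rewrite ?mul1r.
have rh : 0 <= r <= h by rewrite r0 (le_trans rs sh).
have := hC4 n h r x w n0 hx hw h01 rh (hb isT).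
pose u k := flow L (fun k => cf k (x - w)) (fun k => co iota k (F x)) k r.
set us := fsum n _; rewrite (_ : us = fsum n u)// => hdl.
have usr : range (@Pproj R n) (fsum n u) by exact: range_fsum.
pose y := fsum n u + w.
have hco := hcoercive n0 usr hw.
have eip := ip_extend_Pproj n u (F y).
have eN : `|fsum n u| ^+ 2 = \sum_(1 <= k < n.+1) u k ^+ 2 by exact: norm_fsum.
have eH := Hnorm_half n u.
rewrite eip eN eH in hco.
have dw := Hdom_range c 1 hw.
have phiB : phi w <= gamma + gamma * M ^+ 2.
  rewrite hphi// lerD2l; apply: ler_wpM2l; first exact: ltW.
  apply: (@sup_cont_repr _ n w (fun z => z ^+ 2) hw) => p q p0 pq.
  by apply: lerXn2r; rewrite ?nnegrE// (le_trans p0).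
have PhiB : Phi w <= gamma + gamma * M `^ gamma.
  rewrite hPhi// lerD2l; apply: ler_wpM2l; first exact: ltW.
  apply: (@sup_cont_repr _ n w (fun z => z `^ gamma) hw) => p q p0 pq.
  exact: (ge0_ler_powR (ltW gamma0) p0 (le_trans p0 pq) pq).
have PhiZ : Phi w <= 2 * gamma * (1 + M + N w) ^+ (g + 2 * q0).
  apply: (le_trans PhiB).
  have z1 : 1 <= (1 + M + N w) ^+ (g + 2 * q0) by exact: exprn_ege1.
  have z2 : M `^ gamma <= (1 + M + N w) ^+ (g + 2 * q0).
    apply: (@le_trans _ _ ((1 + M + N w) `^ gamma)).
      have MZ : M <= 1 + M + N w by rewrite addrAC lerDr addr_ge0.
      exact: (ge0_ler_powR (ltW gamma0) M0 Z0 MZ).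
    apply: (@le_trans _ _ ((1 + M + N w) ^+ g)); last by rewrite ler_weXn2l// leq_addr.
    rewrite -(powR_mulrn g Z0); apply: ler_powR => //.
    by apply: ltW; exact: truncnS_gt.
  exact: (add_mul_le (ltW gamma0) z1 z2).
pose dl := F x - F y.
have dlZ : (2 * e)^-1 * `|dl| ^+ 2 <= (2 * e)^-1 * C4 ^+ 2 * (1 + M + N w) ^+ (g + 2 * q0).
  rewrite -mulrA; apply: ler_wpM2l => //.
  apply: (@le_trans _ _ ((C4 * (1 + N w) ^+ q0) ^+ 2)).
    apply: lerXn2r; rewrite ?nnegrE//.
    by rewrite mulr_ge0// exprn_ge0// addr_ge0.
  rewrite exprMn; apply: ler_wpM2l; first exact: sqr_ge0.
  rewrite -exprM mulnC; apply: (@le_trans _ _ ((1 + M + N w) ^+ (2 * q0))).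
    by apply: lerXn2r; rewrite ?nnegrE ?addr_ge0// lerD2r lerDl.
  by rewrite ler_weXn2l// leq_addl.
have hy := young_co n u dl.
have split : \sum_(1 <= k < n.+1) u k * co iota k (F x) =
    \sum_(1 <= k < n.+1) u k * co iota k (F y) + \sum_(1 <= k < n.+1) u k * co iota k dl.
  rewrite -big_split /= big_nat [RHS]big_nat; apply: eq_bigr => k /andP[k0 _].
  by rewrite -mulrDr /dl (coB c0 ha hV _ _ k0) addrC subrK.
have e1 : \sum_(1 <= k < n.+1) flow L (fun k => cf k (x - w)) (fun k => true%:R * co iota k (F x)) k r * (true%:R * co iota k (F x)) =
   \sum_(1 <= k < n.+1) u k * co iota k (F x).
  by apply: eq_bigr => k _; rewrite fE mul1r.
have e2 : \sum_(1 <= k < n.+1) flow L (fun k => cf k (x - w)) (fun k => true%:R * co iota k (F x)) k r ^+ 2 =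
   \sum_(1 <= k < n.+1) u k ^+ 2 by apply: eq_bigr => k _; rewrite fE.
have e3 : \sum_(1 <= k < n.+1) L k * flow L (fun k => cf k (x - w)) (fun k => true%:R * co iota k (F x)) k r ^+ 2 =
   \sum_(1 <= k < n.+1) L k * u k ^+ 2 by apply: eq_bigr => k _; rewrite fE.
rewrite e1 e2 e3 split.
have p1 := ler_wpM2r (SS0 u) phiB.
exact: (coercive_real hco hy p1 dlZ PhiZ).
Qed.

End CellBound.

(** * Discrete Gronwall inequality and sums along the grid *)

Section DiscreteGronwall.
Variable R : realType.

Lemma gronwall_discrete (S al be : nat -> R) (N : nat) :
  (forall j, (j < N)%N -> 0 <= al j) -> (forall j, (j < N)%N -> 0 <= be j) -> 0 <= S 0%N ->
  (forall j, (j < N)%N -> S j.+1 <= expR (al j) * (S j + be j)) ->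
  S N <= expR (\sum_(0 <= j < N) al j) * (S 0%N + \sum_(0 <= j < N) be j).
Proof.
move=> + + S0; elim: N => [|N IH] al0 be0 hS.
  by rewrite !big_geq// expR0 mul1r addr0.
have {}IH := IH (fun j jN => al0 j (ltnW jN)) (fun j jN => be0 j (ltnW jN)) (fun j jN => hS j (ltnW jN)).
rewrite !big_nat_recr//=; apply: (le_trans (hS N (ltnSn N))).
have E0 := expR_ge0 (al N); have bN := be0 N (ltnSn N).
rewrite expRD [expR _ * expR (al N)]mulrC -mulrA; apply: ler_wpM2l => //.
rewrite addrA mulrDr; apply: lerD => //; apply: ler_peMl => //.
have : 0 <= \sum_(0 <= j < N) al j.
  by rewrite big_nat; apply: sumr_ge0 => j /andP[_ jN]; exact: al0 (ltnW jN).
by rewrite -expR0 ler_expR.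
Qed.

(** Young's inequality with weight d, so that the cross term costs a factor exp d; over all cells
    these factors multiply to at most exp T. *)
Lemma sqr_add_le (d q p : R) : 0 < d <= 1 -> (p + d * q) ^+ 2 <= expR d * p ^+ 2 + 2 * d * q ^+ 2.
Proof.
move=> /andP[d0 d1]; have h := expR_ge1Dx d; have := sqr_ge0 (p - q) => h1.
have h2 : (1 + d) * p ^+ 2 <= expR d * p ^+ 2 by rewrite ler_wpM2r ?sqr_ge0.
have h3 : d * (2 * p * q) <= d * (p ^+ 2 + q ^+ 2).
  by rewrite ler_wpM2l ?(ltW d0)//; have := h1; rewrite sqrrB; lra.
have h4 : d * q ^+ 2 * d <= d * q ^+ 2 * 1 by rewrite ler_wpM2l// mulr_ge0 ?sqr_ge0// ltW.
have -> : (p + d * q) ^+ 2 = p ^+ 2 + d * (2 * p * q) + d * q ^+ 2 * d by ring.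
lra.
Qed.

Lemma energy_const_ge1 (E C5 K1 X : R) : 0 <= E -> 0 <= C5 -> 0 <= K1 -> 0 <= X ->
  1 <= 1 + 2 * E * X + 4 * E * C5 + 4 * E * K1 + 2 * K1.
Proof.
move=> E0 C50 K10 X0; have := mulr_ge0 E0 X0; have := mulr_ge0 E0 C50; have := mulr_ge0 E0 K10.
lra.
Qed.

Lemma energy_real (E C5 K1 X A1 A2 A3 e S : R) : 0 <= E -> 0 <= C5 -> 0 <= K1 -> 0 <= X ->
  0 <= A1 -> 0 <= A2 -> 1 <= A3 -> 1 <= e -> S <= E * (X + (2 * C5 * A1 + 2 * K1 * e * A2)) ->
  2 * S + 2 * (K1 * A3) <=
  (1 + 2 * E * X + 4 * E * C5 + 4 * E * K1 + 2 * K1) * e * (A1 + A2 + A3).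
Proof.
move=> E0 C50 K10 X0 A10 A20 A31 e1 hS.
have e0 : 0 <= e by exact: le_trans e1.
have A30 : 0 <= A3 by exact: le_trans A31.
have s1 : 1 <= A1 + A2 + A3 by lra.
have a1 : A1 <= e * (A1 + A2 + A3).
  by apply: (@le_trans _ _ (A1 + A2 + A3)); [lra|apply: ler_peMl => //; lra].
have a3 : A3 <= e * (A1 + A2 + A3).
  by apply: (@le_trans _ _ (A1 + A2 + A3)); [lra|apply: ler_peMl => //; lra].
have a2 : e * A2 <= e * (A1 + A2 + A3) by apply: ler_wpM2l => //; lra.
have a0 : 1 <= e * (A1 + A2 + A3) by rewrite -[1]mulr1; apply: ler_pM.
move: a0 a1 a2 a3; rewrite -mulrA; set Q := e * (A1 + A2 + A3) => a0 a1 a2 a3.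
have b0 := ler_wpM2l (mulr_ge0 E0 X0) a0.
have b1 := ler_wpM2l (mulr_ge0 E0 C50) a1.
have b2 := ler_wpM2l (mulr_ge0 E0 K10) a2.
have b3 := ler_wpM2l K10 a3.
have Q0 : 0 <= Q by exact: le_trans a0.
have -> : (1 + 2 * E * X + 4 * E * C5 + 4 * E * K1 + 2 * K1) * Q =
  Q + 2 * (E * X * Q) + 4 * (E * C5 * Q) + 4 * (E * K1 * Q) + 2 * (K1 * Q) by ring.
have : E * (X + (2 * C5 * A1 + 2 * K1 * e * A2)) = E * X * 1 + 2 * (E * C5 * A1) + 2 * (E * K1 * (e * A2)) by ring.
lra.
Qed.

Lemma forcing_real (d C K e a a' b b' : R) : 0 <= d -> 0 <= C -> 0 <= K -> 0 <= e ->
  a <= a' -> b <= b' ->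
  2 * d * (C * a + e * (K * b)) <= 2 * C * (d * a') + 2 * K * e * (d * b').
Proof.
move=> d0 C0 K0 e0 aa bb.
have h1 := ler_wpM2l (mulr_ge0 d0 C0) aa.
have h2 := ler_wpM2l (mulr_ge0 (mulr_ge0 d0 e0) K0) bb.
have -> : 2 * d * (C * a + e * (K * b)) = 2 * (d * C * a) + 2 * (d * e * K * b) by ring.
have -> : 2 * C * (d * a') + 2 * K * e * (d * b') = 2 * (d * C * a') + 2 * (d * e * K * b') by ring.
lra.
Qed.

Lemma sqr_split_le (p q : R) : p ^+ 2 <= 2 * (p - q) ^+ 2 + 2 * q ^+ 2.
Proof. by have := sqr_ge0 (p - q - q); lra. Qed.

Definition wsum (N : nat) (tau z : nat -> R) : R :=
  \sum_(0 <= j < N) (tau j.+1 - tau j) * z j +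
  \sum_(0 <= j < N) (tau j.+1 - tau j) * z j.+1 + z N.

End DiscreteGronwall.

(** * Energy estimate along a path *)

Section PathEnergy.
Variable R : realType.
Local Notation H := (L2_01 R).
Variables (c alpha : R) (c0 : 0 < c) (ha : 0 <= alpha <= 1 / 2).
Variables (V : completeNormedModType R) (iota : {linear H -> V}).
Hypothesis hV : is_Hcompletion c (- alpha) iota.
Variables (rho varrho theta vartheta chi gamma varphi T : R).
Hypothesis hrho : 0 <= rho < varrho.
Hypothesis hvarrho : varrho < 1 / 4.
Hypothesis theta0 : 0 < theta.
Hypothesis vt0 : 0 < vartheta.
Hypothesis hchi : 0 < chi <= (varrho - rho) / (1 + vartheta).
Hypothesis gamma0 : 0 < gamma.
Hypothesis hvarphi : 0 <= varphi < 1.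
Hypothesis T0 : 0 < T.
Variables (F : H -> V) (phi Phi : H -> R) (xi : H).
Hypothesis hlip : forall n, (0 < n)%N -> forall v w : L2_01 R,
  range (@Pproj R n) v -> range (@Pproj R n) w ->
  `|F v - F w| <= theta *
    (1 + Hnorm c rho v `^ vartheta + Hnorm c rho w `^ vartheta) *
    Hnorm c rho (v - w).
Hypothesis hphi : forall u, Hdom c 1 u ->
    phi u = gamma + gamma *
      sup [set `|cont_repr u x| ^+ 2 | x in `]0%R, 1%R[%classic].
Hypothesis hPhi : forall u, Hdom c 1 u ->
    Phi u = gamma + gamma *
      sup [set `|cont_repr u x| `^ gamma | x in `]0%R, 1%R[%classic].
Hypothesis hcoercive : forall n, (0 < n)%N -> forall v w : L2_01 R,
    range (@Pproj R n) v -> range (@Pproj R n) w ->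
    ip v (extend iota (@Pproj R n) (F (v + w))) <=
      phi w * `|v| ^+ 2 + varphi * Hnorm c (1 / 2) v ^+ 2 + Phi w.
Local Notation L := (lam c).
Local Notation NN := (Hnorm c varrho).

(** The sup norm enters through [phi] and [Phi], the norm of $H_\varrho$ through the freezing error;
    the summand 1 makes powers increase with the exponent. *)
Definition noise_size n (w : nat -> R) : R := 1 + supn n w + NN (fsum n w).

Lemma noise_size_ge1 n w : 1 <= noise_size n w.
Proof. by rewrite /noise_size -addrA lerDl addr_ge0 ?supn_ge0 ?Hnorm_ge0. Qed.

Lemma sum_sqr_noise n (w : nat -> R) :
  \sum_(1 <= k < n.+1) w k ^+ 2 <= (L 1 `^ (- varrho)) ^+ 2 * noise_size n w ^+ 2.
Proof.
have N0 : 0 <= NN (fsum n w) by exact: Hnorm_ge0.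
apply: (@le_trans _ _ ((L 1 `^ (- varrho)) ^+ 2 * NN (fsum n w) ^+ 2)); last first.
  apply: ler_wpM2l; first exact: sqr_ge0.
  apply: lerXn2r; rewrite ?nnegrE//; first exact: le_trans (noise_size_ge1 n w).
  by rewrite /noise_size lerDr addr_ge0 ?supn_ge0.
have -> := Hnorm_range c varrho (range_fsum n w).
rewrite mulr_sumr big_nat [leRHS]big_nat; apply: ler_sum => k /andP[k0 kn].
rewrite (cf_fsum _ _ k0) -ltnS kn [true%:R * _]mul1r exprMn mulrA -exprMn.
have Lk := lam_gt0 c0 k0; have L1 := lam_gt0 c0 (isT : (0 < 1)%N).
have L1k := le_lam c0 k0.
have vr : 0 <= varrho by have /andP[r0 rv] := hrho; exact: (ltW (le_lt_trans r0 rv)).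
apply: ler_peMl; first exact: sqr_ge0.
apply: exprn_ege1; rewrite powRN.
rewrite ler_pdivlMl ?powR_gt0// mulr1.
exact: (ge0_ler_powR vr (ltW L1) (ltW Lk) L1k).
Qed.

Lemma path_energy : exists2 C7 : R, 1 <= C7 & exists G : nat, forall n (h eta : R) (y o : R -> H) (tau : nat -> R) (N : nat),
  (0 < n)%N -> 0 < h <= 1 -> 1 <= eta ->
  (forall s, 0 <= s <= T -> range (@Pproj R n) (y s)) ->
  tau 0%N = 0 -> (forall j, 0 <= tau j <= T) ->
  (forall j, tau j.+1 = tau j \/ tau j = j%:R * h /\ tau j < tau j.+1 <= j.+1%:R * h) ->
  (forall j, (j <= N)%N -> scheme c iota varrho chi F xi n h y o (tau j)) ->
  (forall k, (0 < k <= n)%N -> cf k (o 0) = 0) ->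
  let w j k := wrec c eta tau (fun i l => cf l (o (tau i))) j k in
  2 * gamma * (\sum_(0 <= j < N) (tau j.+1 - tau j) * supn n (w j) ^+ 2) <= 1 ->
  `|y (tau N)| ^+ 2 <= C7 * eta ^+ 2 * wsum N tau (fun j => noise_size n (w j) ^+ G).
Proof.
have [C5 C50 [G hcell]] := cell_bound c0 ha hV hrho hvarrho theta0 vt0 hchi gamma0 hvarphi hlip hphi hPhi hcoercive.
pose K1 := (L 1 `^ (- varrho)) ^+ 2.
have K10 : 0 <= K1 by exact: sqr_ge0.
(* The exponent collects d_j from [sqr_add_le], 2 gamma d_j from the constant part of [phi], and at
   most 1 from the smallness condition. *)
pose E := expR ((1 + 2 * gamma) * T + 1).
have E0 : 0 <= E by exact: expR_ge0.
pose C7 := 1 + 2 * E * `|xi| ^+ 2 + 4 * E * C5 + 4 * E * K1 + 2 * K1.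
exists C7.
  by apply: energy_const_ge1 => //; exact: sqr_ge0.
exists (G + 2)%N => n h eta y o tau N n0 h01 eta1 yr tau0 tauT tauS hs ho w hM.
have /andP[h0 h1] := h01.
pose d j := tau j.+1 - tau j.
have dh j : 0 <= d j <= h.
  rewrite /d; have [->|[tj /andP[lt le]]] := tauS j; first by rewrite subrr lexx ltW.
  by rewrite subr_ge0 (ltW lt)/= tj lerBlDr -[X in _ <= X + _]mul1r -mulrDl addrC natr1.
have d0 j : 0 <= d j by have /andP[] := dh j.
pose Z j := noise_size n (w j).
have Z1 j : 1 <= Z j by exact: noise_size_ge1.
have Z0 j : 0 <= Z j by exact: le_trans (Z1 j).
pose x j := y (tau j); pose wf j : H := fsum n (w j).
have xr j : range (@Pproj R n) (x j) by exact: yr.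
have wr j : range (@Pproj R n) (wf j) by exact: range_fsum.
have cfw j k : (0 < k <= n)%N -> cf k (wf j) = w j k.
  by move=> /andP[k0 kn]; rewrite (cf_fsum _ _ k0) kn mul1r.
pose v j k := cf k (x j - wf j).
have vE j k : (0 < k <= n)%N -> v j k = cf k (x j) - w j k.
  by move=> hk; rewrite /v (cfB k (x j)) (cfw j k hk).
pose S j := \sum_(1 <= k < n.+1) v j k ^+ 2.
have S0 j : 0 <= S j by apply: sumr_ge0 => k _; exact: sqr_ge0.
pose M j := supn n (w j).
have wS j : \sum_(1 <= k < n.+1) w j k ^+ 2 <= K1 * Z j ^+ 2 by exact: sum_sqr_noise.
have t2 : 0 <= 2 :> R by [].
have eta0 : 0 <= eta by exact: le_trans eta1.
pose al j := d j * (1 + 2 * gamma) + 2 * gamma * (d j * M j ^+ 2).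
pose be j := 2 * d j * (C5 * Z j ^+ G + eta ^+ 2 * (K1 * Z j.+1 ^+ 2)).
have al0 j : 0 <= al j.
  have g2 : 0 <= 2 * gamma by rewrite mulr_ge0// ltW.
  exact: (addr_ge0 (mulr_ge0 (d0 j) (addr_ge0 ler01 g2)) (mulr_ge0 g2 (mulr_ge0 (d0 j) (sqr_ge0 _)))).
have be0 j : 0 <= be j.
  apply: mulr_ge0; first exact: mulr_ge0.
  apply: addr_ge0; first by rewrite mulr_ge0// exprn_ge0.
  by apply: mulr_ge0; [exact: sqr_ge0|apply: mulr_ge0 => //; exact: sqr_ge0].
have step j : (j < N)%N -> S j.+1 <= expR (al j) * (S j + be j).
  move=> jN; have [te|[tj /andP[lt le]]] := tauS j.
    have d00 : d j = 0 by rewrite /d te subrr.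
    have we k : w j.+1 k = w j k.
      by rewrite /w/= te subrr mul0r oppr0 expR0 mulr0 addr0 invr1 !mul1r subrr addr0.
    have -> : S j.+1 = S j.
      apply: eq_bigr => k _; rewrite /v /x te /wf; congr (cf k (_ - _) ^+ 2).
      by apply: fsum_eq => i _; exact: we.
    have := al0 j; rewrite -ler_expR expR0 => h2.
    by apply: (le_trans _ (ler_wpM2r _ h2)); rewrite ?mul1r ?lerDl// addr_ge0.
  have dp : 0 < d j by rewrite subr_gt0.
  have d1 : d j <= 1 by have /andP[_ hd] := dh j; exact: le_trans hd h1.
  pose b := taming c varrho chi xi n h y o (tau j).
  have hb : b -> NN (x j) <= h `^ (- chi).
    rewrite /b /taming ger0_norm ?(ltW h0)// => hb; apply: (le_trans _ hb).
    by rewrite lerDl; exact: Hnorm_ge0.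
  have hc := hcell n b h (d j) (x j) (wf j) n0 (xr j) (wr j) h01 (dh j) hb.
  cbv zeta in hc.
  have sE : supn n (fun k => cf k (wf j)) = M j by apply: supn_eq => k hk; exact: cfw.
  rewrite sE -/(S j) in hc.
  pose p k := flow L (v j) (fun k => b%:R * co iota k (F (x j))) k (d j).
  have hp : \sum_(1 <= k < n.+1) p k ^+ 2 <=
      expR (2 * (gamma + gamma * M j ^+ 2) * d j) * (S j + 2 * (C5 * Z j ^+ G) * d j) by exact: hc.
  (* The recursion reads (1 + eta d) w_(j+1) = exp (- d lam) w_j + noise increment, so subtracting
     w_(j+1) from the scheme cancels the noise and leaves the flow plus d eta w_(j+1). *)
  have vS k : (0 < k <= n)%N -> v j.+1 k = p k + d j * (eta * w j.+1 k).
    move=> hk; rewrite (vE _ _ hk) /x.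
    have sj : scheme c iota varrho chi F xi n h y o (j%:R * h) by rewrite -tj; exact: hs (ltnW jN).
    have ltj : j%:R * h < tau j.+1 by rewrite -tj.
    have := scheme_rec c0 ha hV h0 hk ltj le sj (hs _ jN).
    rewrite -tj -/(d j) => ->.
    have wE : (1 + eta * d j) * w j.+1 k = expR (- (d j * L k)) * w j k +
        (cf k (o (tau j.+1)) - expR (- (d j * L k)) * cf k (o (tau j))).
      rewrite /w/= -/(d j) mulrA divff ?mul1r// gt_eqF// ltr_pwDl// mulr_ge0//.
    have -> : d j * (eta * w j.+1 k) = (1 + eta * d j) * w j.+1 k - w j.+1 k by ring.
    rewrite wE /p /flow (vE _ _ hk) /drift -/b -/(x j); ring.
  apply: (@le_trans _ _ (\sum_(1 <= k < n.+1) (expR (d j) * p k ^+ 2 + 2 * d j * eta ^+ 2 * w j.+1 k ^+ 2))).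
    rewrite /S big_nat [leRHS]big_nat; apply: ler_sum => k hk; rewrite (vS k hk).
    apply: (le_trans (sqr_add_le _ _ _)); first by rewrite dp.
    by rewrite exprMn -!mulrA.
  rewrite big_split/= -!mulr_sumr.
  have q1 := ler_wpM2l (expR_ge0 (d j)) hp.
  have q2 : 2 * d j * eta ^+ 2 * (\sum_(1 <= k < n.+1) w j.+1 k ^+ 2) <= 2 * d j * eta ^+ 2 * (K1 * Z j.+1 ^+ 2).
    by apply: ler_wpM2l => //; rewrite mulr_ge0 ?sqr_ge0// mulr_ge0.
  apply: (le_trans (lerD q1 q2)).
  have e1 : expR (d j) * expR (2 * (gamma + gamma * M j ^+ 2) * d j) = expR (al j).
    by rewrite -expRD /al; congr expR; ring.
  rewrite [X in X + _]mulrA e1 /be.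
  have ea : 1 <= expR (al j) by rewrite -expR0 ler_expR.
  have q3 : 2 * d j * eta ^+ 2 * (K1 * Z j.+1 ^+ 2) <= expR (al j) * (2 * d j * eta ^+ 2 * (K1 * Z j.+1 ^+ 2)).
    exact: (ler_peMl (mulr_ge0 (mulr_ge0 (mulr_ge0 t2 (d0 j)) (sqr_ge0 eta)) (mulr_ge0 K10 (sqr_ge0 _))) ea).
  apply: (le_trans (lerD (lexx _) q3)); rewrite -mulrDr; apply: ler_wpM2l; first exact: expR_ge0.
  by rewrite le_eqVlt; apply/orP; left; apply/eqP; ring.
have gr := gronwall_discrete (fun j _ => al0 j) (fun j _ => be0 j) (S0 0%N) step.
have telesc : \sum_(0 <= j < N) d j = tau N.
  by rewrite /d telescope_sumr// tau0 subr0.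
have sal : \sum_(0 <= j < N) al j <= (1 + 2 * gamma) * T + 1.
  rewrite /al big_split/= -mulr_suml -mulr_sumr telesc; apply: lerD => //.
  rewrite mulrC; apply: ler_wpM2l; first by rewrite addr_ge0// mulr_ge0// ltW.
  by have /andP[] := tauT N.
have S00 : S 0%N <= `|xi| ^+ 2.
  have t0 : 0 <= tau 0%N by rewrite tau0.
  apply: le_trans (bessel n xi); rewrite /S big_nat [leRHS]big_nat; apply: ler_sum => k hk.
  rewrite (vE _ _ hk) /x /w /= subr0.
  have -> := scheme_cf c0 ha hV h0 hk t0 (hs 0%N (leq0n N)).
  cbv beta; rewrite tau0 set_itvoo0 Rintegral_set0 addr0 (ho _ hk) addr0 mul0r oppr0 expR0 mul1r.
  exact: lexx.
have ZG j : Z j ^+ G <= Z j ^+ (G + 2) by rewrite ler_weXn2l// leq_addr.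
have Z2 j : Z j ^+ 2 <= Z j ^+ (G + 2) by rewrite ler_weXn2l// leq_addl.
have ZN1 : 1 <= Z N ^+ (G + 2) by exact: exprn_ege1.
have e21 : 1 <= eta ^+ 2 by exact: exprn_ege1.
pose A1 := \sum_(0 <= j < N) d j * Z j ^+ (G + 2).
pose A2 := \sum_(0 <= j < N) d j * Z j.+1 ^+ (G + 2).
pose A3 := Z N ^+ (G + 2).
have A10 : 0 <= A1 by apply: sumr_ge0 => j _; exact: (mulr_ge0 (d0 j) (exprn_ge0 _ (Z0 j))).
have A20 : 0 <= A2 by apply: sumr_ge0 => j _; exact: (mulr_ge0 (d0 j) (exprn_ge0 _ (Z0 j.+1))).
have sbe : \sum_(0 <= j < N) be j <= 2 * C5 * A1 + 2 * K1 * eta ^+ 2 * A2.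
  rewrite /A1 /A2 !mulr_sumr -big_split/=; apply: ler_sum => j _.
  exact: (forcing_real (d0 j) C50 K10 (sqr_ge0 eta) (ZG j) (Z2 j.+1)).
have SN : S N <= E * (`|xi| ^+ 2 + (2 * C5 * A1 + 2 * K1 * eta ^+ 2 * A2)).
  apply: (le_trans gr); apply: ler_pM.
  - exact: expR_ge0.
  - by apply: addr_ge0 => //; apply: sumr_ge0 => j _.
  - by rewrite ler_expR.
  - exact: lerD.
have yN : `|x N| ^+ 2 <= 2 * S N + 2 * (K1 * A3).
  have -> := norm_range (xr N).
  apply: (@le_trans _ _ (2 * S N + 2 * (\sum_(1 <= k < n.+1) w N k ^+ 2))).
    rewrite /S !mulr_sumr -big_split /= big_nat [leRHS]big_nat; apply: ler_sum => k hk.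
    rewrite (vE _ _ hk); exact: sqr_split_le.
  rewrite lerD2l; apply: ler_wpM2l => //; apply: (le_trans (wS N)).
  exact: ler_wpM2l.
apply: (le_trans yN).
have A31 : 1 <= A3 by [].
have X0 : 0 <= `|xi| ^+ 2 by exact: sqr_ge0.
exact: (energy_real E0 C50 K10 X0 A10 A20 A31 e21 SN).
Qed.

End PathEnergy.

(** * Uniform moments *)

Section LadderMoment.
Context d (Omega : measurableType d) (R : realType) (P : probability Omega R).

Lemma weighted_amgm (t s b : R) : 0 < t -> 1 <= s -> 0 <= b -> b <= t * s ^+ 2 + t^-1 * b ^+ 2.
Proof.
move=> t0 s1 b0; have h : 0 <= t^-1 * (t * s - b) ^+ 2 by rewrite mulr_ge0 ?sqr_ge0 ?invr_ge0 ?(ltW t0).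
have -> : t * s ^+ 2 + t^-1 * b ^+ 2 = t^-1 * (t * s - b) ^+ 2 + 2 * (s * b).
  by field; rewrite gt_eqF.
have : b <= s * b by rewrite ler_peMl.
lra.
Qed.

Lemma geo_sum_le (n : nat) : \sum_(0 <= m < n) (2 ^+ m)^-1 <= 2 :> R.
Proof.
suff : \sum_(0 <= m < n) (2 ^+ m)^-1 <= 2 - 2 * (2 ^+ n)^-1 :> R.
  by move=> h; apply: (le_trans h); rewrite gerBl mulr_ge0// invr_ge0 exprn_ge0.
elim: n => [|n IH]; first by rewrite big_geq// expr0 invr1 mulr1 subrr.
rewrite big_nat_recr//= exprS invfM; move: IH; move: (\sum_(_ <= _ < _) _) ((2 ^+ n)^-1) => a b.
by move=> IH; rewrite mulrA divff// mul1r; lra.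
Qed.

Variables (Q : nat) (KS KB : R) (Y : Omega -> R) (S B : nat -> Omega -> R).
Hypothesis mY : measurable_fun [set: Omega] Y.
Hypothesis mS : forall m, measurable_fun [set: Omega] (S m).
Hypothesis mB : forall m, measurable_fun [set: Omega] (B m).
Hypothesis Y0 : forall w, 0 <= Y w.
Hypothesis S0 : forall m w, 0 <= S m w.
Hypothesis B1 : forall m w, 1 <= B m w.
Hypothesis SB : {ae P, forall w, forall m, S m w <= 1 -> Y w <= B m w}.
Local Notation q := (16 * Q).+1.
Hypothesis hS : forall m, (\int[P]_w (S m w ^+ (2 * q))%:E <= (KS * (2 ^+ m)^-1 ^+ (2 * q))%:E)%E.
Hypothesis hB : forall m, (\int[P]_w (B m w ^+ (2 * Q))%:E <= (KB * 2 ^+ (32 * Q * m))%:E)%E.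

(** This weight balances the two terms: t m 2^(- 2 q m) and 2^(32 Q (m + 1)) / t m are both of order
    2^-m, because 2 q = 32 Q + 2. *)
Let t m : R := 2 ^+ ((32 * Q).+1 * m).
Let t0 m : 0 < t m. Proof. exact: exprn_gt0. Qed.

(* If S m <= 1 first holds at m = m'+1 then Y^Q <= B m^Q <= S m'^q B m^Q, and the
   weighted AM-GM inequality separates S from B. *)
Lemma ladder_moment : (\int[P]_w (Y w ^+ Q)%:E <= (1 + KB + 2 * (KS + 2 ^+ (32 * Q) * KB))%:E)%E.
Proof.
have B0 m w : 0 <= B m w by exact: le_trans (B1 m w).
pose term m w := t m * S m w ^+ (2 * q) + (t m)^-1 * B m.+1 w ^+ (2 * Q).
have term0 m w : 0 <= term m w.
  by rewrite /term addr_ge0// mulr_ge0 ?exprn_ge0 ?invr_ge0 ?(ltW (t0 m)).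
have termB m w : 1 < S m w -> B m.+1 w ^+ Q <= term m w.
  move=> s1; rewrite /term mulnC exprM [(2 * Q)%N]mulnC exprM.
  apply: weighted_amgm => //; [exact: exprn_ege1 (ltW s1)|exact: exprn_ge0].
(* Truncation at k avoids assuming that some level succeeds: if none up to k does, each of the first
   k terms is at least 1 and their sum dominates k. *)
have key w : (forall m, S m w <= 1 -> Y w <= B m w) -> forall k,
    Num.min (Y w ^+ Q) k%:R <= (1 + B 0%N w ^+ (2 * Q)) + \sum_(0 <= m < k) term m w.
  move=> hw k.
  have BQ x : 0 <= x -> x ^+ Q <= 1 + x ^+ (2 * Q) :> R.
    by move=> x0; rewrite mulnC exprM; have := sqr_ge0 (x ^+ Q - 1); nra.
  have a0 : 0 <= 1 + B 0%N w ^+ (2 * Q) by rewrite addr_ge0// exprn_ge0.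
  have [/existsP[i hi]|] := boolP [exists i : 'I_k.+1, S i w <= 1].
    have [m hm mmin] := ex_minnP (ex_intro (fun m => S m w <= 1) (i : nat) hi).
    have mk : (m <= k)%N by apply: leq_trans (mmin _ hi) _; rewrite -ltnS.
    have YB : Y w ^+ Q <= B m w ^+ Q by apply: lerXn2r; rewrite ?nnegrE//; exact: hw.
    rewrite ge_min; apply/orP; left; apply: (le_trans YB).
    case: m hm mmin mk YB => [|m] hm mmin mk YB.
      apply: (le_trans (BQ _ (B0 0%N w))); rewrite lerDl; exact: sumr_ge0.
    have sm : 1 < S m w.
      by rewrite ltNge; apply/negP => /mmin; rewrite ltnn.
    apply: (le_trans (termB m w sm)).
    apply: (@le_trans _ _ (\sum_(0 <= m < k) term m w)); last by rewrite lerDr.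
    rewrite (bigD1_seq m) ?iota_uniq ?mem_index_iota//= lerDl; exact: sumr_ge0.
  rewrite negb_exists => /forallP hn.
  rewrite ge_min; apply/orP; right.
  apply: (@le_trans _ _ (\sum_(0 <= m < k) term m w)); last by rewrite lerDr.
  have -> : k%:R = \sum_(0 <= m < k) 1 :> R by rewrite sumr_const_nat subn0.
  rewrite big_nat [leRHS]big_nat; apply: ler_sum => m /andP[_ mk].
  have := hn (Ordinal (ltnW mk : (m < k.+1)%N)); rewrite -ltNge /= => /termB h.
  apply: (le_trans _ h); exact: exprn_ege1.
have mterm m : measurable_fun [set: Omega] (term m).
  by apply: measurable_funD; apply: measurable_funM => //; exact: measurable_funX.
have mmin k : measurable_fun [set: Omega] (fun w => Num.min (Y w ^+ Q) k%:R).
  by apply: measurable_minr => //; exact: measurable_funX.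
have KB0 : 0 <= KB.
  have := hB 0; rewrite muln0 expr0 mulr1; rewrite -lee_fin; apply: le_trans.
  by apply: int_ge0 => w; rewrite exprn_ge0.
have KS0 : 0 <= KS.
  have := hS 0; rewrite expr0 invr1 expr1n mulr1; rewrite -lee_fin; apply: le_trans.
  by apply: int_ge0 => w; rewrite exprn_ge0.
have Iterm m : (\int[P]_w (term m w)%:E <= ((KS + 2 ^+ (32 * Q) * KB) * (2 ^+ m)^-1)%:E)%E.
  have m1 : measurable_fun [set: Omega] (fun w => S m w ^+ (2 * q)) by exact: measurable_funX.
  have m2 : measurable_fun [set: Omega] (fun w => B m.+1 w ^+ (2 * Q)) by exact: measurable_funX.
  have z1 w : 0 <= S m w ^+ (2 * q) by rewrite exprn_ge0.
  have z2 w : 0 <= B m.+1 w ^+ (2 * Q) by rewrite exprn_ge0.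
  have ti : 0 <= (t m)^-1 by rewrite invr_ge0 ltW.
  have m3 : measurable_fun [set: Omega] (fun w => t m * S m w ^+ (2 * q)) by exact: measurable_funM.
  have m4 : measurable_fun [set: Omega] (fun w => (t m)^-1 * B m.+1 w ^+ (2 * Q)) by exact: measurable_funM.
  have z3 w : 0 <= t m * S m w ^+ (2 * q) by rewrite mulr_ge0// ltW.
  have z4 w : 0 <= (t m)^-1 * B m.+1 w ^+ (2 * Q) by rewrite mulr_ge0.
  rewrite (intD _ measurableT m3 m4 z3 z4) (intZ _ measurableT (ltW (t0 m)) m1 z1) (intZ _ measurableT ti m2 z2).
  apply: (@le_trans _ _ ((t m)%:E * (KS * (2 ^+ m)^-1 ^+ (2 * q))%:E + ((t m)^-1)%:E * (KB * 2 ^+ (32 * Q * m.+1))%:E)%E).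
    by apply: leeD; apply: lee_wpmul2l; rewrite ?lee_fin// ltW.
  rewrite -!EFinM -EFinD lee_fin le_eqVlt; apply/orP; left; apply/eqP.
  have e1 : t m * (2 ^+ m)^-1 ^+ (2 * q) = (2 ^+ m)^-1.
    rewrite /t -exprVn -exprM (_ : m * (2 * q) = (32 * Q).+1 * m + m)%N; last by rewrite -?[(32 * Q).+1]addn1 -?[(16 * Q).+1]addn1; ring.
    by rewrite exprD mulrA -exprMn divff// expr1n mul1r exprVn.
  have e2 : (t m)^-1 * 2 ^+ (32 * Q * m.+1) = 2 ^+ (32 * Q) * (2 ^+ m)^-1.
    rewrite /t mulSn exprD mulnS exprD.
    have := exprn_gt0 m (ltr0n R 2); have := exprn_gt0 (32 * Q * m) (ltr0n R 2).
    move: (2 ^+ m : R) (2 ^+ (32 * Q * m) : R) (2 ^+ (32 * Q) : R) => a b e b0 a0.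
    by field; rewrite !gt_eqF.
  by rewrite mulrCA e1 [X in _ + X]mulrCA e2; ring.
pose C := 1 + KB + 2 * (KS + 2 ^+ (32 * Q) * KB).
have bound k : (\int[P]_w (Num.min (Y w ^+ Q) k%:R)%:E <= C%:E)%E.
  have mR : measurable_fun [set: Omega] (fun w => (1 + B 0%N w ^+ (2 * Q)) + \sum_(0 <= m < k) term m w).
    apply: measurable_funD; last exact: measurable_sum.
    by apply: measurable_funD => //; exact: measurable_funX.
  have m0 w : 0 <= Num.min (Y w ^+ Q) k%:R by rewrite le_min exprn_ge0// ler0n.
  have s0 w : 0 <= \sum_(0 <= m < k) term m w by exact: sumr_ge0.
  have a0 w : 0 <= 1 + B 0%N w ^+ (2 * Q) by rewrite addr_ge0// exprn_ge0.
  apply: (@le_trans _ _ (\int[P]_w ((1 + B 0%N w ^+ (2 * Q)) + \sum_(0 <= m < k) term m w)%:E)%E).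
    apply: ae_ge0_le_integral => //.
    - by move=> w _; rewrite lee_fin.
    - exact/measurable_EFinP.
    - by move=> w _; rewrite lee_fin addr_ge0.
    - exact/measurable_EFinP.
    - by move: SB; apply: ae_mono => w hw _; rewrite lee_fin; exact: key.
  have mB0 : measurable_fun [set: Omega] (fun w => B 0%N w ^+ (2 * Q)) by exact: measurable_funX.
  have m1 : measurable_fun [set: Omega] (fun w => 1 + B 0%N w ^+ (2 * Q)) by exact: measurable_funD.
  have m2 : measurable_fun [set: Omega] (fun w => \sum_(0 <= m < k) term m w) by exact: measurable_sum.
  rewrite (intD _ measurableT m1 m2 a0 s0).
  have zB w : 0 <= B 0%N w ^+ (2 * Q) by rewrite exprn_ge0.
  have -> : (\int[P]_w (1 + B 0%N w ^+ (2 * Q))%:E = 1 + \int[P]_w (B 0%N w ^+ (2 * Q))%:E)%E.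
    rewrite (intD _ measurableT (measurable_cst _) mB0 (fun=> ler01) zB).
    by rewrite integral_prob_cst.
  have h1 : (\int[P]_w (\sum_(0 <= m < k) term m w)%:E <= (2 * (KS + 2 ^+ (32 * Q) * KB))%:E)%E.
    have := @int_sum_le _ Omega R P nat (index_iota 0 k) (fun=> 1) (fun m => (KS + 2 ^+ (32 * Q) * KB) * (2 ^+ m)^-1)
      term (fun=> ler01) mterm term0 Iterm.
    under eq_integral do under eq_bigr do rewrite mul1r.
    move=> h; apply: (le_trans h); rewrite lee_fin.
    under eq_bigr do rewrite mul1r.
    rewrite -mulr_sumr mulrC; apply: ler_wpM2r; last exact: geo_sum_le.
    by rewrite addr_ge0// mulr_ge0// exprn_ge0.
  have h0 := hB 0; rewrite muln0 expr0 mulr1 in h0.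
  apply: (le_trans (leeD (leeD (lexx 1%E) h0) h1)).
  by rewrite -!EFinD.
apply: (@ae_fatou _ _ _ P (fun k w => (Num.min (Y w ^+ Q) k%:R)%:E)).
- by move=> k; exact/measurable_EFinP.
- by apply/measurable_EFinP; exact: measurable_funX.
- by move=> k w; rewrite lee_fin le_min exprn_ge0// ler0n.
- apply: aeW => w; apply: cvg_near_cst.
  exists (Num.truncn (Y w ^+ Q)).+1 => // k /= hk.
  have hY : Y w ^+ Q <= k%:R.
    by apply: ltW; apply: (lt_le_trans (truncnS_gt _)); rewrite ler_nat.
  by rewrite min_l.
- by apply: nearW => k; exact: bound.
Qed.

End LadderMoment.

(** * Moments of the noise size *)

Section NoiseMoments.
Context d (Omega : measurableType d) (R : realType) (P : probability Omega R).
Variables (c : R) (c0 : 0 < c).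
Local Notation H := (L2_01 R).
Local Notation leb := (@lebesgue_measure R).
Local Notation TR := (measurableTypeR R).
Local Notation L := (lam c).
Variable T : R.
Variable W : R -> H -> Omega -> R.
Hypothesis T0 : 0 < T.
Hypothesis hW : is_cylindrical_wiener P T W.
Variable varrho : R.
Hypothesis hvarrho : varrho < 1 / 4.

Lemma Hnorm_fsum_sqr n (w : nat -> R) :
  Hnorm c varrho (fsum n w) ^+ 2 = \sum_(1 <= k < n.+1) (L k `^ varrho * w k) ^+ 2.
Proof.
apply: etrans (Hnorm_range c varrho (range_fsum n w)) _.
apply: eq_big_nat => k /andP[k0 kn]; rewrite (cf_fsum _ _ k0) -ltnS kn.
by rewrite [true%:R * _]mul1r.
Qed.

Lemma noise_size_measurable n (w : nat -> Omega -> R) :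
  (forall k, measurable_fun [set: Omega] (w k)) ->
  measurable_fun [set: Omega] (fun om => noise_size c varrho n (w^~ om)).
Proof.
move=> mw; have [_ ms] := supn_measurable n mw.
apply: measurable_funD; first exact: measurable_funD.
have -> : (fun om => Hnorm c varrho (fsum n (w^~ om))) =
    (fun om => (\sum_(1 <= k < n.+1) (L k `^ varrho * w k om) ^+ 2) `^ (1 / 2)).
  apply/funext => om; rewrite -Hnorm_fsum_sqr -powR_mulrn ?Hnorm_ge0// -powRrM.
  by rewrite (_ : 2%:R * (1 / 2) = 1) ?powRr1 ?Hnorm_ge0//; field.
have ms2 : measurable_fun [set: Omega] (fun om => \sum_(1 <= k < n.+1) (L k `^ varrho * w k om) ^+ 2).
  by apply: measurable_sum => k; apply: measurable_funX; exact: measurable_funM.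
exact: (measurableT_comp (@measurable_powR R (1 / 2)) ms2).
Qed.

Lemma pow3_le (x y : R) (r : nat) : 0 <= x -> 0 <= y ->
  (1 + x + y) ^+ r.+1 <= 3 ^+ r * (1 + x ^+ r.+1 + y ^+ r.+1).
Proof.
move=> x0 y0.
have z0 (i : nat) : 0 <= nth 0 [:: 1; x; y] i by case: i => [|[|[|i]]]//=; rewrite nth_nil.
have := @jensen_sum R nat (iota 0 3) (fun=> 1) (nth 0 [:: 1; x; y]) r (fun=> ler01) z0.
rewrite /= !big_cons !big_nil /= !mul1r !addr0 expr1n !addrA.
by rewrite (_ : 1 + 1 + 1 = 3 :> R)//; ring.
Qed.

Lemma noise_moment (r : nat) : exists2 K : R, 0 <= K & forall n m w,
  gauss_coords P c T W n (etam R m) w ->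
  (\int[P]_om (noise_size c varrho n (w^~ om) ^+ r)%:E <= K%:E)%E.
Proof.
(* [supn_moment] wants an order above 3, and r <= 2 s lets the larger power dominate, as the noise
   size is at least 1. *)
pose s := r.+4; have s3 : (3 < s)%N by [].
have s0 : (0 < s)%N by [].
have [K1 K10 hK1] := supn_moment c0 T0 hW s3.
have [K2 K20 hK2] := Hnorm_moment c0 T0 hW hvarrho s0.
have es : (2 * s = (2 * s).-1.+1)%N by [].
exists (3 ^+ (2 * s).-1 * (1 + K1 + K2)).
  by rewrite mulr_ge0 ?exprn_ge0// !addr_ge0.
move=> n m w hw; have [mw _] := hw.
have mN := noise_size_measurable n mw.
have [_ ms] := supn_measurable n mw.
have N1 om := noise_size_ge1 c varrho n (w^~ om).
pose X om := supn n (w^~ om) ^+ (2 * s).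
pose Yh om := (\sum_(1 <= k < n.+1) (L k `^ varrho * w k om) ^+ 2) ^+ s.
have X0 om : 0 <= X om by apply: exprn_ge0; exact: supn_ge0.
have Y0 om : 0 <= Yh om by apply: exprn_ge0; apply: sumr_ge0 => k _; exact: sqr_ge0.
have mX : measurable_fun [set: Omega] X by exact: measurable_funX.
have mY : measurable_fun [set: Omega] Yh.
  apply: measurable_funX; apply: measurable_sum => k; apply: measurable_funX; exact: measurable_funM.
have t0 : 0 <= 3 ^+ (2 * s).-1 :> R by exact: exprn_ge0.
have m1 : measurable_fun [set: Omega] (fun om => 1 + X om) by exact: measurable_funD.
have m2 : measurable_fun [set: Omega] (fun om => 1 + X om + Yh om) by exact: measurable_funD.
have z1 om : 0 <= 1 + X om by exact: addr_ge0.
have z2 om : 0 <= 1 + X om + Yh om by exact: addr_ge0.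
have m3 : measurable_fun [set: Omega] (fun om => 3 ^+ (2 * s).-1 * (1 + X om + Yh om)) by exact: measurable_funM.
apply: (@le_trans _ _ (\int[P]_om (3 ^+ (2 * s).-1 * (1 + X om + Yh om))%:E)%E).
  apply: int_le => //; first exact: measurable_funX.
    by move=> om _; apply: exprn_ge0; exact: le_trans (N1 om).
  move=> om _; apply: (@le_trans _ _ (noise_size c varrho n (w^~ om) ^+ (2 * s))).
    by rewrite ler_weXn2l// /s mul2n -addnn -!addSnnS !addSn !leqW// leq_addr.
  have h := @pow3_le (supn n (w^~ om)) (Hnorm c varrho (fsum n (w^~ om))) (2 * s).-1
    (supn_ge0 _ _) (Hnorm_ge0 _ _ _).
  apply: (le_trans h); rewrite -es; apply: ler_wpM2l => //; apply: lerD => //.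
  by rewrite /Yh -Hnorm_fsum_sqr exprM.
rewrite (intZ _ measurableT t0 m2 z2) (intD _ measurableT m1 mY z1 Y0).
rewrite (intD _ measurableT (measurable_cst _) mX (fun=> ler01) X0) integral_prob_cst.
have hX : (\int[P]_om (X om)%:E <= K1%:E)%E.
  apply: (le_trans (hK1 n m w hw)); rewrite lee_fin; apply: ler_piMr => //.
  apply: exprn_ile1; first by rewrite invr_ge0 exprn_ge0.
  by rewrite invf_le1 ?exprn_gt0//; apply: exprn_ege1; lra.
have hY : (\int[P]_om (Yh om)%:E <= K2%:E)%E.
  apply: (le_trans (hK2 n (etam R m) w (ltW (etam_gt0 R m)) hw)).
  exact: lexx.
apply: (@le_trans _ _ ((3 ^+ (2 * s).-1)%:E * (1 + K1%:E + K2%:E))%E); last exact: lexx.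
apply: lee_wpmul2l; first by rewrite lee_fin.
by apply: leeD hY; apply: leeD.
Qed.

End NoiseMoments.


(** * Moments of the scheme, uniform in n and t *)

Section SchemeMoments.
Context d (Omega : measurableType d) (R : realType) (P : probability Omega R).
Local Notation H := (L2_01 R).
Local Notation leb := (@lebesgue_measure R).
Local Notation TR := (measurableTypeR R).
Variables (c alpha : R) (c0 : 0 < c) (ha : 0 <= alpha <= 1 / 2).
Variables (V : completeNormedModType R) (iota : {linear H -> V}).
Hypothesis hV : is_Hcompletion c (- alpha) iota.
Variables (rho varrho theta vartheta chi gamma varphi T : R).
Hypothesis hrho : 0 <= rho < varrho.
Hypothesis hvarrho : varrho < 1 / 4.
Hypothesis theta0 : 0 < theta.
Hypothesis vt0 : 0 < vartheta.
Hypothesis hchi : 0 < chi <= (varrho - rho) / (1 + vartheta).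
Hypothesis gamma0 : 0 < gamma.
Hypothesis hvarphi : 0 <= varphi < 1.
Hypothesis T0 : 0 < T.
Variables (F : H -> V) (phi Phi : H -> R) (xi : H).
Hypothesis hlip : forall n, (0 < n)%N -> forall v w : L2_01 R,
  range (@Pproj R n) v -> range (@Pproj R n) w ->
  `|F v - F w| <= theta *
    (1 + Hnorm c rho v `^ vartheta + Hnorm c rho w `^ vartheta) *
    Hnorm c rho (v - w).
Hypothesis hphi : forall u, Hdom c 1 u ->
    phi u = gamma + gamma *
      sup [set `|cont_repr u x| ^+ 2 | x in `]0%R, 1%R[%classic].
Hypothesis hPhi : forall u, Hdom c 1 u ->
    Phi u = gamma + gamma *
      sup [set `|cont_repr u x| `^ gamma | x in `]0%R, 1%R[%classic].
Hypothesis hcoercive : forall n, (0 < n)%N -> forall v w : L2_01 R,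
    range (@Pproj R n) v -> range (@Pproj R n) w ->
    ip v (extend iota (@Pproj R n) (F (v + w))) <=
      phi w * `|v| ^+ 2 + varphi * Hnorm c (1 / 2) v ^+ 2 + Phi w.
Variable W : R -> H -> Omega -> R.
Hypothesis hW : is_cylindrical_wiener P T W.
Local Notation L := (lam c).

Lemma wsum_ge1 N (tau z : nat -> R) : (forall j, tau j <= tau j.+1) -> (forall j, 1 <= z j) ->
  1 <= wsum N tau z.
Proof.
move=> tS z1; rewrite /wsum; apply: (le_trans (z1 N)); rewrite lerDr.
have p j i : 0 <= (tau j.+1 - tau j) * z i.
  by rewrite mulr_ge0 ?subr_ge0// (le_trans ler01).
by rewrite addr_ge0// sumr_ge0.
Qed.

(** The parts of [wsum] as one weighted list, so that Jensen's inequality is applied once, with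
    total weight 2 tau N + 1. *)
Definition wseq N (tau : nat -> R) : seq (R * nat) :=
  [seq (tau j.+1 - tau j, j) | j <- index_iota 0 N] ++
  [seq (tau j.+1 - tau j, j.+1) | j <- index_iota 0 N] ++ [:: (1, N)].

(** The absolute values make the weights nonnegative at every index, as [jensen_sum] asks, without
    changing those on the list. *)
Lemma wsumE N (tau z : nat -> R) : (forall j, tau j <= tau j.+1) ->
  wsum N tau z = \sum_(i <- wseq N tau) `|i.1| * z i.2.
Proof.
move=> tS; rewrite /wsum /wseq !big_cat !big_map /= big_seq1 /= normr1 mul1r -addrA.
have e j : `|tau j.+1 - tau j| = tau j.+1 - tau j by rewrite ger0_norm// subr_ge0.
by do ![congr (_ + _)]; apply: eq_bigr => j _; rewrite e.
Qed.

Lemma wseq_weight N (tau : nat -> R) : (forall j, tau j <= tau j.+1) -> tau 0%N = 0 ->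
  \sum_(i <- wseq N tau) `|i.1| = 2 * tau N + 1.
Proof.
move=> tS t0; have := wsumE N (fun=> 1) tS; under [RHS]eq_bigr do rewrite mulr1.
move=> <-; rewrite /wsum; under eq_bigr do rewrite mulr1.
by rewrite telescope_sumr// t0 subr0; ring.
Qed.

Lemma wsum_pow N (tau z : nat -> R) (r : nat) : (forall j, tau j <= tau j.+1) -> tau 0%N = 0 ->
  (forall j, 0 <= z j) -> tau N <= T ->
  wsum N tau z ^+ r <= (2 * T + 1) ^+ r * wsum N tau (fun j => z j ^+ r).
Proof.
move=> tS t0 z0 tN.
have tN0 : 0 <= tau N by elim: N {tN} => [|N IH]; rewrite ?t0// (le_trans IH).
have T1 : 1 <= 2 * T + 1 by have := T0; lra.
have w0 : 0 <= wsum N tau (fun j => z j ^+ r).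
  have p j i : 0 <= (tau j.+1 - tau j) * z i ^+ r by rewrite mulr_ge0 ?subr_ge0// exprn_ge0.
  by rewrite /wsum !addr_ge0// ?sumr_ge0// exprn_ge0.
case: r w0 => [|r] w0.
  rewrite !expr0 mul1r; have := @wsum_ge1 N tau (fun=> 1) tS (fun=> lexx 1).
  exact.
rewrite !(wsumE _ _ tS).
apply: (le_trans (@jensen_sum R _ (wseq N tau) (fun i => `|i.1|) (fun i => z i.2) r (fun i => normr_ge0 _) (fun i => z0 _))).
apply: ler_wpM2r.
  by apply: sumr_ge0 => i _; rewrite mulr_ge0// exprn_ge0.
rewrite (wseq_weight N tS t0).
apply: (@le_trans _ _ ((2 * T + 1) ^+ r)); last by rewrite ler_weXn2l.
apply: lerXn2r; rewrite ?nnegrE.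
- by rewrite addr_ge0// mulr_ge0.
- exact: le_trans T1.
- by rewrite lerD2r ler_wpM2l.
Qed.

(** [ladder_moment] with Y the squared norm, S the quantity of the smallness condition and B the
    bound of [path_energy], one level per damping rate [etam m]. The constant can be chosen before
    n, h and the grid because the moments of S and B see the grid only through total weights bounded
    in terms of T. *)
Lemma scheme_moment (Q : nat) : (0 < Q)%N -> exists C : R, forall n (h : R) (y o : R -> Omega -> H) (tau : nat -> R) (N : nat),
  (0 < n)%N -> 0 < h <= 1 ->
  (forall s, 0 <= s <= T -> borel_rv (y s) /\ forall w, range (@Pproj R n) (y s w)) ->
  (forall s, 0 <= s <= T -> borel_rv (o s)) ->
  (forall s k, 0 <= s <= T -> (0 < k <= n)%N ->
     isG P T W (fun r : TR => resp c k s r *: eigf R k) (fun w => cf k (o s w))) ->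
  tau 0%N = 0 -> (forall j, 0 <= tau j <= T) ->
  (forall j, tau j.+1 = tau j \/ tau j = j%:R * h /\ tau j < tau j.+1 <= j.+1%:R * h) ->
  (forall j, {ae P, forall w, scheme c iota varrho chi F xi n h (y^~ w) (o^~ w) (tau j)}) ->
  (\int[P]_w (`|y (tau N) w| ^+ (2 * Q))%:E <= C%:E)%E.
Proof.
move=> Q0; have [C7 C71 [G hE]] := path_energy c0 ha hV T hrho hvarrho theta0 vt0 hchi gamma0 hvarphi xi hlip hphi hPhi hcoercive.
(* S is quadratic in the sup norms, so its q-th power needs their moments of order 2 q, which carry
   the factor 2^(- q m) required by the ladder. *)
pose q := (2 * (16 * Q).+1)%N.
have q3 : (3 < q)%N.
  by apply: (@leq_trans (2 * 17)) => //; rewrite /q leq_mul2l /= ltnS leq_pmulr.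
have [KM KM0 hKM] := supn_moment c0 T0 hW q3.
have [KZ KZ0 hKZ] := noise_moment c0 T0 hW hvarrho (G * (2 * Q))%N.
pose KS := (2 * gamma) ^+ q * (T ^+ q * KM).
pose KB := C7 ^+ (2 * Q) * ((2 * T + 1) ^+ (2 * Q) * ((2 * T + 1) * KZ)).
exists (1 + KB + 2 * (KS + 2 ^+ (32 * Q) * KB)) => n h y o tau N n0 h01 hy ho oG tau0 tauT tauS hs.
have tS j : tau j <= tau j.+1.
  by have [->|[_ /andP[/ltW]]] := tauS j.
have C70 : 0 <= C7 by exact: le_trans C71.
pose eta m := etam R m.
have eta1 m : 1 <= eta m by apply: exprn_ege1; lra.
pose w m j k om := wrec c (eta m) tau (fun i l => cf l (o (tau i) om)) j k.
have gw m j : gauss_coords P c T W n (eta m) (w m j).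
  apply: (wrec_gauss c0 hW (ltW (etam_gt0 R m)) tS (fun j => ho _ (tauT j))).
  by move=> i k hk; exact: oG.
have mw m j k : measurable_fun [set: Omega] (w m j k) by have [h1 _] := gw m j; exact: h1.
pose M m j om := supn n (fun k => w m j k om).
pose Z m j om := noise_size c varrho n (fun k => w m j k om).
have mM m j : measurable_fun [set: Omega] (M m j) by have [_ h1] := supn_measurable n (mw m j).
have mZ m j : measurable_fun [set: Omega] (Z m j) by exact: noise_size_measurable.
have M0 m j om : 0 <= M m j om by exact: supn_ge0.
have Z1 m j om : 1 <= Z m j om by exact: noise_size_ge1.
have Z0 m j om : 0 <= Z m j om by exact: le_trans (Z1 m j om).
have d0 j : 0 <= tau j.+1 - tau j by rewrite subr_ge0.
pose Y om := `|y (tau N) om| ^+ 2.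
pose S m om := 2 * gamma * (\sum_(0 <= j < N) (tau j.+1 - tau j) * M m j om ^+ 2).
pose B m om := C7 * eta m ^+ 2 * wsum N tau (fun j => Z m j om ^+ G).
have g2 : 0 <= 2 * gamma by rewrite mulr_ge0// ltW.
have tN : tau N <= T by have /andP[] := tauT N.
have tel : \sum_(0 <= j < N) (tau j.+1 - tau j) = tau N by rewrite telescope_sumr// tau0 subr0.
have YQ om : `|y (tau N) om| ^+ (2 * Q) = Y om ^+ Q by rewrite exprM.
under eq_integral do rewrite YQ.
have wsum1 m om : 1 <= wsum N tau (fun j => Z m j om ^+ G).
  by apply: wsum_ge1 => // j; exact: exprn_ege1.
have Ce m : 1 <= C7 * eta m ^+ 2 by rewrite -[1]mulr1; apply: ler_pM => //; exact: exprn_ege1.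
have mwsum m (r : nat) : measurable_fun [set: Omega] (fun om => wsum N tau (fun j => Z m j om ^+ r)).
  rewrite /wsum; apply: measurable_funD; last exact: measurable_funX.
  by apply: measurable_funD; apply: measurable_sum => j; apply: measurable_funM => //; exact: measurable_funX.
have mS m : measurable_fun [set: Omega] (S m).
  apply: measurable_funM => //; apply: measurable_sum => j.
  by apply: measurable_funM => //; exact: measurable_funX.
apply: (@ladder_moment _ Omega R P Q KS KB Y S B).
- by have [hb _] := hy _ (tauT N); apply: wmeas_norm2; exact: wmeas_rv.
- exact: mS.
- by move=> m; apply: measurable_funM => //; exact: mwsum.
- by move=> om; exact: sqr_ge0.
- move=> m om; rewrite /S mulr_ge0// sumr_ge0// => j _; rewrite mulr_ge0// sqr_ge0//.
- move=> m om; rewrite /B -[1]mulr1; apply: ler_pM => //.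
- have o0 : {ae P, forall om, forall k, (0 < k <= n)%N -> cf k (o 0 om) = 0}.
    apply: ae_foralln => k; have [hk|hk] := boolP (0 < k <= n)%N; last first.
      by apply: aeW.
    have z0 : 0 <= (0 : R) <= T by rewrite lexx ltW.
    have hG := oG 0 k z0 hk.
    have e : (fun r : TR => resp c k 0 r *: eigf R k) = (fun=> 0).
      apply/funext => r; rewrite /resp (_ : (0 < r < 0) = false) ?mul0r ?scale0r//.
      by apply/negbTE/negP => /andP[a b]; have := lt_trans a b; rewrite ltxx.
    rewrite e in hG.
    by apply: ae_mono (isG_eq T0 hW hG (isG0 P T W)) => om h0 _.
  have hs' : {ae P, forall om, forall j, scheme c iota varrho chi F xi n h (y^~ om) (o^~ om) (tau j)}.
    by apply: ae_foralln.
  apply: filterS2 o0 hs' => om h0 h1 m hm.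
  apply: (hE n h (eta m) (y^~ om) (o^~ om) tau N n0 h01 (eta1 m)) => //.
    by move=> s hs0; have [_ hr] := hy s hs0; exact: hr.
- move=> m; rewrite -/q.
  apply: (@le_trans _ _ (\int[P]_om (\sum_(j <- index_iota 0 N) ((2 * gamma) ^+ q * (T ^+ q.-1 * (tau j.+1 - tau j))) * M m j om ^+ (2 * q))%:E)%E).
    apply: int_le => //.
    + exact: measurable_funX.
    + by apply: measurable_sum => j; apply: measurable_funM => //; exact: measurable_funX.
    + move=> om _; apply: exprn_ge0; rewrite /S mulr_ge0// sumr_ge0// => j _; rewrite mulr_ge0// sqr_ge0//.
    + move=> om _; rewrite /S exprMn.
      under [leRHS]eq_bigr do rewrite -mulrA -[X in _ * X]mulrA.
      rewrite -mulr_sumr -mulr_sumr; apply: ler_wpM2l; first exact: exprn_ge0.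
      have := @jensen_sum R nat (index_iota 0 N) (fun j => tau j.+1 - tau j) (fun j => M m j om ^+ 2) q.-1 d0 (fun j => sqr_ge0 _).
      rewrite (_ : q.-1.+1 = q)// tel => hj; apply: (le_trans hj).
      under eq_bigr do rewrite -exprM.
      apply: ler_wpM2r.
        by apply: sumr_ge0 => j _; rewrite mulr_ge0// exprn_ge0.
      by apply: lerXn2r; rewrite ?nnegrE ?(ltW T0)//; have /andP[] := tauT N.
  have pj j : 0 <= (2 * gamma) ^+ q * (T ^+ q.-1 * (tau j.+1 - tau j)).
    by rewrite mulr_ge0 ?exprn_ge0// mulr_ge0// exprn_ge0// ltW.
  have mMq j : measurable_fun [set: Omega] (fun om => M m j om ^+ (2 * q)) by exact: measurable_funX.
  have zMq j om : 0 <= M m j om ^+ (2 * q) by exact: exprn_ge0.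
  apply: (le_trans (@int_sum_le _ Omega R P nat (index_iota 0 N) _ (fun=> KM * (2 ^+ m)^-1 ^+ q) _ pj mMq zMq (fun j => hKM n m _ (gw m j)))).
  rewrite lee_fin -mulr_suml -mulr_sumr -mulr_sumr tel /KS.
  have b0 : 0 <= KM * (2 ^+ m)^-1 ^+ q by rewrite mulr_ge0// exprn_ge0// invr_ge0 exprn_ge0.
  have -> : (2 * gamma) ^+ q * (T ^+ q * KM) * (2 ^+ m)^-1 ^+ q = (2 * gamma) ^+ q * (T ^+ q.-1 * T) * (KM * (2 ^+ m)^-1 ^+ q).
    by rewrite -exprSr (_ : q.-1.+1 = q)//; ring.
  apply: ler_wpM2r => //; apply: ler_wpM2l; first exact: exprn_ge0.
  by apply: ler_wpM2l => //; exact: exprn_ge0 (ltW T0).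
- move=> m.
  pose A := C7 ^+ (2 * Q) * (eta m ^+ 2) ^+ (2 * Q) * (2 * T + 1) ^+ (2 * Q).
  have A0 : 0 <= A.
    have eta0 : 0 <= eta m by exact: le_trans (eta1 m).
    by rewrite /A !mulr_ge0 ?exprn_ge0// addr_ge0// mulr_ge0// ltW.
  apply: (@le_trans _ _ (\int[P]_om (\sum_(i <- wseq N tau) (A * `|i.1|) * Z m i.2 om ^+ (G * (2 * Q)))%:E)%E).
    apply: int_le => //.
    + by apply: measurable_funX; apply: measurable_funM => //; exact: mwsum.
    + by apply: measurable_sum => j; apply: measurable_funM => //; exact: measurable_funX.
    + move=> om _; apply: exprn_ge0; apply: mulr_ge0; first exact: le_trans (Ce m).
      exact: le_trans (wsum1 m om).
    + move=> om _; rewrite /B exprMn [(C7 * _) ^+ _]exprMn.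
      under [leRHS]eq_bigr do rewrite -mulrA.
      rewrite -mulr_sumr /A -[X in _ <= X]mulrA.
      apply: ler_wpM2l; first by rewrite mulr_ge0 ?exprn_ge0// (le_trans _ (eta1 m)).
      rewrite -(wsumE N (fun j => Z m j om ^+ (G * (2 * Q))) tS).
      have := @wsum_pow N tau (fun j => Z m j om ^+ G) (2 * Q) tS tau0 (fun j => exprn_ge0 _ (Z0 m j om)) tN.
      move=> hw; apply: (le_trans hw); rewrite le_eqVlt; apply/orP; left; apply/eqP; congr (_ * _).
      by congr (wsum N tau _); apply/funext => j; rewrite [RHS]exprM.
  have pj (i : R * nat) : 0 <= A * `|i.1| by exact: mulr_ge0.
  have mZq (i : R * nat) : measurable_fun [set: Omega] (fun om => Z m i.2 om ^+ (G * (2 * Q))) by exact: measurable_funX.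
  have zZq (i : R * nat) om : 0 <= Z m i.2 om ^+ (G * (2 * Q)) by exact: exprn_ge0.
  apply: (le_trans (@int_sum_le _ Omega R P (R * nat)%type (wseq N tau) _ (fun=> KZ) _ pj mZq zZq (fun i => hKZ n m _ (gw m i.2)))).
  rewrite lee_fin -mulr_suml -mulr_sumr.
  have wle : \sum_(i <- wseq N tau) `|i.1| <= 2 * T + 1.
    by rewrite (wseq_weight N tS tau0) lerD2r ler_wpM2l.
  have e : (eta m ^+ 2) ^+ (2 * Q) = 2 ^+ (32 * Q * m).
    by rewrite /eta /etam -!exprM; congr (_ ^+ _); ring.
  have -> : KB * 2 ^+ (32 * Q * m) = A * (2 * T + 1) * KZ by rewrite /KB /A e; ring.
  by apply: ler_wpM2r => //; exact: ler_wpM2l.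
Qed.

End SchemeMoments.

(** * Convergence of moments *)

Section Limits.
Variable R : realType.

Lemma limn_esup_near (u : nat -> \bar R) (e : R) : limn_esup u = 0%E -> 0 < e ->
  \forall n \near \oo, (u n < e%:E)%E.
Proof.
move=> u0 e0; have := near_small e0 (u := esups u).
rewrite -u0 limn_esup_lim => /(_ (is_cvg_esups (u := u))); apply: filterS => n.
by apply: le_lt_trans; apply: ereal_sup_ubound; exists n => /=.
Qed.

Lemma limn_esup_eq0 (u : nat -> \bar R) : (forall n, 0 <= u n)%E ->
  (forall e : R, 0 < e -> \forall n \near \oo, (u n <= e%:E)%E) -> limn_esup u = 0%E.
Proof.
move=> u0 ue; suff h : u n @[n --> \oo] --> 0%E by have [_ ->] := cvg_limn_einf_sup h.
have uf e n : (u n <= e%:E)%E -> u n \is a fin_num.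
  by move=> h; rewrite ge0_fin_numE//; exact: le_lt_trans h (ltry _).
apply/fine_cvgP; split; first by apply: filterS (ue 1 ltr01) => n; exact: uf.
apply/cvgrPdist_le => e e0; apply: filterS (ue e e0) => n hn /=.
rewrite sub0r normrN ger0_norm ?fine_ge0//.
by rewrite -lee_fin fineK// (uf e).
Qed.

(** For each n a violating time is selected whenever there is one; eventual validity along this
    sequence then forces validity at all times. *)
Lemma near_uniform (A : set R) (I : nat -> R -> \bar R) (e : \bar R) : A !=set0 ->
  (forall t : nat -> R, (forall n, A (t n)) -> \forall n \near \oo, (I n (t n) <= e)%E) ->
  \forall n \near \oo, forall s, A s -> (I n s <= e)%E.
Proof.
move=> [a Aa] hI.
have pick n : exists t, A t /\ ((I n t <= e)%E -> forall s : R, A s -> (I n s <= e)%E).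
  have [[s [As Is]]|hn] := pselect (exists s : R, A s /\ ~ (I n s <= e)%E).
    by exists s.
  exists a; split => // _ s As; apply: contrapT => Is; apply: hn; by exists s.
have [t ht] := choice pick.
have := hI t (fun n => (ht n).1); apply: filterS => n hn; exact: (ht n).2.
Qed.

Context d (Omega : measurableType d) (P : probability Omega R).

(* Y^p <= min (Y^p) K + Y^(2p) / K, and Y^(2p) <= 1 + Y^(2Q). *)
Lemma ae_cvg_moment (D : nat -> Omega -> R) (p C : R) (Q : nat) :
  0 < p -> p <= Q%:R -> (forall n, measurable_fun [set: Omega] (D n)) ->
  (forall n w, 0 <= D n w) -> {ae P, forall w, D n w @[n --> \oo] --> 0} ->
  (\forall n \near \oo, \int[P]_w (D n w ^+ (2 * Q))%:E <= C%:E)%E ->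
  forall e : R, 0 < e -> \forall n \near \oo, (\int[P]_w (D n w `^ p)%:E <= e%:E)%E.
Proof.
move=> p0 pQ mD D0 Dcvg DC e e0.
have C0 : 0 <= `|C| by exact: normr_ge0.
pose K := 2 * (1 + `|C|) / e.
have K0 : 0 < K by rewrite divr_gt0// mulr_gt0// ltr_pwDl.
have mDp n : measurable_fun [set: Omega] (fun w => D n w `^ p).
  exact: (measurableT_comp (@measurable_powR R p) (mD n)).
pose f n w := Num.min (D n w `^ p) K.
have f0 n w : 0 <= f n w by rewrite le_min powR_ge0 ltW.
have mf n : measurable_fun [set: Omega] (f n) by exact: measurable_minr.
have fcvg : (\int[P]_w (f n w)%:E)%E @[n --> \oo] --> 0%E.
  have m1 n : measurable_fun [set: Omega] (fun w => (f n w)%:E) by exact/measurable_EFinP.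
  have ig : P.-integrable [set: Omega] (fun=> K%:E) by exact: finite_measure_integrable_cst.
  have fg : {ae P, forall w n, [set: Omega] w -> (`|(f n w)%:E| <= K%:E)%E}.
    by apply: aeW => w n _; rewrite /= lee_fin ger0_norm// ge_min lexx orbT.
  have ff : {ae P, forall w, [set: Omega] w -> (f n w)%:E @[n --> \oo] --> 0%E}.
    move: Dcvg; apply: ae_mono => w hw _; apply/fine_cvgP; split; first exact: nearW.
    apply/cvgrPdist_lt => r r0 /=.
    have rp : 0 < r `^ p^-1 by exact: powR_gt0.
    have /cvgrPdist_lt/(_ _ rp) := hw; apply: filterS => n /=.
    rewrite sub0r normrN (ger0_norm (D0 n w)) sub0r normrN (ger0_norm (f0 n w)) => h.
    rewrite /f gt_min; apply/orP; left.
    have := gt0_ltr_powR p0 (D0 n w) (powR_ge0 r p^-1) h.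
    by rewrite -powRrM mulVf ?gt_eqF// powRr1// ltW.
  have [_ _] := dominated_convergence measurableT m1 (measurable_cst 0%E) ff ig fg.
  by rewrite integral0.
have e2 : 0 < e / 2 by rewrite divr_gt0.
have h1 := near_small e2 fcvg.
apply: filterS2 h1 DC => n h1 h2.
have mQ : measurable_fun [set: Omega] (fun w => D n w ^+ (2 * Q)) by exact: measurable_funX.
have zQ w : 0 <= D n w ^+ (2 * Q) by exact: exprn_ge0.
have Ki : 0 <= K^-1 by rewrite invr_ge0 ltW.
have m1 : measurable_fun [set: Omega] (fun w => 1 + D n w ^+ (2 * Q)) by exact: measurable_funD.
have z1 w : 0 <= 1 + D n w ^+ (2 * Q) by exact: addr_ge0.
have m2 : measurable_fun [set: Omega] (fun w => K^-1 * (1 + D n w ^+ (2 * Q))) by exact: measurable_funM.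
have z2 w : 0 <= K^-1 * (1 + D n w ^+ (2 * Q)) by exact: mulr_ge0.
have m3 : measurable_fun [set: Omega] (fun w => f n w + K^-1 * (1 + D n w ^+ (2 * Q))) by exact: measurable_funD.
apply: (@le_trans _ _ (\int[P]_w (f n w + K^-1 * (1 + D n w ^+ (2 * Q)))%:E)%E).
  apply: int_le => //; first by move=> w _; exact: powR_ge0.
  move=> w _; rewrite /f; have [le|lt] := leP (D n w `^ p) K.
    by rewrite lerDl.
  apply: (@le_trans _ _ (K^-1 * (1 + D n w ^+ (2 * Q)))); last by rewrite lerDr ltW.
  rewrite ler_pdivlMl//.
  apply: (@le_trans _ _ (D n w `^ p * D n w `^ p)).
    by apply: ler_wpM2r; [exact: powR_ge0|exact: ltW].
  have Dx := D0 n w; move: (D n w) Dx {lt zQ z1 z2} => x x0.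
  have [->|xn0] := eqVneq x 0.
    by rewrite powR0 ?gt_eqF// mul0r addr_ge0// exprn_ge0.
  rewrite -powRD ?xn0 ?implybT//.
  have [x1|x1] := leP x 1.
    apply: (@le_trans _ _ 1); last by rewrite lerDl exprn_ge0.
    have pp : 0 <= p + p by rewrite addr_ge0// ltW.
    by have := ge0_ler_powR pp x0 ler01 x1; rewrite powR1.
  apply: (@le_trans _ _ (x ^+ (2 * Q))); last by rewrite lerDr.
  rewrite -(powR_mulrn _ x0); apply: ler_powR; first exact: ltW.
  by rewrite natrM; lra.
rewrite (intD _ measurableT (mf n) m2 (f0 n) z2) (intZ _ measurableT Ki m1 z1).
rewrite (intD _ measurableT (measurable_cst _) mQ (fun=> ler01) zQ) integral_prob_cst.
have h3 : (1 + \int[P]_w (D n w ^+ (2 * Q))%:E <= (1 + `|C|)%:E)%E.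
  rewrite EFinD; apply: leeD => //; apply: (le_trans h2); rewrite lee_fin; exact: ler_norm.
have Ki' : (0 <= (K^-1)%:E)%E by rewrite lee_fin.
apply: (le_trans (leeD (ltW h1) (lee_wpmul2l Ki' h3))).
rewrite -EFinM -EFinD lee_fin /K.
have -> : (2 * (1 + `|C|) / e)^-1 * (1 + `|C|) = e / 2.
  by field; rewrite !gt_eqF// ltr_pwDl.
lra.
Qed.

End Limits.

Section BochnerCongruence.
Context d (T : measurableType d) (R : realType) (E : normedModType R).
Variable mu : {measure set T -> \bar R}.

(** Values outside D do not enter the specification, so the sets of candidates for [get] coincide.
    This justifies replacing the solution by its clamped version under the integral. *)
Lemma bochner_integral_eq (D : set T) (f g : T -> E) : (forall x, D x -> f x = g x) ->
  bochner_integral mu D f = bochner_integral mu D g.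
Proof.
move=> fg; congr get; apply/seteqP.
have sub (f1 g1 : T -> E) y : (forall x, D x -> f1 x = g1 x) ->
    is_bochner_integral mu D f1 y -> is_bochner_integral mu D g1 y.
  move=> h [s [h1 h2 h3 h4]]; exists s; split => //.
    move=> n; apply: eq_measurable_fun (h2 n) => x /set_mem Dx.
    by rewrite h.
  rewrite (_ : (fun n => _) = (fun n => (\int[mu]_(x in D) `|f1 x - simple_eval (s n) x|%:E)%E))//.
  by apply/funext => n; apply: eq_integral => x /set_mem Dx; rewrite h.
by split => y; apply: sub => // x Dx; rewrite fg.
Qed.

End BochnerCongruence.

(** * The grid stopped at a given time *)

Section GridTimes.
Variables (R : realType) (h t T : R).
Hypotheses (h0 : 0 < h) (t0 : 0 <= t) (tT : t <= T).

(** Makes t itself a node: the last cell is shortened and afterwards the nodes pause, which is the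
    shape of [tau] in the energy estimate. *)
Definition stop_grid (j : nat) : R := Num.min (j%:R * h) t.

Lemma stop_grid0 : stop_grid 0 = 0.
Proof. by rewrite /stop_grid mul0r min_l. Qed.

Lemma stop_grid_bound j : 0 <= stop_grid j <= T.
Proof.
rewrite /stop_grid le_min t0 mulr_ge0 ?(ltW h0)//=.
by apply: le_trans tT; rewrite ge_min lexx orbT.
Qed.

Lemma stop_gridS j : stop_grid j.+1 = stop_grid j \/
  stop_grid j = j%:R * h /\ stop_grid j < stop_grid j.+1 <= j.+1%:R * h.
Proof.
rewrite /stop_grid; have jS : j%:R * h < j.+1%:R * h by rewrite ltr_pM2r// ltr_nat.
have [jt|tj] := leP t (j%:R * h).
  by left; rewrite !min_r// (le_trans jt (ltW jS)).
right; split=> //.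
by rewrite lt_min jS tj /= ge_min lexx.
Qed.

Lemma stop_grid_end : exists N, stop_grid N = t.
Proof.
exists (Num.truncn (t / h)).+1; rewrite /stop_grid min_r//.
by rewrite -ler_pdivrMr//; apply: ltW; exact: truncnS_gt.
Qed.

End GridTimes.

(** * From pathwise convergence and moment bounds to the theorem *)

Section Assembly.
Variable R : realType.
Local Notation H := (L2_01 R).
Local Notation TR := (measurableTypeR R).
Local Notation leb := (@lebesgue_measure R).

Lemma norm_le_Hnorm (c r : R) (u : H) : 0 < c -> 0 <= r -> Hdom c r u ->
  `|u| <= lam c 1 `^ (- r) * Hnorm c r u.
Proof.
move=> c0 r0 hu; have N0 := Hnorm_ge0 c r u; have L1 := lam_gt0 c0 (isT : (0 < 1)%N).
apply: norm_le_cf; first by rewrite mulr_ge0// powR_ge0.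
move=> n; rewrite exprMn.
apply: le_trans (ler_wpM2l (sqr_ge0 _) (Hnorm_bessel n hu)).
rewrite mulr_sumr big_nat [leRHS]big_nat; apply: ler_sum => k /andP[k0 _].
have L1k := le_lam c0 k0; have Lk := lam_gt0 c0 k0.
rewrite -exprMn mulrA exprMn; apply: ler_peMl; first exact: sqr_ge0.
apply: exprn_ege1; rewrite powRN ler_pdivlMl ?powR_gt0// mulr1.
exact: (ge0_ler_powR r0 (ltW L1) (ltW Lk) L1k).
Qed.

(** The norm of H is weaker than that of $H_r$, so half-spaces of H, intersected with [Hdom], are
    open in $H_r$ and have measurable preimages. *)
Lemma Hborel_wmeas d (Omega : measurableType d) (c r : R) (Y : Omega -> H) : 0 < c -> 0 <= r ->
  (forall w, Hdom c r (Y w)) -> (forall B, Hborel c r B -> measurable (Y @^-1` B)) ->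
  wmeas [set: Omega] Y.
Proof.
move=> c0 r0 hY mY g; apply: (measurability _ (RGenOInfty.measurableE R)) => //.
move=> _ [_ [a ->] <-]; rewrite setTI.
rewrite (_ : _ @^-1` _ = Y @^-1` [set u : H | Hdom c r u /\ a < ip g u]); last first.
  by apply/seteqP; split => w /=; rewrite in_itv/= andbT => // -[].
apply: mY; apply: sub_sigma_algebra; split; first by move=> u [].
move=> u [hu au]; pose K := `|g| * lam c 1 `^ (- r) + 1.
have K0 : 0 < K by rewrite ltr_wpDl// mulr_ge0// powR_ge0.
exists ((ip g u - a) / K); first by rewrite divr_gt0 ?subr_gt0.
move=> v hv; rewrite ltr_pdivlMr// => hN; split => //.
have h1 := ip_le g (u - v); rewrite ipBr in h1.
have h2 := norm_le_Hnorm c0 r0 (HdomB hu hv).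
have h3 : `|g| * `|u - v| <= Hnorm c r (v - u) * K.
  rewrite -(Hnorm_distC hu hv) mulrC /K mulrDr mulr1.
  apply: (@le_trans _ _ (Hnorm c r (u - v) * (`|g| * lam c 1 `^ (- r)))).
    by rewrite mulrC mulrCA [Hnorm _ _ _ * _]mulrC; apply: ler_wpM2l.
  by rewrite lerDl; exact: Hnorm_ge0.
have h4 := le_lt_trans (le_trans h1 h3) hN.
by move: h4; rewrite ltrBlDr -ltrBlDl opprB addrC subrK.
Qed.

Lemma norm_expn_leD (m : nat) (u v : H) :
  `|u - v| ^+ m <= 2 ^+ m * (`|u| ^+ m + `|v| ^+ m).
Proof.
have h : `|u - v| <= `|u| + `|v| by exact: ler_normB.
move: h (normr_ge0 u) (normr_ge0 v) (normr_ge0 (u - v)).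
move: `|u - v| `|u| `|v| => p a b h a0 b0 p0.
apply: (@le_trans _ _ ((2 * Num.max a b) ^+ m)).
  apply: lerXn2r; rewrite ?nnegrE ?mulr_ge0 ?le_max ?a0//.
  by apply: (le_trans h); have [ab|ba] := leP a b; lra.
rewrite exprMn; apply: ler_wpM2l; first exact: exprn_ge0.
by have [ab|ba] := leP a b; rewrite ?lerDl ?lerDr exprn_ge0.
Qed.

(** The pathwise estimates ask for a path in $H_\varrho$ at every real time, while X is controlled
    on [0, T] only; clamping supplies such a path and leaves [0, T] unchanged. *)
Definition clamp (T s : R) : R := Num.max 0 (Num.min s T).

Lemma clampE (T s : R) : 0 <= s <= T -> clamp T s = s.
Proof. by move=> /andP[s0 sT]; rewrite /clamp min_l// max_r. Qed.

Lemma clamp_bound (T s : R) : 0 <= T -> 0 <= clamp T s <= T.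
Proof. by move=> T0; rewrite /clamp le_max lexx ge_max T0/= ge_min lexx orbT. Qed.

Variables (T c gamma theta vartheta alpha varphi rho varrho chi : R).
Hypotheses (T0 : 0 < T) (c0 : 0 < c) (gamma0 : 0 < gamma) (theta0 : 0 < theta).
Hypotheses (vt0 : 0 < vartheta) (ha : 0 <= alpha <= 1 / 2).
Hypotheses (hvarphi : 0 <= varphi < 1) (hrho : 0 <= rho < varrho).
Hypothesis hvarrho : varrho < 1 / 4.
Hypothesis hchi : 0 < chi <= (varrho - rho) / (1 + vartheta).
Variables (V : completeNormedModType R) (iota : {linear H -> V}).
Hypothesis hV : is_Hcompletion c (- alpha) iota.
Variables (xi : H) (F : H -> V).
Hypothesis hF : Hcontinuous c varrho F.
Variable h : nat -> R.
Hypothesis hh : forall n, (0 < n)%N -> 0 < h n <= T.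
Variables phi Phi : H -> R.
Hypothesis hphi : forall u, Hdom c 1 u ->
    phi u = gamma + gamma *
      sup [set `|cont_repr u x| ^+ 2 | x in `]0%R, 1%R[%classic].
Hypothesis hPhi : forall u, Hdom c 1 u ->
    Phi u = gamma + gamma *
      sup [set `|cont_repr u x| `^ gamma | x in `]0%R, 1%R[%classic].
Hypothesis hh0 : limn_esup (fun m => (h m)%:E) = 0%E.
Hypothesis hcoercive : forall n, (0 < n)%N -> forall v w : L2_01 R,
    range (@Pproj R n) v -> range (@Pproj R n) w ->
    ip v (extend iota (@Pproj R n) (F (v + w))) <=
      phi w * `|v| ^+ 2 + varphi * Hnorm c (1 / 2) v ^+ 2 + Phi w.
Hypothesis hlip : forall n, (0 < n)%N -> forall v w : L2_01 R,
    range (@Pproj R n) v -> range (@Pproj R n) w ->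
    `|F v - F w| <= theta *
      (1 + Hnorm c rho v `^ vartheta + Hnorm c rho w `^ vartheta) *
      Hnorm c rho (v - w).
Context d (Omega : measurableType d) (P : probability Omega R).
Variable W : R -> H -> Omega -> R.
Hypothesis hW : is_cylindrical_wiener P T W.
Variables Xn On : nat -> R -> Omega -> H.
Hypothesis hXn : forall n, (0 < n)%N -> forall t : R, 0 <= t <= T ->
    borel_rv (Xn n t) /\ forall w, range (@Pproj R n) (Xn n t w).
Hypothesis hOn : forall n, (0 < n)%N -> forall t : R, 0 <= t <= T ->
    borel_rv (On n t) /\ forall w, range (@Pproj R n) (On n t w).
Hypothesis hOn_int : forall n, (0 < n)%N -> forall t : R, 0 <= t <= T ->
    is_wiener_integral P W t (fun s u => Pproj n (expA c (t - s) u)) (On n t).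
Hypothesis hXn_eq : forall n, (0 < n)%N -> forall t : R, 0 <= t <= T ->
  {ae P, forall w, scheme c iota varrho chi F xi n (h n) ((Xn n)^~ w) ((On n)^~ w) t}.
Variable X : R -> Omega -> H.
Hypothesis hX : forall t : R, 0 <= t <= T ->
    (forall w, Hdom c varrho (X t w)) /\
    (forall B, Hborel c varrho B -> measurable (X t @^-1` B)).
Hypothesis hX_cont : forall w, Hcontinuous_path c varrho T (fun t => X t w).
Hypothesis hX_eq : forall t : R, 0 <= t <= T -> exists2 Z : Omega -> H,
    is_wiener_integral P W t (fun s => expA c (t - s)) Z &
    {ae P, forall w, sol c iota F xi (X^~ w) t (Z w)}.

Let Xc (w : Omega) (s : R) : H := X (clamp T s) w.
Local Notation coup n w t :=
  (coupled c iota varrho chi F xi (Xc w) n (h n) ((Xn n)^~ w) ((On n)^~ w) t).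

Lemma measurable_decay k (t : R) : measurable_fun [set: TR] (fun s : TR => expR (- ((t - s) * lam c k))).
Proof.
apply: (measurableT_comp (@measurable_expR R)).
apply: continuous_measurable_fun => s.
apply: cvgN; apply: cvgM; last exact: cvg_cst.
by apply: cvgB; [exact: cvg_cst|exact: cvg_id].
Qed.

Lemma noise_isG n t k : 0 <= t <= T -> (0 < k <= n)%N ->
  isG P T W (fun s : TR => resp c k t s *: eigf R k) (fun w => cf k (On n t w)).
Proof.
move=> ht /andP[k0 kn]; have n0 : (0 < n)%N by exact: leq_trans kn.
apply: (isG_wiener hW ht k0 (hOn_int n0 ht) (measurable_decay k t)) => s u /andP[_ st].
have ts : 0 <= t - s by rewrite subr_ge0 ltW.
by rewrite (cf_Pproj _ _ k0) kn mul1r (cf_expA c0 u ts k0).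
Qed.

(** The two stochastic integrals are given separately, but for k <= n their k-th coordinates have
    the same integrand and agree almost surely by [isG_eq]. *)
Lemma coupled_ae n t : (0 < n)%N -> 0 <= t <= T -> {ae P, forall w, coup n w t}.
Proof.
move=> n0 ht; have [Z hZ hXZ] := hX_eq ht.
have hcf : {ae P, forall w k, (0 < k <= n)%N -> cf k (Z w) = cf k (On n t w)}.
  apply: ae_foralln => k; have [hk|hk] := boolP (0 < k <= n)%N; last exact: aeW.
  have /andP[k0 kn] := hk.
  have hG : isG P T W (fun s : TR => resp c k t s *: eigf R k) (fun w => cf k (Z w)).
    apply: (isG_wiener hW ht k0 hZ (measurable_decay k t)) => s u /andP[_ st].
    have ts : 0 <= t - s by rewrite subr_ge0 ltW.
    exact: (cf_expA c0 u ts k0).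
  by apply: ae_mono (isG_eq T0 hW hG (noise_isG ht hk)) => w e _.
have hs := hXn_eq n0 ht.
apply: filterS3 hcf hXZ hs => w h1 h2 h3; exists (Z w); split; [|exact: h3|exact: h1].
have e : Xc w t = X t w := congr1 (fun s => X s w) (clampE ht).
apply: (etrans e (etrans h2 _)); apply: (congr1 (fun b => expA c t xi + b + Z w)).
apply: bochner_integral_eq => s; rewrite /= in_itv/= => /andP[s0 st].
have hs' : 0 <= s <= T by rewrite (ltW s0) (le_trans (ltW st))//; have /andP[] := ht.
exact: (congr1 (fun r => extend iota (expA c (t - s)) (F (X r w))) (esym (clampE hs'))).
Qed.

Lemma h_near (e : R) : 0 < e -> \forall n \near \oo, 0 < h n.+1 <= e.
Proof.
move=> e0; have [N _ hN] := limn_esup_near hh0 e0.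
exists N => // n /= Nn; have /andP[-> _] := hh (ltn0Sn n).
by have := hN n.+1 (leqW Nn); rewrite /= lte_fin => /ltW.
Qed.

(** The equations hold almost surely at each single time, so only countably many times may be used
    at once: the t n and the grid points. The pathwise estimate asks for no others. *)
Lemma ae_converge (t : nat -> R) : (forall n, 0 <= t n <= T) ->
  {ae P, forall w, `|X (t n) w - Xn n.+1 (t n) w| @[n --> \oo] --> 0}.
Proof.
move=> ht.
have A1 : {ae P, forall w n, coup n.+1 w (t n)}.
  by apply: ae_foralln => n; apply: coupled_ae.
have A2 : {ae P, forall w n j, j%:R * h n.+1 <= T -> coup n.+1 w (j%:R * h n.+1)}.
  apply: ae_foralln => n; apply: ae_foralln => j.
  have [jT|jT] := boolP (j%:R * h n.+1 <= T); last exact: aeW.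
  have /andP[hn _] := hh (ltn0Sn n).
  have hj : 0 <= j%:R * h n.+1 <= T by rewrite jT mulr_ge0// ltW.
  by apply: ae_mono (coupled_ae (ltn0Sn n) hj) => w hw _.
apply: filterS2 A1 A2 => w a1 a2; apply/cvgrPdist_le => e e0.
have xdom s : Hdom c varrho (Xc w s) by have [h1 _] := hX (clamp_bound s (ltW T0)); exact: h1.
have xc : Hcontinuous_path c varrho T (Xc w).
  move=> s hs r r0; have [del del0 hdel] := hX_cont w hs r0; exists del; first exact: del0.
  move=> u hu us; have eX v : 0 <= v <= T -> Xc w v = X v w.
    by move=> hv; exact: (congr1 (fun s => X s w) (clampE hv)).
  apply: (eq_ind_r (fun z => Hnorm c varrho (z - Xc w s) < r) _ (eX u hu)).
  apply: (eq_ind_r (fun z => Hnorm c varrho (X u w - z) < r) _ (eX s hs)).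
  exact: hdel.
have /andP[chi0 _] := hchi.
have [n0 [b b0 hb]] := pathwise c0 ha hV hrho hvarrho theta0 vt0 chi0 T0 xi hF hlip xdom xc e0.
have hn := h_near b0; near=> n.
rewrite sub0r normrN normr_id.
have nn : (n0 <= n.+1)%N by apply: leqW; near: n; exists n0.
have hn1 : 0 < h n.+1 <= b by near: n.
have ry u : 0 <= u <= T -> range (@Pproj R n.+1) (Xn n.+1 u w).
  by move=> hu; have [_ hr] := hXn (ltn0Sn n) hu; exact: hr.
have ro u : 0 <= u <= T -> range (@Pproj R n.+1) (On n.+1 u w).
  by move=> hu; have [_ hr] := hOn (ltn0Sn n) hu; exact: hr.
have e1 : X (t n) w = Xc w (t n) := congr1 (fun s => X s w) (esym (clampE (ht n))).
apply: (eq_ind_r (fun z => `|z - Xn n.+1 (t n) w| <= e) _ e1).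
exact: (hb n.+1 (h n.+1) ((Xn n.+1)^~ w) ((On n.+1)^~ w) nn hn1 ry ro (t n) (ht n) (a1 n) (a2 n)).
Unshelve. all: by end_near. Qed.

Lemma approx_moment (Q : nat) : (0 < Q)%N -> exists C : R,
  \forall n \near \oo, forall t, 0 <= t <= T ->
  (\int[P]_w (`|Xn n.+1 t w| ^+ (2 * Q))%:E <= C%:E)%E.
Proof.
move=> Q0.
have [C hC] := scheme_moment c0 ha hV hrho hvarrho theta0 vt0 hchi gamma0 hvarphi T0 xi hlip hphi hPhi hcoercive hW Q0.
exists C; apply: filterS (h_near ltr01) => n hn t /andP[t0 tT].
have /andP[h0 _] := hn; have [N tN] := stop_grid_end t h0.
rewrite -{1}tN.
apply: (hC n.+1 (h n.+1) (Xn n.+1) (On n.+1) (stop_grid (h n.+1) t) N) => //.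
- by move=> s hs; exact: hXn.
- by move=> s hs; have [hb _] := hOn (ltn0Sn n) hs.
- by move=> s k hs hk; exact: noise_isG.
- exact: stop_grid0.
- by move=> j; exact: stop_grid_bound.
- by move=> j; exact: stop_gridS.
- by move=> j; apply: hXn_eq => //; exact: stop_grid_bound.
Qed.

Lemma Xn_measurable n t : 0 <= t <= T -> wmeas [set: Omega] (Xn n.+1 t).
Proof. by move=> ht; have [hb _] := hXn (ltn0Sn n) ht; exact: wmeas_rv. Qed.

Lemma X_measurable t : 0 <= t <= T -> wmeas [set: Omega] (X t).
Proof.
move=> ht; have [h1 h2] := hX ht; apply: (Hborel_wmeas c0 _ h1 h2).
by have /andP[r0 /ltW] := hrho; exact: le_trans.
Qed.

(** The solution inherits the moments of the scheme by Fatou's lemma, from almost sure convergence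
    along the constant sequence of times. *)
Lemma solution_moment (Q : nat) (C t : R) : 0 <= t <= T ->
  (\forall n \near \oo, \int[P]_w (`|Xn n.+1 t w| ^+ (2 * Q))%:E <= C%:E)%E ->
  (\int[P]_w (`|X t w| ^+ (2 * Q))%:E <= C%:E)%E.
Proof.
move=> ht hC.
apply: (@ae_fatou _ _ _ P (fun n w => (`|Xn n.+1 t w| ^+ (2 * Q))%:E)) => //.
- by move=> n; apply/measurable_EFinP; apply: measurable_funX; apply: wmeas_norm; exact: Xn_measurable.
- by apply/measurable_EFinP; apply: measurable_funX; apply: wmeas_norm; exact: X_measurable.
- apply: ae_mono (ae_converge (fun=> ht)) => w hw.
  have hnorm : `|Xn n.+1 t w| @[n --> \oo] --> `|X t w|.
    apply/cvgrPdist_le => e e0; have /cvgrPdist_le/(_ _ e0) := hw; apply: filterS => n.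
    rewrite sub0r normrN normr_id; apply: le_trans; exact: ler_dist_dist.
  have hpow : `|Xn n.+1 t w| ^+ (2 * Q) @[n --> \oo] --> `|X t w| ^+ (2 * Q).
    exact: (cvg_comp _ _ hnorm (@exprn_continuous R (2 * Q) _)).
  by apply/fine_cvgP; split; first exact: nearW.
Qed.

Lemma moment_converge (p : R) (t : nat -> R) : 0 < p -> (forall n, 0 <= t n <= T) ->
  forall e : R, 0 < e -> \forall n \near \oo,
  (\int[P]_w (`|X (t n) w - Xn n.+1 (t n) w| `^ p)%:E <= e%:E)%E.
Proof.
move=> p0 ht; pose Q := (Num.truncn p).+1.
have pQ : p <= Q%:R by apply: ltW; exact: truncnS_gt.
have [C hC] := approx_moment (isT : (0 < Q)%N).
apply: (@ae_cvg_moment R _ _ P _ p (2 ^+ (2 * Q) * (C + C)) Q p0 pQ) => //.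
- by move=> n; apply: wmeas_norm; apply: wmeasB; [exact: X_measurable|exact: Xn_measurable].
- exact: ae_converge.
- apply: filterS (hC) => n hn.
  have m1 : measurable_fun [set: Omega] (fun w => `|X (t n) w| ^+ (2 * Q)).
    by apply: measurable_funX; apply: wmeas_norm; exact: X_measurable.
  have m2 : measurable_fun [set: Omega] (fun w => `|Xn n.+1 (t n) w| ^+ (2 * Q)).
    by apply: measurable_funX; apply: wmeas_norm; exact: Xn_measurable.
  have z1 w : 0 <= `|X (t n) w| ^+ (2 * Q) by exact: exprn_ge0.
  have z2 w : 0 <= `|Xn n.+1 (t n) w| ^+ (2 * Q) by exact: exprn_ge0.
  have m3 : measurable_fun [set: Omega] (fun w => `|X (t n) w| ^+ (2 * Q) + `|Xn n.+1 (t n) w| ^+ (2 * Q)).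
    exact: measurable_funD.
  have z3 w : 0 <= `|X (t n) w| ^+ (2 * Q) + `|Xn n.+1 (t n) w| ^+ (2 * Q) by exact: addr_ge0.
  have t2 : 0 <= 2 ^+ (2 * Q) :> R by exact: exprn_ge0.
  apply: (@le_trans _ _ (\int[P]_w (2 ^+ (2 * Q) * (`|X (t n) w| ^+ (2 * Q) + `|Xn n.+1 (t n) w| ^+ (2 * Q)))%:E)%E).
    apply: int_le => //.
    + apply: measurable_funX; apply: wmeas_norm.
      by apply: wmeasB; [exact: X_measurable|exact: Xn_measurable].
    + exact: measurable_funM.
    + by move=> w _; exact: norm_expn_leD.
  rewrite (intZ _ measurableT t2 m3 z3) (intD _ measurableT m1 m2 z1 z2).
  have b1 : (\int[P]_w (`|X (t n) w| ^+ (2 * Q))%:E <= C%:E)%E.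
    by apply: solution_moment => //; apply: filterS hC => m; exact.
  have b2 := hn (t n) (ht n).
  have t2' : (0 <= (2 ^+ (2 * Q))%:E :> \bar R)%E by rewrite lee_fin.
  exact: (lee_wpmul2l t2' (leeD b1 b2)).
Qed.

Lemma moment_converge_uniform (p e : R) : 0 < p -> 0 < e -> \forall n \near \oo,
  forall s, 0 <= s <= T -> (\int[P]_w (`|X s w - Xn n.+1 s w| `^ p)%:E <= e%:E)%E.
Proof.
move=> p0 e0.
apply: (@near_uniform R [set s | 0 <= s <= T] (fun n s => (\int[P]_w (`|X s w - Xn n.+1 s w| `^ p)%:E)%E) e%:E).
  by exists 0; rewrite /= lexx ltW.
by move=> t ht; exact: moment_converge.
Qed.

End Assembly.


Theorem proposition5p7 (R : realType)
  (T c0 gamma theta vartheta alpha varphi rho varrho chi : R)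
  (hT : 0 < T) (hc0 : 0 < c0) (hgamma : 0 < gamma) (htheta : 0 < theta)
  (hvartheta : 0 < vartheta) (halpha : 0 <= alpha <= 1 / 2)
  (hvarphi : 0 <= varphi < 1) (hrho : 0 <= rho < 1 / 4)
  (hvarrho : rho < varrho < 1 / 4)
  (hchi : 0 < chi <= (varrho - rho) / (1 + vartheta))
  (* V is H_(-alpha), with embedding iota of H *)
  (V : completeNormedModType R) (iota : {linear L2_01 R -> V})
  (hV : is_Hcompletion c0 (- alpha) iota)
  (xi : L2_01 R) (hxi : Hdom c0 (1 / 2) xi)
  (F : L2_01 R -> V) (hF : Hcontinuous c0 varrho F)
  (h : nat -> R) (hh : forall n, (0 < n)%N -> 0 < h n <= T)
  (phi Phi : L2_01 R -> R)
  (hphi : forall u, Hdom c0 1 u ->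
    phi u = gamma + gamma *
      sup [set `|cont_repr u x| ^+ 2 | x in `]0%R, 1%R[%classic])
  (hPhi : forall u, Hdom c0 1 u ->
    Phi u = gamma + gamma *
      sup [set `|cont_repr u x| `^ gamma | x in `]0%R, 1%R[%classic])
  (hh0 : limn_esup (fun m => (h m)%:E) = 0%E)
  (hcoercive : forall n, (0 < n)%N -> forall v w : L2_01 R,
    range (@Pproj R n) v -> range (@Pproj R n) w ->
    ip v (extend iota (@Pproj R n) (F (v + w))) <=
      phi w * `|v| ^+ 2 + varphi * Hnorm c0 (1 / 2) v ^+ 2 + Phi w)
  (hlip : forall n, (0 < n)%N -> forall v w : L2_01 R,
    range (@Pproj R n) v -> range (@Pproj R n) w ->
    `|F v - F w| <= theta *
      (1 + Hnorm c0 rho v `^ vartheta + Hnorm c0 rho w `^ vartheta) *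
      Hnorm c0 rho (v - w))
  (d : measure_display) (Omega : measurableType d) (P : probability Omega R)
  (W : R -> L2_01 R -> Omega -> R) (hW : is_cylindrical_wiener P T W)
  (Xn On : nat -> R -> Omega -> L2_01 R)
  (hXn : forall n, (0 < n)%N -> forall t : R, 0 <= t <= T ->
    borel_rv (Xn n t) /\ forall w, range (@Pproj R n) (Xn n t w))
  (hOn : forall n, (0 < n)%N -> forall t : R, 0 <= t <= T ->
    borel_rv (On n t) /\ forall w, range (@Pproj R n) (On n t w))
  (hOn_int : forall n, (0 < n)%N -> forall t : R, 0 <= t <= T ->
    is_wiener_integral P W t (fun s u => Pproj n (expA c0 (t - s) u)) (On n t))
  (hXn_eq : forall n, (0 < n)%N -> forall t : R, 0 <= t <= T ->
    {ae P, forall w, Xn n t w =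
      Pproj n (expA c0 t xi)
      + bochner_integral (@lebesgue_measure R) `]0%R, t[%classic (fun s : R =>
          let s' := grid_floor (h n) s in
          Pproj n (extend iota (expA c0 (t - s))
            ((Hnorm c0 varrho (Xn n s' w)
              + Hnorm c0 varrho (On n s' w + Pproj n (expA c0 s' xi))
                <= `|h n| `^ (- chi))%R%:R *: F (Xn n s' w))))
      + On n t w})
  (X : R -> Omega -> L2_01 R)
  (hX : forall t : R, 0 <= t <= T ->
    (forall w, Hdom c0 varrho (X t w)) /\
    (forall B, Hborel c0 varrho B -> measurable (X t @^-1` B)))
  (hX_cont : forall w, Hcontinuous_path c0 varrho T (fun t => X t w))
  (hX_eq : forall t : R, 0 <= t <= T -> exists2 Z : Omega -> L2_01 R,
    is_wiener_integral P W t (fun s => expA c0 (t - s)) Z &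
    {ae P, forall w, X t w =
      expA c0 t xi
      + bochner_integral (@lebesgue_measure R) `]0%R, t[%classic (fun s : R =>
          extend iota (expA c0 (t - s)) (F (X s w)))
      + Z w}) :
  forall p : R, 0 < p ->
    limn_esup (fun n => ereal_sup
      [set 'E_P[(fun w => `|X t w - Xn n t w| `^ p)%R]%E
        | t in `[0%R, T]%classic]) = 0%E.
Proof.
move=> p p0.
have /andP[rho0 rho4] := hrho; have /andP[rv v4] := hvarrho.
have hrho' : 0 <= rho < varrho by rewrite rho0.
apply: limn_esup_eq0 => [n|e e0].
  apply: (@le_trans _ _ ('E_P[(fun w => `|X 0 w - Xn n 0 w| `^ p)%R]%E)).
    by rewrite unlock; apply: integral_ge0 => w _; rewrite lee_fin powR_ge0.
  by apply: ereal_sup_ubound; exists 0 => //=; rewrite in_itv/= lexx ltW.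
have [N _ hN] := moment_converge_uniform hT hc0 hgamma htheta hvartheta halpha hvarphi hrho' v4 hchi
  hV hF hh hphi hPhi hh0 hcoercive hlip hW hXn hOn hOn_int hXn_eq hX hX_cont hX_eq p0 e0.
(* The moment estimate is indexed by [n.+1], as the hypotheses on the scheme begin at index 1; index
   0 falls among the discarded terms. *)
exists N.+1 => // -[//|n] /= Nn; apply: ge_ereal_sup => _ [s + <-]; rewrite /= in_itv/= => hs.
by rewrite unlock; exact: (hN n Nn s hs).
Qed.
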